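(* Let $\Omega\subseteq\mathbb{R}^d$, $d\in\{2,3\}$, $T>0$. Suppose that the velocity $u$ in $\partial_t\phi+u\cdot\nabla\phi=0$ generates a unique smooth flow map $x(X,t)$ (and, in case (iii), that the second, divergence-free velocity $v$ generates a smooth flow map $y(X,t)$). Let $\psi=\psi(\phi,\nabla\phi,\theta)$ be the free energy density, $s=-\partial_\theta\psi$, $\mu=\nabla\cdot\partial_{\nabla\phi}\psi-\partial_\phi\psi$, $\eta=\eta(\phi,\theta)>0$ the friction parameter and $\nu$ the constant viscosity. Let the inertial, conservative and dissipative forces be those obtained from the least action principle and the maximum dissipation principle, as specified in the context. Impose the force balance $f_{cons}+f_{diss}=f_{inertial}$ for each flow map. Then: (i) If the temperature satisfies (A1) (it is transported by the flow of $u$) and $E^{kin}=0$, the equation of motion for $\phi$ is given by $$\partial_t\phi+u\cdot\nabla\phi=0,\qquad -\eta(\phi,\theta)(u\cdot\nabla\phi)\nabla\phi=\mu\nabla\phi+s\nabla\theta .$$ (ii) If the temperature satisfies (A2) (it is on a fixed background) and $E^{kin}=0$, the equation of motion for $\phi$ is given by $$\partial_t\phi+u\cdot\nabla\phi=0,\qquad -\eta(\phi,\theta)(u\cdot\nabla\phi)\nabla\phi=\mu\nabla\phi,$$ which can be rewritten as $$\partial_t\phi=\eta(\phi,\theta)^{-1}\mu .$$ For the free energy $\psi=\frac{\epsilon}{2}|\nabla\phi|^2+\frac1\epsilon W(\phi)-\chi(\epsilon)\frac{\lambda}{\theta_c}(\theta-\theta_c)g(\phi)+c_v\theta(1-\log\theta)$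 and $\theta=\theta_c$, this last equation is the classical Allen-Cahn equation $\partial_t\phi=\eta^{-1}\big(\epsilon\Delta\phi-\frac1\epsilon W'(\phi)\big)$. (iii) If the temperature satisfies (A3) (it is transported by the flow of $v$) and $E^{kin}=\int\frac12|v|^2\,dx$ with $\nabla\cdot v=0$, the equation of motion for $\phi$ is given by $$\partial_t\phi+u\cdot\nabla\phi=0,\qquad -\eta(\phi,\theta)\big((u-v)\cdot\nabla\phi\big)\nabla\phi=\mu\nabla\phi,$$ and the equation for $v$ is given by $$\partial_t v+(v\cdot\nabla)v+\nabla p=-\mu\nabla\phi+\nu\Delta v-s\nabla\theta,\qquad \nabla\cdot v=0,$$ where the scalar function $p$ is the pressure (Lagrange multiplier of incompressibility).
   Context: All functions are assumed sufficiently smooth. The variable $\phi$ is a phase function and $\theta>0$ is the absolute temperature. $\psi(\phi,\nabla\phi,\theta)$ is a smooth function of its arguments; $\epsilon,\chi(\epsilon),\lambda,\theta_c,c_v$ are constants and $W,g$ are smooth functions. Kinematics. $\partial_t x(X,t)=u(x(X,t),t)$, $x(X,0)=X$, $u\cdot n=0$ on $\partial\Omega$, and $\phi(x(X,t),t)=\phi_0(X)$. The assumptions on $\theta$ are: - (A1) $\theta(x(X,t),t)=\theta_0(X)$. - (A2) $\theta=\theta(x,t)$ is a given function of Eulerian coordinates, not changed by variations of the flow map $x(X,t)$. - (A3) $\theta(y(X,t),t)=\theta_0(X)$, where $\partial_t y(X,t)=v(y(X,t),t)$, $y(X,0)=X$, for a second velocity $v$; $\theta$ is not changed by variations of $x(X,t)$.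 Inertial and conservative forces (least action principle). For an initial volume $\Omega_0\subseteq\Omega$ put $\Omega_t^x=\{x(X,t):X\in\Omega_0\}$ and $$A(x(\cdot))=\int_0^T\Big(E^{kin}-\int_{\Omega_t^x}\psi(\phi,\nabla\phi,\theta)\,dx\Big)dt,$$ regarded as a functional of the flow map through the kinematics. The forces are defined by $$\frac{d}{d\varepsilon}\Big|_{\varepsilon=0}A(x(\cdot)+\varepsilon\delta x(\cdot))=\int_0^T\int_{\Omega_t^x}(f_{inertial}-f_{cons})\cdot\delta x\,dx\,dt$$ for all smooth $\delta x$ compactly supported in the interior of $\Omega_0\times(0,T)$, where $f_{inertial}$ comes from $E^{kin}$ and $-f_{cons}$ from $-\psi$. Under (A3) this is done separately for the two flow maps. For $x$ (velocity $u$), $\theta$ and $v$ are held fixed as Eulerian fields, giving $f^u_{inertial},f^u_{cons}$. For $y$ (velocity $v$), one uses $\Omega_t^y$ and $E^{kin}=\int_{\Omega_t^y}\frac12|v|^2dx$, with $\theta$ transported by $y$, $\phi$ held fixed as an Eulerian field, and the constraint $\det\nabla_X y=1$ (variations divergence free in Eulerian coordinates). This gives $f^v_{inertial},f^v_{cons}$, where $f^v_{cons}$ is determined up to a gradient and all gradient terms are collected in $\nabla p$. Dissipative forces (maximum dissipation principle). The dissipation functional is $$\mathcal D=\int_\Omega\eta(\phi,\theta)\,|(u-v)\cdot\nabla\phi|^2+\nu|\nabla v|^2\,dx,$$ with $v=0$ in cases (A1) and (A2). The dissipative force $f_{diss}$ (denoted $f^u_{diss}$ under (A3)) is defined by $\frac12\frac{d}{d\varepsilon}|_{\varepsilon=0}\mathcal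 D(u+\varepsilon\delta u)=\int_\Omega f_{diss}\cdot\delta u\,dx$ for all smooth compactly supported $\delta u$, with $\phi,\theta,v$ fixed. Under (A3), $f^v_{diss}$ is defined in the same way by varying $v$ with $\phi,\theta,u$ fixed. Force balance. $f_{cons}+f_{diss}=f_{inertial}$; under (A3) this holds for the forces with superscript $u$ and for those with superscript $v$ separately.
   Formalization: In (ii) the rewriting as ∂_tφ=η^{-1}μ is proved, as an equivalence, only at points in the closure of the set where ∇φ≠0; where ∇φ vanishes on an open set it fails (φ constant with W'(φ)≠0). *)

(* Defs.v *)
From HB Require Import structures.
From mathcomp Require Import all_boot all_order all_algebra.
From mathcomp Require Import all_classical all_reals all_analysis.

Set Implicit Arguments.
Unset Strict Implicit.
Unset Printing Implicit Defensive.
Import Order.TTheory GRing.Theory Num.Theory.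
Import numFieldNormedType.Exports.
Local Open Scope classical_set_scope.
Local Open Scope ring_scope.

Section SigmaFiniteProduct.
Context d1 d2 (T1 : measurableType d1) (T2 : measurableType d2) (R : realType).
Variables (m1 : {sigma_finite_measure set T1 -> \bar R})
  (m2 : {sigma_finite_measure set T2 -> \bar R}).

(* A copy of [m1 \x m2], on which the sigma-finite instance is found. *)
Definition sigma_finite_product : set (T1 * T2)%type -> \bar R :=
  (m1 \x m2)%E.

HB.instance Definition _ := Measure.on sigma_finite_product.

Let sigma_finite_productT : sigma_finite setT sigma_finite_product.
Proof.
have /sigma_finiteP[F [TF ndF Foo]] := sigma_finiteT m1.
have /sigma_finiteP[G [TG ndG Goo]] := sigma_finiteT m2.
exists (fun n => F n `*` G n).
  rewrite -setXTT TF TG predeqE => -[x y]; split.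
    move=> [/= [n _ Fnx] [k _ Gky]]; exists (maxn n k) => //; split.
    - by move: x Fnx; exact/subsetPset/ndF/leq_maxl.
    - by move: y Gky; exact/subsetPset/ndG/leq_maxr.
  by move=> [n _ []/= ? ?]; split; exists n.
move=> k; have [? ?] := Foo k; have [? ?] := Goo k.
split; first exact: measurableX.
rewrite /sigma_finite_product product_measure1E//.
by rewrite lte_mul_pinfty// ge0_fin_numE.
Qed.

HB.instance Definition _ := Measure_isSigmaFinite.Build _ _ _
  sigma_finite_product sigma_finite_productT.

End SigmaFiniteProduct.

(* Lebesgue measure on R^n: the n-fold product of the one-dimensional one. It
   lives on nested pairs; [coords] reads such a point as a row vector. *)
Record euclidean (R : realType) (n : nat) := Euclidean {
  eucl_display : measure_display;
  eucl_space : measurableType eucl_display;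
  eucl_measure : {sigma_finite_measure set eucl_space -> \bar R};
  coords : eucl_space -> 'rV[R]_n }.

Arguments eucl_space {R n}.
Arguments eucl_measure {R n}.
Arguments coords {R n}.

Fixpoint lebesgue_space (R : realType) (n : nat) : euclidean R n :=
  match n with
  | 0 => @Euclidean R 0 _ unit (dirac tt) (fun=> 0)
  | n'.+1 =>
      let E := lebesgue_space R n' in
      @Euclidean R n'.+1 _ (measurableTypeR R * eucl_space E)%type
        (sigma_finite_product lebesgue_measure (eucl_measure E))
        (fun z => row_mx (const_mx z.1 : 'rV[R]_1) (coords E z.2))
  end.

Section VectorCalculus.
Context {R : realType} {d : nat}.
Implicit Types (A : set 'rV[R]_d) (x a b : 'rV[R]_d).

Definition measurable_rV A : Prop :=
  measurable (coords (lebesgue_space R d) @^-1` A).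

Definition integrable_rV A (f : 'rV[R]_d -> R) : Prop :=
  (eucl_measure (lebesgue_space R d)).-integrable
    (coords (lebesgue_space R d) @^-1` A)
    (fun w => (f (coords (lebesgue_space R d) w))%:E).

Definition integral_rV A (f : 'rV[R]_d -> R) : R :=
  \int[eucl_measure (lebesgue_space R d)]_(w in
    coords (lebesgue_space R d) @^-1` A) f (coords (lebesgue_space R d) w).

(* The Euclidean inner product; the library norm on 'rV is the sup norm. *)
Definition dot a b : R := \sum_i a ord0 i * b ord0 i.

Definition partial {W : normedModType R} (i : 'I_d) (f : 'rV[R]_d -> W) x : W :=
  'D_(delta_mx ord0 i) f x.

Definition grad (f : 'rV[R]_d -> R) x : 'rV[R]_d := \row_i partial i f x.

Definition divergence (F : 'rV[R]_d -> 'rV[R]_d) x : R :=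
  \sum_i partial i (fun y => F y ord0 i) x.

Definition laplacian (f : 'rV[R]_d -> R) x : R := divergence (grad f) x.

Definition vlaplacian (F : 'rV[R]_d -> 'rV[R]_d) x : 'rV[R]_d :=
  \row_i laplacian (fun y => F y ord0 i) x.

Definition grad_normsq (F : 'rV[R]_d -> 'rV[R]_d) x : R :=
  \sum_i dot (grad (fun y => F y ord0 i) x) (grad (fun y => F y ord0 i) x).

(* Fields on space-time; the first argument is time. *)
Definition dt {W : normedModType R} (f : R -> 'rV[R]_d -> W) (t : R) x : W :=
  derive1 (fun r => f r x) t.

End VectorCalculus.

Section Smoothness.
Context {R : realType}.

Fixpoint iter_derive {V W : normedModType R} (vs : seq V) (f : V -> W) :
    V -> W :=
  if vs is v :: vs' then 'D_v (iter_derive vs' f) else f.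

(* C^oo on an open set [U]. *)
Definition smooth_on {V W : normedModType R} (U : set V) (f : V -> W) : Prop :=
  forall (vs : seq V) (x : V), U x -> differentiable (iter_derive vs f) x.

(* C^oo up to the boundary: smooth on some open neighbourhood of [A]. *)
Definition smooth_near {V W : normedModType R} (A : set V) (f : V -> W) :
    Prop :=
  exists U : set V, [/\ open U, A `<=` U & smooth_on U f].

Definition spacetime {d : nat} {W : normedModType R} (f : R -> 'rV[R]_d -> W)
  : R * 'rV[R]_d -> W := fun p => f p.1 p.2.

Definition supp {V W : normedModType R} (f : V -> W) : set V :=
  closure [set p | f p != 0].

End Smoothness.

Section Kinematics.
Context {R : realType} {d : nat}.
Variables (Omega : set 'rV[R]_d) (T : R).

Definition cylinder : set (R * 'rV[R]_d) :=
  [set p | (0 < p.1 < T) /\ Omega p.2].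

Definition closed_cylinder : set (R * 'rV[R]_d) :=
  [set p | (0 <= p.1 <= T) /\ closure Omega p.2].

Definition smooth_field {W : normedModType R} (f : R -> 'rV[R]_d -> W) : Prop :=
  smooth_near closed_cylinder (spacetime f).

(* [n] is the outer unit normal of [Omega] at the boundary point [z], the
   boundary being there the regular zero level of a function [rho] with
   [Omega = {rho < 0}]. *)
Definition outer_normal (z n : 'rV[R]_d) : Prop :=
  exists (U : set 'rV[R]_d) (rho : 'rV[R]_d -> R),
    [/\ open U /\ U z, smooth_on U rho,
        rho z = 0 /\ grad rho z != 0,
        forall y, U y -> (Omega y <-> rho y < 0) &
        n = (Num.sqrt (dot (grad rho z) (grad rho z)))^-1 *: grad rho z].

Definition tangential (u : R -> 'rV[R]_d -> 'rV[R]_d) : Prop :=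
  forall t z n, 0 <= t <= T -> outer_normal z n -> dot (u t z) n = 0.

(* Since [u] is tangential at the boundary, its flow maps are diffeomorphisms
   of [Omega] onto itself. *)
Definition flow_map (u x : R -> 'rV[R]_d -> 'rV[R]_d) : Prop :=
  [/\ smooth_field x,
      forall t, 0 <= t <= T -> set_bij Omega Omega (x t),
      exists Y : R -> 'rV[R]_d -> 'rV[R]_d, smooth_field Y /\
        forall t X, 0 <= t <= T -> Omega X -> Y t (x t X) = X,
      forall X, Omega X -> x 0 X = X &
      forall t X, 0 <= t <= T -> Omega X -> dt x t X = u t (x t X)].

Definition unique_flow_map (u x : R -> 'rV[R]_d -> 'rV[R]_d) : Prop :=
  flow_map u x /\
  forall x', flow_map u x' ->
    forall t X, 0 <= t <= T -> Omega X -> x' t X = x t X.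

Definition transported {W : Type} (x : R -> 'rV[R]_d -> 'rV[R]_d)
    (g0 : 'rV[R]_d -> W) (g : R -> 'rV[R]_d -> W) : Prop :=
  forall t X, 0 <= t <= T -> Omega X -> g t (x t X) = g0 X.

(* The Eulerian form of a Lagrangian field [g t X], i.e. the field with value
   [g t X] at the point [x t X]. *)
Definition eulerian {W : Type} (x : R -> 'rV[R]_d -> 'rV[R]_d)
    (g : R -> 'rV[R]_d -> W) (t : R) (y : 'rV[R]_d) : W :=
  g t ('pinv_(fun=> 0) Omega (x t) y).

Definition push {W : Type} (g0 : 'rV[R]_d -> W)
    (x : R -> 'rV[R]_d -> 'rV[R]_d) : R -> 'rV[R]_d -> W :=
  eulerian x (fun=> g0).

Definition velocity (x : R -> 'rV[R]_d -> 'rV[R]_d) :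
    R -> 'rV[R]_d -> 'rV[R]_d := eulerian x (dt x).

(* Integral over 0 < t < T and over the transported volume at time t. *)
Definition volume_integral (Omega0 : set 'rV[R]_d)
    (x : R -> 'rV[R]_d -> 'rV[R]_d) (f : R -> 'rV[R]_d -> R) : R :=
  \int[lebesgue_measure]_(t in `[0, T]) integral_rV (x t @` Omega0) (f t).

End Kinematics.

Section LeastAction.
Context {R : realType} {d : nat}.
Variables (Omega : set 'rV[R]_d) (T : R).

(* Boundedness makes the energy of every transported volume finite. *)
Definition initial_volume (Omega0 : set 'rV[R]_d) : Prop :=
  [/\ Omega0 `<=` Omega, bounded_set Omega0 & measurable_rV Omega0].

Definition variation (Omega0 : set 'rV[R]_d) (dx : R -> 'rV[R]_d -> 'rV[R]_d)
    : Prop :=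
  [/\ smooth_on setT (spacetime dx), compact (supp (spacetime dx)) &
      supp (spacetime dx) `<=` cylinder (interior Omega0) T].

(* [f] is the first variation at the flow map [x], per unit volume of the
   deformed configuration, of the functional [J] of volumes and flow maps,
   tested against the variations satisfying [admissible]. *)
Definition first_variation
    (admissible : (R -> 'rV[R]_d -> 'rV[R]_d) -> Prop)
    (J : set 'rV[R]_d -> (R -> 'rV[R]_d -> 'rV[R]_d) -> R)
    (x f : R -> 'rV[R]_d -> 'rV[R]_d) : Prop :=
  smooth_on (cylinder Omega T) (spacetime f) /\
  forall Omega0 dx, initial_volume Omega0 -> variation Omega0 dx ->
    admissible dx ->
    is_derive (0 : R) (1 : R)
      (fun e => J Omega0 (fun t X => x t X + e *: dx t X))
      (volume_integral T Omega0 x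
         (fun t y => dot (f t y) (eulerian Omega x dx t y))).

Definition unconstrained (dx : R -> 'rV[R]_d -> 'rV[R]_d) : Prop := True.

(* The linearization of the constraint [det (grad_X x) = 1]. *)
Definition divergence_free (x dx : R -> 'rV[R]_d -> 'rV[R]_d) : Prop :=
  forall t y, 0 < t < T -> Omega y ->
    divergence (eulerian Omega x dx t) y = 0.

(* Minus the time integral of the free energy. [Phi] and [Theta] tell how the
   phase and the temperature depend on the flow map. *)
Definition free_energy_action (psi : R -> 'rV[R]_d -> R -> R)
    (Phi Theta : (R -> 'rV[R]_d -> 'rV[R]_d) -> R -> 'rV[R]_d -> R)
    (Omega0 : set 'rV[R]_d) (x : R -> 'rV[R]_d -> 'rV[R]_d) : R :=
  - volume_integral T Omega0 x
      (fun t y => psi (Phi x t y) (grad (Phi x t) y) (Theta x t y)).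

(* Time integral of the kinetic energy; [V] tells how the velocity depends on
   the flow map. *)
Definition kinetic_action
    (V : (R -> 'rV[R]_d -> 'rV[R]_d) -> R -> 'rV[R]_d -> 'rV[R]_d)
    (Omega0 : set 'rV[R]_d) (x : R -> 'rV[R]_d -> 'rV[R]_d) : R :=
  volume_integral T Omega0 x (fun t y => 2^-1 * dot (V x t y) (V x t y)).

Definition no_kinetic_action
  (Omega0 : set 'rV[R]_d) (x : R -> 'rV[R]_d -> 'rV[R]_d) : R := 0.

Definition inertial_force admissible Jkin x (f : R -> 'rV[R]_d -> 'rV[R]_d) :=
  first_variation admissible Jkin x f.

Definition conservative_force admissible psi Phi Theta x
    (f : R -> 'rV[R]_d -> 'rV[R]_d) :=
  first_variation admissible (free_energy_action psi Phi Theta) x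
    (fun t y => - f t y).

End LeastAction.

Section MaximumDissipation.
Context {R : realType} {d : nat}.
Variables (Omega : set 'rV[R]_d) (T : R) (eta : R -> R -> R) (nu : R).

Definition dissipation_density (phi theta : 'rV[R]_d -> R)
    (u v : 'rV[R]_d -> 'rV[R]_d) (x : 'rV[R]_d) : R :=
  eta (phi x) (theta x) * `|dot (u x - v x) (grad phi x)| ^+ 2
  + nu * grad_normsq v x.

Definition dissipation (phi theta : 'rV[R]_d -> R)
    (u v : 'rV[R]_d -> 'rV[R]_d) : R :=
  integral_rV Omega (dissipation_density phi theta u v).

Definition finite_dissipation (phi theta : R -> 'rV[R]_d -> R)
    (u v : R -> 'rV[R]_d -> 'rV[R]_d) : Prop :=
  forall t, 0 < t < T ->
    integrable_rV Omega (dissipation_density (phi t) (theta t) (u t) (v t)).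

(* [f t] is half the first variation at [u t] of the dissipation [D t]. *)
Definition dissipative_force (D : R -> ('rV[R]_d -> 'rV[R]_d) -> R)
    (u f : R -> 'rV[R]_d -> 'rV[R]_d) : Prop :=
  smooth_on (cylinder Omega T) (spacetime f) /\
  forall t (du : 'rV[R]_d -> 'rV[R]_d), 0 < t < T ->
    smooth_on setT du -> compact (supp du) -> supp du `<=` Omega ->
    is_derive (0 : R) (1 : R)
      (fun e => 2^-1 * D t (fun y => u t y + e *: du y))
      (integral_rV Omega (fun y => dot (f t y) (du y))).

End MaximumDissipation.

(* The forces given by the two principles balance. Existentially quantified,
   since under a constraint they are only determined up to a gradient. *)
Definition force_balance (R : realType) (d : nat) (Omega : set 'rV[R]_d) (T : R)
    (is_inertial is_conservative is_dissipative :
      (R -> 'rV[R]_d -> 'rV[R]_d) -> Prop) : Prop :=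
  exists f_inertial f_cons f_diss : R -> 'rV[R]_d -> 'rV[R]_d,
    [/\ is_inertial f_inertial, is_conservative f_cons, is_dissipative f_diss &
        forall t y, 0 < t < T -> Omega y ->
          f_cons t y + f_diss t y = f_inertial t y].

Section FreeEnergy.
Context {R : realType} {d : nat}.
Variable psi : R -> 'rV[R]_d -> R -> R.

Definition psi_phi (a : R) (p : 'rV[R]_d) (th : R) : R :=
  derive1 (fun a' => psi a' p th) a.
Definition psi_grad (a : R) (p : 'rV[R]_d) (th : R) : 'rV[R]_d :=
  grad (fun p' => psi a p' th) p.
Definition psi_theta (a : R) (p : 'rV[R]_d) (th : R) : R :=
  derive1 (fun th' => psi a p th') th.

Variables phi theta : R -> 'rV[R]_d -> R.

Definition entropy (t : R) (x : 'rV[R]_d) : R :=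
  - psi_theta (phi t x) (grad (phi t) x) (theta t x).

Definition chemical_potential (t : R) (x : 'rV[R]_d) : R :=
  divergence (fun y => psi_grad (phi t y) (grad (phi t) y) (theta t y)) x
  - psi_phi (phi t x) (grad (phi t) x) (theta t x).

End FreeEnergy.

(* Main.v *)
From HB Require Import structures.
Require Import Defs.
From mathcomp Require Import all_boot all_order all_algebra.
From mathcomp Require Import all_classical all_reals all_analysis.
From mathcomp Require Import measurable_realfun ring lra.
Set Implicit Arguments.
Unset Strict Implicit.
Unset Printing Implicit Defensive.
Import Order.TTheory GRing.Theory Num.Theory.
Import numFieldNormedType.Exports.
Local Open Scope classical_set_scope.
Local Open Scope ring_scope.

(** The theorem says that the two variational principles define certain forces,
    and that the balance of these forces is the stated system. Everything but
    the pressure comes from one scheme: exhibit a smooth field that represents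
    the variation of the functional, and show that no other field does.

    Displacements. A variation [dx] of a flow map [x] has an Eulerian
    form [w], with [w (t, x t X) = dx t X], which is smooth with compact support
    in the open cylinder, inside the transported volume. The displaced flow is
    [x] followed by the perturbed identity [g |-> g + h *: w (t, g)], and this
    maps the transported volume onto itself ([image_displaced]). The energies
    of the displaced configurations are thus integrals over one and the same
    set, and no Jacobian appears. The inverse of the perturbed identity is the
    fixed point of a contraction, and so is its derivative; hence all the
    transported quantities of the displaced configuration have expansions in
    [h] to second order, uniform in the point ([varied]), and the action is
    differentiated under the integral sign ([is_derive_volume_integral]).

    Conservative forces. A transported quantity f varies by - D_w f, and its
    gradient by the gradient of that. Integrating by parts the term with the
    gradient of the phase yields [conservative_density], namely mu grad phi
    if the phase is transported, plus s grad theta if the temperature is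
    ([conservative_first_variation]).

    Inertial forces. They vanish when the Eulerian velocity is held fixed, the
    volume being preserved ([inertial_force_fixed]). Otherwise the velocity
    varies by - D_w v + (d/dt + D_v) w, and when v and w are free of divergence
    the variation of the kinetic energy is the work of minus the acceleration
    up to exact derivatives ([kinetic_balance], [kinetic_first_variation]).

    Dissipative forces. The dissipation is quadratic, so half of its variation
    is its polar form; the viscous part is integrated by parts
    ([friction_variation_u], [dissipation_variation_v]).

    Uniqueness. Each Eulerian test field is the displacement of a variation
    ([test_field_variation]), and a continuous function orthogonal to all bumps
    is zero ([fundamental_lemma]). Without constraint the forces are therefore
    unique, and the balance of forces is an equation between known fields
    ([phase_force_balance]). Under the constraint only divergence-free test
    fields are available, and what remains of the momentum balance is
    orthogonal to all of them. Such a field is a gradient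
    ([orthogonal_gradient]): a bump smeared along a closed polygon, in the
    direction of its edges, is a divergence-free test field that measures the
    circulation of the field along the translates of the polygon
    ([smeared_circulation], [polygon_field]), so all circulations along closed
    polygons vanish, and line integrals from a point chosen in each component of
    the domain define the pressure. Conversely a pressure gradient does no work
    along divergence-free variations ([viscous_force_balance]).

    The transport equation is the chain rule along trajectories
    ([phase_transport]). It turns the motion law into [grad phi] times the
    gradient flow equation, and division by [grad phi] is possible on the
    closure of the set where it does not vanish, by continuity
    ([motion_gradient_flow]). At the critical temperature the coupling term of
    the free energy vanishes, and mu is the Allen-Cahn potential
    ([allen_cahn_potential]). *)

(** * Smooth functions *)

Section SmoothCalculus.
Context {R : realType}.
Implicit Types V W : normedModType R.

Lemma differentiable_approx V W (f : V -> W) (df : {linear V -> W}) x :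
  continuous df ->
  (forall e : R, 0 < e ->
     \forall h \near (0 : V), `|f (h + x) - f x - df h| <= e * `|h|) ->
  differentiable f x /\ 'd f x = df :> (V -> W).
Proof.
move=> dfc H.
have fE : f \o shift x = cst (f x) + df +o_ (0 : V) id.
  apply/eqaddoP => e e0; near=> h.
  rewrite /= !fctE opprD addrA; near: h; exact: H.
have dE := diff_unique dfc fE; split=> //.
by apply/diff_locallyP; rewrite dE.
Unshelve. all: by end_near. Qed.

Lemma near_differentiable V W (f g : V -> W) x :
  (\near x, f x = g x) -> differentiable f x ->
  differentiable g x /\ 'd g x = 'd f x :> (V -> W).
Proof.
move=> fg df; apply: differentiable_approx; first exact: diff_continuous.
move=> e e0.
have fgx : f x = g x by exact: (nbhs_singleton fg).
have /diff_locallyP[_ /eqaddoP /(_ e e0)] := df.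
have fgs : \forall h \near (0 : V), f (h + x) = g (h + x).
  by move: fg; rewrite (near_shift 0) subr0.
apply: filterS2 fgs => h <-.
by rewrite /= !fctE opprD addrA fgx.
Qed.

(** Smoothness to a finite order. Closure properties go by induction on the
    order: the derivative of a product or of a composite is made of products
    and composites of functions smooth to the order before. *)
Fixpoint smooth_upto (n : nat) V W (U : set V) (f : V -> W) : Prop :=
  if n is n'.+1 then
    (forall x, U x -> differentiable f x) /\
    forall v, smooth_upto n' U ('D_v f)
  else True.

Lemma iter_derive_rcons V W (vs : seq V) v (f : V -> W) :
  iter_derive (rcons vs v) f = iter_derive vs ('D_v f).
Proof. by elim: vs => //= a vs ->. Qed.

Lemma smooth_on_derive V W U (f : V -> W) v :
  smooth_on U f -> smooth_on U ('D_v f).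
Proof. by move=> sf vs x Ux; rewrite -iter_derive_rcons; apply: sf. Qed.

Lemma smooth_onP V W U (f : V -> W) :
  smooth_on U f <-> forall n, smooth_upto n U f.
Proof.
split=> [sf n|].
  elim: n f sf => //= n IH f sf; split; first by move=> x; exact: (sf [::]).
  by move=> v; apply: IH; exact: smooth_on_derive.
move=> sf vs; elim/last_ind: vs f sf => [|vs v IH] f sf x Ux.
  by case: (sf 1%N) => + _; apply.
rewrite iter_derive_rcons; apply: IH => // n.
by case: (sf n.+1) => _; apply.
Qed.

Lemma smooth_on_differentiable V W U (f : V -> W) x :
  smooth_on U f -> U x -> differentiable f x.
Proof. by move=> sf Ux; apply: (sf [::]). Qed.

Lemma smooth_onS V W (U U' : set V) (f : V -> W) :
  U `<=` U' -> smooth_on U' f -> smooth_on U f.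
Proof. by move=> UU' sf vs x /UU'; apply: sf. Qed.

Lemma smooth_onU V W (U U' : set V) (f : V -> W) :
  smooth_on U f -> smooth_on U' f -> smooth_on (U `|` U') f.
Proof. by move=> sf sf' vs x [/sf|/sf']. Qed.

Lemma near_derive_eq V W (f g : V -> W) x v :
  (\near x, f x = g x) -> 'D_v f x = 'D_v g x.
Proof.
have [->|v0] := eqVneq v 0; first by rewrite !derive0.
by move=> fg; apply: near_eq_derive.
Qed.

Lemma open_near V (U : set V) (P : V -> Prop) :
  open U -> (forall x, U x -> P x) -> forall x, U x -> \near x, P x.
Proof. by move=> oU UP x Ux; apply: filterS (open_nbhs_nbhs (conj oU Ux)). Qed.

Lemma smooth_upto_ext n V W U (f g : V -> W) : open U ->
  (forall x, U x -> f x = g x) -> smooth_upto n U f -> smooth_upto n U g.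
Proof.
move=> oU; elim: n f g => //= n IH f g fg [df sf]; split.
  by move=> x Ux; have [] := near_differentiable (open_near oU fg Ux) (df x Ux).
move=> v; apply: IH (sf v) => x Ux; apply: near_derive_eq.
exact: open_near Ux.
Qed.

Lemma smooth_on_ext V W U (f g : V -> W) : open U ->
  (forall x, U x -> f x = g x) -> smooth_on U f -> smooth_on U g.
Proof.
move=> oU fg /smooth_onP sf; apply/smooth_onP => n.
exact: smooth_upto_ext (sf n).
Qed.

(** The step of these inductions: it remains to find, for the derivative, a
    formula valid on the open set. *)
Lemma smooth_uptoS n V W U (f : V -> W) : open U ->
  (forall x, U x -> differentiable f x) ->
  (forall v, exists2 g, smooth_upto n U g &
     forall x, U x -> 'D_v f x = g x) ->
  smooth_upto n.+1 U f.
Proof.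
move=> oU df sf; split=> // v; have [g sg fg] := sf v.
by apply: smooth_upto_ext sg => // x Ux; rewrite fg.
Qed.

Lemma smooth_uptoW n V W U (f : V -> W) :
  smooth_upto n.+1 U f -> smooth_upto n U f.
Proof.
elim: n f => // n IH f [df sf]; split=> // v; exact: IH.
Qed.

Lemma smooth_upto_cst n V W U (a : W) : open U -> smooth_upto n U (cst a : V -> W).
Proof.
move=> oU; elim: n a => // n IH a; apply: smooth_uptoS => //.
by move=> v; exists (cst 0) => // x _; rewrite derive_cst.
Qed.

Lemma smooth_cst V W U (a : W) : open U -> smooth_on U (fun _ : V => a).
Proof. by move=> oU; apply/smooth_onP => n; apply: smooth_upto_cst. Qed.

Lemma smooth_upto_linear n V W U (L : {linear V -> W}) : open U -> continuous L ->
  smooth_upto n U L.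
Proof.
case: n => // n oU cL; apply: smooth_uptoS => //.
  by move=> x _; exact: linear_differentiable.
move=> v; exists (cst (L v)); first exact: smooth_upto_cst.
by move=> x _; rewrite deriveE ?diff_lin//; exact: linear_differentiable.
Qed.

Lemma smooth_linear V W U (L : {linear V -> W}) : open U -> continuous L ->
  smooth_on U L.
Proof. by move=> oU cL; apply/smooth_onP => n; apply: smooth_upto_linear. Qed.

Lemma smooth_id V U : open U -> smooth_on U (fun x : V => x).
Proof. by move=> oU; apply: (@smooth_linear _ _ _ idfun) => // x. Qed.

Lemma smooth_upto_add n V W U (f g : V -> W) : open U ->
  smooth_upto n U f -> smooth_upto n U g -> smooth_upto n U (f + g).
Proof.
move=> oU; elim: n f g => [|n IH] f g; first by move=> _ _; exact: I.
move=> [df sf] [dg sg]; apply: smooth_uptoS; first exact: oU.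
  by move=> x Ux; apply: differentiableD; [exact: df|exact: dg].
move=> v; exists ('D_v f + 'D_v g); first exact: (IH _ _ (sf v) (sg v)).
by move=> x Ux; rewrite deriveD//; apply: diff_derivable; [exact: df|exact: dg].
Qed.

Lemma smooth_add V W U (f g : V -> W) : open U ->
  smooth_on U f -> smooth_on U g -> smooth_on U (fun x => f x + g x).
Proof.
move=> oU /smooth_onP sf /smooth_onP sg; apply/smooth_onP => n.
exact: smooth_upto_add.
Qed.

Lemma differentiable_lin_comp V W W' (L : {linear W -> W'}) (f : V -> W) x v :
  continuous L -> differentiable f x ->
  differentiable (L \o f) x /\ 'D_v (L \o f) x = L ('D_v f x).
Proof.
move=> cL df.
have dL : differentiable L (f x) by exact: linear_differentiable.
have dLf : differentiable (L \o f) x by exact: differentiable_comp.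
split=> //; rewrite !deriveE// diff_comp//.
by rewrite diff_lin.
Qed.

Lemma smooth_upto_lin_comp n V W W' U (L : {linear W -> W'}) (f : V -> W) :
  open U -> continuous L -> smooth_upto n U f -> smooth_upto n U (L \o f).
Proof.
move=> oU cL; elim: n f => // n IH f [df sf]; apply: smooth_uptoS => //.
  by move=> x /df dfx; have [] := differentiable_lin_comp 0 cL dfx.
move=> v; exists (L \o 'D_v f); first exact: IH (sf v).
by move=> x /df dfx; have [_ ->] := differentiable_lin_comp v cL dfx.
Qed.

Lemma smooth_lin_comp V W W' U (L : {linear W -> W'}) (f : V -> W) :
  open U -> continuous L -> smooth_on U f -> smooth_on U (fun x => L (f x)).
Proof.
move=> oU cL /smooth_onP sf; apply/smooth_onP => n.
exact: smooth_upto_lin_comp.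
Qed.

Lemma smooth_scale V W U k (f : V -> W) : open U ->
  smooth_on U f -> smooth_on U (fun x => k *: f x).
Proof.
move=> oU; apply: (@smooth_lin_comp _ _ _ _ ( *:%R k)) => //.
exact: scaler_continuous.
Qed.

Lemma smooth_opp V W U (f : V -> W) : open U ->
  smooth_on U f -> smooth_on U (fun x => - f x).
Proof.
move=> oU sf; apply: (smooth_on_ext oU _ (smooth_scale (-1) oU sf)).
by move=> x _; rewrite scaleN1r.
Qed.

Lemma smooth_sub V W U (f g : V -> W) : open U ->
  smooth_on U f -> smooth_on U g -> smooth_on U (fun x => f x - g x).
Proof. by move=> oU sf sg; apply: smooth_add => //; exact: smooth_opp. Qed.

Lemma smooth_sum V W U (I : Type) (s : seq I) (P : pred I) (f : I -> V -> W) :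
  open U -> (forall i, smooth_on U (f i)) ->
  smooth_on U (fun x => \sum_(i <- s | P i) f i x).
Proof.
move=> oU sf; elim: s => [|i s IH].
  by apply: (smooth_on_ext oU _ (smooth_cst 0 oU)) => x _; rewrite big_nil.
case Pi : (P i).
  apply: (smooth_on_ext oU _ (smooth_add oU (sf i) IH)) => x _.
  by rewrite big_cons Pi.
by apply: (smooth_on_ext oU _ IH) => x _; rewrite big_cons Pi.
Qed.

Lemma smooth_upto_mul n V U (f g : V -> R) : open U ->
  smooth_upto n U f -> smooth_upto n U g -> smooth_upto n U (f * g).
Proof.
move=> oU; elim: n f g => // n IH f g sf sg.
have [[df sf'] [dg sg']] := (sf, sg); apply: smooth_uptoS => //.
  by move=> x Ux; apply: differentiableM; [exact: df|exact: dg].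
move=> v; exists (f * 'D_v g + g * 'D_v f).
  by apply: smooth_upto_add => //; apply: IH;
    [exact: smooth_uptoW sf|exact: sg'|exact: smooth_uptoW sg|exact: sf'].
move=> x Ux; rewrite deriveM//; apply: diff_derivable; [exact: df|exact: dg].
Qed.

Lemma smooth_mul V U (f g : V -> R) : open U ->
  smooth_on U f -> smooth_on U g -> smooth_on U (fun x => f x * g x).
Proof.
move=> oU /smooth_onP sf /smooth_onP sg; apply/smooth_onP => n.
exact: smooth_upto_mul.
Qed.

Lemma smooth_prod V U (I : Type) (s : seq I) (P : pred I) (f : I -> V -> R) :
  open U -> (forall i, smooth_on U (f i)) ->
  smooth_on U (fun x => \prod_(i <- s | P i) f i x).
Proof.
move=> oU sf; elim: s => [|i s IH].
  by apply: (smooth_on_ext oU _ (smooth_cst (1 : R) oU)) => x _; rewrite big_nil.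
case Pi : (P i).
  apply: (smooth_on_ext oU _ (smooth_mul oU (sf i) IH)) => x _.
  by rewrite big_cons Pi.
by apply: (smooth_on_ext oU _ IH) => x _; rewrite big_cons Pi.
Qed.

Lemma smooth_scalel V W U (f : V -> R) (a : W) : open U ->
  smooth_on U f -> smooth_on U (fun x => f x *: a).
Proof.
move=> oU.
have lin : linear ( *:%R ^~ a : R -> W).
  by move=> k y z; rewrite scalerDl scalerA.
pose L : {linear R -> W} := HB.pack ( *:%R ^~ a : R -> W) (GRing.isLinear.Build _ _ _ _ _ lin).
by apply: (@smooth_lin_comp _ _ _ _ L) => // x; exact: scalel_continuous.
Qed.

Lemma smooth_upto_pair n V W W' U (f : V -> W) (g : V -> W') : open U ->
  smooth_upto n U f -> smooth_upto n U g ->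
  smooth_upto n U (fun x => (f x, g x)).
Proof.
move=> oU; elim: n f g => // n IH f g [df sf] [dg sg]; apply: smooth_uptoS => //.
  by move=> x Ux; apply: differentiable_pair; [exact: df|exact: dg].
move=> v; exists (fun x => ('D_v f x, 'D_v g x)); first exact: IH (sf v) (sg v).
move=> x Ux; have [dfx dgx] := (df x Ux, dg x Ux).
rewrite !deriveE ?diff_pair//.
exact: differentiable_pair.
Qed.

Lemma smooth_pair V W W' U (f : V -> W) (g : V -> W') : open U ->
  smooth_on U f -> smooth_on U g -> smooth_on U (fun x => (f x, g x)).
Proof.
move=> oU /smooth_onP sf /smooth_onP sg; apply/smooth_onP => n.
exact: smooth_upto_pair.
Qed.

(** Finite dimension with continuous coordinates. The chain rule differentiates
    the outer function in a direction that depends on the point; expanded in a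
    basis, this becomes a sum of products of functions of the point. *)
Definition finite_basis V : Prop :=
  exists n (e : 'I_n -> V) (c : 'I_n -> {linear V -> R}),
    (forall i, continuous (c i)) /\ forall v, v = \sum_i c i v *: e i.

Lemma derive_basis V W (f : V -> W) x n (e : 'I_n -> V) (c : 'I_n -> R) v :
  differentiable f x -> v = \sum_i c i *: e i ->
  'D_v f x = \sum_i c i *: 'D_(e i) f x.
Proof.
move=> df vE; rewrite deriveE// vE linear_sum; apply: eq_bigr => i _.
by rewrite linearZ/= deriveE.
Qed.

Lemma smooth_upto_comp n V W U U' (f : W -> R) (g : V -> W) :
  finite_basis W -> open U -> open U' ->
  (forall x, U x -> U' (g x)) ->
  smooth_upto n U' f -> smooth_upto n U g -> smooth_upto n U (f \o g).
Proof.
move=> [m [e [c [cc cE]]]] oU oU' gU; elim: n f => // n IH f [df sf] sg.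
have [dg sg'] := sg; apply: smooth_uptoS => //.
  by move=> x Ux; apply: differentiable_comp; [exact: dg|apply/df/gU].
move=> v; exists (\sum_i ((c i \o 'D_v g) * ('D_(e i) f \o g))).
  elim/big_ind: _ => [|? ? ? ?|i _].
  - exact: smooth_upto_cst.
  - exact: smooth_upto_add.
  - apply: smooth_upto_mul => //; first exact: smooth_upto_lin_comp (sg' v).
    by apply: IH; [exact: sf|exact: smooth_uptoW sg].
move=> x Ux; have [dgx dfx] := (dg x Ux, df _ (gU x Ux)).
have dfgx : differentiable (f \o g) x by exact: differentiable_comp.
rewrite (deriveE _ dfgx) (diff_comp dgx dfx) /comp -(deriveE _ dgx) -(deriveE _ dfx).
rewrite (derive_basis dfx (cE _)) fct_sumE.
exact: eq_bigr.
Qed.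

Lemma smooth_comp V W U U' (f : W -> R) (g : V -> W) :
  finite_basis W -> open U -> open U' ->
  (forall x, U x -> U' (g x)) ->
  smooth_on U' f -> smooth_on U g -> smooth_on U (fun x => f (g x)).
Proof.
move=> fW oU oU' gU /smooth_onP sf /smooth_onP sg; apply/smooth_onP => n.
exact: smooth_upto_comp gU (sf n) (sg n).
Qed.

Lemma finite_basisR : finite_basis R.
Proof.
exists 1%N, (fun=> 1), (fun=> idfun); split=> [i x //|v].
by rewrite big_ord1 /= /GRing.scale/= mulr1.
Qed.

Lemma finite_basis_rV d : finite_basis 'rV[R]_d.
Proof.
have lin i : linear (fun v : 'rV[R]_d => v ord0 i).
  by move=> k y z; rewrite !mxE.
pose L i : {linear 'rV[R]_d -> R} :=
  HB.pack (fun v : 'rV[R]_d => v ord0 i) (GRing.isLinear.Build _ _ _ _ _ (lin i)).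
exists d, (fun i => delta_mx ord0 i), L; split.
  by move=> i; exact: coord_continuous.
by move=> v; rewrite [LHS]row_sum_delta.
Qed.

Lemma finite_basis_prod V W : finite_basis V -> finite_basis W ->
  finite_basis (V * W)%type.
Proof.
move=> [n [e [c [cc cE]]]] [n' [e' [c' [cc' cE']]]].
have lin i : linear (fun p : V * W =>
    match fintype.split (i : 'I_(n + n')) with
    | inl j => c j p.1 | inr j => c' j p.2 end).
  by move=> k y z; case: fintype.split => j; rewrite linearP.
pose L (i : 'I_(n + n')) : {linear (V * W)%type -> R} :=
  HB.pack (fun p : V * W => match fintype.split i with inl j => c j p.1 | inr j => c' j p.2 end)
    (GRing.isLinear.Build _ _ _ _ _ (lin i)).
exists (n + n')%N, (fun i => match fintype.split i with inl j => (e j, 0) | inr j => (0, e' j) end), L.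
split.
  move=> i /= p; case: (fintype.split i) => j.
    by apply: (@continuous_comp _ _ _ fst (c j)); [exact: cvg_fst|exact: cc].
  by apply: (@continuous_comp _ _ _ snd (c' j)); [exact: cvg_snd|exact: cc'].
have scaleE a (x : V) (y : W) : a *: ((x, y) : V * W) = (a *: x, a *: y) by [].
have addE (x x' : V) (y y' : W) :
  ((x, y) : V * W) + (x', y') = (x + x', y + y') by [].
move=> [v w]; rewrite big_split_ord/=.
rewrite (eq_bigr (fun i => (c i v *: e i, 0))); last first.
  by move=> i _; rewrite /= (unsplitK (inl i)) scaleE scaler0.
rewrite [X in _ = _ + X](eq_bigr (fun i => (0, c' i w *: e' i))); last first.
  by move=> i _; rewrite /= (unsplitK (inr i)) scaleE scaler0.
have sum1 : \sum_(i < n) ((c i v *: e i, 0) : V * W) = (\sum_(i < n) c i v *: e i, 0).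
  by elim/big_rec2: _ => // i y1 y2 _ ->; rewrite addE addr0.
have sum2 : \sum_(i < n') ((0, c' i w *: e' i) : V * W) =
    (0, \sum_(i < n') c' i w *: e' i).
  by elim/big_rec2: _ => // i y1 y2 _ ->; rewrite addE addr0.
by rewrite sum1 sum2 addE addr0 add0r -cE -cE'.
Qed.

End SmoothCalculus.

(** * Mean value estimates *)

Section SmoothEstimates.
Context {R : realType}.
Implicit Types V W : normedModType R.

Lemma derive_comp V W W' (f : W -> W') (g : V -> W) x v :
  differentiable g x -> differentiable f (g x) ->
  'D_v (fun y => f (g y)) x = 'D_('D_v g x) f (g x).
Proof.
move=> dg df; have dfg : differentiable (f \o g) x by exact: differentiable_comp.
by rewrite -[LHS]/('D_v (f \o g) x) (deriveE _ dfg) (diff_comp dg df)/= -(deriveE _ dg) -(deriveE _ df).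
Qed.

Lemma derive_scalev V (f : V -> R) x k v : differentiable f x ->
  'D_(k *: v) f x = k * 'D_v f x.
Proof. by move=> df; rewrite !deriveE// linearZ. Qed.

Lemma derive_subv V (f : V -> R) x v w : differentiable f x ->
  'D_(v - w) f x = 'D_v f x - 'D_w f x.
Proof. by move=> df; rewrite !deriveE// linearB. Qed.

Lemma derive_addv V (f : V -> R) x v w : differentiable f x ->
  'D_(v + w) f x = 'D_v f x + 'D_w f x.
Proof. by move=> df; rewrite !deriveE// linearD. Qed.

Lemma is_derive_line V W (f : V -> W) x v (s : R) :
  differentiable f (x + s *: v) ->
  is_derive s 1 (fun r : R => f (x + r *: v)) ('D_v f (x + s *: v)).
Proof.
move=> df.
have [dg Dg] : differentiable (fun r : R => x + r *: v) s /\
    'D_1 (fun r : R => x + r *: v) s = v.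
  have H : is_diff s ((cst x : R -> V) + *:%R^~ v) (0 + *:%R^~ v).
    exact: is_diffD.
  have [d1 d2] := H; split; first exact: d1.
  rewrite -[LHS]/('D_1 (cst x + *:%R^~ v) s) deriveE// d2 /=.
  by rewrite fctE/= add0r scale1r.
apply: DeriveDef.
  by apply: diff_derivable; apply: (differentiable_comp dg df).
by rewrite (derive_comp _ dg df) Dg.
Qed.

Lemma MVT_line V (f : V -> R) x v :
  (forall s, 0 <= s <= 1 -> differentiable f (x + s *: v)) ->
  exists2 s, 0 <= s <= 1 & f (x + v) - f x = 'D_v f (x + s *: v).
Proof.
move=> df.
have [|||s sI E] := @MVT_segment R (fun r => f (x + r *: v))
    (fun r => 'D_v f (x + r *: v)) 0 1 => //.
- move=> s; rewrite in_itv/= => /andP[s0 s1].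
  by apply: is_derive_line; apply: df; rewrite !ltW.
- apply: derivable_within_continuous => s; rewrite in_itv/= => sI.
  by have [] := is_derive_line (df _ sI).
- exists s; first by move: sI; rewrite in_itv.
  by move: E; rewrite scale1r scale0r addr0 subr0 mulr1.
Qed.

Lemma smooth_on_continuous V W U (f : V -> W) x :
  smooth_on U f -> U x -> {for x, continuous f}.
Proof.
by move=> sf Ux; exact: (differentiable_continuous (smooth_on_differentiable sf Ux)).
Qed.

Lemma continuous_near_bounded (T : topologicalType) W (f : T -> W) x :
  {for x, continuous f} -> \forall y \near x, `|f y| <= `|f x| + 1.
Proof.
move=> cf; have /cvgrPdist_lt /(_ 1 ltr01) := cf.
apply: filterS => y /ltW fxy.
rewrite -[f y](subrK (f x)) addrC (le_trans (ler_normD _ _))// lerD2l.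
by rewrite distrC.
Qed.

Lemma finite_basis_bound V : finite_basis V ->
  exists n (e : 'I_n -> V) (c : 'I_n -> V -> R) (L : R),
    [/\ 0 <= L, (forall i, continuous (c i)), (forall v, v = \sum_i c i v *: e i) &
        forall i v, `|c i v| <= L * `|v|].
Proof.
move=> [n [e [c [cc cE]]]]; exists n, e, (fun i => c i).
have /choice[k kP] i : exists k : R, 0 < k /\ forall x, `|c i x| <= k * `|x|.
  by have [k k0 kH] := linear_lipschitz (cc i); exists k.
exists (\sum_i k i); split => // [|i v].
  by apply: sumr_ge0 => i _; apply: ltW; case: (kP i).
apply: le_trans (_ : k i * `|v| <= _); first by case: (kP i).
rewrite ler_wpM2r// (bigD1 i)//= lerDl sumr_ge0// => j _.
by apply: ltW; case: (kP j).
Qed.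

Lemma derive_near_bounded V U (f : V -> R) x :
  finite_basis V -> open U -> smooth_on U f -> U x ->
  \forall M \near +oo & y \near x, forall k, `|'D_k f y| <= M * `|k|.
Proof.
move=> /finite_basis_bound[n [e [c [L [L0 _ cE cL]]]]] oU sf Ux.
pose B := \sum_i (`|'D_(e i) f x| + 1) * L.
exists ([set M | B <= M], [set y | U y /\ forall i, `|'D_(e i) f y| <= `|'D_(e i) f x| + 1]).
  split; first exact: nbhs_pinfty_ge (num_real _).
  apply: filterI; first exact: open_nbhs_nbhs.
  apply: filter_forall => i; apply: continuous_near_bounded.
  by apply: (smooth_on_continuous _ Ux); exact: smooth_on_derive.
move=> [M y] /= [BM [Uy H]] k.
rewrite (derive_basis (smooth_on_differentiable sf Uy) (cE k)).
apply: le_trans (ler_norm_sum _ _ _) _.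
apply: le_trans (_ : B * `|k| <= _); last by rewrite ler_wpM2r.
rewrite /B mulr_suml ler_sum// => i _.
rewrite /GRing.scale/= normrM mulrC -mulrA ler_pM//.
Qed.

Lemma derive2_near_bounded V U (f : V -> R) x :
  finite_basis V -> open U -> smooth_on U f -> U x ->
  \forall M \near +oo & y \near x, forall k, `|'D_k ('D_k f) y| <= M * `|k| ^+ 2.
Proof.
move=> fV; have [n [e [c [L [L0 _ cE cL]]]]] := finite_basis_bound fV.
move=> oU sf Ux.
have H : forall i, exists M : R, \forall y \near x, forall k, `|'D_k ('D_(e i) f) y| <= M * `|k|.
  move=> i; have [[A B]/= [A0 B0] AB] := derive_near_bounded fV oU (smooth_on_derive (e i) sf) Ux.
  have [M AM] := @filter_ex _ (pinfty_nbhs R) _ _ A0.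
  by exists M; apply: filterS B0 => y By; exact: (AB (M, y)).
have {H}/choice[M MP] := H.
pose B := \sum_i `|M i| * L.
exists ([set M | B <= M], [set y | U y /\ forall i, forall k, `|'D_k ('D_(e i) f) y| <= M i * `|k|]).
  split; first exact: nbhs_pinfty_ge (num_real _).
  apply: filterI; first exact: open_nbhs_nbhs.
  by apply: filter_forall => i; exact: MP.
move=> [M' y] /= [BM [Uy H]] k.
have E : 'D_k ('D_k f) y = \sum_i c i k *: 'D_k ('D_(e i) f) y.
  have -> : 'D_k ('D_k f) y = 'D_k (\sum_i c i k *: 'D_(e i) f) y.
    apply: near_derive_eq; apply: (open_near oU _ Uy) => z Uz.
    by rewrite (derive_basis (smooth_on_differentiable sf Uz) (cE k)) fct_sumE.
  have dd i : derivable ('D_(e i) f) y k.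
    by apply/diff_derivable/(smooth_on_differentiable _ Uy)/smooth_on_derive.
  rewrite derive_sum => [|i]; last exact: derivableZ.
  by apply: eq_bigr => i _; rewrite deriveZ.
rewrite E; apply: le_trans (ler_norm_sum _ _ _) _.
apply: le_trans (_ : B * `|k| ^+ 2 <= _); last by rewrite ler_wpM2r// exprn_ge0.
rewrite /B mulr_suml ler_sum// => i _.
rewrite /GRing.scale/= normrM expr2.
apply: le_trans (ler_pM (normr_ge0 _) (normr_ge0 _) (cL i k) (H i k)) _.
rewrite [leLHS](_ : _ = M i * L * (`|k| * `|k|)); last by ring.
by rewrite ler_wpM2r ?mulr_ge0// ler_wpM2r// ler_norm.
Qed.

(** Near each point the derivatives of the first two orders are bounded by one
    constant for a whole neighbourhood; compactness of [K] makes the constant,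
    and the size of the increments, independent of the point. *)
Lemma uniform_taylor V (U K : set V) (f : V -> R) :
  finite_basis V -> open U -> smooth_on U f -> compact K -> K `<=` U ->
  exists2 C : R, 0 <= C & exists2 r : R, 0 < r &
    (forall a k, K a -> `|'D_k f a| <= C * `|k|) /\
    forall a k, K a -> `|k| < r ->
      [/\ U (a + k), `|f (a + k) - f a| <= C * `|k| &
          `|f (a + k) - f a - 'D_k f a| <= C * `|k| ^+ 2].
Proof.
move=> fV oU sf /compact_near_coveringP cK KU.
pose P (C : R) (a : V) := [/\ 0 <= C, forall k, `|'D_k f a| <= C * `|k| & forall k, `|k| < C^-1 ->
      [/\ U (a + k), `|f (a + k) - f a| <= C * `|k| &
          `|f (a + k) - f a - 'D_k f a| <= C * `|k| ^+ 2]].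
suff H : \forall C \near +oo, K `<=` P C.
  have [C [C0 KP]] : exists C : R, 0 < C /\ K `<=` P C.
    apply: (@filter_ex _ (pinfty_nbhs R)); apply: filterI => //.
    exact: nbhs_pinfty_gt (num_real _).
  exists C; first exact: ltW.
  exists C^-1; first by rewrite invr_gt0.
  by split=> [a k /KP[_ + _]|a k /KP[_ _ + kr]]; apply.
apply: cK => a Ka; have Ua := KU _ Ka.
have H1 := derive_near_bounded fV oU sf Ua.
have H2 := derive2_near_bounded fV oU sf Ua.
case: H1 => [[A1 B1]/= [A1oo B1a] AB1].
case: H2 => [[A2 B2]/= [A2oo B2a] AB2].
have : nbhs a (U `&` (B1 `&` B2)).
  by apply: filterI; [exact: open_nbhs_nbhs|exact: filterI].
move=> /nbhs_ballP[e /= e0 eB].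
exists (ball a (e / 2), A1 `&` (A2 `&` [set M | 0 < M /\ (e / 2)^-1 <= M])).
  split; first by apply: nbhsx_ballx; rewrite divr_gt0.
  apply: filterI => //; apply: filterI => //; apply: filterI.
    exact: nbhs_pinfty_gt (num_real _).
  exact: nbhs_pinfty_ge (num_real _).
move=> [b M] /= [ab [A1M [A2M [M0 eM]]]]; split; first exact: ltW.
  move=> k; apply: (AB1 (M, b)); split=> //.
  have /eB[_ []] // : ball a e b.
  by apply: le_ball ab; rewrite ler_pdivrMr// ler_pMr// ler1n.
move=> k kM.
have inB s : 0 <= s <= 1 -> (U `&` (B1 `&` B2)) (b + s *: k).
  move=> /andP[s0 s1]; apply: eB; rewrite -ball_normE/=.
  move: ab; rewrite -ball_normE/= => ab.
  rewrite opprD addrA (le_lt_trans (ler_normB _ _))// (splitr e) ltrD//.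
  rewrite normrZ ger0_norm// (le_lt_trans (ler_piMl _ s1))//.
  rewrite (lt_le_trans kM)// -[leRHS]invrK lef_pV2// posrE// invr_gt0 divr_gt0//.
have df s : 0 <= s <= 1 -> differentiable f (b + s *: k).
  by move=> /inB[Us _]; exact: smooth_on_differentiable Us.
have b0 : b + 0 *: k = b by rewrite scale0r addr0.
have b1 : b + 1 *: k = b + k by rewrite scale1r.
split.
- by have [] : (U `&` (B1 `&` B2)) (b + 1 *: k); [apply: inB; rewrite lexx ler01|rewrite b1].
- have [s s01 ->] := MVT_line df.
  by apply: (AB1 (M, b + s *: k)); split => //; case: (inB _ s01) => _ [].
- have [s s01 ->] := MVT_line df.
  have [s0 s1] := andP s01.
  have ddf r : 0 <= r <= 1 -> differentiable ('D_k f) (b + r *: (s *: k)).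
    move=> /andP[r0 r1]; rewrite scalerA.
    have /inB[Us _] : 0 <= r * s <= 1 by rewrite mulr_ge0//= mulr_ile1.
    exact: (smooth_on_differentiable (smooth_on_derive k sf) Us).
  have [r r01 E] := MVT_line ddf.
  have [r0 r1] := andP r01.
  rewrite E scalerA.
  have rs01 : 0 <= r * s <= 1 by rewrite mulr_ge0//= mulr_ile1.
  have [Urs [_ B2rs]] := inB _ rs01.
  have dDf := smooth_on_differentiable (smooth_on_derive k sf) Urs.
  rewrite deriveE// linearZ/= -deriveE// normrM ger0_norm//.
  apply: le_trans (ler_piMl _ s1) _ => //.
  exact: (AB2 (M, b + (r * s) *: k)).
Qed.

Lemma continuous_derive_along (T : topologicalType) W U (f : W -> R)
    (a k : T -> W) t :
  finite_basis W -> open U -> smooth_on U f -> U (a t) ->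
  {for t, continuous a} -> {for t, continuous k} ->
  {for t, continuous (fun p => 'D_(k p) f (a p))}.
Proof.
move=> [n [e [c [cc cE]]]] oU sf Ut ca ck.
have nU : \forall p \near t, U (a p) by apply: ca; exact: open_nbhs_nbhs.
have E p : U (a p) -> 'D_(k p) f (a p) = \sum_i c i (k p) * 'D_(e i) f (a p).
  by move=> Up; rewrite (derive_basis (smooth_on_differentiable sf Up) (cE (k p))).
change ((fun p => 'D_(k p) f (a p)) @ t --> 'D_(k t) f (a t)); rewrite (E _ Ut).
have E' : \forall p \near t, \sum_i c i (k p) * 'D_(e i) f (a p) = 'D_(k p) f (a p).
  by apply: filterS nU => p Up; rewrite E.
apply: (cvg_trans (near_eq_cvg E')).
apply: cvg_big => [|i _]; first exact: add_continuous.
apply: cvgM.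
  by apply: (@continuous_comp _ _ _ k (c i)) => //; exact: cc.
apply: (@continuous_comp _ _ _ a ('D_(e i) f)) => //.
exact: (smooth_on_continuous (smooth_on_derive (e i) sf) Ut).
Qed.

(** The mean value theorem used twice, for the increment in the direction [v]
    as a function along [u], then for ['D_u f] along [v]. *)
Lemma mixed_difference V U (f : V -> R) x u v (h r : R) : 0 <= h -> h * (`|u| + `|v|) < r ->
  ball x r `<=` U -> smooth_on U f ->
  exists y, `|y - x| <= h * (`|u| + `|v|) /\
   f (x + h *: u + h *: v) - f (x + h *: u) - (f (x + h *: v) - f x) =
   h * h * 'D_v ('D_u f) y.
Proof.
move=> h0 hr xrU sf.
have inU s t : 0 <= s <= 1 -> 0 <= t <= 1 -> U (x + s *: (h *: u) + t *: (h *: v)) /\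
   `|x + s *: (h *: u) + t *: (h *: v) - x| <= h * (`|u| + `|v|).
  move=> /andP[s0 s1] /andP[t0 t1].
  have H : `|x + s *: (h *: u) + t *: (h *: v) - x| <= h * (`|u| + `|v|).
    rewrite -[x + _ + _]addrA [x + _]addrC addrK (le_trans (ler_normD _ _))// mulrDr.
    by rewrite lerD// !normrZ !(ger0_norm h0) ger0_norm// ler_piMl// mulr_ge0.
  split=> //; apply: xrU; rewrite -ball_normE/= distrC; exact: le_lt_trans hr.
pose g y := f (y + h *: v) - f y.
have sf' w : smooth_on U ('D_w f) by exact: smooth_on_derive.
have dsh y w : U (y + w) -> differentiable (fun z => f (z + w)) y /\
    forall k, 'D_k (fun z => f (z + w)) y = 'D_k f (y + w).
  move=> Uy.
  have dw : is_diff y (id + cst w) (id + 0) by exact: is_diffD.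
  have [d1 d2] := dw.
  have dfy := smooth_on_differentiable sf Uy.
  split; first exact: (@differentiable_comp _ _ _ _ (id + cst w) f).
  move=> k; have D : 'D_k (id + cst w) y = k.
    by rewrite (deriveE _ d1) d2 /= addr0.
  by have := @derive_comp _ _ _ f (id + cst w) y k d1 dfy; rewrite D.
have dg s : 0 <= s <= 1 -> differentiable g (x + s *: (h *: u)).
  move=> s01; apply: differentiableB.
    by apply: (dsh _ _ _).1; rewrite -[h *: v]scale1r; apply: (inU _ _ s01 _).1; rewrite ler01/=.
  apply: (smooth_on_differentiable sf).
  by rewrite -[x + _]addr0 -[0](scale0r (h *: v)); apply: (inU _ _ s01 _).1; rewrite lexx ler01.
have [s s01 E] := MVT_line dg.
have U1 : U (x + s *: (h *: u) + h *: v).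
  by rewrite -[h *: v]scale1r; apply: (inU _ _ s01 _).1; rewrite ler01/=.
have U0 : U (x + s *: (h *: u)).
  by rewrite -[x + _]addr0 -[0](scale0r (h *: v)); apply: (inU _ _ s01 _).1; rewrite lexx ler01.
have dD t : 0 <= t <= 1 -> differentiable ('D_u f) (x + s *: (h *: u) + t *: (h *: v)).
  by move=> t01; apply: (smooth_on_differentiable (sf' u)); case: (inU s t).
have [t t01 E2] := MVT_line dD.
exists (x + s *: (h *: u) + t *: (h *: v)); split; first by case: (inU s t).
have -> : f (x + h *: u + h *: v) - f (x + h *: u) - (f (x + h *: v) - f x) =
    g (x + h *: u) - g x by [].
have [Ut _] := inU _ _ s01 t01.
have [d1 D1] := dsh _ _ U1.
rewrite E deriveB; [|exact: diff_derivable|exact/diff_derivable/(smooth_on_differentiable sf)].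
rewrite D1.
have df1 := smooth_on_differentiable sf U1.
have df0 := smooth_on_differentiable sf U0.
have dfD := smooth_on_differentiable (sf' u) Ut.
rewrite (derive_scalev _ _ df1) (derive_scalev _ _ df0).
by rewrite -mulrBr E2 (derive_scalev _ _ dfD) mulrA.
Qed.

(** Schwarz's theorem. The mixed difference is symmetric in the two directions,
    so that both iterated derivatives, at points near [x], give the same
    number. *)
Lemma derive_commute V U (f : V -> R) x u v : open U -> smooth_on U f -> U x ->
  'D_u ('D_v f) x = 'D_v ('D_u f) x.
Proof.
move=> oU sf Ux; apply/eqP; rewrite -subr_eq0 -normr_le0.
apply/ler_addgt0Pr => e e0; rewrite add0r (splitr e).
have sf2 w w' : {for x, continuous ('D_w ('D_w' f))}.
  by apply: (smooth_on_continuous _ Ux); do 2 apply: smooth_on_derive.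
have e2 : 0 < e / 2 by rewrite divr_gt0.
have /nbhs_ballP[r /= r0 rP] : \forall y \near x, U y /\
   (`|'D_u ('D_v f) x - 'D_u ('D_v f) y| < e / 2 /\
    `|'D_v ('D_u f) x - 'D_v ('D_u f) y| < e / 2).
  apply: filterI; first exact: open_nbhs_nbhs.
  by apply: filterI; [have /cvgrPdist_lt := sf2 u v|have /cvgrPdist_lt := sf2 v u]; apply.
pose h := r / (2 * (`|u| + `|v| + 1)).
have N0 : 0 < `|u| + `|v| + 1 by rewrite ltr_wpDl// addr_ge0.
have h0 : 0 < h by rewrite divr_gt0// mulr_gt0.
have hr : h * (`|u| + `|v|) < r.
  rewrite /h -mulrA gtr_pMr// mulrC ltr_pdivrMr ?mulr_gt0// mul1r.
  by have := normr_ge0 u; have := normr_ge0 v; lra.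
have rU : ball x r `<=` U by move=> y /rP[].
have [y [yx yE]] := mixed_difference (ltW h0) hr rU sf.
have hr' : h * (`|v| + `|u|) < r by rewrite addrC.
have [z [zx zE]] := mixed_difference (ltW h0) hr' rU sf.
have E : 'D_v ('D_u f) y = 'D_u ('D_v f) z.
  have hh : h * h != 0 by rewrite mulf_neq0// gt_eqF.
  apply: (mulfI hh); apply: (etrans (esym yE)); apply: (etrans _ zE).
  rewrite [x + h *: v + h *: u]addrAC.
  have swap (a b c e' : R) : a - b - (c - e') = a - c - (b - e') by ring.
  exact: swap.
have By : ball x r y by rewrite -ball_normE/= distrC; exact: le_lt_trans hr.
have [_ [_ Hy]] := rP y By.
have Bz : ball x r z by rewrite -ball_normE/= distrC; exact: le_lt_trans hr'.
have [_ [Hz _]] := rP z Bz.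
apply: le_trans (ler_distD ('D_u ('D_v f) z) _ _) _.
apply: lerD; first exact: (ltW Hz).
rewrite -E distrC; exact: (ltW Hy).
Qed.

End SmoothEstimates.

(** * Integration in coordinates *)

Section Charts.
Context {R : realType}.

(** What the integration of continuous functions with compact support asks of
    a measure whose points are read as vectors through [e]. Lebesgue measure
    lives on nested pairs while the fields live on rows, and all these
    properties pass to products; separability is there so that an open set of
    a product is a countable union of measurable boxes. *)
Record chart dd (T : measurableType dd) (X : normedModType R)
    (nu : {measure set T -> \bar R}) (e : T -> X) : Prop := Chart {
  chart_open : forall A, open A -> measurable (e @^-1` A);
  chart_fin : forall M : R, (nu (e @^-1` [set x | (`|x| <= M)%R]) < +oo)%E;
  chart_pos : forall A, open A -> A !=set0 -> (0 < nu (e @^-1` A))%E;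
  chart_sep : exists D : nat -> X, dense (range D);
  chart_cpt : forall M : R, compact [set x : X | `|x| <= M] }.

(** Closed balls are compact in a chart, so that bounded support stands for
    compact support. *)
Definition test_fun (X : normedModType R) (f : X -> R) : Prop :=
  continuous f /\ exists M : R, forall x, M < `|x| -> f x = 0.

Section OneChart.
Context dd (T : measurableType dd) (X : normedModType R).
Context (nu : {measure set T -> \bar R}) (e : T -> X).
Hypothesis ch : chart nu e.

Lemma chart_ball_measurable M : measurable (e @^-1` [set x | `|x| <= M]).
Proof.
rewrite (_ : _ @^-1` _ = ~` (e @^-1` [set x | M < `|x|])); last first.
  by apply/seteqP; split=> z /=; [rewrite ltNge => -> //|move/negP; rewrite -leNgt].
apply: measurableC; apply: (chart_open ch).
have : open ((fun x : X => `|x|) @^-1` [set y : R | M < y]).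
  by apply: open_comp; [move=> x _; exact: norm_continuous|exact: open_gt].
by [].
Qed.

Lemma chart_measurable_fun U (f : X -> R) : open U ->
  (forall x, U x -> {for x, continuous f}) ->
  measurable_fun (e @^-1` U) (f \o e).
Proof.
move=> oU cf mU; apply: (measurability _ (RGenOInfty.measurableE R)).
move=> /= _ [_ [a ->] <-].
rewrite (_ : _ `&` _ = e @^-1` (U `&` f @^-1` `]a, +oo[)); last first.
  by apply/seteqP; split=> z.
apply: (chart_open ch); rewrite openE => x [Ux fx].
apply: filterI; first exact: open_nbhs_nbhs.
apply: (cf _ Ux); apply: open_nbhs_nbhs; split=> //.
exact: mU.
Qed.

Lemma test_fun_measurable f : test_fun f -> measurable_fun setT (f \o e).
Proof.
by move=> [cf _]; apply: (@chart_measurable_fun setT f openT) => x _; apply: cf.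
Qed.

Lemma test_fun_bounded (f : X -> R) : test_fun f -> exists2 B : R, 0 <= B & forall x, `|f x| <= B.
Proof.
move=> [cf [M fM]].
have := chart_cpt ch (M := M) => cK.
have := @continuous_compact _ _ f _ (continuous_subspaceT cf) cK.
move=> /compact_bounded[B [_ /(_ (`|B| + 1))H]].
exists (`|B| + 1); first by rewrite addr_ge0.
move=> x; have [xM|/fM ->] := leP `|x| M; last by rewrite normr0 addr_ge0.
apply: H; last by exists x.
by rewrite (le_lt_trans (ler_norm B))// ltrDl.
Qed.

Lemma test_fun_integrable f : test_fun f -> nu.-integrable setT (EFin \o (f \o e)).
Proof.
move=> tf; have [B B0 fB] := test_fun_bounded tf.
have mf := test_fun_measurable tf; have [cf [M fM]] := tf.
have mK := chart_ball_measurable M.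
have : nu.-integrable (e @^-1` [set x | `|x| <= M]) (EFin \o (f \o e)).
  apply: measurable_bounded_integrable => //.
  - exact: (chart_fin ch).
  - exact: measurable_funS mf.
  - exists B; split; first exact: num_real.
    by move=> C BC x _ /=; apply: le_trans (fB _) (ltW BC).
rewrite integrable_mkcond//; congr (_.-integrable _ _).
apply/funext => z; rewrite patchE; case: ifPn => //.
by rewrite notin_setE/= => /negP; rewrite -ltNge => /fM ->.
Qed.

Lemma integral_chart_bound f B M : 0 <= B -> test_fun f -> (forall x, `|f x| <= B) ->
  (forall x, M < `|x| -> f x = 0) ->
  `|\int[nu]_z f (e z)| <= B * fine (nu (e @^-1` [set x | `|x| <= M])).
Proof.
move=> B0 tf fB fM; have mK := chart_ball_measurable M.
have if_ := test_fun_integrable tf.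
apply: (le_trans (le_normr_Rintegral _ _)) => //.
rewrite -(Rintegral_cst nu mK) [leRHS]Rintegral_mkcond.
apply: le_Rintegral => //.
- by have := integrable_norm if_.
- have : nu.-integrable (e @^-1` [set x | `|x| <= M]) (EFin \o cst B).
    apply: measurable_bounded_integrable => //; first exact: (chart_fin ch).
    exists B; split; first exact: num_real.
    by move=> C BC x _ /=; rewrite ger0_norm// ltW.
  rewrite integrable_mkcond//; congr (_.-integrable _ _).
  by apply/funext => z; rewrite /= !patchE; case: ifP.
- move=> z _; rewrite patchE; case: ifPn => // /=.
  by rewrite notin_setE/= => /negP; rewrite -ltNge => /fM ->; rewrite normr0.
Qed.

(** The function exceeds half its value at [x0] on a nonempty open set, which
    has positive measure. *)
Lemma integral_chart_gt0 f x0 : test_fun f -> (forall x, 0 <= f x) -> 0 < f x0 ->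
  0 < \int[nu]_z f (e z).
Proof.
move=> tf f0 fx0; have [cf [M fM]] := tf.
have if_ := test_fun_integrable tf.
pose A := [set x | f x0 / 2 < f x].
have oA : open A.
  have : open (f @^-1` [set y : R | f x0 / 2 < y]).
    by apply: open_comp; [move=> x _; exact: cf|exact: open_gt].
  by [].
have A0 : A !=set0 by exists x0; rewrite /A/= ltr_pdivrMr// ltr_pMr// ltr1n.
have mA := chart_open ch oA.
have AM : A `<=` [set x | `|x| <= M].
  move=> x Ax /=; rewrite leNgt; apply/negP => /fM fx.
  by move: Ax; rewrite /A/= fx ltNge divr_ge0// ltW.
have Afin : (nu (e @^-1` A) < +oo)%E.
  apply: le_lt_trans (chart_fin ch M); apply: le_measure; rewrite ?inE//.
    exact: chart_ball_measurable.
  by move=> z; apply: AM.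
have : 0 < f x0 / 2 * fine (nu (e @^-1` A)).
  rewrite mulr_gt0// ?divr_gt0//; apply: fine_gt0.
  by rewrite Afin (chart_pos ch).
move=> /lt_le_trans; apply.
rewrite -(Rintegral_cst nu mA) [leLHS]Rintegral_mkcond.
apply: le_Rintegral => //.
- have : nu.-integrable (e @^-1` A) (EFin \o cst (f x0 / 2)).
    apply: measurable_bounded_integrable => //.
    exists (f x0 / 2); split; first exact: num_real.
    by move=> C BC x _ /=; rewrite ger0_norm ?ltW// divr_gt0.
  rewrite integrable_mkcond//; congr (_.-integrable _ _).
  by apply/funext => z; rewrite /= !patchE; case: ifP.
- move=> z _; rewrite patchE; case: ifPn => //=.
  by rewrite inE => /ltW.
Qed.

Lemma integral_testD f g : test_fun f -> test_fun g ->
  \int[nu]_z (f (e z) + g (e z)) = \int[nu]_z f (e z) + \int[nu]_z g (e z).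
Proof.
move=> tf tg; rewrite -[LHS]/(\int[nu]_z (((f \o e) z) + ((g \o e) z))).
by rewrite RintegralD//; exact: test_fun_integrable.
Qed.

Lemma integral_testZ k f : test_fun f ->
  \int[nu]_z (k * f (e z)) = k * \int[nu]_z f (e z).
Proof.
move=> tf; rewrite -[LHS]/(\int[nu]_z (k * ((f \o e) z))).
by rewrite RintegralZl//; exact: test_fun_integrable.
Qed.

End OneChart.

Lemma test_fun0 (X : normedModType R) : test_fun (fun _ : X => 0).
Proof. by split; [move=> x; exact: cvg_cst|exists 0]. Qed.

Lemma test_funD (X : normedModType R) (f g : X -> R) :
  test_fun f -> test_fun g -> test_fun (fun x => f x + g x).
Proof.
move=> [cf [M fM]] [cg [N gN]]; split.
  by move=> x; apply: cvgD; [exact: cf|exact: cg].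
by exists (Num.max M N) => x; rewrite gt_max => /andP[/fM -> /gN ->]; rewrite addr0.
Qed.

Lemma test_funM (X : normedModType R) (f g : X -> R) :
  continuous f -> test_fun g -> test_fun (fun x => f x * g x).
Proof.
move=> cf [cg [N gN]]; split.
  by move=> x; apply: cvgM; [exact: cf|exact: cg].
by exists N => x /gN ->; rewrite mulr0.
Qed.

Lemma test_funZ (X : normedModType R) k (f : X -> R) :
  test_fun f -> test_fun (fun x => k * f x).
Proof. by move=> tf; apply: (test_funM _ tf) => x; exact: cvg_cst. Qed.

Lemma test_fun_sum (X : normedModType R) (I : Type) (s : seq I) (f : I -> X -> R) :
  (forall i, test_fun (f i)) -> test_fun (fun x => \sum_(i <- s) f i x).
Proof.
move=> tf; elim: s => [|i s IH].
  have := @test_fun0 X; congr test_fun; apply/funext => x; by rewrite big_nil.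
have := test_funD (tf i) IH; congr test_fun; apply/funext => x; by rewrite big_cons.
Qed.

Lemma continuous_zero_off (T : topologicalType) (W : normedModType R)
    (U K : set T) (f : T -> W) :
  open U -> closed K -> K `<=` U -> (forall x, U x -> {for x, continuous f}) ->
  (forall x, ~ K x -> f x = 0) -> continuous f.
Proof.
move=> oU cK KU cf f0 x; have [Kx|nKx] := pselect (K x); first exact/cf/KU.
have nK : \forall y \near x, (~` K) y.
  by apply: open_nbhs_nbhs; split => //; exact: closed_openC.
rewrite /continuous_at (f0 _ nKx); apply: (cvg_trans _ (@cvg_cst _ (0 : W) _ (nbhs x) _)).
apply: near_eq_cvg; apply: filterS nK => y nKy; by rewrite f0.
Qed.

Lemma test_fun_off (X : normedModType R) (U K : set X) (f : X -> R) :
  open U -> compact K -> K `<=` U -> (forall x, U x -> {for x, continuous f}) ->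
  (forall x, ~ K x -> f x = 0) -> test_fun f.
Proof.
move=> oU cK KU cf f0; split.
  apply: (continuous_zero_off oU _ KU cf f0).
  exact: (compact_closed (@norm_hausdorff _ _) cK).
have [M [_ H]] := compact_bounded cK.
exists (M + 1) => x Mx; apply: f0 => Kx.
have MM : M < M + 1 by rewrite ltrDl.
have /= := H _ MM x Kx.
by rewrite leNgt Mx.
Qed.

Lemma chart_real : chart (@lebesgue_measure R) (@idfun R).
Proof.
split.
- by move=> A oA; exact: open_measurable.
- move=> M; rewrite (_ : _ @^-1` _ = `[- M, M]%classic); last first.
    by apply/seteqP; split=> x; rewrite /= in_itv/= ler_norml.
  rewrite [X in (X < _)%E](lebesgue_measure_itv `[- M, M])/=.
  by case: ifP => // _; rewrite -EFinB ltry.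
- move=> A oA [x Ax].
  have /nbhs_ballP[r /= r0 rA] : nbhs x A by exact: open_nbhs_nbhs.
  apply: (@lt_le_trans _ _ (lebesgue_measure (ball x r))).
    by rewrite lebesgue_measure_ball ?ltW// lte_fin mulrn_wgt0.
  apply: le_measure; rewrite ?inE//; first exact: measurable_ball.
  exact: open_measurable.
- exists (fun n => if unpickle n is Some q then ratr q else 0).
  move=> A A0 oA; have [x [Ax [q _ qx]]] := @dense_rat R A A0 oA.
  exists x; split=> //; exists (pickle q) => //.
  by rewrite pickleK.
- move=> M; rewrite (_ : [set _ | _] = `[- M, M]%classic); last first.
    by apply/seteqP; split=> x; rewrite /= in_itv/= ler_norml.
  exact: segment_compact.
Qed.

Section ProductChart.
Context d1 d2 (T1 : measurableType d1) (T2 : measurableType d2).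
Context (X1 X2 : normedModType R).
Context (m1 : {sigma_finite_measure set T1 -> \bar R}).
Context (m2 : {sigma_finite_measure set T2 -> \bar R}).
Context (e1 : T1 -> X1) (e2 : T2 -> X2).
Hypotheses (ch1 : chart m1 e1) (ch2 : chart m2 e2).

Let e (z : T1 * T2) : X1 * X2 := (e1 z.1, e2 z.2).

Lemma chart_prod : chart (m1 \x m2)%E e.
Proof.
have [D1 D1d] := chart_sep ch1; have [D2 D2d] := chart_sep ch2.
have opn A : open A -> measurable (e @^-1` A).
  move=> oA.
  pose b1 (p : nat * nat * nat) := ball (D1 p.1.1) (p.2.+1%:R^-1 : R).
  pose b2 (p : nat * nat * nat) := ball (D2 p.1.2) (p.2.+1%:R^-1 : R).
  pose F p := [set z | (b1 p `*` b2 p `<=` A) /\ (b1 p `*` b2 p) (e z)].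
  (* the products of balls, centred in the two dense sequences and with radii
     inverse to integers, that lie in [A] *)
  have -> : e @^-1` A = \bigcup_p F p.
    apply/seteqP; split=> [z Az|z [p _ [pA pz]]]; last exact: pA.
    have /nbhs_ballP[r /= r0 rA] : nbhs (e z) A by exact: open_nbhs_nbhs.
    have [n nr] : exists n, n.+1%:R^-1 < r / 2 :> R.
      have r2 : 0 < r / 2 by rewrite divr_gt0.
      have := near_infty_natSinv_lt (PosNum r2) => -[N _ HN].
      by exists N; exact: (HN N (leqnn N)).
    have nn : n.+1%:R^-1 + n.+1%:R^-1 < r by rewrite (splitr r) ltrD.
    have n0 : 0 < n.+1%:R^-1 :> R by rewrite invr_gt0.
    have [x1 [/= z1 [i _ ix1]]] : (ball (e1 z.1) (n.+1%:R^-1 : R) `&` range D1) !=set0.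
      by apply: D1d; [exists (e1 z.1); exact: ballxx|exact: ball_open].
    have [x2 [/= z2 [j _ jx2]]] : (ball (e2 z.2) (n.+1%:R^-1 : R) `&` range D2) !=set0.
      by apply: D2d; [exists (e2 z.2); exact: ballxx|exact: ball_open].
    exists (i, j, n) => //; split; last first.
      by split; rewrite /b1 /b2/= ?ix1 ?jx2; exact: ball_sym.
    move=> [y1 y2] [/= B1 B2]; apply: rA; split => /=.
    + by apply: (le_ball (ltW nn)); apply: (ball_triangle z1); rewrite -ix1.
    + by apply: (le_ball (ltW nn)); apply: (ball_triangle z2); rewrite -jx2.
  apply: countable_bigcupT_measurable; first exact: countableP.
  move=> p; have [pA|npA] := pselect (b1 p `*` b2 p `<=` A).
    rewrite (_ : F p = (e1 @^-1` b1 p) `*` (e2 @^-1` b2 p)); last first.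
      by apply/seteqP; split=> z; [case|split].
    by apply: measurableX; [apply: (chart_open ch1)|apply: (chart_open ch2)]; exact: ball_open.
  rewrite (_ : F p = set0) //; last by apply/seteqP; split=> z //; case.
split=> //.
- move=> M; have mM : measurable (e @^-1` [set x | (`|x| <= M)%R]).
    rewrite (_ : _ @^-1` _ = (e1 @^-1` [set x | (`|x| <= M)%R]) `*`
      (e2 @^-1` [set x | (`|x| <= M)%R])); last first.
      by apply/seteqP; split=> z /=; rewrite prod_normE ge_max => /andP.
    by apply: measurableX; [exact: (chart_ball_measurable ch1)|exact: (chart_ball_measurable ch2)].
  apply: (@le_lt_trans _ _ ((m1 \x m2)%E ((e1 @^-1` [set x | (`|x| <= M)%R]) `*` (e2 @^-1` [set x | (`|x| <= M)%R])))).
    apply: le_measure; rewrite ?inE//.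
    + apply: measurableX; [exact: (chart_ball_measurable ch1)|exact: (chart_ball_measurable ch2)].
    + by move=> z /=; rewrite prod_normE ge_max => /andP[].
  rewrite product_measure1E; [|exact: (chart_ball_measurable ch1)|exact: (chart_ball_measurable ch2)].
  have [f1 f2] := (chart_fin ch1 M, chart_fin ch2 M).
  by rewrite lte_mul_pinfty// ge0_fin_numE.
- move=> A oA [x Ax].
  have /nbhs_ballP[r /= r0 rA] : nbhs x A by exact: open_nbhs_nbhs.
  apply: (@lt_le_trans _ _ ((m1 \x m2)%E ((e1 @^-1` (ball x.1 r)) `*` (e2 @^-1` (ball x.2 r))))).
    have o1 : open (ball x.1 r) by exact: ball_open.
    have o2 : open (ball x.2 r) by exact: ball_open.
    rewrite product_measure1E; [|exact: (chart_open ch1)|exact: (chart_open ch2)].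
    apply: mule_gt0.
      by apply: (chart_pos ch1) => //; exists x.1; exact: ballxx.
    by apply: (chart_pos ch2) => //; exists x.2; exact: ballxx.
  apply: le_measure; rewrite ?inE//; last first.
  - by move=> z [/= z1 z2]; apply: rA.
  - exact: opn.
  - by apply: measurableX; [apply: (chart_open ch1)|apply: (chart_open ch2)]; exact: ball_open.
- exists (fun n => if @unpickle (nat * nat)%type n is Some p then (D1 p.1, D2 p.2) else (0, 0)).
  move=> A [x Ax] oA.
  have /nbhs_ballP[r /= r0 rA] : nbhs x A by exact: open_nbhs_nbhs.
  have [x1 [/= z1 [i _ ix1]]] : (ball x.1 r `&` range D1) !=set0.
    by apply: D1d; [exists x.1; exact: ballxx|exact: ball_open].
  have [x2 [/= z2 [j _ jx2]]] : (ball x.2 r `&` range D2) !=set0.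
    by apply: D2d; [exists x.2; exact: ballxx|exact: ball_open].
  exists (x1, x2); split; first by apply: rA.
  by exists (pickle (i, j)) => //; rewrite pickleK/= ix1 jx2.
- move=> M; rewrite (_ : [set _ | _] = [set x : X1 | `|x| <= M] `*` [set x : X2 | `|x| <= M]); last first.
    by apply/seteqP; split=> z /=; rewrite prod_normE ge_max => /andP.
  by apply: compact_setX; [exact: (chart_cpt ch1)|exact: (chart_cpt ch2)].
Qed.

End ProductChart.
End Charts.

(** * Lebesgue measure on rows *)

Section LebesgueSpace.
Context {R : realType}.

Notation eucl d := (eucl_space (lebesgue_space R d)).
Notation leb d := (eucl_measure (lebesgue_space R d)).
Notation crd d := (coords (lebesgue_space R d)).

Definition cons_rV d (p : R * 'rV[R]_d) : 'rV[R]_d.+1 :=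
  row_mx (const_mx p.1 : 'rV[R]_1) p.2.

Definition tail_rV d (v : 'rV[R]_d.+1) : 'rV[R]_d := rsubmx (v : 'rV[R]_(1 + d)).

Lemma cons_rV0 d (p : R * 'rV[R]_d) : cons_rV p ord0 ord0 = p.1.
Proof.
by rewrite /cons_rV mxE; case: splitP => j //= ij; rewrite mxE.
Qed.

Lemma cons_rVS d (p : R * 'rV[R]_d) i : cons_rV p ord0 (lift ord0 i) = p.2 ord0 i.
Proof.
rewrite /cons_rV mxE; case: splitP => j /= ij; first by rewrite ord1 in ij.
by congr (p.2 _ _); apply/val_inj/eqP; rewrite -(eqn_add2l 1) -ij.
Qed.

Lemma tail_rVE d (v : 'rV[R]_d.+1) i : tail_rV v ord0 i = v ord0 (lift ord0 i).
Proof. by rewrite mxE; congr (v _ _); exact/val_inj. Qed.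

Lemma cons_rVK d (v : 'rV[R]_d.+1) : cons_rV (v ord0 ord0, tail_rV v) = v.
Proof.
apply/rowP => i; case: (unliftP ord0 i) => [j ->|->].
  by rewrite cons_rVS tail_rVE.
by rewrite cons_rV0.
Qed.

Lemma normr_rV_le d (v : 'rV[R]_d) (M : R) : 0 <= M ->
  (`|v| <= M) <-> (forall i, `|v ord0 i| <= M).
Proof.
move=> M0; rewrite -[`|v|]/(mx_norm v) mx_normrE; split=> [/bigmax_leP[_ H] i|H].
  exact: (H (ord0, i)).
by apply/bigmax_leP; split=> // -[i j] _ /=; rewrite ord1.
Qed.

Lemma coord_le_norm d (v : 'rV[R]_d) i : `|v ord0 i| <= `|v|.
Proof. by apply: (normr_rV_le v (normr_ge0 v)).1. Qed.

Lemma norm_cons_rV d (p : R * 'rV[R]_d) : `|cons_rV p| = `|p|.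
Proof.
apply/le_anti/andP; split; last first.
  rewrite prod_normE ge_max; apply/andP; split.
    by rewrite -cons_rV0; exact: coord_le_norm.
  by apply/normr_rV_le => // i; rewrite -cons_rVS; exact: coord_le_norm.
apply/normr_rV_le => // i; rewrite prod_normE le_max.
case: (unliftP ord0 i) => [j ->|->].
  by rewrite cons_rVS coord_le_norm orbT.
by rewrite cons_rV0 lexx.
Qed.

Lemma cons_rV_linear d : linear (@cons_rV d).
Proof.
move=> k p q; apply/rowP => i; rewrite !mxE.
by case: splitP => j _; rewrite !mxE.
Qed.

HB.instance Definition _ d := GRing.isLinear.Build R (R * 'rV[R]_d)%type
  'rV[R]_d.+1 _ (@cons_rV d) (@cons_rV_linear d).

Lemma continuous_cons_rV d : continuous (@cons_rV d).
Proof.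
move=> p; apply/cvgrPdist_lt => e e0.
apply: filterS (nbhsx_ballx p e e0) => q.
by rewrite -ball_normE/= -linearB norm_cons_rV.
Qed.

Lemma chart_rV d : chart (leb d) (crd d).
Proof.
elim: d => [|d IH].
- split => //=.
  + by move=> M; rewrite diracE; case: (_ \in _); rewrite ltry.
  + move=> A _ [x Ax]; rewrite diracE mem_set//=.
    by move: Ax; rewrite (thinmx0 x).
  + exists (fun=> 0) => A [x Ax] _; exists x; split=> //; exists 0%N => //.
    by rewrite (thinmx0 x).
  + move=> M; rewrite (_ : [set _ | _] = if `|0 : 'rV[R]_0| <= M then [set 0] else set0).
      by case: ifP => _; [exact: compact_set1|exact: compact0].
    apply/seteqP; split=> x /=; rewrite (thinmx0 x).
      by move=> ->.
    by case: ifP.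
- have chp := chart_prod chart_real IH.
  have cE (z : eucl d.+1) : crd d.+1 z = cons_rV (idfun z.1, crd d z.2) by [].
  split.
  + move=> A oA.
    have oA' : open (@cons_rV d @^-1` A).
      by apply: open_comp => // p _; exact: continuous_cons_rV.
    exact: (chart_open chp oA').
  + move=> M; have := chart_fin chp M; congr (_ < _)%E; congr (_ _).
    by apply/seteqP; split=> z /=; rewrite -norm_cons_rV.
  + move=> A oA [x Ax].
    have oA' : open (@cons_rV d @^-1` A).
      by apply: open_comp => // p _; exact: continuous_cons_rV.
    apply: (chart_pos chp oA').
    by exists (x ord0 ord0, tail_rV x); rewrite /= cons_rVK.
  + have [D Dd] := chart_sep chp; exists (fun n => cons_rV (D n)).
    move=> A [x Ax] oA.
    have oA' : open (@cons_rV d @^-1` A).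
      by apply: open_comp => // p _; exact: continuous_cons_rV.
    have [p [/= Ap [n _ np]]] : (@cons_rV d @^-1` A `&` range D) !=set0.
      by apply: Dd => //; exists (x ord0 ord0, tail_rV x); rewrite /= cons_rVK.
    by exists (cons_rV p); split => //; exists n => //; rewrite np.
  + move=> M; apply: bounded_closed_compact.
      exists M; split; first exact: num_real.
      by move=> N MN x /= xM; rewrite (le_trans xM)// ltW.
    have : closed ((fun x : 'rV[R]_d.+1 => `|x|) @^-1` [set y : R | y <= M]).
      apply: closed_comp; last exact: closed_le.
      by move=> x _; exact: norm_continuous.
    by [].
Qed.

Lemma chart_spacetime d : chart (lebesgue_measure \x leb d)%E
  (fun z : measurableTypeR R * eucl d => (z.1, crd d z.2)).
Proof. exact: (chart_prod chart_real (chart_rV d)). Qed.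

(** The Borel structure of the coordinates: a point of the underlying
    measurable space can be recovered measurably from its row of coordinates. *)
Fixpoint of_coords d : 'rV[R]_d -> eucl d :=
  match d with
  | 0 => fun _ => tt
  | d'.+1 => fun v => (v ord0 ord0, of_coords (tail_rV v))
  end.

Lemma of_coordsK d v : crd d (of_coords v) = v.
Proof.
elim: d v => [|d IH] v /=; first by rewrite [RHS]thinmx0.
rewrite IH -[row_mx _ _]/(cons_rV (v ord0 ord0, tail_rV v)).
exact: cons_rVK.
Qed.

Lemma measurable_of_coords d dd (T : measurableType dd) (f : T -> 'rV[R]_d) :
  (forall i, measurable_fun setT (fun z => f z ord0 i)) ->
  measurable_fun setT (fun z => of_coords (f z)).
Proof.
elim: d f => [|d IH] f mf /=; first exact: measurable_cst.
apply: measurable_fun_pair; first exact: mf.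
apply: IH => i.
rewrite (_ : (fun z => _) = (fun z => f z ord0 (lift ord0 i))); first exact: mf.
by apply/funext => z; rewrite tail_rVE.
Qed.

End LebesgueSpace.

Notation eucl R d := (eucl_space (lebesgue_space R d)).
Notation leb R d := (eucl_measure (lebesgue_space R d)).
Notation crd R d := (coords (lebesgue_space R d)).

(** * Fubini and the divergence theorem *)

Lemma continuous_pairl (R : realType) (X1 X2 : normedModType R) (x : X1) :
  continuous (fun y : X2 => (x, y)).
Proof. by move=> y; apply: cvg_pair; [exact: cvg_cst|exact: cvg_id]. Qed.

Section Fubini.
Context {R : realType}.
Context d1 d2 (T1 : measurableType d1) (T2 : measurableType d2).
Context (X1 X2 : normedModType R).
Context (m1 : {sigma_finite_measure set T1 -> \bar R}).
Context (m2 : {sigma_finite_measure set T2 -> \bar R}).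
Context (e1 : T1 -> X1) (e2 : T2 -> X2).
Hypotheses (ch1 : chart m1 e1) (ch2 : chart m2 e2).
Variable F : X1 * X2 -> R.
Hypothesis tF : test_fun F.

Lemma test_fun_slice1 x : test_fun (fun y => F (x, y)).
Proof.
have [cF [M FM]] := tF; split.
  move=> y; apply: (@continuous_comp _ _ _ (fun y => (x, y)) F); last exact: cF.
  by apply: cvg_pair; [exact: cvg_cst|exact: cvg_id].
by exists M => y My; apply: FM; rewrite prod_normE lt_max My orbT.
Qed.

Lemma test_fun_slice2 y : test_fun (fun x => F (x, y)).
Proof.
have [cF [M FM]] := tF; split.
  move=> x; apply: (@continuous_comp _ _ _ (fun x => (x, y)) F); last exact: cF.
  by apply: cvg_pair; [exact: cvg_id|exact: cvg_cst].
by exists M => x Mx; apply: FM; rewrite prod_normE lt_max Mx.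
Qed.

Let F' (z : T1 * T2) : \bar R := (F (e1 z.1, e2 z.2))%:E.

Let iF' : (m1 \x m2)%E.-integrable setT F'.
Proof. exact: (test_fun_integrable (chart_prod ch1 ch2) tF). Qed.

Let fubini_FE : fubini_F m2 F' = EFin \o (fun x => \int[m2]_y F (e1 x, e2 y)).
Proof.
apply/funext => x; rewrite /= /Rintegral fineK//.
exact: (integrable_fin_num _ (test_fun_integrable ch2 (test_fun_slice1 (e1 x)))).
Qed.

Let fubini_GE : fubini_G m1 F' = EFin \o (fun y => \int[m1]_x F (e1 x, e2 y)).
Proof.
apply/funext => y; rewrite /= /Rintegral fineK//.
exact: (integrable_fin_num _ (test_fun_integrable ch1 (test_fun_slice2 (e2 y)))).
Qed.

Lemma integrable_partial1 :
  m1.-integrable setT (EFin \o (fun x => \int[m2]_y F (e1 x, e2 y))).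
Proof. by rewrite -fubini_FE; exact: integrable_fubini_F. Qed.

Lemma integral_prod1 :
  \int[m1]_x \int[m2]_y F (e1 x, e2 y) = \int[(m1 \x m2)%E]_z F (e1 z.1, e2 z.2).
Proof.
rewrite /Rintegral -[in RHS](integral12_prod_meas1 iF') fubini_FE.
by [].
Qed.

Lemma integral_prod2 :
  \int[m2]_y \int[m1]_x F (e1 x, e2 y) = \int[(m1 \x m2)%E]_z F (e1 z.1, e2 z.2).
Proof.
rewrite /Rintegral -[in RHS](integral21_prod_meas1 iF') fubini_GE.
by [].
Qed.

Lemma fubini_test_fun :
  \int[m1]_x \int[m2]_y F (e1 x, e2 y) = \int[m2]_y \int[m1]_x F (e1 x, e2 y).
Proof. by rewrite integral_prod1 integral_prod2. Qed.

End Fubini.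

Section Divergence.
Context {R : realType}.

Lemma derive_test_fun (X : normedModType R) (f : X -> R) v :
  test_fun f -> continuous ('D_v f) -> test_fun ('D_v f).
Proof.
move=> [cf [M fM]] cD; split=> //; exists M => x Mx.
have oM : open [set y : X | M < `|y|].
  have : open ((fun x : X => `|x|) @^-1` [set y : R | M < y]).
    by apply: open_comp; [move=> y _; exact: norm_continuous|exact: open_gt].
  by [].
rewrite (@near_derive_eq _ _ _ f (cst 0)) ?derive_cst//.
by apply: (open_near oM) => // y /fM.
Qed.

Lemma integral_derive_real (f : R -> R) : test_fun f ->
  (forall x, derivable f x 1) -> continuous ('D_1 f) ->
  \int[@lebesgue_measure R]_x 'D_1 f x = 0.
Proof.
move=> tf df cD; have [cf [M fM]] := tf.
have [cD' [N DN]] := derive_test_fun tf cD.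
pose K := Num.max `|M| `|N| + 1.
have MK : M < K by rewrite (le_lt_trans (ler_norm M))// ltr_pwDr// le_max lexx.
have NK : N < K by rewrite (le_lt_trans (ler_norm N))// ltr_pwDr// le_max lexx orbT.
have K0 : 0 < K by rewrite ltr_wpDl// le_max normr_ge0.
have KK : - K < K by rewrite gtrN.
have fK : f K = 0 by apply: fM; rewrite gtr0_norm.
have fNK : f (- K) = 0 by apply: fM; rewrite normrN gtr0_norm.
have -> : \int[@lebesgue_measure R]_x 'D_1 f x = \int[@lebesgue_measure R]_(x in `[-K, K]) 'D_1 f x.
  rewrite [RHS]Rintegral_mkcond; congr Rintegral; apply/funext => x.
  rewrite patchE; case: ifPn => //; rewrite notin_setE/= in_itv/= -ler_norml => /negP.
  by rewrite -ltNge => /(lt_trans NK)/DN.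
rewrite /Rintegral (@continuous_FTC2 _ _ f)//=.
- by rewrite fK fNK subrr.
- exact: continuous_subspaceT.
- split.
  + by move=> x _; exact: df.
  + by apply: cvg_at_right_filter; exact: cf.
  + by apply: cvg_at_left_filter; exact: cf.
- by move=> x _; rewrite derive1E.
Qed.

Lemma derive_congr (V V' W : normedModType R) (f : V -> W) (g : V' -> W) x v y w :
  (forall h : R, f (h *: v + x) = g (h *: w + y)) ->
  'D_v f x = 'D_w g y /\ derivable f x v = derivable g y w.
Proof.
move=> fg; have fg0 : f x = g y by have := fg 0; rewrite !scale0r !add0r.
rewrite /derive /derivable.
suff -> : (fun h => h^-1 *: ((f \o shift x) (h *: v) - f x)) =
    (fun h => h^-1 *: ((g \o shift y) (h *: w) - g y)) by [].
by apply/funext => h; rewrite /= fg fg0.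
Qed.

Lemma derive_slice1 (X1 X2 W : normedModType R) (F : X1 * X2 -> W) x y v :
  'D_v (fun x => F (x, y)) x = 'D_((v, 0)) F (x, y) /\
  derivable (fun x => F (x, y)) x v = derivable F (x, y) (v, 0).
Proof.
by apply: derive_congr => h; congr F; congr (_, _); rewrite /= scaler0 add0r.
Qed.

Lemma derive_slice2 (X1 X2 W : normedModType R) (F : X1 * X2 -> W) x y v :
  'D_v (fun y => F (x, y)) y = 'D_((0, v)) F (x, y) /\
  derivable (fun y => F (x, y)) y v = derivable F (x, y) (0, v).
Proof.
by apply: derive_congr => h; congr F; congr (_, _); rewrite /= scaler0 add0r.
Qed.

Section ProductDerivative.
Context dd (T : measurableType dd) (X : normedModType R).
Context (m : {sigma_finite_measure set T -> \bar R}) (e : T -> X).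
Hypothesis ch : chart m e.

(** By Fubini the derivative is integrated first along its own direction, on
    an interval at whose ends the function vanishes. *)
Lemma integral_derive_fst (F : R * X -> R) : test_fun F ->
  (forall p, derivable F p (1, 0)) -> continuous ('D_((1, 0)) F) ->
  \int[@lebesgue_measure R]_t \int[m]_z 'D_((1, 0)) F (t, e z) = 0.
Proof.
move=> tF dF cD.
have tD := derive_test_fun tF cD.
rewrite (@fubini_test_fun R _ _ _ _ _ _ lebesgue_measure m idfun e chart_real ch _ tD).
have H z : \int[@lebesgue_measure R]_t 'D_((1, 0)) F (idfun t, e z) = 0.
  under eq_Rintegral do rewrite -(derive_slice1 _ _ _ _).1.
  apply: integral_derive_real; first exact: test_fun_slice2 tF _.
    by move=> t; rewrite (derive_slice1 _ _ _ _).2.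
  rewrite (_ : 'D_(1 : R) (fun x : R => F (x, e z)) = fun t => 'D_((1, 0)) F (t, e z)).
    exact: (test_fun_slice2 tD (e z)).1.
  by apply/funext => t; rewrite (derive_slice1 _ _ _ _).1.
under eq_Rintegral do rewrite H.
by rewrite Rintegral_cst// mul0r.
Qed.

End ProductDerivative.

Lemma derive_cons d (f : 'rV[R]_d.+1 -> R) p v :
  'D_v (fun q => f (cons_rV q)) p = 'D_(cons_rV v) f (cons_rV p) /\
  derivable (fun q => f (cons_rV q)) p v = derivable f (cons_rV p) (cons_rV v).
Proof. by apply: derive_congr => h; rewrite linearP. Qed.

Lemma delta_cons0 d : delta_mx ord0 ord0 = cons_rV (1, 0) :> 'rV[R]_d.+1.
Proof.
apply/rowP => i; rewrite mxE; case: (unliftP ord0 i) => [j ->|->].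
  by rewrite cons_rVS mxE.
by rewrite cons_rV0 eqxx.
Qed.

Lemma delta_consS d (j : 'I_d) :
  delta_mx ord0 (lift ord0 j) = cons_rV (0, delta_mx ord0 j) :> 'rV[R]_d.+1.
Proof.
apply/rowP => i; rewrite mxE; case: (unliftP ord0 i) => [k ->|->].
  by rewrite cons_rVS mxE (inj_eq lift_inj).
by rewrite cons_rV0.
Qed.

Lemma test_fun_cons d (f : 'rV[R]_d.+1 -> R) : test_fun f ->
  test_fun (fun p => f (cons_rV p)).
Proof.
move=> [cf [M fM]]; split.
  by move=> p; apply: (@continuous_comp _ _ _ (@cons_rV R d) f);
    [exact: continuous_cons_rV|exact: cf].
by exists M => p; rewrite -norm_cons_rV => /fM.
Qed.

Lemma integral_partial d (f : 'rV[R]_d -> R) i : test_fun f ->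
  (forall x, derivable f x (delta_mx ord0 i)) -> continuous (partial i f) ->
  \int[leb R d]_z partial i f (crd R d z) = 0.
Proof.
elim: d f i => [|d IH] f i tf df cD; first by case: (i).
have tD := derive_test_fun tf cD.
have tDc := test_fun_cons tD.
have ch := @chart_rV R d.
pose F (p : R * 'rV[R]_d) := f (cons_rV p).
have tF : test_fun F by exact: test_fun_cons.
have -> : \int[leb R d.+1]_z partial i f (crd R d.+1 z) =
  \int[@lebesgue_measure R]_t \int[leb R d]_z partial i f (cons_rV (t, crd R d z)).
  exact: (esym (integral_prod1 chart_real ch tDc)).
move: tDc {tD}; rewrite /partial; case: (unliftP ord0 i) df cD => [j ->|->] df cD tDc.
- have H t : \int[leb R d]_z 'D_(delta_mx ord0 (lift ord0 j)) f (cons_rV (t, crd R d z)) = 0.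
    have E x : 'D_(delta_mx ord0 (lift ord0 j)) f (cons_rV (t, x)) =
        partial j (fun y => F (t, y)) x.
      by rewrite delta_consS -(derive_cons _ _ _).1 /partial (derive_slice2 _ _ _ _).1.
    under eq_Rintegral do rewrite E.
    apply: IH.
    + exact: test_fun_slice1 tF t.
    + by move=> x; rewrite (derive_slice2 _ _ _ _).2 (derive_cons _ _ _).2 -delta_consS.
    + rewrite (_ : partial j _ = fun x => 'D_(delta_mx ord0 (lift ord0 j)) f (cons_rV (t, x))).
        exact: (test_fun_slice1 tDc t).1.
      by apply/funext => x; rewrite E.
  under eq_Rintegral do rewrite H.
  by rewrite Rintegral_cst// mul0r.
- have E p : 'D_(delta_mx ord0 ord0) f (cons_rV p) = 'D_((1, 0)) F p.
    by rewrite delta_cons0 -(derive_cons _ _ _).1.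
  under eq_Rintegral do under eq_Rintegral do rewrite E.
  apply: (integral_derive_fst ch tF).
    by move=> p; rewrite (derive_cons _ _ _).2 -delta_cons0.
  rewrite (_ : 'D_((1, 0)) F = fun p => 'D_(delta_mx ord0 ord0) f (cons_rV p)).
    exact: tDc.1.
  by apply/funext => p; rewrite E.
Qed.

End Divergence.

(** * Integrals over space-time *)

Section SpacetimeIntegral.
Context {R : realType} {d : nat}.
Implicit Types F G : R * 'rV[R]_d -> R.

Definition spacetime_integral F : R :=
  \int[@lebesgue_measure R]_t \int[leb R d]_z F (t, crd R d z).

Let chst := @chart_spacetime R d.

Lemma spacetime_integralE F : test_fun F -> spacetime_integral F =
  \int[(@lebesgue_measure R \x leb R d)%E]_z F (z.1, crd R d z.2).
Proof. exact: (integral_prod1 chart_real (chart_rV d)). Qed.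

Lemma spacetime_integralD F G : test_fun F -> test_fun G ->
  spacetime_integral (fun p => F p + G p) = spacetime_integral F + spacetime_integral G.
Proof.
move=> tF tG; rewrite !spacetime_integralE//; last exact: test_funD.
exact: (integral_testD chst).
Qed.

Lemma spacetime_integralZ k F : test_fun F ->
  spacetime_integral (fun p => k * F p) = k * spacetime_integral F.
Proof.
move=> tF; rewrite !spacetime_integralE//; last exact: test_funZ.
exact: (integral_testZ chst).
Qed.

Lemma spacetime_integral_bound (M : R) : exists2 C : R, 0 <= C & forall F B,
  0 <= B -> test_fun F -> (forall p, `|F p| <= B) ->
  (forall p, M < `|p| -> F p = 0) -> `|spacetime_integral F| <= B * C.
Proof.
eexists; last first.
  by move=> F B B0 tF FB FM; rewrite spacetime_integralE//;
    apply: (integral_chart_bound chst B0 tF FB FM).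
exact: fine_ge0.
Qed.

Lemma spacetime_integral0 : spacetime_integral (fun=> 0) = 0.
Proof.
rewrite /spacetime_integral; under eq_Rintegral do rewrite Rintegral_cst// mul0r.
by rewrite Rintegral_cst// mul0r.
Qed.

Lemma eq_spacetime_integral F G : F =1 G -> spacetime_integral F = spacetime_integral G.
Proof. by move=> /funext ->. Qed.

Lemma spacetime_integral_dt F : test_fun F -> (forall p, derivable F p (1, 0)) ->
  continuous ('D_((1, 0)) F) -> spacetime_integral ('D_((1, 0)) F) = 0.
Proof. exact: (integral_derive_fst (chart_rV d)). Qed.

Lemma spacetime_integral_partial F (i : 'I_d) : test_fun F ->
  (forall p, derivable F p (0, delta_mx ord0 i)) ->
  continuous ('D_((0, delta_mx ord0 i)) F) ->
  spacetime_integral ('D_((0, delta_mx ord0 i)) F) = 0.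
Proof.
move=> tF dF cD; have tD := derive_test_fun tF cD.
have H t : \int[leb R d]_z 'D_((0, delta_mx ord0 i)) F (t, crd R d z) = 0.
  under eq_Rintegral do rewrite -(derive_slice2 _ _ _ _).1.
  apply: (@integral_partial R d (fun y => F (t, y)) i).
  - exact: (test_fun_slice1 tF).
  - by move=> x; rewrite (derive_slice2 _ _ _ _).2.
  - rewrite (_ : partial i _ = fun y => 'D_((0, delta_mx ord0 i)) F (t, y)).
      exact: (test_fun_slice1 tD t).1.
    by apply/funext => y; rewrite /partial (derive_slice2 _ _ _ _).1.
rewrite /spacetime_integral; under eq_Rintegral do rewrite H.
by rewrite Rintegral_cst// mul0r.
Qed.

End SpacetimeIntegral.

Section VolumeIntegral.
Context {R : realType} {d : nat}.
Variables (T : R) (O : set 'rV[R]_d) (x : R -> 'rV[R]_d -> 'rV[R]_d).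
Let A t := x t @` O.
Notation mu := (@lebesgue_measure R).

Lemma volume_integralE (f : R -> 'rV[R]_d -> R) (F : R * 'rV[R]_d -> R) :
  (forall t z, 0 <= t <= T -> A t z -> f t z = F (t, z)) ->
  (forall t z, F (t, z) != 0 -> 0 <= t <= T /\ A t z) ->
  volume_integral T O x f = spacetime_integral F.
Proof.
move=> fF F0; rewrite /volume_integral Rintegral_mkcond.
apply: eq_Rintegral => t _; rewrite patchE; case: ifPn => [|tT].
  rewrite inE/= in_itv/= => tT; rewrite /integral_rV Rintegral_mkcond.
  apply: eq_Rintegral => z _; rewrite patchE; case: ifPn => [|zA].
    by rewrite inE/= => zA; rewrite fF.
  apply/esym/eqP; apply: contraT => /F0[_ zA'].
  by move: zA; rewrite notin_setE.
rewrite [RHS](_ : _ = \int[leb R d]_z cst 0 z); first by rewrite Rintegral_cst// mul0r.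
apply: eq_Rintegral => z _.
apply/eqP; apply: contraT => /F0[tT' _].
by move: tT; rewrite notin_setE/= in_itv/=.
Qed.

Definition volume_integrable (f : R -> 'rV[R]_d -> R) : Prop :=
  [/\ forall t, 0 <= t <= T -> measurable_rV (A t),
      forall t, 0 <= t <= T -> integrable_rV (A t) (f t) &
      mu.-integrable `[0, T] (EFin \o (fun t => integral_rV (A t) (f t)))].

(** A variation changes the density of a volume integral by a test function
    only. The change of the integral is then an integral over space-time, for
    which all the calculus of test functions is available. *)
Lemma volume_integralD (f a : R -> 'rV[R]_d -> R) (b : R * 'rV[R]_d -> R) :
  volume_integrable f -> test_fun b ->
  (forall t z, b (t, z) != 0 -> 0 <= t <= T /\ A t z) ->
  (forall t z, 0 <= t <= T -> A t z -> a t z = f t z + b (t, z)) ->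
  volume_integral T O x a = volume_integral T O x f + spacetime_integral b.
Proof.
move=> [mA if_ iF] tb b0 E.
have ch := @chart_rV R d.
have bE : volume_integral T O x (fun t z => b (t, z)) = spacetime_integral b.
  exact: volume_integralE.
rewrite -bE /volume_integral.
have ib t : (leb R d).-integrable setT (EFin \o (fun z => b (t, crd R d z))).
  exact: (test_fun_integrable ch (test_fun_slice1 tb t)).
have ibA t : 0 <= t <= T -> integrable_rV (A t) (fun z => b (t, z)).
  by move=> tT; exact: (integrableS measurableT (mA t tT) (@subsetT _ _) (ib t)).
have bAE t : 0 <= t <= T -> integral_rV (A t) (fun z => b (t, z)) =
    \int[leb R d]_z b (t, crd R d z).
  move=> tT; rewrite /integral_rV Rintegral_mkcond; apply: eq_Rintegral => z _.
  rewrite patchE; case: ifPn => // zA; apply/esym/eqP; apply: contraT => /b0[_ zA'].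
  by move: zA; rewrite notin_setE.
rewrite -RintegralD; [|exact: measurable_itv|exact: iF|].
- apply: eq_Rintegral => t; rewrite inE/= in_itv/= => tT.
  rewrite /integral_rV -RintegralD.
  + by apply: eq_Rintegral => z; rewrite inE/= => zA; rewrite E.
  + exact: mA.
  + exact: if_.
  + exact: ibA.
- have : mu.-integrable `[0, T] (EFin \o (fun t => \int[leb R d]_z b (t, crd R d z))).
    apply: integrableS (integrable_partial1 chart_real ch tb) => //.
  apply: eq_integrable => // t; rewrite inE/= in_itv/= => tT.
  by rewrite bAE.
Qed.

End VolumeIntegral.

(** * Volumes transported by a flow *)

Section TransportedVolumes.
Context {R : realType} {d : nat}.
Variables (Omega : set 'rV[R]_d) (openOmega : open Omega) (T : R).
Variables (u x Y : R -> 'rV[R]_d -> 'rV[R]_d).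
Hypotheses (smooth_x : smooth_field Omega T x)
  (bij_x : forall t, 0 <= t <= T -> set_bij Omega Omega (x t))
  (smooth_Y : smooth_field Omega T Y)
  (Yx : forall t X, 0 <= t <= T -> Omega X -> Y t (x t X) = X).

Lemma inverse_in t z : 0 <= t <= T -> Omega z -> Omega (Y t z) /\ x t (Y t z) = z.
Proof.
move=> tT Oz; have [_ _ surj] := bij_x tT.
have [X OX <-] := surj _ Oz; by rewrite Yx.
Qed.

Lemma image_inverse O t z : O `<=` Omega -> 0 <= t <= T ->
  (x t @` O) z <-> Omega z /\ O (Y t z).
Proof.
move=> OO tT; have [xO _ _] := bij_x tT; split=> [[X OX <-]|[Oz OY]].
  by split; [apply: xO; exact: OO|rewrite Yx//; exact: OO].
by exists (Y t z) => //; have [_ ->] := inverse_in tT Oz.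
Qed.

Variable O : set 'rV[R]_d.
Hypothesis iO : initial_volume Omega O.

Let e (z : measurableTypeR R * eucl R d) : R * 'rV[R]_d := (z.1, crd R d z.2).
Let D : set (measurableTypeR R * eucl R d) :=
  [set z | 0 <= z.1 <= T /\ (x z.1 @` O) (crd R d z.2)].
Let chst := @chart_spacetime R d.

(** The region swept by the volume is the preimage of the volume under the
    inverse flow. Measurability of a set of rows being that of the
    corresponding set of nested pairs, the inverse flow is lifted to the pairs
    by [of_coords]. *)
Let D_measurable : measurable D.
Proof.
have [OO _ mO] := iO.
have [N [oN Ncyl sN]] := smooth_Y.
pose U := N `&` [set p : R * 'rV[R]_d | Omega p.2].
have oU : open U.
  apply: openI => //.
  have : open ((fun p : R * 'rV[R]_d => p.2) @^-1` Omega).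
    by apply: open_comp => // p _; exact: cvg_snd.
  by [].
have mU : measurable (e @^-1` U) := chart_open chst oU.
pose f (z : measurableTypeR R * eucl R d) : 'rV[R]_d :=
  \row_i ((fun z => Y (e z).1 (e z).2 ord0 i) \_ (e @^-1` U)) z.
have mf : measurable_fun setT (fun z => of_coords (f z)).
  apply: measurable_of_coords => i.
  rewrite (_ : (fun z => _) = (fun z => Y (e z).1 (e z).2 ord0 i) \_ (e @^-1` U)); last first.
    by apply/funext => z; rewrite mxE.
  apply/(measurable_restrictT _ mU).
  apply: (chart_measurable_fun chst (U := U) (f := fun p => Y p.1 p.2 ord0 i)) => //.
  move=> p [Np _].
  apply: (@continuous_comp _ _ _ (spacetime Y) (fun v => v ord0 i)).
    exact: smooth_on_continuous Np.
  exact: coord_continuous.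
have m1 : measurable [set z : measurableTypeR R * eucl R d | 0 <= z.1 <= T].
  rewrite (_ : [set _ | _] = fst @^-1` `[0, T]%classic).
    by rewrite -[X in measurable X]setTI; apply: measurable_fst.
  by apply/seteqP; split=> z; rewrite /= in_itv.
have m2 : measurable ((fun z => of_coords (f z)) @^-1` (crd R d @^-1` O)).
  by rewrite -[X in measurable X]setTI; apply: mf.
rewrite (_ : D = (e @^-1` U) `&` ([set z | 0 <= z.1 <= T] `&`
    ((fun z => of_coords (f z)) @^-1` (crd R d @^-1` O)))).
  by apply: measurableI => //; exact: measurableI.
have fE z : (e @^-1` U) z -> crd R d (of_coords (f z)) = Y z.1 (crd R d z.2).
  move=> Uz; rewrite of_coordsK; apply/rowP => i; rewrite mxE patchE mem_set//.
apply/seteqP; split=> z.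
  move=> [tT zO].
  have [Oz OYz] := (image_inverse _ OO tT).1 zO.
  have Uz : (e @^-1` U) z.
    by split => //; apply: Ncyl; split => //; exact: subset_closure.
  by split => //; split => //=; rewrite fE.
move=> [[Nz Oz] [tT]] /=; rewrite fE// => OYz; split => //.
exact/(image_inverse _ OO tT).
Qed.

Lemma transported_volume_compact : exists K : set (R * 'rV[R]_d),
  [/\ compact K, K `<=` closed_cylinder Omega T &
      forall t z, 0 <= t <= T -> (x t @` O) z -> K (t, z)].
Proof.
have [OO bO mO] := iO; have [N [oN Ncyl sN]] := smooth_x.
have cO : compact (closure O).
  apply: bounded_closed_compact; last exact: closed_closure.
  have [M [rM MO]] := bO; exists (M + 1); split; first exact: num_real.
  move=> M' MM' z; have : closed [set z : 'rV[R]_d | `|z| <= M'].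
    have : closed ((fun x : 'rV[R]_d => `|x|) @^-1` [set y : R | y <= M']).
      apply: closed_comp; last exact: closed_le.
      by move=> y _; exact: norm_continuous.
    by [].
  move=> /closure_id cE; rewrite [X in _ -> X](_ : _ = [set z : 'rV[R]_d | `|z| <= M'] z)//.
  rewrite cE; apply: closure_subset => y Oy /=; apply: MO => //.
  by rewrite (le_lt_trans _ MM')// lerDl.
pose S := `[0, T]%classic `*` closure O.
have cS : compact S by apply: compact_setX => //; exact: segment_compact.
have SC : S `<=` closed_cylinder Omega T.
  move=> [t X] [/=]; rewrite in_itv/= => tT XO; split => //=.
  exact: closure_subset XO.
pose Phi (p : R * 'rV[R]_d) := (p.1, x p.1 p.2).
have cPhi p : S p -> {for p, continuous Phi}.
  move=> Sp.
  have c1 : (fun q : R * 'rV[R]_d => q.1) @ p --> p.1 by exact: cvg_fst.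
  have c2 : spacetime x @ p --> spacetime x p.
    exact: (smooth_on_continuous sN (Ncyl _ (SC _ Sp))).
  exact: (cvg_pair c1 c2).
exists (Phi @` S); split.
- apply: continuous_compact => //; apply: continuous_in_subspaceT => p.
  by rewrite inE; exact: cPhi.
- move=> _ [[t X] StX <-]; have [/=] := StX; rewrite in_itv/= => tT XO.
  split => //= B.
  have cxt : {for X, continuous (x t)}.
    have := cPhi _ StX => cP.
    have : {for X, continuous (fun X => (Phi (t, X)).2)}.
      apply: (@continuous_comp _ _ _ (fun X => Phi (t, X)) snd); last exact: cvg_snd.
      by apply: (@continuous_comp _ _ _ (fun X => (t, X)) Phi) => //; exact: continuous_pairl.
    by [].
  move=> /cxt /XO [X' [OX' BX']].
  exists (x t X'); split=> //.
  by have [xO _ _] := bij_x tT; apply: xO; exact: OO.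
- move=> t z tT [X OX <-]; exists (t, X) => //; split; first by rewrite /= in_itv.
  exact: subset_closure.
Qed.

(** The region swept by a bounded volume lies in a compact set, where the
    density is bounded and which has finite measure. *)
Lemma volume_integrable_continuous (N : set (R * 'rV[R]_d)) (f : R -> 'rV[R]_d -> R) :
  open N -> closed_cylinder Omega T `<=` N ->
  (forall p, N p -> {for p, continuous (spacetime f)}) ->
  volume_integrable T O x f.
Proof.
move=> oN NC cf.
have [K [cK KC OK]] := transported_volume_compact.
have [B [rB KB]] : bounded_set (spacetime f @` K).
  apply: compact_bounded; apply: continuous_compact => //.
  apply: continuous_in_subspaceT => p; rewrite inE => Kp.
  by apply/cf/NC/KC.
have fB p : K p -> `|spacetime f p| <= `|B| + 1.
  move=> Kp; apply: KB; last by exists p.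
  by rewrite (le_lt_trans (ler_norm B))// ltrDl.
have [M [_ KM]] := compact_bounded cK.
have DM : D `<=` e @^-1` [set p | `|p| <= M + 1].
  move=> z [tT zO]; apply: KM; first by rewrite ltrDl.
  exact: OK.
pose mm := (@lebesgue_measure R \x leb R d)%E.
have Dfin : (mm D < +oo)%E.
  apply: le_lt_trans (chart_fin chst (M + 1)); apply: le_measure; rewrite ?inE//.
  exact: (chart_ball_measurable chst).
pose g := (spacetime f \o e) \_ D.
have mfD : measurable_fun D (spacetime f \o e).
  apply: (measurable_funS (chart_open chst oN)); last exact: (chart_measurable_fun chst oN cf).
  by move=> z [tT zO]; apply/NC/KC/OK.
have ig : mm.-integrable setT (EFin \o g).
  have : mm.-integrable D (EFin \o (spacetime f \o e)).
    apply: measurable_bounded_integrable => //.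
    exists (`|B| + 1); split; first exact: num_real.
    move=> C BC z [tT zO] /=; apply: le_trans (ltW BC); apply: fB; exact: OK.
  rewrite integrable_mkcond// /g; congr (_.-integrable _ _).
  by apply/funext => z; rewrite /= !patchE; case: ifP.
have mA t : 0 <= t <= T -> measurable_rV (x t @` O).
  move=> tT; have := measurable_xsection t D_measurable.
  congr measurable; apply/seteqP; split=> z /=.
    by move/xsectionP => [].
  by move=> zO; apply/xsectionP; split.
have iA t : 0 <= t <= T -> integrable_rV (x t @` O) (f t).
  move=> tT; rewrite /integrable_rV.
  apply: (@measurable_bounded_integrable _ _ _ _ (fun z => f t (crd R d z))).
  - exact: mA.
  - apply: le_lt_trans (chart_fin (chart_rV d) (M + 1)); apply: le_measure; rewrite ?inE//.
    + exact: mA.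
    + exact: (chart_ball_measurable (chart_rV d)).
    + move=> z zO; have : D (t, z) by [].
      by move/DM => /=; rewrite prod_normE ge_max => /andP[].
  - pose Nt := [set z : 'rV[R]_d | N (t, z)].
    have cpair z : {for z, continuous (fun z : 'rV[R]_d => (t, z))}.
      exact: continuous_pairl.
    have oNt : open Nt.
      have : open ((fun z : 'rV[R]_d => (t, z)) @^-1` N).
        by apply: open_comp => // z _; exact: cpair.
      by [].
    apply: (measurable_funS (chart_open (chart_rV d) oNt)); last first.
      apply: (chart_measurable_fun (chart_rV d) oNt (f := f t)) => z Ntz.
      exact: (@continuous_comp _ _ _ (fun z => (t, z)) (spacetime f) z (cpair z) (cf _ Ntz)).
    by move=> z zO; apply/NC/KC; exact: OK.
  - exists (`|B| + 1); split; first exact: num_real.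
    move=> C BC z zO /=; apply: le_trans (ltW BC).
    by have := fB (t, crd R d z); apply; exact: OK.
split=> //.
have : lebesgue_measure.-integrable `[0, T]%classic (fubini_F (leb R d) (EFin \o g)).
  by apply: integrableS (integrable_fubini_F ig) => //; exact: measurable_itv.
apply: eq_integrable => //.
move=> t; rewrite inE/= in_itv/= => tT.
rewrite /fubini_F /integral_rV /Rintegral /= fineK; last first.
  by apply: (integrable_fin_num _ (iA t tT)); exact: mA.
rewrite [RHS]integral_mkcond; apply: eq_integral => z _.
rewrite /g /= !patchE; case: ifPn; rewrite ?(inE, notin_setE) => zD; case: ifPn => //; rewrite ?(inE, notin_setE).
  by case: zD => /= _ zO /(_ zO).
by move=> /= zO; case: zD.
Qed.

End TransportedVolumes.

(** * Rows, contractions and test functions *)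

Section Rows.
Context {R : realType} {d : nat}.
Implicit Types V : normedModType R.

Lemma coord_linear (i : 'I_d) : linear (fun v : 'rV[R]_d => v ord0 i).
Proof. by move=> k y z; rewrite !mxE. Qed.

Definition coord (i : 'I_d) : 'rV[R]_d -> R := fun v => v ord0 i.

HB.instance Definition _ i := GRing.isLinear.Build R 'rV[R]_d R _ (coord i) (coord_linear i).

Lemma continuous_coord i : continuous (coord i).
Proof. exact: coord_continuous. Qed.

Lemma smooth_coord V U (F : V -> 'rV[R]_d) i : open U -> smooth_on U F ->
  smooth_on U (fun p => F p ord0 i).
Proof.
by move=> oU sF; apply: (@smooth_lin_comp _ _ _ _ _ (coord i)) => //; exact: continuous_coord.
Qed.

Lemma smooth_row V U (F : V -> 'rV[R]_d) : open U ->
  (forall i, smooth_on U (fun p => F p ord0 i)) -> smooth_on U F.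
Proof.
move=> oU sF.
apply: (@smooth_on_ext _ _ _ _ (fun p => \sum_i F p ord0 i *: (delta_mx ord0 i : 'rV[R]_d))) => //.
  by move=> x _; rewrite [RHS]row_sum_delta.
by apply: smooth_sum => // i; exact: smooth_scalel.
Qed.

Lemma derive_coord V (F : V -> 'rV[R]_d) x v i : differentiable F x ->
  differentiable (fun p => F p ord0 i) x /\
  'D_v (fun p => F p ord0 i) x = ('D_v F x) ord0 i.
Proof.
by move=> dF; have := differentiable_lin_comp v (@continuous_coord i) dF.
Qed.

Lemma continuous_row (T : topologicalType) (F : T -> 'rV[R]_d) t :
  (forall i, {for t, continuous (fun p => F p ord0 i)}) -> {for t, continuous F}.
Proof.
move=> cF.
have -> : F = (fun p => \sum_i F p ord0 i *: (delta_mx ord0 i : 'rV[R]_d)).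
  by apply/funext => p; rewrite [LHS]row_sum_delta.
apply: cvg_big => [|i _]; first exact: add_continuous.
by apply: cvgZr_tmp; exact: cF.
Qed.

End Rows.

Section ContinuousPairs.
Variables (T X Y : topologicalType).

Lemma continuous_pairing (f : T -> X) (g : T -> Y) t :
  {for t, continuous f} -> {for t, continuous g} ->
  {for t, continuous (fun q => (f q, g q))}.
Proof. by move=> cf cg; exact: (cvg_pair cf cg). Qed.

Lemma continuous_fst (p : X * Y) : {for p, continuous (@fst X Y)}.
Proof. exact: cvg_fst. Qed.

Lemma continuous_snd (p : X * Y) : {for p, continuous (@snd X Y)}.
Proof. exact: cvg_snd. Qed.

Lemma continuous_const (a : X) (t : T) : {for t, continuous (fun=> a)}.
Proof. exact: cvg_cst. Qed.

End ContinuousPairs.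

Section FixedPoint.
Context {R : realType} {d : nat}.
Notation V := 'rV[R]_d.

Definition half_lipschitz (f : V -> V) := forall a b, `|f a - f b| <= 2^-1 * `|a - b|.

Lemma half_lipschitz_fixed_point f : half_lipschitz f -> exists p, p = f p.
Proof.
rewrite /half_lipschitz; case: d f => [|d'] f lf.
  by exists 0; rewrite [RHS]thinmx0.
pose X : completeNormedModType R := HB.pack 'rV[R]_d'.+1
  (Uniform_isComplete.Build 'rV[R]_d'.+1 (@mx_complete R 1 d'.+1)).
pose F : {fun [set: X] >-> [set: X]} :=
  HB.pack f (isFun.Build _ _ setT setT f (fun _ _ => I)).
have cF : is_contraction F.
  exists (2^-1)%:nng; split; first by rewrite /= invf_lt1// ltr1n.
  by move=> [a b] _; exact: lf.
have [p _ pE] := banach_fixed_point cF closedT (ex_intro _ 0 I).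
by exists p.
Qed.

Lemma fixed_point_close f p q : half_lipschitz f -> p = f p ->
  `|p - q| <= 2 * `|f q - q|.
Proof.
move=> lf pE; have := lf p q; rewrite -pE => H.
have := ler_distD (f q) p q; have := normr_ge0 (f q - q).
lra.
Qed.

Lemma fixed_point_unique f p q : half_lipschitz f -> p = f p -> q = f q -> p = q.
Proof.
move=> lf pE qE; apply/eqP; rewrite -subr_eq0 -normr_le0.
by rewrite (le_trans (fixed_point_close q lf pE))// -qE subrr normr0 mulr0.
Qed.

(** A fixed point is within twice the defect of any other point; applied to
    [k0], whose defect tends to zero, this gives the continuity of fixed points
    in a parameter. *)
Lemma fixed_point_continuous (T : Type) (F : set_system T) {FF : Filter F}
    (f : T -> V -> V) (k : T -> V) (k0 : V) :
  (forall p, half_lipschitz (f p)) -> (forall p, k p = f p (k p)) ->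
  f p k0 @[p --> F] --> k0 -> k @ F --> k0.
Proof.
move=> lf kE cf; apply/cvgrPdist_lt => e e0.
have e2 : 0 < e / 2 by rewrite divr_gt0.
move/cvgrPdist_lt : cf => /(_ _ e2); apply: filterS => p H.
rewrite distrC (le_lt_trans (fixed_point_close k0 (lf p) (kE p)))//.
by rewrite mulrC -ltr_pdivlMr// distrC.
Qed.

End FixedPoint.

Section SmoothTestFunctions.
Context {R : realType} {d : nat}.
Notation V := 'rV[R]_d.
Notation E := (R * 'rV[R]_d)%type.

Definition bounded_support (W : normedModType R) (f : E -> W) :=
  exists M : R, forall p, M < `|p| -> f p = 0.

Lemma finite_basisE : finite_basis E.
Proof. exact: (finite_basis_prod finite_basisR (finite_basis_rV d)). Qed.

Lemma smooth_test_fun (f : E -> R) : smooth_on setT f -> bounded_support f -> test_fun f.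
Proof. by move=> sf bf; split => // p; exact: (smooth_on_continuous sf). Qed.

Lemma bounded_support_derive (f : E -> R) v : smooth_on setT f -> bounded_support f ->
  bounded_support ('D_v f).
Proof.
move=> sf bf; apply: (derive_test_fun (smooth_test_fun sf bf) _).2 => p.
exact: (smooth_on_continuous (smooth_on_derive v sf)).
Qed.

Lemma rV_sum_delta (k : V) : k = \sum_i k ord0 i *: (delta_mx ord0 i : V).
Proof. by rewrite [LHS]row_sum_delta. Qed.

Lemma spatial_basis (k : V) :
  ((0, k) : E) = \sum_i k ord0 i *: ((0, delta_mx ord0 i) : E).
Proof.
rewrite [in LHS](rV_sum_delta k).
have -> : \sum_i k ord0 i *: ((0, delta_mx ord0 i) : E) =
   (0, \sum_i k ord0 i *: (delta_mx ord0 i : V)) => //.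
elim/big_rec2: _ => // i y1 y2 _ ->.
rewrite -[_ *: (0, _)]/(_ *: 0, _ *: _) -[(_, _) + (_, _)]/(_ + _, _ + _).
by rewrite scaler0 addr0.
Qed.

Lemma spatial_derive_bound (f : E -> R) : smooth_on setT f -> bounded_support f ->
  exists2 L : R, 0 <= L & forall p k, `|'D_((0, k)) f p| <= L * `|k|.
Proof.
move=> sf bf.
have /choice[B BP] (i : 'I_d) : exists B : R, 0 <= B /\ forall p, `|'D_((0, delta_mx ord0 i)) f p| <= B.
  have tD := smooth_test_fun (smooth_on_derive (0, delta_mx ord0 i) sf)
    (bounded_support_derive (0, delta_mx ord0 i) sf bf).
  by have [B B0 BP] := test_fun_bounded (@chart_spacetime R d) tD; exists B.
exists (\sum_i B i) => [|p k]; first by apply: sumr_ge0 => i _; case: (BP i).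
rewrite (derive_basis (smooth_on_differentiable sf I) (spatial_basis k)).
rewrite (le_trans (ler_norm_sum _ _ _))// mulr_suml ler_sum// => i _.
rewrite normrZ mulrC ler_pM//; first by case: (BP i) => _.
exact: coord_le_norm.
Qed.

Lemma spatial_lipschitz (f : E -> R) : smooth_on setT f -> bounded_support f ->
  exists2 L : R, 0 <= L & forall t z z', `|f (t, z) - f (t, z')| <= L * `|z - z'|.
Proof.
move=> sf bf; have [L L0 LP] := spatial_derive_bound sf bf.
exists L => // t z z'.
have [s _] := @MVT_line R _ f (t, z') (0, z - z') (fun s _ => smooth_on_differentiable sf I).
rewrite -[(t, z') + _]/(t + 0, z' + (z - z')) addr0 subrKC => ->.
exact: LP.
Qed.

End SmoothTestFunctions.

(** * Eulerian form of a displacement *)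

Section Transplant.
Context {R : realType} {d : nat}.
Notation V := 'rV[R]_d.
Notation E := (R * 'rV[R]_d)%type.
Variables (Omega : set V) (T : R).

Lemma open_cylinder : open Omega -> open (cylinder Omega T).
Proof.
move=> oO.
have o1 : open ((fun p : E => p.1) @^-1` [set t | 0 < t]).
  by apply: open_comp; [move=> p _; exact: cvg_fst|exact: open_gt].
have o2 : open ((fun p : E => p.1) @^-1` [set t | t < T]).
  by apply: open_comp; [move=> p _; exact: cvg_fst|exact: open_lt].
have o3 : open ((fun p : E => p.2) @^-1` Omega).
  by apply: open_comp => // p _; exact: cvg_snd.
rewrite (_ : cylinder Omega T = (fun p : E => p.1) @^-1` [set t | 0 < t] `&`
   ((fun p : E => p.1) @^-1` [set t | t < T] `&` (fun p : E => p.2) @^-1` Omega)).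
  by apply: openI => //; exact: openI.
apply/seteqP; split=> p /=; first by move=> [/andP[]].
by move=> [? [? ?]]; split => //; apply/andP.
Qed.

Lemma cylinder_closed : cylinder Omega T `<=` closed_cylinder Omega T.
Proof.
move=> p [/andP[t0 tT] Op]; split; first by rewrite !ltW.
exact: subset_closure.
Qed.

Lemma smooth_field_cylinder (W : normedModType R) (f : R -> V -> W) :
  smooth_field Omega T f -> smooth_on (cylinder Omega T) (spacetime f).
Proof.
by move=> [N [oN NC sf]]; apply: smooth_onS sf => p /cylinder_closed/NC.
Qed.

(** The relation is symmetric, and is used both ways: variations of the flow
    map are read in Eulerian coordinates, and Eulerian test fields are read as
    variations of the flow map. *)
Record inverse_flows (x Y : R -> V -> V) : Prop := InverseFlows {
  inverse_smoothl : smooth_field Omega T x;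
  inverse_smoothr : smooth_field Omega T Y;
  inverse_funl : forall t X, 0 <= t <= T -> Omega X -> Omega (x t X);
  inverse_funr : forall t X, 0 <= t <= T -> Omega X -> Omega (Y t X);
  inverse_lr : forall t X, 0 <= t <= T -> Omega X -> Y t (x t X) = X;
  inverse_rl : forall t X, 0 <= t <= T -> Omega X -> x t (Y t X) = X }.

Lemma inverse_flows_sym x Y : inverse_flows x Y -> inverse_flows Y x.
Proof. by case=> *; split. Qed.

Lemma flow_map_inverse u x : flow_map Omega T u x -> exists Y, inverse_flows x Y.
Proof.
move=> [sx bx [Y [sY Yx]] _ _]; exists Y; split => //.
- by move=> t X tT OX; have [xO _ _] := bx _ tT; exact: xO.
- by move=> t X tT OX; have [_ _ /(_ _ OX)[X' OX' <-]] := bx _ tT; rewrite Yx.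
- by move=> t X tT OX; have [_ _ /(_ _ OX)[X' OX' <-]] := bx _ tT; rewrite Yx.
Qed.

Lemma inverse_flows_bij x Y t : inverse_flows x Y -> 0 <= t <= T ->
  set_bij Omega Omega (x t).
Proof.
move=> xY tT; split.
- by move=> X OX; exact: (inverse_funl xY).
- move=> X X'; rewrite !inE => OX OX' e.
  by rewrite -(inverse_lr xY tT OX) e (inverse_lr xY tT OX').
- move=> z Oz; exists (Y t z); first exact: (inverse_funr xY).
  exact: (inverse_rl xY).
Qed.

(** The displacement [dx], given in material coordinates, as a field on
    space-time. The support is compact in the open cylinder, so that the
    extension by zero is smooth. *)
Definition transplant (Y : R -> V -> V) (dx : R -> V -> V) (p : E) : V :=
  if `[< cylinder Omega T p >] then dx p.1 (Y p.1 p.2) else 0.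

Hypothesis oO : open Omega.
Variables (x Y : R -> V -> V).
Hypothesis xY : inverse_flows x Y.
Variable (dx : R -> V -> V).
Hypotheses (sdx : smooth_on setT (spacetime dx))
  (cdx : compact (supp (spacetime dx)))
  (dxO : supp (spacetime dx) `<=` cylinder Omega T).

Let w := transplant Y dx.
Let K := (fun p : E => (p.1, x p.1 p.2)) @` supp (spacetime dx).

Lemma transplant_image_compact : compact K.
Proof.
apply: continuous_compact => //; apply: continuous_in_subspaceT => p.
rewrite inE => /dxO Qp.
have c1 : (fun q : E => q.1) @ p --> p.1 by exact: cvg_fst.
have c2 : spacetime x @ p --> spacetime x p.
  exact: (smooth_on_continuous (smooth_field_cylinder (inverse_smoothl xY)) Qp).
exact: (cvg_pair c1 c2).
Qed.

Lemma cylinder_le t z : cylinder Omega T (t, z) -> 0 <= t <= T.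
Proof. by move=> [/= /andP[t0 tT] _]; rewrite !ltW. Qed.

Lemma transplant_image_cylinder : K `<=` cylinder Omega T.
Proof.
move=> _ [[t X] /dxO [/= tT OX] <-]; split => //=.
apply: (inverse_funl xY) => //; exact: (@cylinder_le t X).
Qed.

Lemma transplant_off p : ~ K p -> w p = 0.
Proof.
move=> nK; rewrite /w /transplant; case: asboolP => // -[tT Op].
apply/eqP; apply: contra_notT nK => wp; exists (p.1, Y p.1 p.2).
  by apply: subset_closure.
rewrite /= (inverse_rl xY)//; first by case: (p).
exact: (@cylinder_le p.1 p.2).
Qed.

Lemma transplant_supp : supp w `<=` K.
Proof.
have cK : closed K := compact_closed (@norm_hausdorff _ _) transplant_image_compact.
rewrite [X in _ `<=` X](closure_id K).1//; apply: closure_subset => p /= wp.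
by apply: contrapT => /transplant_off w0; rewrite w0 eqxx in wp.
Qed.

Lemma transplant_smooth : smooth_on setT w.
Proof.
have oQ := open_cylinder oO.
have cK : closed K := compact_closed (@norm_hausdorff _ _) transplant_image_compact.
have -> : setT = cylinder Omega T `|` ~` K.
  apply/esym/seteqP; split=> // p _; have [Kp|] := pselect (K p); last by right.
  by left; exact: transplant_image_cylinder.
apply: smooth_onU.
  apply: (@smooth_on_ext _ _ _ _ (fun p => spacetime dx (p.1, spacetime Y p))) => //.
    by move=> p Qp; rewrite /w /transplant; case: asboolP.
  apply: smooth_row => // i.
  apply: (@smooth_comp _ _ _ _ setT (fun p => spacetime dx p ord0 i) (fun p => (p.1, spacetime Y p))) => //.
  - exact: finite_basisE.
  - exact: openT.
  - by apply: smooth_coord => //; exact: openT.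
  - apply: smooth_pair => //.
      apply: (@smooth_linear _ _ _ _ fst) => // p; exact: cvg_fst.
    exact: (smooth_field_cylinder (inverse_smoothr xY)).
apply: (@smooth_on_ext _ _ _ _ (fun=> 0)).
- exact: closed_openC.
- by move=> p /transplant_off ->.
- by apply: smooth_cst; exact: closed_openC.
Qed.

Lemma transplant_supp_compact : compact (supp w).
Proof.
apply: subclosed_compact transplant_image_compact transplant_supp.
exact: closed_closure.
Qed.

Lemma transplant_supp_cylinder : supp w `<=` cylinder Omega T.
Proof. by move=> p /transplant_supp/transplant_image_cylinder. Qed.

End Transplant.

(** * Perturbations of the identity *)

Section PerturbedIdentity.
Context {R : realType} {d : nat}.
Notation V := 'rV[R]_d.
Notation E := (R * 'rV[R]_d)%type.
Variables (w : E -> V) (K : set E).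
Hypotheses (sw : smooth_on setT w) (cK : compact K) (w0 : forall p, ~ K p -> w p = 0).

Let swi i : smooth_on setT (fun p => w p ord0 i).
Proof. by apply: smooth_coord => //; exact: openT. Qed.

Let bwi i : bounded_support (fun p => w p ord0 i).
Proof.
have [M [_ KM]] := compact_bounded cK; exists (M + 1) => p Mp.
have nKp : ~ K p.
  by move=> Kp; have /= := KM (M + 1) (ltr_pwDr ltr01 (lexx M)) p Kp; rewrite leNgt Mp.
by rewrite w0// mxE.
Qed.

Lemma spatial_derive_coord k p i : ('D_((0, k)) w p) ord0 i = 'D_((0, k)) (fun p => w p ord0 i) p.
Proof. by have [_ ->] := derive_coord (0, k) i (smooth_on_differentiable sw (I : setT p)). Qed.

(** A single bound for the size and the spatial Lipschitz constants of [w] and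
    of its derivatives. When [`|h| * L] is at most one half, the maps whose
    fixed points are taken below are contractions. *)
Definition flow_constant (L : R) : Prop :=
  [/\ 0 <= L, (forall t z z', `|w (t, z) - w (t, z')| <= L * `|z - z'|),
      (forall p, `|w p| <= L), (forall k p, `|'D_((0, k)) w p| <= L * `|k|) &
      (forall k t z z', `|'D_((0, k)) w (t, z) - 'D_((0, k)) w (t, z')| <= L * `|k| * `|z - z'|)].

Lemma flow_constant_exists : exists L, flow_constant L.
Proof.
have /choice[L1 L1P] (i : 'I_d) : exists L : R, 0 <= L /\
    forall t z z', `|w (t, z) ord0 i - w (t, z') ord0 i| <= L * `|z - z'|.
  by have [L L0 LP] := spatial_lipschitz (swi i) (bwi i); exists L.
have /choice[L2 L2P] (i : 'I_d) : exists L : R, 0 <= L /\ forall p, `|w p ord0 i| <= L.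
  have [L L0 LP] := test_fun_bounded (@chart_spacetime R d) (smooth_test_fun (swi i) (bwi i)).
  by exists L.
have /choice[L3 L3P] (i : 'I_d) : exists L : R, 0 <= L /\
    forall p k, `|'D_((0, k)) (fun p => w p ord0 i) p| <= L * `|k|.
  by have [L L0 LP] := spatial_derive_bound (swi i) (bwi i); exists L.
have /choice[L4 L4P] (ij : 'I_d * 'I_d) : exists L : R, 0 <= L /\
    forall t z z', `|'D_((0, delta_mx ord0 ij.2)) (fun p => w p ord0 ij.1) (t, z) -
      'D_((0, delta_mx ord0 ij.2)) (fun p => w p ord0 ij.1) (t, z')| <= L * `|z - z'|.
  case: ij => i j /=; have := smooth_on_derive (0, delta_mx ord0 j) (swi i).
  move=> /spatial_lipschitz H.
  have [L L0 LP] := H (bounded_support_derive _ (swi i) (bwi i)).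
  by exists L.
pose S1 := \sum_i L1 i; pose S2 := \sum_i L2 i; pose S3 := \sum_i L3 i; pose S4 := \sum_i \sum_j L4 (i, j).
have S10 : 0 <= S1 by apply: sumr_ge0 => i _; case: (L1P i).
have S20 : 0 <= S2 by apply: sumr_ge0 => i _; case: (L2P i).
have S30 : 0 <= S3 by apply: sumr_ge0 => i _; case: (L3P i).
have S40 : 0 <= S4 by apply: sumr_ge0 => i _; apply: sumr_ge0 => j _; case: (L4P (i, j)).
have le1 i : L1 i <= S1.
  by rewrite /S1 (bigD1 i)//= lerDl sumr_ge0// => j _; case: (L1P j).
have le2 i : L2 i <= S2.
  by rewrite /S2 (bigD1 i)//= lerDl sumr_ge0// => j _; case: (L2P j).
have le3 i : L3 i <= S3.
  by rewrite /S3 (bigD1 i)//= lerDl sumr_ge0// => j _; case: (L3P j).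
exists (S1 + S2 + S3 + S4); split.
- by rewrite !addr_ge0.
- move=> t z z'; apply/normr_rV_le; first by rewrite mulr_ge0// !addr_ge0.
  move=> i; rewrite !mxE; have [_ H] := L1P i.
  by rewrite (le_trans (H t z z'))// ler_wpM2r//; have := le1 i; lra.
- move=> p; apply/normr_rV_le; first by rewrite !addr_ge0.
  move=> i; have [_ H] := L2P i.
  by rewrite (le_trans (H p))//; have := le2 i; lra.
- move=> k p; apply/normr_rV_le; first by rewrite mulr_ge0// !addr_ge0.
  move=> i; rewrite spatial_derive_coord; have [_ H] := L3P i.
  by rewrite (le_trans (H p k))// ler_wpM2r//; have := le3 i; lra.
- move=> k t z z'; apply/normr_rV_le; first by rewrite !mulr_ge0// !addr_ge0.
  move=> i; rewrite !mxE !spatial_derive_coord.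
  rewrite !(derive_basis (smooth_on_differentiable (swi i) (I : setT (_, _))) (spatial_basis k)).
  rewrite -sumrB (le_trans (ler_norm_sum _ _ _))//.
  apply: le_trans (_ : \sum_j L4 (i, j) * `|k| * `|z - z'| <= _).
    apply: ler_sum => j _; rewrite -scalerBr normrZ mulrAC mulrC.
    have [L40 H] := L4P (i, j).
    by apply: ler_pM => //; exact: coord_le_norm.
  rewrite -!mulr_suml ler_wpM2r// ler_wpM2r//.
  have : \sum_j L4 (i, j) <= S4.
    rewrite /S4 [leRHS](bigD1 i)//= lerDl.
    by apply: sumr_ge0 => i' _; apply: sumr_ge0 => j _; case: (L4P (i', j)).
  lra.
Qed.

Variable L : R.
Hypothesis LP : flow_constant L.

Let L0 : 0 <= L. Proof. by case: LP. Qed.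
Let Lb p : `|w p| <= L. Proof. by case: LP. Qed.
Let Lip t z z' : `|w (t, z) - w (t, z')| <= L * `|z - z'|. Proof. by case: LP. Qed.
Let LD k p : `|'D_((0, k)) w p| <= L * `|k|. Proof. by case: LP. Qed.
Let LipD k t z z' : `|'D_((0, k)) w (t, z) - 'D_((0, k)) w (t, z')| <= L * `|k| * `|z - z'|.
Proof. by case: LP. Qed.

Let DB k k' p : 'D_((0, k - k')) w p = 'D_((0, k)) w p - 'D_((0, k')) w p.
Proof.
have dw := smooth_on_differentiable sw (I : setT p).
by rewrite !deriveE// -linearB; congr ('d _ _ (_, _)); rewrite subrr.
Qed.

Definition small (h : R) := `|h| * L <= 2^-1.

(** The inverse of the perturbed identity [g |-> g + h *: w (t, g)]. As the
    fixed point of a contraction it comes with estimates uniform in the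
    point. *)
Definition undisplaced (h : R) (p : E) : V := xget 0 [set g | g = p.2 - h *: w (p.1, g)].

Lemma half_lipschitz_displacement h p : small h ->
  half_lipschitz (fun g => p.2 - h *: w (p.1, g)).
Proof.
move=> sh a b; rewrite opprB addrC subrKA -scalerBr normrZ.
rewrite (le_trans (ler_wpM2l (normr_ge0 h) (Lip _ _ _)))// mulrA distrC.
by rewrite ler_wpM2r.
Qed.

Lemma undisplacedE h p : small h ->
  undisplaced h p = p.2 - h *: w (p.1, undisplaced h p).
Proof.
move=> sh; rewrite /undisplaced.
have [g gE] := half_lipschitz_fixed_point (half_lipschitz_displacement p sh).
exact: (xgetPex 0 (ex_intro (fun g => g = p.2 - h *: w (p.1, g)) g gE)).
Qed.

Lemma undisplacedK h p : small h ->
  undisplaced h p + h *: w (p.1, undisplaced h p) = p.2.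
Proof. by move=> sh; rewrite {1}(undisplacedE p sh) subrK. Qed.

Lemma undisplaced_unique h t g : small h -> undisplaced h (t, g + h *: w (t, g)) = g.
Proof.
move=> sh; apply: (fixed_point_unique (half_lipschitz_displacement (t, g + h *: w (t, g)) sh)).
  exact: undisplacedE.
by rewrite /= addrK.
Qed.

Lemma undisplaced_off h p : small h -> ~ K p -> undisplaced h p = p.2.
Proof.
move=> sh nK; have := undisplaced_unique p.1 p.2 sh.
by rewrite -surjective_pairing w0// scaler0 addr0 -surjective_pairing.
Qed.

(** The perturbed identity fixes the points outside the support of [w], hence
    preserves every set that contains this support. *)
Lemma undisplaced_on (S : set V) h t z : small h -> (forall z, K (t, z) -> S z) ->
  S z -> S (undisplaced h (t, z)).
Proof.
move=> sh KS Sz; apply: contrapT => nS.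
have nK : ~ K (t, undisplaced h (t, z)) by move=> /KS.
by have := undisplacedK (t, z) sh; rewrite /= w0// scaler0 addr0 => e; rewrite e in nS.
Qed.

Lemma undisplaced_dist h p : small h -> `|undisplaced h p - p.2| <= `|h| * L.
Proof.
move=> sh; rewrite {1}(undisplacedE p sh) addrAC subrr add0r normrN normrZ.
by rewrite ler_wpM2l.
Qed.

Lemma undisplaced_taylor h p : small h ->
  `|undisplaced h p - p.2 - h *: (- w p)| <= L * L * h ^+ 2.
Proof.
move=> sh; have -> : undisplaced h p - p.2 = - (h *: w (p.1, undisplaced h p)).
  by rewrite {1}(undisplacedE p sh) addrAC subrr add0r.
rewrite scalerN opprK addrC -scalerBr normrZ.
have := Lip p.1 p.2 (undisplaced h p); rewrite -surjective_pairing => H.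
have H2 := undisplaced_dist p sh; rewrite distrC in H2.
apply: le_trans (ler_wpM2l (normr_ge0 h) (le_trans H (ler_wpM2l L0 H2))) _.
rewrite [leLHS](_ : _ = L * L * (`|h| * `|h|)); last by ring.
by rewrite -normrM -expr2 ger0_norm// sqr_ge0.
Qed.

Lemma w_continuous : continuous w.
Proof. by move=> p; exact: (smooth_on_continuous sw). Qed.

Lemma undisplaced_continuous h : small h -> continuous (undisplaced h).
Proof.
move=> sh p.
apply: (fixed_point_continuous (f := fun q g => q.2 - h *: w (q.1, g))).
- by move=> q; exact: half_lipschitz_displacement.
- by move=> q; exact: undisplacedE.
- rewrite {2}(undisplacedE p sh).
  apply: cvgB; first exact: cvg_snd.
  apply: cvgZl_tmp.
  apply: (@continuous_comp _ _ _ (fun q : E => (q.1, undisplaced h p)) w); last exact: w_continuous.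
  by apply: continuous_pairing; [exact: continuous_fst|exact: continuous_const].
Qed.

(** The directional derivative of [undisplaced h] along [v], obtained without
    an inverse function theorem: differentiating the fixed point equation of
    [undisplaced] gives a fixed point equation for the derivative. *)
Definition stretch (h : R) (v : V) (p : E) : V :=
  xget 0 [set k | k = v - h *: 'D_((0, k)) w (p.1, undisplaced h p)].

Lemma half_lipschitz_stretch h v q : small h ->
  half_lipschitz (fun k => v - h *: 'D_((0, k)) w q).
Proof.
move=> sh a b; rewrite opprB addrC subrKA -scalerBr normrZ -DB.
rewrite (le_trans (ler_wpM2l (normr_ge0 h) (LD _ _)))// mulrA distrC.
by rewrite ler_wpM2r.
Qed.

Lemma stretchE h v p : small h ->
  stretch h v p = v - h *: 'D_((0, stretch h v p)) w (p.1, undisplaced h p).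
Proof.
move=> sh; rewrite /stretch.
have [g gE] := half_lipschitz_fixed_point (half_lipschitz_stretch v (p.1, undisplaced h p) sh).
exact: (xgetPex 0 (ex_intro (fun k => k = v - h *: 'D_((0, k)) w (p.1, undisplaced h p)) g gE)).
Qed.

Lemma stretch_dist h v p : small h -> `|stretch h v p - v| <= 2 * (`|h| * L * `|v|).
Proof.
move=> sh.
have lf := half_lipschitz_stretch v (p.1, undisplaced h p) sh.
have fE := stretchE v p sh.
have H : `|stretch h v p - v| <=
    2 * `|v - h *: 'D_((0, v)) w (p.1, undisplaced h p) - v|.
  exact: (fixed_point_close v lf fE).
apply: (le_trans H); rewrite ler_wpM2l//.
have -> : v - h *: 'D_((0, v)) w (p.1, undisplaced h p) - v =
    - (h *: 'D_((0, v)) w (p.1, undisplaced h p)).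
  by rewrite addrAC subrr add0r.
by rewrite normrN normrZ -mulrA ler_wpM2l.
Qed.

Lemma stretch_taylor h v p : small h ->
  `|stretch h v p - v - h *: (- 'D_((0, v)) w p)| <= 3 * L * L * `|v| * h ^+ 2.
Proof.
move=> sh.
have -> : stretch h v p - v = - (h *: 'D_((0, stretch h v p)) w (p.1, undisplaced h p)).
  by rewrite {1}(stretchE v p sh) addrAC subrr add0r.
rewrite scalerN opprK addrC -scalerBr normrZ.
set g := (p.1, undisplaced h p); set k := stretch h v p.
have H1 : `|'D_((0, v)) w p - 'D_((0, v)) w g| <= L * `|v| * (`|h| * L).
  have := LipD v p.1 p.2 (undisplaced h p); rewrite -surjective_pairing => H.
  apply: (le_trans H); rewrite ler_wpM2l ?mulr_ge0// distrC.
  exact: undisplaced_dist.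
have H2 : `|'D_((0, v)) w g - 'D_((0, k)) w g| <= L * (2 * (`|h| * L * `|v|)).
  rewrite -DB (le_trans (LD _ _))// ler_wpM2l// distrC; exact: stretch_dist.
have H3 := ler_distD ('D_((0, v)) w g) ('D_((0, v)) w p) ('D_((0, k)) w g).
have H4 : `|'D_((0, v)) w p - 'D_((0, k)) w g| <= 3 * L * L * `|v| * `|h|.
  apply: (le_trans H3); apply: (le_trans (lerD H1 H2)).
  by rewrite [leLHS](_ : _ = 3 * L * L * `|v| * `|h|)//; ring.
apply: le_trans (ler_wpM2l (normr_ge0 h) H4) _.
rewrite [leLHS](_ : _ = 3 * L * L * `|v| * (`|h| * `|h|)); last by ring.
by rewrite -normrM -expr2 ger0_norm// sqr_ge0.
Qed.

Lemma spatial_derive_off k p : ~ K p -> 'D_((0, k)) w p = 0.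
Proof.
move=> nK; rewrite (@near_derive_eq _ _ _ w (cst 0)) ?derive_cst//.
have cl : closed K := compact_closed (@norm_hausdorff _ _) cK.
by apply: (@open_near _ _ (~` K) _ (closed_openC cl)) => // q /w0.
Qed.

Lemma stretch_off h v p : small h -> ~ K p -> stretch h v p = v.
Proof.
move=> sh nK; rewrite (stretchE v p sh) undisplaced_off// -surjective_pairing.
by rewrite spatial_derive_off// scaler0 subr0.
Qed.

Lemma spatial_derive_continuous k : continuous ('D_((0, k)) w).
Proof. by move=> p; exact: (smooth_on_continuous (smooth_on_derive (0, k) sw)). Qed.

Lemma stretch_continuous h v : small h -> continuous (stretch h v).
Proof.
move=> sh p.
apply: (fixed_point_continuous (f := fun q k => v - h *: 'D_((0, k)) w (q.1, undisplaced h q))).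
- by move=> q; exact: half_lipschitz_stretch.
- by move=> q; exact: stretchE.
- rewrite {2}(stretchE v p sh).
  apply: cvgB; first exact: cvg_cst.
  apply: cvgZl_tmp.
  apply: (@continuous_comp _ _ _ (fun q : E => (q.1, undisplaced h q)) ('D_((0, stretch h v p)) w)).
    by apply: continuous_pairing; [exact: continuous_fst|exact: undisplaced_continuous].
  exact: spatial_derive_continuous.
Qed.

(** The difference quotients of [undisplaced] solve fixed point equations too,
    whose limit is the equation of [stretch]; fixed points being continuous in
    the parameter, the quotients converge to [stretch]. *)
Lemma undisplaced_derive h t z v : small h ->
  is_derive (0 : R) (1 : R) (fun s : R => undisplaced h (t, z + s *: v)) (stretch h v (t, z)).
Proof.
move=> sh; set g0 := undisplaced h (t, z); set k := stretch h v (t, z).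
pose q (s : R) : V := if s == 0 then k else s^-1 *: (undisplaced h (t, z + s *: v) - g0).
pose f (s : R) (a : V) : V := if s == 0 then v - h *: 'D_((0, a)) w (t, g0)
  else v - h *: (s^-1 *: (w (t, g0 + s *: a) - w (t, g0))).
suff qk : q @ 0^' --> k.
  have E : (fun s : R => s^-1 *: (((fun s : R => undisplaced h (t, z + s *: v)) \o shift 0) (s *: 1)
      - undisplaced h (t, z + 0 *: v))) @ 0^' --> k.
    apply: cvg_trans qk; apply: near_eq_cvg; near=> s.
    have s0 : s != 0 by near: s; exact: nbhs_dnbhs_neq.
    have e : s *: (1 : R) + 0 = s by rewrite addr0 /GRing.scale/= mulr1.
    by rewrite /q (negbTE s0) /= e scale0r addr0.
  split; first by apply/cvg_ex; exists k.
  by apply: cvg_lim => //; exact: norm_hausdorff.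
apply: (fixed_point_continuous (f := f)).
- move=> s; rewrite /f; have [_|s0] := eqVneq s 0; first exact: half_lipschitz_stretch.
  move=> a b; rewrite opprB addrC subrKA -scalerBr -scalerBr opprB subrKA.
  rewrite !normrZ.
  apply: (@le_trans _ _ (`|h| * (`|s^-1| * (L * `|s *: (b - a)|)))).
    rewrite ler_wpM2l// ler_wpM2l//.
    by rewrite (le_trans (Lip _ _ _))// opprD addrACA subrr add0r scalerBr.
  have s0' : `|s| != 0 by rewrite normr_eq0.
  rewrite normrZ normfV [L * _]mulrCA mulKf// mulrA distrC.
  by rewrite ler_wpM2r.
- move=> s; rewrite /q /f; have [_|s0] := eqVneq s 0; first exact: (stretchE v (t, z) sh).
  rewrite [s *: (_ *: _)]scalerA mulfV// scale1r subrKC.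
  have e1 := undisplacedE (t, z + s *: v) sh.
  have e2 := undisplacedE (t, z) sh.
  set W1 := w (t, undisplaced h (t, z + s *: v)) in e1 *.
  transitivity (s^-1 *: ((z + s *: v - h *: W1) - (z - h *: w (t, g0)))).
    by congr (_ *: (_ - _)).
  by apply/rowP => i; rewrite !mxE; field.
- have dw := smooth_on_differentiable sw (I : setT (t, g0)).
  have dv : derivable w (t, g0) (0, k) by exact: diff_derivable.
  apply: (@cvg_trans _ ((fun s : R => v - h *: (s^-1 *: ((w \o shift (t, g0)) (s *: (0, k)) - w (t, g0)))) @ 0^')).
    apply: near_eq_cvg; near=> s.
    have s0 : s != 0 by near: s; exact: nbhs_dnbhs_neq.
    have pE : (t, g0 + s *: k) = s *: ((0, k) : E) + (t, g0).
      by rewrite -[RHS]/(s *: 0 + t, s *: k + g0) scaler0 add0r [g0 + _]addrC.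
    by rewrite /f (negbTE s0) pE.
  have kE : v - h *: 'D_((0, k)) w (t, g0) = k := esym (stretchE v (t, z) sh).
  have lim : (fun s : R => v - h *: (s^-1 *: ((w \o shift (t, g0)) (s *: (0, k)) - w (t, g0)))) @ 0^'
      --> v - h *: 'D_((0, k)) w (t, g0).
    apply: cvgB; first exact: cvg_cst.
    by apply: cvgZl_tmp; exact: dv.
  by rewrite kE in lim.
Unshelve. all: by end_near. Qed.

Lemma derive_comp_undisplaced (W : normedModType R) (f : E -> W) h t z v : small h ->
  differentiable f (t, undisplaced h (t, z)) ->
  'D_v (fun z => f (t, undisplaced h (t, z))) z =
  'D_((0, stretch h v (t, z))) f (t, undisplaced h (t, z)).
Proof.
move=> sh df; have [dg Dg] := undisplaced_derive t z v sh.
pose gam (s : R) : E := (t, undisplaced h (t, z + s *: v)).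
have dund : differentiable (fun s : R => undisplaced h (t, z + s *: v)) 0.
  exact/derivable1_diffP.
have dcst : differentiable (fun _ : R => t) 0 by exact: differentiable_cst.
have dgam : differentiable gam 0 by exact: differentiable_pair.
have Dgam : 'D_1 gam 0 = (0, stretch h v (t, z)).
  rewrite (deriveE _ dgam) (diff_pair dcst dund).
  rewrite -(deriveE _ dund) -(deriveE _ dcst) Dg.
  by congr (_, _); exact: derive_cst.
have gam0 : gam 0 = (t, undisplaced h (t, z)) by rewrite /gam scale0r addr0.
transitivity ('D_1 (fun s : R => f (gam s)) 0).
  apply: (derive_congr _).1 => s; rewrite /gam addr0 addrC.
  by rewrite /GRing.scale /= mulr1.
have dfg : differentiable f (gam 0) by rewrite gam0.
by rewrite (derive_comp (1 : R) dgam dfg) Dgam gam0.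
Qed.

End PerturbedIdentity.

(** * Differentiation of integrals of varied fields *)

Lemma continuous_for_ext (R : realType) (X W : normedModType R) (Q : set X) (f g : X -> W) p :
  open Q -> (forall q, Q q -> f q = g q) -> Q p ->
  {for p, continuous f} -> {for p, continuous g}.
Proof.
move=> oQ fg Qp; rewrite /prop_for /continuous_at (fg _ Qp) => cf.
apply: cvg_trans cf; apply: near_eq_cvg.
by apply: (open_near oQ _ Qp) => q Qq; rewrite fg.
Qed.

Section SmoothVariations.
Context {R : realType} {d : nat}.
Notation V := 'rV[R]_d.
Notation E := (R * 'rV[R]_d)%type.
Variables (Q K : set E).
Hypotheses (oQ : open Q) (cK : compact K) (KQ : K `<=` Q).
Implicit Types W : normedModType R.

(** The estimate, uniform in the point, plays the part of dominated convergence
    when such families are integrated. The class is stable under pairing and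
    under composition with smooth maps, which brings in all the densities of
    the displaced configurations. *)
Definition varied W (a : R -> E -> W) (a' : E -> W) : Prop :=
  [/\ forall p, Q p -> {for p, continuous a'},
      forall p, Q p -> ~ K p -> a' p = 0 &
      exists h0 M : R, 0 < h0 /\ forall h, `|h| <= h0 -> forall p, Q p ->
        [/\ {for p, continuous (a h)}, ~ K p -> a h p = a 0 p &
            `|a h p - a 0 p - h *: a' p| <= M * h ^+ 2]].

Lemma varied_cst W (f : E -> W) : (forall p, Q p -> {for p, continuous f}) ->
  varied (fun=> f) (fun=> 0).
Proof.
move=> cf; split => //; first by move=> p _; exact: continuous_const.
exists 1, 0; split => // h _ p Qp; split => //; first exact: cf.
by rewrite subrr scaler0 subr0 normr0 mul0r.
Qed.

Lemma varied_bounded W (a : R -> E -> W) a' : varied a a' ->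
  exists B, forall p, Q p -> `|a' p| <= B.
Proof.
move=> [ca a0 _].
have : compact (a' @` K).
  apply: continuous_compact => //; apply: continuous_in_subspaceT => p.
  by rewrite inE => /KQ; exact: ca.
move=> /compact_bounded[B [_ HB]]; exists (Num.max (B + 1) 0) => p Qp.
have [Kp|nKp] := pselect (K p).
  by rewrite le_max HB// ?ltrDl//; exists p.
by rewrite a0// normr0 le_max lexx orbT.
Qed.

Lemma varied_pair W W' (a : R -> E -> W) a' (b : R -> E -> W') b' :
  varied a a' -> varied b b' ->
  varied (fun h p => (a h p, b h p)) (fun p => (a' p, b' p)).
Proof.
move=> [ca a0 [h1 [M1 [h10 H1]]]] [cb b0 [h2 [M2 [h20 H2]]]]; split.
- by move=> p Qp; apply: continuous_pairing; [exact: ca|exact: cb].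
- by move=> p Qp nK; rewrite a0// b0.
- exists (Num.min h1 h2), (Num.max M1 M2); split; first by rewrite lt_min h10.
  move=> h; rewrite le_min => /andP[hh1 hh2] p Qp.
  have [c1 e1 t1] := H1 h hh1 p Qp; have [c2 e2 t2] := H2 h hh2 p Qp; split.
  + exact: continuous_pairing.
  + by move=> nK; rewrite e1// e2.
  + rewrite prod_normE ge_max; apply/andP; split => /=.
      by rewrite (le_trans t1)// ler_wpM2r ?sqr_ge0// le_max lexx.
    by rewrite (le_trans t2)// ler_wpM2r ?sqr_ge0// le_max lexx orbT.
Qed.

Lemma varied_row (a : R -> E -> V) (a' : E -> V) :
  (forall i, varied (fun h p => a h p ord0 i) (fun p => a' p ord0 i)) -> varied a a'.
Proof.
move=> va; split.
- by move=> p Qp; apply: continuous_row => i; case: (va i) => + _ _; apply.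
- by move=> p Qp nK; apply/rowP => i; rewrite mxE; case: (va i) => _ + _; apply.
- have /choice[hM hMP] (i : 'I_d) : exists hM : R * R, 0 < hM.1 /\ forall h, `|h| <= hM.1 ->
    forall p, Q p -> [/\ {for p, continuous (fun p => a h p ord0 i)},
      ~ K p -> a h p ord0 i = a 0 p ord0 i &
      `|a h p ord0 i - a 0 p ord0 i - h *: a' p ord0 i| <= hM.2 * h ^+ 2].
    by case: (va i) => _ _ [h [M H]]; exists (h, M).
  have [h0 [h00 h0P]] : exists h0 : R, 0 < h0 /\ forall i, h0 <= (hM i).1.
    exists (\big[Num.min/1]_i (hM i).1); split.
      by apply: lt_bigmin => // i _; case: (hMP i).
    by move=> i; exact: bigmin_le_cond.
  exists h0, (\sum_i `|(hM i).2|); split => // h hh0 p Qp; split.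
  + by apply: continuous_row => i; have [_ /(_ h (le_trans hh0 (h0P i)) p Qp)[]] := hMP i.
  + move=> nK; apply/rowP => i.
    by have [_ /(_ h (le_trans hh0 (h0P i)) p Qp)[_ + _]] := hMP i; apply.
  + apply/normr_rV_le; first by rewrite mulr_ge0 ?sqr_ge0// sumr_ge0.
    move=> i; rewrite !mxE.
    have [_ /(_ h (le_trans hh0 (h0P i)) p Qp)[_ _ t]] := hMP i.
    apply: (le_trans t); rewrite ler_wpM2r ?sqr_ge0//.
    by rewrite (le_trans (ler_norm _))// (bigD1 i)//= lerDl sumr_ge0.
Qed.

(** Off the compact [K] nothing varies; on [K] the values of the family stay in
    a compact part of [U], where the expansion of [f] to second order is
    uniform. *)
Lemma varied_comp W (U : set W) (f : W -> R) (a : R -> E -> W) a' :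
  finite_basis W -> open U -> smooth_on U f ->
  (forall p, Q p -> {for p, continuous (a 0)}) ->
  (forall p, Q p -> U (a 0 p)) -> varied a a' ->
  varied (fun h p => f (a h p)) (fun p => 'D_(a' p) f (a 0 p)).
Proof.
move=> fW oU sf ca0 aU va; have [B aB] := varied_bounded va.
have {}aB p : Q p -> `|a' p| <= `|B| by move=> Qp; rewrite (le_trans (aB _ Qp))// ler_norm.
have [ca a0 [h1 [M [h10 H]]]] := va.
have cS : compact (a 0 @` K).
  apply: continuous_compact => //; apply: continuous_in_subspaceT => p.
  by rewrite inE => /KQ; exact: ca0.
have SU : a 0 @` K `<=` U by move=> _ [p Kp <-]; exact/aU/KQ.
have [C C0 [r r0 [DC TC]]] := uniform_taylor fW oU sf cS SU.
split.
- move=> p Qp; apply: (continuous_derive_along fW oU sf) => //; [exact: aU|exact: ca0|exact: ca].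
- by move=> p Qp nK; rewrite a0// derive0.
- pose A := `|B| + `|M| + 1.
  have A0 : 0 < A by rewrite /A ltr_pwDr// addr_ge0.
  pose h0 := Num.min (Num.min h1 1) (r / (2 * A)).
  have h00 : 0 < h0 by rewrite !lt_min h10 ltr01/= divr_gt0// mulr_gt0.
  have bnd h p : `|h| <= h0 -> Q p -> `|a h p - a 0 p| <= A * `|h| /\ `|a h p - a 0 p| < r.
    rewrite !le_min => /andP[/andP[hh1 hh2] hr] Qp.
    have [_ _ t] := H h hh1 p Qp.
    have le1 : `|a h p - a 0 p| <= A * `|h|.
      have := ler_normD (a h p - a 0 p - h *: a' p) (h *: a' p); rewrite subrK => /le_trans; apply.
      have u1 : `|h *: a' p| <= `|B| * `|h|.
        by rewrite normrZ mulrC ler_wpM2r// aB.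
      have u2 : `|a h p - a 0 p - h *: a' p| <= (`|M| + 1) * `|h|.
        apply: (le_trans t).
        apply: (@le_trans _ _ (`|M| * h ^+ 2)); first by rewrite ler_wpM2r ?sqr_ge0// ler_norm.
        rewrite -real_normK ?num_real// expr2 mulrA ler_wpM2r//.
        by rewrite (le_trans (ler_wpM2l (normr_ge0 M) hh2))// mulr1 lerDl.
      apply: (le_trans (lerD u2 u1)).
      by rewrite -mulrDl ler_wpM2r// /A addrC addrA.
    split=> //; rewrite (le_lt_trans le1)//.
    rewrite (le_lt_trans (ler_wpM2l (ltW A0) hr))//.
    rewrite [ltLHS](_ : _ = r / 2); last by field; rewrite gt_eqF.
    by rewrite ltr_pdivrMr// ltr_pMr// ltr1n.
  have inU h p : `|h| <= h0 -> Q p -> U (a h p).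
    move=> hh Qp; have [Kp|nK] := pselect (K p).
      have [_ kr] := bnd h p hh Qp.
      have [+ _ _] := TC (a 0 p) _ (ex_intro2 _ _ p Kp erefl) kr.
      by rewrite subrKC.
    have hh1 : `|h| <= h1 by move: hh; rewrite !le_min => /andP[/andP[]].
    by have [_ -> // _] := H h hh1 p Qp; exact: aU.
  exists h0, (C * A ^+ 2 + C * `|M|); split=> // h hh p Qp.
  have hh1 : `|h| <= h1 by move: hh; rewrite !le_min => /andP[/andP[]].
  have [c e t] := H h hh1 p Qp; split.
  + apply: (@continuous_comp _ _ _ (a h) f) => //.
    exact: (smooth_on_continuous sf (inU _ _ hh Qp)).
  + by move=> nK; rewrite e.
  + have [Kp|nK] := pselect (K p); last first.
      rewrite e// a0// derive0 subrr scaler0 subr0 normr0 mulr_ge0 ?sqr_ge0//.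
      by rewrite addr_ge0// mulr_ge0// sqr_ge0.
    have [le1 kr] := bnd h p hh Qp.
    have Sp : (a 0 @` K) (a 0 p) by exists p.
    have [_ _] := TC _ _ Sp kr; rewrite subrKC => T2.
    have df := smooth_on_differentiable sf (aU _ Qp).
    have DE : 'D_(a h p - a 0 p) f (a 0 p) - h *: 'D_(a' p) f (a 0 p) =
        'D_(a h p - a 0 p - h *: a' p) f (a 0 p).
      by rewrite [RHS](derive_subv _ _ df) (derive_scalev _ _ df).
    have T3 : `|'D_(a h p - a 0 p) f (a 0 p) - h *: 'D_(a' p) f (a 0 p)| <= C * (`|M| * h ^+ 2).
      rewrite DE (le_trans (DC _ _ Sp))// ler_wpM2l// (le_trans t)//.
      by rewrite ler_wpM2r ?sqr_ge0// ler_norm.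
    have := ler_distD ('D_(a h p - a 0 p) f (a 0 p)) (f (a h p) - f (a 0 p)) (h *: 'D_(a' p) f (a 0 p)).
    move=> /le_trans; apply; rewrite mulrDl; apply: lerD; last by rewrite -mulrA.
    apply: (le_trans T2); rewrite -mulrA ler_wpM2l//.
    have -> : A ^+ 2 * h ^+ 2 = (A * `|h|) ^+ 2 by rewrite exprMn real_normK ?num_real.
    by rewrite ler_pXn2r ?nnegrE ?mulr_ge0// ltW.
Qed.

Lemma varied_eq W (a b : R -> E -> W) a' b' :
  (forall h p, Q p -> a h p = b h p) -> (forall p, Q p -> a' p = b' p) ->
  varied a a' -> varied b b'.
Proof.
move=> ab ab' [ca a0 [h0 [M [h00 H]]]]; split.
- by move=> p Qp; exact: (continuous_for_ext oQ ab' Qp (ca p Qp)).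
- by move=> p Qp nK; rewrite -ab'// a0.
- exists h0, M; split=> // h hh p Qp; have [c e t] := H h hh p Qp; split.
  + exact: (continuous_for_ext oQ (ab h) Qp c).
  + by move=> nK; rewrite -!ab// e.
  + by rewrite -!ab// -ab'.
Qed.

Definition zero_extend W (f : E -> W) (p : E) : W := if `[< Q p >] then f p else 0.

Lemma zero_extendE W (f : E -> W) p : Q p -> zero_extend f p = f p.
Proof. by move=> Qp; rewrite /zero_extend; case: asboolP. Qed.

Lemma test_fun_zero_extend (f : E -> R) : (forall p, Q p -> {for p, continuous f}) ->
  (forall p, Q p -> ~ K p -> f p = 0) -> test_fun (zero_extend f).
Proof.
move=> cf f0; apply: (test_fun_off oQ cK KQ) => p.
  move=> Qp; apply: (continuous_for_ext oQ _ Qp (cf p Qp)) => q Qq.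
  by rewrite zero_extendE.
by rewrite /zero_extend; case: asboolP => // Qp nK; exact: f0.
Qed.

Lemma is_derive_quadratic (J : R -> R) D h0 C : 0 < h0 ->
  (forall h, `|h| <= h0 -> `|J h - J 0 - h * D| <= C * h ^+ 2) -> is_derive (0 : R) (1 : R) J D.
Proof.
move=> h00 H.
have lim : (fun h : R => h^-1 *: ((J \o shift 0) (h *: 1) - J 0)) @ 0^' --> D.
  apply/cvgrPdist_le => e e0; near=> h.
  have hn0 : h != 0 by near: h; exact: nbhs_dnbhs_neq.
  have hh : `|h| <= h0.
    by near: h; apply: dnbhs0_le.
  have hC : `|h| <= e / (`|C| + 1).
    by near: h; apply: dnbhs0_le; rewrite divr_gt0// ltr_pwDr.
  have e1 : h *: (1 : R) + 0 = h by rewrite addr0 /GRing.scale/= mulr1.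
  rewrite /= e1 distrC.
  have -> : h^-1 *: (J h - J 0) - D = h^-1 * (J h - J 0 - h * D).
    by rewrite /GRing.scale/=; field.
  rewrite normrM normfV mulrC ler_pdivrMr ?normr_gt0//.
  apply: le_trans (H h hh) _; rewrite -real_normK ?num_real// expr2 mulrA.
  rewrite ler_wpM2r//.
  apply: (@le_trans _ _ ((`|C| + 1) * `|h|)).
    by rewrite ler_wpM2r// (le_trans (ler_norm _))// lerDl.
  by rewrite mulrC -ler_pdivlMr// ltr_pwDr.
split; first by apply/cvg_ex; exists D.
by apply: cvg_lim.
Unshelve. all: by end_near. Qed.

(** The densities differ from the base density on a fixed compact set only,
    and to second order uniformly there; integration over this set leaves a
    quadratic remainder. *)
Lemma is_derive_volume_integral T O (x : R -> V -> V) (J : R -> R)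
    (A0 : R -> V -> R) (a : R -> E -> R) a' h0 :
  varied a a' -> volume_integrable T O x A0 ->
  (forall p, K p -> (x p.1 @` O) p.2) -> (forall p, Q p -> 0 <= p.1 <= T) ->
  (forall t z, Q (t, z) -> A0 t z = a 0 (t, z)) ->
  0 < h0 ->
  (forall h, `|h| <= h0 -> exists2 F, J h = volume_integral T O x F &
     forall t z, 0 <= t <= T -> (x t @` O) z ->
       F t z = if `[< Q (t, z) >] then a h (t, z) else A0 t z) ->
  is_derive (0 : R) (1 : R) J (spacetime_integral (zero_extend a')).
Proof.
move=> va iA KO QT A0a h00 JF.
have [ca' a'0 [h1 [M [h10 H]]]] := va.
have [MK [_ HMK]] := compact_bounded cK.
have [C C0 CP] := @spacetime_integral_bound R d (MK + 1).
pose b h := zero_extend (fun p => a h p - a 0 p).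
have tb h : `|h| <= h1 -> test_fun (b h).
  move=> hh; apply: test_fun_zero_extend => p Qp.
    have [c _ _] := H h hh p Qp.
    have n0 : `|0 : R| <= h1 by rewrite normr0 ltW.
    have [c0 _ _] := H 0 n0 p Qp.
    exact: cvgB.
  by move=> nK; have [_ -> // _] := H h hh p Qp; rewrite subrr.
have ta' : test_fun (zero_extend a') by exact: test_fun_zero_extend.
have JE h : `|h| <= h0 -> `|h| <= h1 ->
    J h = volume_integral T O x A0 + spacetime_integral (b h).
  move=> hh0 hh1; have [F -> FE] := JF h hh0.
  apply: volume_integralD => //; first exact: tb.
    move=> t z; rewrite /b /zero_extend; case: asboolP; last by rewrite eqxx.
    move=> Qtz bn0; split; first exact: (QT (t, z)).
    have [Kp|nK] := pselect (K (t, z)); first exact: (KO (t, z)).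
    by have [_ e _] := H h hh1 _ Qtz; rewrite e// subrr eqxx in bn0.
  move=> t z tT zO; rewrite FE// /b /zero_extend; case: asboolP => Qtz.
    by rewrite A0a// subrKC.
  by rewrite addr0.
have J0E : J 0 = volume_integral T O x A0.
  rewrite JE ?normr0 ?ltW// (@eq_spacetime_integral _ _ (b 0) (fun=> 0)).
    by rewrite spacetime_integral0 addr0.
  by move=> p; rewrite /b /zero_extend subrr; case: ifP.
apply: (@is_derive_quadratic _ _ (Num.min h0 h1) (`|M| * C)); first by rewrite lt_min h00.
move=> h; rewrite le_min => /andP[hh0 hh1].
have cancel_v (v s y : R) : v + s - v - y = s - y by ring.
rewrite J0E JE// cancel_v.
have -> : spacetime_integral (b h) - h * spacetime_integral (zero_extend a') =
    spacetime_integral (fun p => b h p + (- h) * zero_extend a' p).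
  rewrite spacetime_integralD ?spacetime_integralZ//; [|exact: tb|exact: test_funZ].
  by rewrite mulNr.
rewrite mulrAC; apply: CP.
- by rewrite mulr_ge0// sqr_ge0.
- by apply: test_funD; [exact: tb|exact: test_funZ].
- move=> p; rewrite /b /zero_extend; case: asboolP => Qp; last first.
    by rewrite mulr0 addr0 normr0 mulr_ge0// sqr_ge0.
  have [_ _ t] := H h hh1 p Qp; rewrite mulNr (le_trans t)// ler_wpM2r ?sqr_ge0//.
  exact: ler_norm.
- move=> p Mp; have nK : ~ K p.
    move=> Kp; have /= := HMK (MK + 1) (ltr_pwDr ltr01 (lexx MK)) p Kp.
    by rewrite leNgt Mp.
  rewrite /b /zero_extend; case: asboolP => Qp; last by rewrite mulr0 addr0.
  by have [_ e _] := H h hh1 p Qp; rewrite e// a'0// subrr mulr0 addr0.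
Qed.

End SmoothVariations.

(** * Displaced flow maps *)

Section ZeroExtension.
Context {R : realType} {d : nat}.
Notation V := 'rV[R]_d.
Notation E := (R * 'rV[R]_d)%type.
Variables (Q K : set E).
Hypotheses (oQ : open Q) (cK : compact K) (KQ : K `<=` Q).

Lemma zero_extend_smooth (f : E -> R) : smooth_on Q f -> (forall p, Q p -> ~ K p -> f p = 0) ->
  smooth_on setT (zero_extend Q f).
Proof.
move=> sf f0.
have clK : closed K := compact_closed (@norm_hausdorff _ _) cK.
have -> : setT = Q `|` ~` K.
  by apply/esym/seteqP; split=> // p _; have [/KQ|] := pselect (K p); [left|right].
apply: smooth_onU.
  by apply: (smooth_on_ext oQ _ sf) => p Qp; rewrite zero_extendE.
apply: (smooth_on_ext (closed_openC clK) _ (smooth_cst 0 (closed_openC clK))) => p nK.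
by rewrite /zero_extend; case: asboolP => // Qp; rewrite f0.
Qed.

Lemma zero_extend_support (f : E -> R) : (forall p, Q p -> ~ K p -> f p = 0) ->
  bounded_support (zero_extend Q f).
Proof.
move=> f0; have [M [_ KM]] := compact_bounded cK; exists (M + 1) => p Mp.
have nKp : ~ K p.
  by move=> Kp; have /= := KM (M + 1) (ltr_pwDr ltr01 (lexx M)) p Kp; rewrite leNgt Mp.
by rewrite /zero_extend; case: asboolP => // Qp; rewrite f0.
Qed.

Lemma derive_off (f : E -> R) v p : (forall p, Q p -> ~ K p -> f p = 0) -> Q p -> ~ K p ->
  'D_v f p = 0.
Proof.
move=> f0 Qp nK.
have clK : closed K := compact_closed (@norm_hausdorff _ _) cK.
have oQK : open (Q `&` ~` K) by apply: openI => //; exact: closed_openC.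
rewrite (@near_derive_eq _ _ _ f (cst 0)) ?derive_cst//.
by apply: (open_near oQK) => // q [Qq nKq]; exact: f0.
Qed.

Lemma derive_zero_extend (f : E -> R) v : (forall p, Q p -> ~ K p -> f p = 0) ->
  'D_v (zero_extend Q f) = zero_extend Q ('D_v f).
Proof.
move=> f0; apply/funext => p.
have clK : closed K := compact_closed (@norm_hausdorff _ _) cK.
have [Qp|nQ] := pselect (Q p).
  rewrite zero_extendE//; apply: near_derive_eq.
  by apply: (open_near oQ) => // q Qq; rewrite zero_extendE.
rewrite [RHS]/zero_extend; case: asboolP => // _.
rewrite (@near_derive_eq _ _ _ _ (cst 0)) ?derive_cst//.
apply: (open_near (closed_openC clK)); last by move=> /KQ.
by move=> q nK; rewrite /zero_extend; case: asboolP => // Qq; rewrite f0.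
Qed.

Definition coordinate_direction (v : E) := v = (1, 0) \/ exists i, v = (0, delta_mx ord0 i).

Lemma spacetime_integral_derive (F : E -> R) v : coordinate_direction v ->
  smooth_on setT F -> bounded_support F -> spacetime_integral ('D_v F) = 0.
Proof.
move=> vE sF bF; have tF := smooth_test_fun sF bF.
have dF p w : derivable F p w.
  by apply: diff_derivable; exact: (smooth_on_differentiable sF).
have cF w : continuous ('D_w F).
  by move=> p; exact: (smooth_on_continuous (smooth_on_derive w sF)).
case: vE => [->|[i ->]]; first exact: spacetime_integral_dt.
exact: spacetime_integral_partial.
Qed.

(** The product, extended by zero, is a smooth test function, and integrals of
    derivatives of test functions vanish. *)
Lemma integration_by_parts_spacetime (f g : E -> R) v : coordinate_direction v ->
  smooth_on Q f -> smooth_on Q g -> (forall p, Q p -> ~ K p -> g p = 0) ->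
  spacetime_integral (zero_extend Q (fun p => f p * 'D_v g p)) =
  - spacetime_integral (zero_extend Q (fun p => 'D_v f p * g p)).
Proof.
move=> vE sf sg g0; apply/eqP; rewrite -addr_eq0; apply/eqP.
have fg0 p : Q p -> ~ K p -> f p * g p = 0 by move=> Qp nK; rewrite g0// mulr0.
have c f' : smooth_on Q f' -> forall p, Q p -> {for p, continuous f'}.
  by move=> sf' p; exact: smooth_on_continuous.
have t1 : test_fun (zero_extend Q (fun p => f p * 'D_v g p)).
  apply: (test_fun_zero_extend oQ cK KQ).
    by apply: c; apply: smooth_mul => //; exact: smooth_on_derive.
  by move=> p Qp nK; rewrite derive_off// mulr0.
have t2 : test_fun (zero_extend Q (fun p => 'D_v f p * g p)).
  apply: (test_fun_zero_extend oQ cK KQ).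
    by apply: c; apply: smooth_mul => //; exact: smooth_on_derive.
  by move=> p Qp nK; rewrite g0// mulr0.
rewrite -spacetime_integralD//.
rewrite -[RHS](spacetime_integral_derive vE (zero_extend_smooth (smooth_mul oQ sf sg) fg0)
  (zero_extend_support fg0)).
rewrite (derive_zero_extend _ fg0); apply: eq_spacetime_integral => p.
rewrite /zero_extend; case: asboolP => Qp; last by rewrite addr0.
rewrite -[X in _ = 'D_v X p]/(f * g) deriveM; last 2 first.
  by apply: diff_derivable; exact: (smooth_on_differentiable sf).
  by apply: diff_derivable; exact: (smooth_on_differentiable sg).
by rewrite /GRing.scale/= [g p * _]mulrC.
Qed.

End ZeroExtension.

Section DisplacedFlow.
Context {R : realType} {d : nat}.
Notation V := 'rV[R]_d.
Notation E := (R * 'rV[R]_d)%type.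
Variables (Omega : set V) (T : R) (x Y : R -> V -> V) (O : set V) (dx : R -> V -> V).
Hypotheses (oO : open Omega) (xY : inverse_flows Omega T x Y)
  (iO : initial_volume Omega O) (vdx : Defs.variation T O dx).

Let Q := cylinder Omega T.
Let OO : O `<=` Omega. Proof. by case: iO. Qed.
Let sdx : smooth_on setT (spacetime dx). Proof. by case: vdx. Qed.
Let cdx : compact (supp (spacetime dx)). Proof. by case: vdx. Qed.

Lemma variation_support_cylinder : supp (spacetime dx) `<=` cylinder Omega T.
Proof.
case: vdx => _ _ H p /H [pT pO]; split => //; apply: OO; exact: interior_subset.
Qed.

(** The Eulerian field that moves the particle at [x t X] by [dx t X]; the
    displaced flow is [x] followed by the perturbed identity of this field. *)
Definition displacement := transplant Omega T Y dx.
Definition displacement_support : set E :=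
  (fun p : E => (p.1, x p.1 p.2)) @` supp (spacetime dx).
Notation w := displacement.
Notation K := displacement_support.

Lemma displacement_smooth : smooth_on setT w.
Proof. exact: (transplant_smooth oO xY sdx cdx variation_support_cylinder). Qed.

Lemma displacement_compact : compact K.
Proof. exact: (transplant_image_compact xY cdx variation_support_cylinder). Qed.

Lemma displacement_supportQ : K `<=` Q.
Proof. exact: (transplant_image_cylinder xY variation_support_cylinder). Qed.

Lemma displacement_off p : ~ K p -> w p = 0.
Proof. exact: (transplant_off xY). Qed.

Lemma displacement_support_volume p : K p -> (x p.1 @` O) p.2.
Proof.
case: vdx => _ _ H [[t X] /H [_ XO] <-] /=; exists X => //; exact: interior_subset.
Qed.

Lemma displacementE t X : 0 <= t <= T -> Omega X -> w (t, x t X) = dx t X.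
Proof.
move=> tT OX; rewrite /displacement /transplant; case: asboolP => /= Qp.
  by rewrite (inverse_lr xY).
apply/esym/eqP; apply: contra_notT Qp => dn0.
have /variation_support_cylinder[tT' _] : supp (spacetime dx) (t, X).
  exact: subset_closure.
by split => //=; exact: (inverse_funl xY).
Qed.

Variable L : R.
Hypothesis LP : flow_constant w L.

Section Small.
Variable h : R.
Hypothesis sh : small L h.
Notation g := (undisplaced w h).

Definition displaced_flow (h : R) : R -> V -> V := fun t X => x t X + h *: dx t X.

Lemma undisplaced_Omega t z : Omega z -> Omega (g (t, z)).
Proof.
move=> Oz; apply: (undisplaced_on displacement_off LP (S := Omega) sh) => // z' /displacement_supportQ.
by move=> [].
Qed.

Lemma displaced_pinv t z : 0 <= t <= T -> Omega z ->
  'pinv_(fun=> 0) Omega (displaced_flow h t) z = Y t (g (t, z)).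
Proof.
move=> tT Oz; have Og := undisplaced_Omega t Oz.
have OY := inverse_funr xY tT Og.
have inj : {in Omega &, injective (displaced_flow h t)}.
  move=> X X'; rewrite !inE => OX OX'; rewrite /displaced_flow.
  rewrite -(displacementE tT OX) -(displacementE tT OX') => e.
  have := undisplaced_unique LP t (x t X) sh.
  rewrite e (undisplaced_unique LP)// => exX.
  by rewrite -(inverse_lr xY tT OX) -exX (inverse_lr xY tT OX').
rewrite -[in LHS](_ : displaced_flow h t (Y t (g (t, z))) = z).
  by rewrite (pinvKV (fun=> 0) inj)// inE.
rewrite /displaced_flow -(displacementE tT OY) (inverse_rl xY)//.
exact: (undisplacedK LP (t, z) sh).
Qed.

Lemma eulerian_displaced W (f : R -> V -> W) t z : 0 <= t <= T -> Omega z ->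
  eulerian Omega (displaced_flow h) f t z = f t (Y t (g (t, z))).
Proof. by move=> tT Oz; rewrite /eulerian displaced_pinv. Qed.

(** The displaced flow is the flow followed by a perturbation of the identity
    supported in the transported volume, which maps this volume onto itself.
    The domain of the energy integrals is therefore the same for all the
    variations: only their densities have to be differentiated. *)
Lemma image_displaced t : 0 <= t <= T -> displaced_flow h t @` O = x t @` O.
Proof.
move=> tT.
have KS z : K (t, z) -> (x t @` O) z by move/displacement_support_volume.
have xhE X : O X -> displaced_flow h t X = x t X + h *: w (t, x t X).
  by move=> /OO OX; rewrite /displaced_flow displacementE.
apply/seteqP; split=> z [X OX].
  rewrite xhE// => <-; apply: contrapT => nz.
  have nK : ~ K (t, x t X + h *: w (t, x t X)) by move=> /KS.
  have := undisplaced_off displacement_off LP sh nK.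
  rewrite (undisplaced_unique LP)//= => e; apply: nz; rewrite -e; by exists X.
move=> zE; have Sz : (x t @` O) z by exists X.
have [X' OX' gE] := undisplaced_on displacement_off LP sh KS Sz.
exists X' => //; rewrite xhE// gE.
exact: (undisplacedK LP (t, z) sh).
Qed.

(** A transported quantity keeps its value along the particles: at a point of
    the displaced configuration it has the value it had where the particle
    comes from. *)
Lemma push_displaced W (f0 : V -> W) (f : R -> V -> W) t z :
  transported Omega T x f0 f -> 0 <= t <= T -> Omega z ->
  push Omega f0 (displaced_flow h) t z = f t (g (t, z)).
Proof.
move=> tr tT Oz; rewrite /push eulerian_displaced//.
have Og := undisplaced_Omega t Oz.
by rewrite -(tr t) ?(inverse_rl xY)//; exact: (inverse_funr xY).
Qed.

Lemma grad_push_displaced (f0 : V -> R) (f : R -> V -> R) t z :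
  transported Omega T x f0 f -> smooth_field Omega T f -> 0 <= t <= T -> Omega z ->
  grad (push Omega f0 (displaced_flow h) t) z =
  \row_i 'D_((0, stretch w h (delta_mx ord0 i) (t, z))) (spacetime f) (t, g (t, z)).
Proof.
move=> tr [N [oN NC sN]] tT Oz; apply/rowP => i; rewrite !mxE /partial.
rewrite (@near_derive_eq _ _ _ _ (fun z => spacetime f (t, g (t, z)))); last first.
  by apply: (open_near oO) => // z' Oz'; rewrite (push_displaced tr).
apply: (derive_comp_undisplaced displacement_smooth LP) => //.
apply: (smooth_on_differentiable sN); apply: NC; split => //=.
by apply: subset_closure; exact: undisplaced_Omega.
Qed.

End Small.

Lemma eulerian_flow W (f : R -> V -> W) t z : 0 <= t <= T -> Omega z ->
  eulerian Omega x f t z = f t (Y t z).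
Proof.
move=> tT Oz; rewrite /eulerian; have [_ inj _] := inverse_flows_bij xY tT.
rewrite -[in LHS](inverse_rl xY tT Oz) (pinvKV (fun=> 0) inj)// inE.
exact: (inverse_funr xY).
Qed.

Lemma eulerian_variation t z : 0 < t < T -> Omega z -> eulerian Omega x dx t z = w (t, z).
Proof.
move=> /andP[t0 tT] Oz; rewrite eulerian_flow ?(ltW t0) ?ltW//.
rewrite /displacement /transplant; case: asboolP => //= -[].
by split => //; apply/andP.
Qed.

Lemma volume_integral_force (f : R -> V -> V) :
  volume_integral T O x (fun t y => dot (f t y) (eulerian Omega x dx t y)) =
  spacetime_integral (zero_extend Q (fun p => dot (spacetime f p) (w p))).
Proof.
have dot0 (a : V) : dot a 0 = 0 by rewrite /dot big1// => i _; rewrite mxE mulr0.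
apply: volume_integralE => [t z tT zO|t z].
  have Oz : Omega z by case: zO => X OX <-; apply: (inverse_funl xY) => //; exact: OO.
  rewrite /zero_extend; case: asboolP => [[tT' _]|nQ]; first by rewrite eulerian_variation.
  rewrite eulerian_flow// -(displacementE tT (inverse_funr xY tT Oz)) (inverse_rl xY)//.
  by rewrite displacement_off ?dot0// => /displacement_supportQ.
rewrite /zero_extend; case: asboolP; last by rewrite eqxx.
move=> Qp; have [Kp _|nK] := pselect (K (t, z)); last first.
  by rewrite displacement_off// dot0 eqxx.
split; first by apply: (@cylinder_le R d Omega T t z).
exact: (displacement_support_volume Kp).
Qed.

End DisplacedFlow.

(** * Local test functions and thermodynamic fields *)

Section LocalTestFunctions.
Context {R : realType} {d : nat}.
Notation V := 'rV[R]_d.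
Notation E := (R * 'rV[R]_d)%type.
Variables (Q K : set E).
Hypotheses (oQ : open Q) (cK : compact K) (KQ : K `<=` Q).

(** Fields such as forces are smooth in the open set [Q] only, and nothing is
    known of them near its boundary. Multiplied by a field supported in the
    compact [K] they become test functions, once extended by zero. *)
Definition local_test (f : E -> R) : Prop :=
  smooth_on Q f /\ forall p, Q p -> ~ K p -> f p = 0.

Definition local_integral (f : E -> R) : R := spacetime_integral (zero_extend Q f).

Lemma local_test_fun f : local_test f -> test_fun (zero_extend Q f).
Proof.
move=> [sf f0]; apply: (test_fun_zero_extend oQ cK KQ) => // p Qp.
exact: smooth_on_continuous Qp.
Qed.

Lemma local_testD f g : local_test f -> local_test g -> local_test (fun p => f p + g p).
Proof.
move=> [sf f0] [sg g0]; split; first exact: smooth_add.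
by move=> p Qp nK; rewrite f0// g0// addr0.
Qed.

Lemma local_testM (f g : E -> R) : smooth_on Q f -> local_test g -> local_test (fun p => f p * g p).
Proof.
move=> sf [sg g0]; split; first exact: smooth_mul.
by move=> p Qp nK; rewrite g0// mulr0.
Qed.

Lemma local_test_sum (I : Type) (s : seq I) (f : I -> E -> R) : (forall i, local_test (f i)) ->
  local_test (fun p => \sum_(i <- s) f i p).
Proof.
move=> tf; split; first by apply: smooth_sum => // i; case: (tf i).
by move=> p Qp nK; rewrite big1// => i _; case: (tf i) => _; apply.
Qed.

Lemma local_test_derive f v : local_test f -> local_test ('D_v f).
Proof.
move=> [sf f0]; split; first exact: smooth_on_derive.
by move=> p Qp nK; exact: (derive_off oQ cK v f0).
Qed.

Lemma eq_local_integral f g : (forall p, Q p -> f p = g p) ->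
  local_integral f = local_integral g.
Proof.
move=> fg; apply: eq_spacetime_integral => p; rewrite /zero_extend.
by case: asboolP => // /fg.
Qed.

Lemma local_integralD f g : local_test f -> local_test g ->
  local_integral (fun p => f p + g p) = local_integral f + local_integral g.
Proof.
move=> tf tg; rewrite /local_integral -spacetime_integralD; try exact: local_test_fun.
apply: eq_spacetime_integral => p; rewrite /zero_extend.
by case: asboolP => // _; rewrite addr0.
Qed.

Lemma local_integralZ k f : local_test f ->
  local_integral (fun p => k * f p) = k * local_integral f.
Proof.
move=> tf; rewrite /local_integral -spacetime_integralZ; last exact: local_test_fun.
apply: eq_spacetime_integral => p; rewrite /zero_extend.
by case: asboolP => // _; rewrite mulr0.
Qed.

Lemma local_integral0 : local_integral (fun=> 0) = 0.
Proof.
rewrite -[RHS](@spacetime_integral0 R d); apply: eq_spacetime_integral => p.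
by rewrite /zero_extend; case: asboolP.
Qed.

Lemma local_integral_sum (I : Type) (s : seq I) (f : I -> E -> R) :
  (forall i, local_test (f i)) ->
  local_integral (fun p => \sum_(i <- s) f i p) = \sum_(i <- s) local_integral (f i).
Proof.
move=> tf; elim: s => [|i s IH].
  rewrite big_nil -[RHS]local_integral0; apply: eq_local_integral => p _; exact: big_nil.
rewrite big_cons -IH -(local_integralD (tf i) (local_test_sum s tf)).
by apply: eq_local_integral => p _; exact: big_cons.
Qed.

Lemma local_integral_parts (f g : E -> R) v : coordinate_direction v ->
  smooth_on Q f -> local_test g ->
  local_integral (fun p => f p * 'D_v g p) = - local_integral (fun p => 'D_v f p * g p).
Proof. by move=> vE sf [sg g0]; exact: (integration_by_parts_spacetime oQ cK KQ vE sf sg g0). Qed.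

End LocalTestFunctions.

Section PartialDerivatives.
Context {R : realType} {d : nat}.
Notation V := 'rV[R]_d.
Notation E := (R * 'rV[R]_d)%type.

Lemma grad_spacetime (f : R -> V -> R) t z :
  grad (f t) z = \row_i 'D_((0, delta_mx ord0 i)) (spacetime f) (t, z).
Proof.
apply/rowP => i; rewrite !mxE /partial.
by rewrite -(derive_slice2 (spacetime f) t z _).1.
Qed.

Lemma dt_spacetime (W : normedModType R) (f : R -> V -> W) t z :
  dt f t z = 'D_((1, 0)) (spacetime f) (t, z).
Proof.
rewrite /dt derive1E.
by rewrite -(derive_slice1 (spacetime f) t z _).1.
Qed.

Lemma spatial_derive_dot (f : R -> V -> R) t z k : differentiable (spacetime f) (t, z) ->
  'D_((0, k)) (spacetime f) (t, z) = dot k (grad (f t) z).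
Proof.
move=> df; rewrite (derive_basis df (spatial_basis k)) /dot.
by apply: eq_bigr => i _; rewrite grad_spacetime mxE.
Qed.

Lemma dotC (a b : V) : dot a b = dot b a.
Proof. by apply: eq_bigr => i _; rewrite mulrC. Qed.

Lemma dotDl (a b c : V) : dot (a + b) c = dot a c + dot b c.
Proof. by rewrite /dot -big_split; apply: eq_bigr => i _; rewrite mxE mulrDl. Qed.

Lemma dotZl k (a c : V) : dot (k *: a) c = k * dot a c.
Proof. by rewrite /dot mulr_sumr; apply: eq_bigr => i _; rewrite mxE mulrA. Qed.

Lemma dotNl (a c : V) : dot (- a) c = - dot a c.
Proof. by rewrite -scaleN1r dotZl mulN1r. Qed.

Lemma dot0l (c : V) : dot 0 c = 0.
Proof. by rewrite -(scale0r 0) dotZl mul0r. Qed.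

Lemma dotDr (a b c : V) : dot c (a + b) = dot c a + dot c b.
Proof. by rewrite !(dotC c) dotDl. Qed.

Lemma dotZr k (a c : V) : dot c (k *: a) = k * dot c a.
Proof. by rewrite !(dotC c) dotZl. Qed.

Lemma smooth_dot (X : normedModType R) (U : set X) (f g : X -> V) : open U ->
  smooth_on U f -> smooth_on U g -> smooth_on U (fun p => dot (f p) (g p)).
Proof.
move=> oU sf sg; apply: smooth_sum => // i.
by apply: smooth_mul => //; exact: smooth_coord.
Qed.

Lemma smooth_grad (Q : set E) (f : R -> V -> R) : open Q -> smooth_on Q (spacetime f) ->
  smooth_on Q (spacetime (fun t => grad (f t))).
Proof.
move=> oQ sf; apply: smooth_row => // i.
apply: (smooth_on_ext oQ _ (smooth_on_derive (0, delta_mx ord0 i) sf)) => -[t z] _.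
by rewrite /spacetime/= grad_spacetime mxE.
Qed.

Lemma smooth_scale_field (X : normedModType R) (U : set X) (k : X -> R) (f : X -> V) :
  open U -> smooth_on U k -> smooth_on U f -> smooth_on U (fun p => k p *: f p).
Proof.
move=> oU sk sf; apply: smooth_row => // i.
apply: (smooth_on_ext oU _ (smooth_mul oU sk (smooth_coord i oU sf))) => p _.
by rewrite mxE.
Qed.

End PartialDerivatives.

Section ThermodynamicFields.
Context {R : realType} {d : nat}.
Notation V := 'rV[R]_d.
Notation E := (R * 'rV[R]_d)%type.
Variable psi : R -> V -> R -> R.
Let psi' (q : R * V * R) := psi q.1.1 q.1.2 q.2.
Let U := [set q : R * V * R | 0 < q.2].
Hypothesis smooth_psi : smooth_on U psi'.

Lemma open_positive_temperature : open U.
Proof.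
have : open ((fun q : R * V * R => q.2) @^-1` [set y : R | 0 < y]).
  by apply: open_comp; [move=> q _; exact: continuous_snd|exact: open_gt].
by [].
Qed.

Lemma psi_phiE a p th : psi_phi psi a p th = 'D_(((1, 0), 0)) psi' (a, p, th).
Proof.
rewrite /psi_phi derive1E.
rewrite (derive_slice1 (fun q : R * V => psi' (q, th)) a p _).1.
by rewrite (derive_slice1 psi' (a, p) th _).1.
Qed.

Lemma psi_gradE a p th i :
  psi_grad psi a p th ord0 i = 'D_(((0, delta_mx ord0 i), 0)) psi' (a, p, th).
Proof.
rewrite /psi_grad mxE /partial.
rewrite (derive_slice2 (fun q : R * V => psi' (q, th)) a p _).1.
by rewrite (derive_slice1 psi' (a, p) th _).1.
Qed.

Lemma psi_thetaE a p th : psi_theta psi a p th = 'D_(((0, 0), 1)) psi' (a, p, th).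
Proof.
rewrite /psi_theta derive1E.
by rewrite (derive_slice2 psi' (a, p) th _).1.
Qed.

Lemma derive_psi (q : R * V * R) al be ga : U q ->
  'D_((al, be, ga)) psi' q =
  al * psi_phi psi q.1.1 q.1.2 q.2 + dot be (psi_grad psi q.1.1 q.1.2 q.2) +
  ga * psi_theta psi q.1.1 q.1.2 q.2.
Proof.
move=> Uq; have df := smooth_on_differentiable smooth_psi Uq.
have addE (a a' : R) (b b' : V) (c c' : R) :
  ((a, b, c) : R * V * R) + (a', b', c') = (a + a', b + b', c + c') by [].
have scE k (a : R) (b : V) (c : R) :
  k *: ((a, b, c) : R * V * R) = (k * a, k *: b, k * c) by [].
have -> : (al, be, ga) = (al *: (((1, 0), 0) : R * V * R) +
   \sum_i be ord0 i *: (((0, delta_mx ord0 i), 0) : R * V * R)) + ga *: (((0, 0), 1) : R * V * R).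
  have -> : \sum_i be ord0 i *: (((0, delta_mx ord0 i), 0) : R * V * R) = ((0, be), 0).
    transitivity (((0, \sum_i be ord0 i *: (delta_mx ord0 i : V)), 0) : R * V * R); last first.
      by rewrite -rV_sum_delta.
    elim/big_rec2: _ => // i y1 y2 _ ->.
    by rewrite scE addE mulr0 addr0.
  by rewrite !scE !addE !scaler0 !mulr0 !mulr1 !addr0 !add0r.
case: q Uq df => [[a p] th] Uq df /=.
rewrite !(derive_addv _ _ df) !(derive_scalev _ _ df) psi_phiE psi_thetaE.
congr (_ + _ + _).
rewrite (deriveE _ df) linear_sum /dot; apply: eq_bigr => i _.
by rewrite linearZ/= psi_gradE (deriveE _ df).
Qed.

Variables phi theta : R -> V -> R.

(** As one smooth map into the arguments of the free energy density, so that
    all its partial derivatives are composites of smooth maps. *)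
Definition thermo_state (p : E) : R * V * R :=
  (spacetime phi p, grad (phi p.1) p.2, spacetime theta p).

Variable N : set E.
Hypotheses (oN : open N) (sphi : smooth_on N (spacetime phi))
  (stheta : smooth_on N (spacetime theta)) (th0 : forall p, N p -> 0 < spacetime theta p).

Lemma thermo_state_smooth : smooth_on N thermo_state.
Proof.
apply: smooth_pair => //; apply: smooth_pair => //.
exact: smooth_grad.
Qed.

Lemma thermo_state_positive p : N p -> U (thermo_state p).
Proof. exact: th0. Qed.

Lemma finite_basis_state : finite_basis (R * V * R)%type.
Proof.
apply: finite_basis_prod; last exact: finite_basisR.
exact: finite_basis_prod finite_basisR (finite_basis_rV d).
Qed.

Lemma smooth_of_state (f : R * V * R -> R) : smooth_on U f ->
  smooth_on N (fun p => f (thermo_state p)).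
Proof.
move=> sf; apply: (smooth_comp finite_basis_state oN open_positive_temperature) => //.
exact: thermo_state_smooth.
Qed.

Lemma smooth_psi_phi : smooth_on N (fun p => psi_phi psi (spacetime phi p)
  (grad (phi p.1) p.2) (spacetime theta p)).
Proof.
apply: (smooth_on_ext oN _ (smooth_of_state (smooth_on_derive (((1, 0), 0) : R * V * R) smooth_psi))) => p _.
by rewrite psi_phiE.
Qed.

Lemma smooth_psi_theta : smooth_on N (fun p => psi_theta psi (spacetime phi p)
  (grad (phi p.1) p.2) (spacetime theta p)).
Proof.
apply: (smooth_on_ext oN _ (smooth_of_state (smooth_on_derive (((0, 0), 1) : R * V * R) smooth_psi))) => p _.
by rewrite psi_thetaE.
Qed.

Lemma smooth_psi_grad i : smooth_on N (fun p => psi_grad psi (spacetime phi p)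
  (grad (phi p.1) p.2) (spacetime theta p) ord0 i).
Proof.
apply: (smooth_on_ext oN _ (smooth_of_state (smooth_on_derive (((0, delta_mx ord0 i), 0)) smooth_psi))) => p _.
by rewrite psi_gradE.
Qed.

Lemma chemical_potentialE t z : chemical_potential psi phi theta t z =
  \sum_i 'D_((0, delta_mx ord0 i)) (fun p : E => psi_grad psi (spacetime phi p)
     (grad (phi p.1) p.2) (spacetime theta p) ord0 i) (t, z)
  - psi_phi psi (phi t z) (grad (phi t) z) (theta t z).
Proof.
apply: (congr1 (fun a => a - psi_phi psi (phi t z) (grad (phi t) z) (theta t z))).
apply: eq_bigr => i _.
exact: (derive_slice2 (fun p : E => psi_grad psi (spacetime phi p)
     (grad (phi p.1) p.2) (spacetime theta p) ord0 i) t z _).1.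
Qed.

Lemma smooth_chemical_potential : smooth_on N (spacetime (chemical_potential psi phi theta)).
Proof.
have s := smooth_sub oN (smooth_sum (index_enum 'I_d) xpredT oN
  (fun i => smooth_on_derive (0, delta_mx ord0 i) (smooth_psi_grad i))) smooth_psi_phi.
apply: (smooth_on_ext oN _ s) => -[t z] _.
by rewrite [RHS]chemical_potentialE.
Qed.

Lemma smooth_entropy : smooth_on N (spacetime (entropy psi phi theta)).
Proof. exact: (smooth_opp oN smooth_psi_theta). Qed.

End ThermodynamicFields.

(** * Variation of transported quantities *)

Section ConservativeForce.
Context {R : realType} {d : nat}.
Notation V := 'rV[R]_d.
Notation E := (R * 'rV[R]_d)%type.
Variables (Omega : set V) (T : R) (x Y : R -> V -> V) (O : set V) (dx : R -> V -> V).
Hypotheses (oO : open Omega) (xY : inverse_flows Omega T x Y)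
  (iO : initial_volume Omega O) (vdx : Defs.variation T O dx).

Let Q := cylinder Omega T.
Notation w := (displacement Omega T Y dx).
Notation K := (displacement_support x dx).

Let oQ : open Q. Proof. exact: open_cylinder. Qed.
Let sw : smooth_on setT w. Proof. exact: (displacement_smooth oO xY iO vdx). Qed.
Let cK : compact K. Proof. exact: (displacement_compact xY iO vdx). Qed.
Let KQ : K `<=` Q. Proof. exact: (displacement_supportQ xY iO vdx). Qed.
Let w0 p : ~ K p -> w p = 0. Proof. exact: (displacement_off xY). Qed.

Lemma derive_affine (X W : normedModType R) (g : X -> W) v l c :
  (forall h : R, g (h *: l + v) = g v + h *: c) -> 'D_l g v = c.
Proof.
move=> H; rewrite /derive; apply: lim_near_cst; first exact: norm_hausdorff.
near=> h; have h0 : h != 0 by near: h; exact: nbhs_dnbhs_neq.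
by rewrite /= H addrAC subrr add0r scalerA mulVf// scale1r.
Unshelve. all: by end_near. Qed.

Lemma smooth_w U : smooth_on U w.
Proof. by apply: smooth_onS sw. Qed.

Lemma local_test_along (f : E -> R) : smooth_on Q f ->
  local_test Q K (fun p => 'D_((0, w p)) f p).
Proof.
move=> sf; split.
  have s : smooth_on Q (fun p => \sum_i w p ord0 i * 'D_((0, delta_mx ord0 i)) f p).
    apply: smooth_sum => // i; apply: smooth_mul => //; last exact: smooth_on_derive.
    by apply: smooth_coord => //; exact: smooth_w.
  apply: (smooth_on_ext oQ _ s) => p Qp.
  by rewrite (derive_basis (smooth_on_differentiable sf Qp) (spatial_basis (w p))).
by move=> p Qp nK; rewrite w0// -[(0, 0)]/(0 : E) derive0.
Qed.

(** By Schwarz's theorem, spatial derivatives pass under ['D_((0, w p))] up to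
    the derivative of the direction. *)
Lemma derive_along (f : E -> R) i p : smooth_on Q f -> Q p ->
  'D_((0, delta_mx ord0 i)) (fun p => 'D_((0, w p)) f p) p =
  'D_((0, 'D_((0, delta_mx ord0 i)) w p)) f p +
  'D_((0, w p)) ('D_((0, delta_mx ord0 i)) f) p.
Proof.
move=> sf Qp.
pose D j := 'D_((0, delta_mx ord0 j)) f.
have sD j : smooth_on Q (D j) by exact: smooth_on_derive.
have df q (Qq : Q q) := smooth_on_differentiable sf Qq.
transitivity ('D_((0, delta_mx ord0 i)) (\sum_j (fun q => w q ord0 j) * D j) p).
  apply: near_derive_eq; apply: (open_near oQ _ Qp) => q Qq.
  by rewrite (derive_basis (df q Qq) (spatial_basis (w q))) fct_sumE.
have dwj j : derivable (fun q => w q ord0 j) p (0, delta_mx ord0 i).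
  apply: diff_derivable; apply: (smooth_on_differentiable _ Qp).
  by apply: smooth_coord => //; exact: smooth_w.
have dDj j : derivable (D j) p (0, delta_mx ord0 i).
  by apply: diff_derivable; exact: (smooth_on_differentiable (sD j) Qp).
rewrite derive_sum => [|j]; last exact: derivableM.
rewrite (derive_basis (df p Qp) (spatial_basis ('D_((0, delta_mx ord0 i)) w p))).
have dDi := smooth_on_differentiable (sD i) Qp.
rewrite (derive_basis dDi (spatial_basis (w p))) -big_split.
apply: eq_bigr => j _; rewrite (deriveM (dwj j) (dDj j)).
have [_ cE] := derive_coord (0, delta_mx ord0 i) j (smooth_on_differentiable sw (I : setT p)).
rewrite cE addrC.
have comm : 'D_((0, delta_mx ord0 i)) (D j) p = 'D_((0, delta_mx ord0 j)) (D i) p.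
  exact: (derive_commute _ _ oQ sf Qp).
exact: (congr2 +%R (mulrC (D j p) _) (congr1 (fun c => w p ord0 j *: c) comm)).
Qed.

Lemma flow_constant_w : exists L, flow_constant w L.
Proof. exact: (flow_constant_exists sw cK w0). Qed.

Lemma small_parameter (L : R) : 0 <= L ->
  exists2 h0 : R, 0 < h0 & forall h, `|h| <= h0 -> small L h.
Proof.
move=> L0; exists (2 * (L + 1))^-1; first by rewrite invr_gt0 mulr_gt0// ltr_pwDr.
move=> h hh; rewrite /small (le_trans (ler_wpM2r L0 hh))//.
rewrite invfM -mulrA -[leRHS]mulr1 ler_wpM2l// mulrC ler_pdivrMr ?ltr_pwDr//.
by rewrite mul1r lerDl.
Qed.

Lemma undisplaced0 L p : flow_constant w L -> undisplaced w 0 p = p.2.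
Proof.
move=> LP; have s0 : small L 0 by rewrite /small normr0 mul0r.
by rewrite (undisplacedE LP p s0) scale0r subr0.
Qed.

Lemma stretch0 L v p : flow_constant w L -> stretch w 0 v p = v.
Proof.
move=> LP; have s0 : small L 0 by rewrite /small normr0 mul0r.
by rewrite (stretchE sw LP v p s0) scale0r subr0.
Qed.

Lemma varied_undisplaced : varied Q K (fun h => undisplaced w h) (fun p => - w p).
Proof.
have [L LP] := flow_constant_w; have [L0 _ _ _ _] := LP.
have [h0 h00 sm] := small_parameter L0.
split.
- by move=> p _; apply: cvgN; exact: (smooth_on_continuous sw).
- by move=> p _ nK; rewrite w0// oppr0.
- exists h0, (L * L); split; first exact: h00.
  move=> h /sm sh p Qp; split.
  + exact: (undisplaced_continuous sw LP sh).
  + by move=> nK; rewrite (undisplaced_off w0 LP)// (undisplaced0 p LP).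
  + by rewrite (undisplaced0 p LP); exact: (undisplaced_taylor LP).
Qed.

Lemma varied_stretch v : varied Q K (fun h => stretch w h v) (fun p => - 'D_((0, v)) w p).
Proof.
have [L LP] := flow_constant_w; have [L0 _ _ _ _] := LP.
have [h0 h00 sm] := small_parameter L0.
split.
- by move=> p _; apply: cvgN; exact: (spatial_derive_continuous sw).
- by move=> p _ nK; rewrite (spatial_derive_off cK w0)// oppr0.
- exists h0, (3 * L * L * `|v|); split; first exact: h00.
  move=> h /sm sh p Qp; split.
  + by have c := stretch_continuous sw LP (v := v) sh; exact: (c p).
  + by move=> nK; rewrite (stretch_off sw cK w0 LP v sh nK) (stretch0 _ _ LP).
  + by rewrite (stretch0 _ _ LP); exact: (stretch_taylor sw LP v p sh).
Qed.

Lemma varied_position : varied Q K (fun h p => (p.1, undisplaced w h p)) (fun p => (0, - w p)).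
Proof.
have vf : varied Q K (fun _ (p : E) => p.1) (fun=> 0).
  by apply: varied_cst => p _; exact: continuous_fst.
exact: (varied_pair vf varied_undisplaced).
Qed.

Lemma position0 (p : E) : (p.1, undisplaced w 0 p) = p.
Proof. by have [L LP] := flow_constant_w; rewrite (undisplaced0 p LP) -surjective_pairing. Qed.

Lemma position0_continuous (p : E) :
  {for p, continuous (fun p : E => (p.1, undisplaced w 0 p))}.
Proof.
rewrite (_ : (fun p : E => _) = id); first exact: cvg_id.
by apply/funext => q; exact: position0.
Qed.

Lemma derive_spatial_opp (f : E -> R) p (k : V) : differentiable f p ->
  'D_((0, - k)) f p = - 'D_((0, k)) f p.
Proof.
move=> df; have -> : (0, - k) = (-1) *: ((0, k) : E).
  by rewrite -[RHS]/(_ *: 0, _ *: _) scaler0 scaleN1r.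
by rewrite (derive_scalev _ _ df) mulN1r.
Qed.

Lemma varied_transported (f : E -> R) : smooth_on Q f ->
  varied Q K (fun h p => f (p.1, undisplaced w h p)) (fun p => - 'D_((0, w p)) f p).
Proof.
move=> sf.
have Q0 (p : E) : Q p -> Q (p.1, undisplaced w 0 p) by rewrite position0.
have c0 (p : E) : Q p -> {for p, continuous (fun p : E => (p.1, undisplaced w 0 p))}.
  by move=> _; exact: position0_continuous.
have := varied_comp cK KQ finite_basisE oQ sf c0 Q0 varied_position.
apply: (varied_eq oQ) => [h p _|p Qp]; first by [].
rewrite position0.
exact: (derive_spatial_opp _ (smooth_on_differentiable sf Qp)).
Qed.

(** Smooth in the point and the direction taken together, so that both can be
    varied at once. *)
Definition directional (f : E -> R) (q : E * V) : R :=
  \sum_j q.2 ord0 j * 'D_((0, delta_mx ord0 j)) f q.1.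

Let oU : open [set q : E * V | Q q.1].
Proof.
have : open ((fun q : E * V => q.1) @^-1` Q).
  by apply: open_comp => // q _; exact: continuous_fst.
by [].
Qed.

Lemma directionalE (f : E -> R) q : smooth_on Q f -> Q q.1 ->
  directional f q = 'D_((0, q.2)) f q.1.
Proof.
by move=> sf Qq; rewrite (derive_basis (smooth_on_differentiable sf Qq) (spatial_basis q.2)).
Qed.

Lemma smooth_directional (f : E -> R) : smooth_on Q f ->
  smooth_on [set q : E * V | Q q.1] (directional f).
Proof.
move=> sf; apply: (smooth_sum _ _ oU) => j; apply: (smooth_mul oU).
  apply: (smooth_coord _ oU).
  by apply: (@smooth_linear _ _ _ _ snd oU) => q; exact: continuous_snd.
apply: (@smooth_comp R (E * V)%type E _ Q ('D_((0, delta_mx ord0 j)) f) fst finite_basisE oU oQ).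
- by [].
- exact: smooth_on_derive.
- by apply: (@smooth_linear _ _ _ _ fst oU) => q; exact: continuous_fst.
Qed.

Lemma derive_directional (f : E -> R) p v k l : smooth_on Q f -> Q p ->
  'D_((k, l)) (directional f) (p, v) =
  'D_k ('D_((0, v)) f) p + 'D_((0, l)) f p.
Proof.
move=> sf Qp; pose F := directional f.
have FE q : Q q.1 -> F q = 'D_((0, q.2)) f q.1 by exact: directionalE.
have Up : [set q : E * V | Q q.1] (p, v) by [].
have dF : differentiable (directional f) (p, v).
  exact: (smooth_on_differentiable (smooth_directional sf) Up).
have -> : (k, l) = ((k, 0) : E * V) + (0, l).
  have addE (a a' : E) (b b' : V) : ((a, b) : E * V) + (a', b') = (a + a', b + b') by [].
  by rewrite addE addr0 add0r.
have nF : \near p, F (p, v) = 'D_((0, v)) f p.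
  apply: (@open_near _ _ Q (fun q => F (q, v) = 'D_((0, v)) f q) oQ _ p Qp) => q Qq.
  exact: (FE (q, v) Qq).
rewrite (derive_addv _ _ dF) -(derive_slice1 F p v k).1 (near_derive_eq k nF).
apply: (congr1 (fun c => _ + c)).
rewrite -(derive_slice2 F p v l).1; apply: derive_affine => h.
have df := smooth_on_differentiable sf Qp.
rewrite (FE (p, h *: l + v) Qp) (FE (p, v) Qp) /=.
have -> : (0, h *: l + v) = h *: ((0, l) : E) + (0, v).
  by rewrite -[RHS]/(h *: 0 + 0, h *: l + v) scaler0 addr0.
by rewrite (derive_addv _ _ df) (derive_scalev _ _ df) addrC.
Qed.

(** The gradient of a transported quantity varies through the point where it
    is taken and through the stretched direction. By [derive_along] the two
    contributions add up to the gradient of the variation of the quantity. *)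
Lemma varied_transported_grad (f : E -> R) i : smooth_on Q f ->
  varied Q K (fun h p => 'D_((0, stretch w h (delta_mx ord0 i) p)) f (p.1, undisplaced w h p))
    (fun p => - 'D_((0, delta_mx ord0 i)) (fun p => 'D_((0, w p)) f p) p).
Proof.
move=> sf.
have sF := smooth_directional sf.
have [L LP] := flow_constant_w.
have [L0 _ _ _ _] := LP; have [h0 h00 sm] := small_parameter L0.
have va := varied_pair varied_position (varied_stretch (delta_mx ord0 i)).
have a0E (p : E) : ((p.1, undisplaced w 0 p), stretch w 0 (delta_mx ord0 i) p) = (p, delta_mx ord0 i).
  by rewrite position0 (stretch0 _ _ LP).
have ca0 (p : E) : Q p -> {for p, continuous (fun p : E => ((p.1, undisplaced w 0 p), stretch w 0 (delta_mx ord0 i) p))}.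
  move=> _; rewrite (_ : (fun p : E => _) = (fun p => (p, delta_mx ord0 i))).
    by apply: continuous_pairing; [exact: cvg_id|exact: continuous_const].
  by apply/funext => q; exact: a0E.
have Q0 p : Q p -> [set q : E * V | Q q.1] ((p.1, undisplaced w 0 p), stretch w 0 (delta_mx ord0 i) p).
  by rewrite a0E.
have vF := varied_comp cK KQ (finite_basis_prod finite_basisE (finite_basis_rV d)) oU sF ca0 Q0 va.
split.
- have sA := smooth_on_derive (0, delta_mx ord0 i) (local_test_along sf).1.
  by move=> p Qp; apply: cvgN; exact: (smooth_on_continuous sA Qp).
- move=> p Qp nK; rewrite (derive_off oQ cK) ?oppr0//.
  exact: (local_test_along sf).2.
- have [_ _ [h2 [M2 [h20 H2]]]] := vF.
  exists (Num.min h0 h2), M2; split; first by rewrite lt_min h00.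
  have FE h (p : E) : `|h| <= h0 -> Q p -> directional f ((p.1, undisplaced w h p), stretch w h (delta_mx ord0 i) p) =
      'D_((0, stretch w h (delta_mx ord0 i) p)) f (p.1, undisplaced w h p).
    move=> /sm sh Qp.
    have Qg : Q (p.1, undisplaced w h p).
      case: p Qp => t z [/= tT Oz]; split => //=.
      exact: (undisplaced_Omega xY iO vdx LP sh).
    by rewrite (derive_basis (smooth_on_differentiable sf Qg) (spatial_basis _)).
  move=> h; rewrite le_min => /andP[hh0 hh2] p Qp.
  have n0 : `|0 : R| <= h0 by rewrite normr0 ltW.
  have [c e t] := H2 h hh2 p Qp; split.
  + exact: (continuous_for_ext oQ (fun q Qq => FE h q hh0 Qq) Qp c).
  + by move=> nK; exact: (etrans (esym (FE h p hh0 Qp)) (etrans (e nK) (FE 0 p n0 Qp))).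
  + have DE : 'D_((0, - w p, - 'D_((0, delta_mx ord0 i)) w p)) (directional f)
       ((p.1, undisplaced w 0 p), stretch w 0 (delta_mx ord0 i) p) =
       - 'D_((0, delta_mx ord0 i)) (fun p => 'D_((0, w p)) f p) p.
      apply: (etrans (congr1 (fun q => 'D_((0, - w p, - 'D_((0, delta_mx ord0 i)) w p)) (directional f) q) (a0E p))).
      apply: (etrans (derive_directional _ _ _ sf Qp)).
      apply: (etrans _ (esym (congr1 -%R (derive_along i sf Qp)))).
      have e1 := derive_spatial_opp (w p)
        (smooth_on_differentiable (smooth_on_derive (0, delta_mx ord0 i) sf) Qp).
      have e2 := derive_spatial_opp ('D_((0, delta_mx ord0 i)) w p) (smooth_on_differentiable sf Qp).
      exact: (etrans (congr2 +%R e1 e2) (etrans (addrC _ _) (esym (opprD _ _)))).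
    have eqs := congr2 (fun a b => a - b)
      (congr2 (fun a b => a - b) (FE h p hh0 Qp) (FE 0 p n0 Qp)) (congr1 ( *:%R h) DE).
    by rewrite eqs in t.
Qed.

End ConservativeForce.

(** * First variation of the free energy *)

Section ConservativeFirstVariation.
Context {R : realType} {d : nat}.
Notation V := 'rV[R]_d.
Notation E := (R * 'rV[R]_d)%type.
Variables (Omega : set V) (T : R) (x Y : R -> V -> V) (O : set V) (dx : R -> V -> V).
Hypotheses (oO : open Omega) (xY : inverse_flows Omega T x Y)
  (iO : initial_volume Omega O) (vdx : Defs.variation T O dx).

Let Q := cylinder Omega T.
Notation w := (displacement Omega T Y dx).
Notation K := (displacement_support x dx).

Let oQ : open Q. Proof. exact: open_cylinder. Qed.
Let sw : smooth_on setT w. Proof. exact: (displacement_smooth oO xY iO vdx). Qed.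
Let cK : compact K. Proof. exact: (displacement_compact xY iO vdx). Qed.
Let KQ : K `<=` Q. Proof. exact: (displacement_supportQ xY iO vdx). Qed.
Let w0 p : ~ K p -> w p = 0. Proof. exact: (displacement_off xY). Qed.

Lemma varied_if (W : normedModType R) (b : bool) (a1 a2 : R -> E -> W) a1' a2' :
  (b -> varied Q K a1 a1') -> varied Q K a2 a2' ->
  varied Q K (fun h p => if b then a1 h p else a2 h p)
    (fun p => if b then a1' p else a2' p).
Proof. by case: b => [/(_ isT)|]. Qed.

Variable psi : R -> V -> R -> R.
Let psi' (q : R * V * R) := psi q.1.1 q.1.2 q.2.
Hypothesis smooth_psi : smooth_on [set q : R * V * R | 0 < q.2] psi'.
Variables (phi theta : R -> V -> R).
Variable N : set E.
Hypotheses (oN : open N) (NC : closed_cylinder Omega T `<=` N)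
  (sphi : smooth_on N (spacetime phi)) (stheta : smooth_on N (spacetime theta))
  (th0 : forall p, N p -> 0 < spacetime theta p).
(* [mp] and [mt] tell whether the phase and the temperature are carried along by
   the variations of the flow map; the conservative forces of all the cases are
   instances. *)
Variables (mp mt : bool) (phi0 theta0 : V -> R).
Hypotheses (trp : mp -> transported Omega T x phi0 phi)
  (trt : mt -> transported Omega T x theta0 theta).

Let QN : Q `<=` N. Proof. by move=> p /cylinder_closed/NC. Qed.
Let sphiQ : smooth_on Q (spacetime phi). Proof. exact: smooth_onS QN sphi. Qed.
Let sthetaQ : smooth_on Q (spacetime theta). Proof. exact: smooth_onS QN stheta. Qed.
Let th0Q p : Q p -> 0 < spacetime theta p. Proof. by move=> /QN/th0. Qed.

Definition transported_phase := if mp then push Omega phi0 else fun _ => phi.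
Definition transported_temperature := if mt then push Omega theta0 else fun _ => theta.

Definition conservative_density (t : R) (y : V) : V :=
  mp%:R *: (chemical_potential psi phi theta t y *: grad (phi t) y) +
  mt%:R *: (entropy psi phi theta t y *: grad (theta t) y).

Let slope h (p : E) : V :=
  \row_i (if mp then 'D_((0, stretch w h (delta_mx ord0 i) p)) (spacetime phi) (p.1, undisplaced w h p)
           else 'D_((0, delta_mx ord0 i)) (spacetime phi) p).

Let state h (p : E) : R * V * R :=
  (if mp then spacetime phi (p.1, undisplaced w h p) else spacetime phi p,
   slope h p,
   if mt then spacetime theta (p.1, undisplaced w h p) else spacetime theta p).

Let Wphi (p : E) := 'D_((0, w p)) (spacetime phi) p.
Let Wtheta (p : E) := 'D_((0, w p)) (spacetime theta) p.

Let state' (p : E) : R * V * R :=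
  (if mp then - Wphi p else 0,
   \row_i (if mp then - 'D_((0, delta_mx ord0 i)) Wphi p else 0),
   if mt then - Wtheta p else 0).

Let varied_state : varied Q K state state'.
Proof.
have cont (f : E -> R) : smooth_on Q f -> forall p, Q p -> {for p, continuous f}.
  by move=> sf p; exact: smooth_on_continuous.
apply: varied_pair.
  apply: varied_pair.
    apply: varied_if => [_|]; first exact: (varied_transported oO xY iO vdx).
    by apply: varied_cst; exact: cont.
  apply: varied_row => i.
  pose A h (p : E) := if mp then 'D_((0, stretch w h (delta_mx ord0 i) p)) (spacetime phi) (p.1, undisplaced w h p)
           else 'D_((0, delta_mx ord0 i)) (spacetime phi) p.
  pose A' (p : E) := if mp then - 'D_((0, delta_mx ord0 i)) Wphi p else 0.
  have : varied Q K A A'.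
    apply: varied_if => [_|]; first exact: (varied_transported_grad oO xY iO vdx).
    by apply: varied_cst; apply: cont; exact: smooth_on_derive.
  by apply: (varied_eq oQ) => [h p _|p _]; rewrite mxE.
apply: varied_if => [_|]; first exact: (varied_transported oO xY iO vdx).
by apply: varied_cst; exact: cont.
Qed.

Let state0 p : state 0 p = thermo_state phi theta p.
Proof.
have [L LP] := flow_constant_w oO xY iO vdx.
have pE := position0 oO xY iO vdx.
rewrite /state /slope /thermo_state pE; congr (_, _, _).
- by case: (mp).
- case: p pE => t z pE; rewrite grad_spacetime; apply/rowP => i; rewrite !mxE.
  by rewrite (stretch0 oO xY iO vdx _ _ LP); case: (mp).
- by case: (mt).
Qed.

Let varied_energy : varied Q K (fun h p => psi' (state h p))
  (fun p => 'D_(state' p) psi' (state 0 p)).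
Proof.
apply: (varied_comp cK KQ finite_basis_state (@open_positive_temperature R d) smooth_psi _ _ varied_state).
  move=> p Qp; have -> : state 0 = thermo_state phi theta by apply/funext => q; exact: state0.
  exact: (smooth_on_continuous (thermo_state_smooth oN sphi stheta) (QN Qp)).
by move=> p Qp; rewrite state0; exact: th0Q.
Qed.

Let energy_integrable : volume_integrable T O x (fun t z => psi' (thermo_state phi theta (t, z))).
Proof.
apply: (volume_integrable_continuous oO (inverse_smoothl xY) _ (inverse_smoothr xY) _ iO oN NC).
- by move=> t tT; exact: (inverse_flows_bij xY tT).
- exact: (inverse_lr xY).
move=> p Np; have s := smooth_of_state oN sphi stheta th0 smooth_psi.
have -> : spacetime (fun t z => psi' (thermo_state phi theta (t, z))) =
    (fun p => psi' (thermo_state phi theta p)) by apply/funext => -[].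
exact: (smooth_on_continuous s Np).
Qed.

Let energy_displaced L h t z : flow_constant w L -> small L h -> 0 <= t <= T -> Omega z ->
  psi (transported_phase (displaced_flow x dx h) t z)
    (grad (transported_phase (displaced_flow x dx h) t) z)
    (transported_temperature (displaced_flow x dx h) t z) = psi' (state h (t, z)).
Proof.
move=> LP sh tT Oz; rewrite /psi' /state /slope /=; congr psi.
- rewrite /transported_phase; case: (mp) trp => // /(_ isT) tr.
  exact: (push_displaced xY iO vdx LP sh tr tT Oz).
- rewrite /transported_phase; case: (mp) trp => [/(_ isT) tr|_].
    apply: (grad_push_displaced oO xY iO vdx LP sh tr _ tT Oz).
    by exists N.
  exact: grad_spacetime.
- rewrite /transported_temperature; case: (mt) trt => // /(_ isT) tr.
  exact: (push_displaced xY iO vdx LP sh tr tT Oz).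
Qed.

Let energy_variation : is_derive (0 : R) (1 : R)
  (fun h => free_energy_action T psi transported_phase transported_temperature O
     (fun t X => x t X + h *: dx t X))
  (- local_integral Q (fun p => 'D_(state' p) psi' (state 0 p))).
Proof.
have [L LP] := flow_constant_w oO xY iO vdx; have [L0 _ _ _ _] := LP.
have [h0 h00 sm] := small_parameter L0.
apply: is_deriveN.
apply: (is_derive_volume_integral oQ cK KQ varied_energy energy_integrable _ _ _ h00).
- by move=> p; exact: (displacement_support_volume vdx).
- by move=> [t z] Qp; exact: (@cylinder_le R d Omega T t z).
- by move=> t z Qp; rewrite state0.
move=> h /sm sh.
exists (fun t y => psi (transported_phase (displaced_flow x dx h) t y)
    (grad (transported_phase (displaced_flow x dx h) t) y)
    (transported_temperature (displaced_flow x dx h) t y)).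
  rewrite /volume_integral; apply: eq_Rintegral => t; rewrite inE/= in_itv/= => tT.
  by have <- := image_displaced xY iO vdx LP sh tT.
move=> t z tT zO.
have Oz : Omega z.
  by case: iO zO => OO _ _ [X OX <-]; exact: (inverse_funl xY tT (OO X OX)).
rewrite (energy_displaced LP sh tT Oz); case: asboolP => // nQ.
have nK : ~ K (t, z) by move/KQ.
have u1 := undisplaced_off w0 LP sh nK.
have u0 : undisplaced w 0 (t, z) = (t, z).2 by exact: (undisplaced0 _ LP).
have sE : slope h (t, z) = slope 0 (t, z).
  apply/rowP => i.
  have s1 := stretch_off sw cK w0 LP (delta_mx ord0 i) sh nK.
  have s0 : stretch w 0 (delta_mx ord0 i) (t, z) = delta_mx ord0 i.
    exact: (stretch0 oO xY iO vdx _ _ LP).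
  rewrite [LHS]mxE.
  rewrite [RHS]mxE.
  rewrite u1 s1.
  rewrite u0 s0.
  exact: erefl.
by rewrite -state0 /state u1 u0 sE.
Qed.

Let I f := local_integral Q f.

(** Integration by parts moves the derivatives from the variation [Wphi] of
    the phase onto [psi_grad], and the divergence so obtained completes
    [- psi_phi] to the chemical potential. *)
Let energy_gradient :
  I (fun p => 'D_(state' p) psi' (state 0 p)) =
  I (fun p => dot (spacetime conservative_density p) (w p)).
Proof.
have sphi' : smooth_on Q (fun p => psi_phi psi (spacetime phi p) (grad (phi p.1) p.2) (spacetime theta p)).
  exact: (smooth_psi_phi smooth_psi oQ sphiQ sthetaQ th0Q).
have stheta' : smooth_on Q (fun p => psi_theta psi (spacetime phi p) (grad (phi p.1) p.2) (spacetime theta p)).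
  exact: (smooth_psi_theta smooth_psi oQ sphiQ sthetaQ th0Q).
pose pg i (p : E) := psi_grad psi (spacetime phi p) (grad (phi p.1) p.2) (spacetime theta p) ord0 i.
have sgrad' i : smooth_on Q (pg i).
  exact: (smooth_psi_grad smooth_psi oQ sphiQ sthetaQ th0Q).
have tW : local_test Q K Wphi by exact: (local_test_along oO xY iO vdx).
have tWt : local_test Q K Wtheta by exact: (local_test_along oO xY iO vdx).
pose f1 (p : E) := psi_phi psi (spacetime phi p) (grad (phi p.1) p.2) (spacetime theta p) * Wphi p.
pose f2 i (p : E) := pg i p * 'D_((0, delta_mx ord0 i)) Wphi p.
pose f2' i (p : E) := 'D_((0, delta_mx ord0 i)) (pg i) p * Wphi p.
pose f3 (p : E) := psi_theta psi (spacetime phi p) (grad (phi p.1) p.2) (spacetime theta p) * Wtheta p.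
have t1 : local_test Q K f1 by exact: (local_testM oQ sphi' tW).
have t2 i : local_test Q K (f2 i).
  by apply: (local_testM oQ (sgrad' i)); exact: (local_test_derive oQ cK _ tW).
have t2' i : local_test Q K (f2' i).
  by apply: (local_testM oQ _ tW); exact: smooth_on_derive.
have t3 : local_test Q K f3 by exact: (local_testM oQ stheta' tWt).
have cst_s (k : R) : smooth_on Q (fun _ : E => k) by exact: smooth_cst.
have tZ k f : local_test Q K f -> local_test Q K (fun p => k * f p).
  by move=> tf; exact: (local_testM oQ (cst_s k) tf).
have parts i : I (f2 i) = - I (f2' i).
  by apply: (local_integral_parts oQ cK KQ) => //; right; exists i.
have ts2 := local_test_sum oQ (index_enum 'I_d) t2.
have ts2' := local_test_sum oQ (index_enum 'I_d) t2'.
have -> : I (fun p => 'D_(state' p) psi' (state 0 p)) =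
    - mp%:R * (I f1 + \sum_i I (f2 i)) + - mt%:R * I f3.
  rewrite /I -(local_integral_sum oQ cK KQ)// -(local_integralD oQ cK KQ)//.
  rewrite -(local_integralZ oQ cK KQ); last exact: (local_testD oQ t1 ts2).
  rewrite -(local_integralZ oQ cK KQ)// -(local_integralD oQ cK KQ); last 2 first.
    exact: (tZ _ _ (local_testD oQ t1 ts2)).
    exact: tZ.
  apply: eq_local_integral => p Qp.
  rewrite state0 (derive_psi smooth_psi _ _ _ (thermo_state_positive phi th0 (QN Qp))).
  rewrite /f1 /f3 /Wphi /Wtheta; case: (mp); case: (mt) => /=.
  - rewrite -/(Wphi p) -/(Wtheta p) !mulN1r opprD; congr (_ + _ + _).
    + by rewrite mulNr mulrC.
    + by rewrite -sumrN; apply: eq_bigr => i _; rewrite mxE mulNr mulrC.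
    + by rewrite mulNr mulrC.
  - rewrite -/(Wphi p) -/(Wtheta p) !mulN1r opprD mul0r oppr0 mul0r; congr (_ + _ + _).
    + by rewrite mulNr mulrC.
    + by rewrite -sumrN; apply: eq_bigr => i _; rewrite mxE mulNr mulrC.
  - rewrite -/(Wtheta p) mulN1r !mul0r oppr0 mul0r !add0r.
    rewrite [X in X + _](big1 _ _)// => [|i _]; last by rewrite mxE mul0r.
    by rewrite add0r mulNr mulrC.
  - rewrite !mul0r oppr0 !mul0r !addr0 add0r.
    by rewrite [LHS]big1// => i _; rewrite mxE mul0r.
rewrite (eq_bigr _ (fun i _ => parts i)) sumrN.
rewrite /I -(local_integral_sum oQ cK KQ)//.
have -> : local_integral Q (fun p => dot (spacetime conservative_density p) (w p)) =
    mp%:R * (local_integral Q (fun p => \sum_i f2' i p) + (-1) * local_integral Q f1)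
    + - mt%:R * local_integral Q f3.
  rewrite -(local_integralZ oQ cK KQ)// -(local_integralD oQ cK KQ)//; last exact: tZ.
  rewrite -(local_integralZ oQ cK KQ); last exact: (local_testD oQ ts2' (tZ _ _ t1)).
  rewrite -(local_integralZ oQ cK KQ)// -(local_integralD oQ cK KQ); last 2 first.
    exact: (tZ _ _ (local_testD oQ ts2' (tZ _ _ t1))).
    exact: (tZ _ _ t3).
  apply: eq_local_integral => -[t z] Qp.
  have WE : Wphi (t, z) = dot (grad (phi t) z) (w (t, z)).
    rewrite dotC; apply: spatial_derive_dot.
    exact: (smooth_on_differentiable sphiQ Qp).
  have WtE : Wtheta (t, z) = dot (grad (theta t) z) (w (t, z)).
    rewrite dotC; apply: spatial_derive_dot.
    exact: (smooth_on_differentiable sthetaQ Qp).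
  rewrite /spacetime/= dotDl !dotZl -WE -WtE.
  congr (_ + _); last first.
    by rewrite /f3 /entropy /spacetime/= !mulNr mulrN.
  congr (_ * _); rewrite chemical_potentialE mulrBl mulN1r; congr (_ - _).
  by rewrite mulr_suml.
by rewrite mulN1r -[in RHS]opprB mulrN mulNr.
Qed.

Lemma smooth_conservative_density : smooth_on Q (spacetime conservative_density).
Proof.
have sk (k : R) : smooth_on Q (fun _ : E => k) by exact: smooth_cst.
apply: (smooth_add oQ).
  apply: (smooth_scale_field oQ (sk _)); apply: (smooth_scale_field oQ).
    exact: (smooth_chemical_potential smooth_psi oQ sphiQ sthetaQ th0Q).
  exact: smooth_grad.
apply: (smooth_scale_field oQ (sk _)); apply: (smooth_scale_field oQ).
  exact: (smooth_entropy smooth_psi oQ sphiQ sthetaQ th0Q).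
exact: smooth_grad.
Qed.

Lemma conservative_first_variation : is_derive (0 : R) (1 : R)
  (fun h => free_energy_action T psi transported_phase transported_temperature O
     (fun t X => x t X + h *: dx t X))
  (volume_integral T O x
     (fun t y => dot (- conservative_density t y) (eulerian Omega x dx t y))).
Proof.
have [e1 e2] := energy_variation; split; first exact: e1.
rewrite e2 (volume_integral_force xY iO vdx (fun t y => - conservative_density t y)).
have sE := smooth_conservative_density.
have tE : local_test Q K (fun p => dot (spacetime conservative_density p) (w p)).
  split; first by apply: (smooth_dot oQ sE); apply: smooth_onS sw.
  by move=> p Qp nK; rewrite w0// dotC dot0l.
apply: (etrans (congr1 -%R energy_gradient)).
apply: (etrans (esym (mulN1r _))).
apply: (etrans (esym (local_integralZ oQ cK KQ (- 1) tE))).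
by apply: eq_local_integral => p Qp; rewrite mulN1r -dotNl.
Qed.

End ConservativeFirstVariation.

(** * First variation of the kinetic energy *)

(** The algebra of the kinetic variation at a point, where [v0], [dv] stand
    for the derivatives of the velocity in time and space, [w0], [dw] for those
    of the displacement, and [e] for the kinetic energy density. The variation
    of the energy is the work of minus the acceleration, plus the time
    derivative of the product v . w, plus the divergences of v (v . w) and
    - e w. Both fields being free of divergence, the terms with [dv j j] and
    [dw j j] may be inserted at will. *)
Lemma kinetic_balance (R : comRingType) (n : nat) (v w v0 w0 : 'I_n -> R)
    (dv dw : 'I_n -> 'I_n -> R) (e : R) :
  \sum_j dv j j = 0 -> \sum_j dw j j = 0 ->
  \sum_i v i * (- (\sum_j w j * dv i j) + (w0 i + \sum_j v j * dw i j)) =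
  \sum_i - (v0 i + \sum_j v j * dv i j) * w i +
  (\sum_i (v i * w0 i + w i * v0 i) +
   \sum_j (v j * (\sum_i (v i * dw i j + w i * dv i j)) + (\sum_i v i * w i) * dv j j) -
   \sum_j (e * dw j j + w j * (\sum_i v i * dv i j))).
Proof.
move=> dv0 dw0; rewrite !big_split/= -!mulr_sumr dv0 dw0 !mulr0 addr0 add0r.
have ex1 : \sum_j w j * (\sum_i v i * dv i j) = \sum_i v i * (\sum_j w j * dv i j).
  under eq_bigr do rewrite mulr_sumr; rewrite exchange_big/=.
  by apply: eq_bigr => i _; rewrite mulr_sumr; apply: eq_bigr => j _; ring.
have ex2 : \sum_j v j * (\sum_i (v i * dw i j + w i * dv i j)) =
    \sum_i v i * (\sum_j v j * dw i j) + \sum_i w i * (\sum_j v j * dv i j).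
  under eq_bigr do rewrite big_split mulrDr/=.
  rewrite big_split; congr (_ + _).
    under eq_bigr do rewrite mulr_sumr; rewrite exchange_big/=.
    by apply: eq_bigr => i _; rewrite mulr_sumr; apply: eq_bigr => j _; ring.
  under eq_bigr do rewrite mulr_sumr; rewrite exchange_big/=.
  by apply: eq_bigr => i _; rewrite mulr_sumr; apply: eq_bigr => j _; ring.
rewrite ex1 ex2.
have -> : \sum_i v i * (- (\sum_j w j * dv i j) + (w0 i + \sum_j v j * dw i j)) =
  - (\sum_i v i * (\sum_j w j * dv i j)) + (\sum_i v i * w0 i + \sum_i v i * (\sum_j v j * dw i j)).
  by rewrite -sumrN -!big_split; apply: eq_bigr => i _ /=; ring.
have -> : \sum_i - (v0 i + \sum_j v j * dv i j) * w i =
  - (\sum_i w i * v0 i) - \sum_i w i * (\sum_j v j * dv i j).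
  by rewrite -!sumrN -!big_split; apply: eq_bigr => i _ /=; ring.
ring.
Qed.

Lemma displacement_on (R : realType) (d : nat) (Omega : set 'rV[R]_d) T Y (dx : R -> 'rV[R]_d -> 'rV[R]_d) p :
  cylinder Omega T p -> displacement Omega T Y dx p = dx p.1 (Y p.1 p.2).
Proof. by move=> Qp; rewrite /displacement /transplant; case: asboolP. Qed.

Lemma displacement_outside (R : realType) (d : nat) (Omega : set 'rV[R]_d) T Y (dx : R -> 'rV[R]_d -> 'rV[R]_d) p :
  ~ cylinder Omega T p -> displacement Omega T Y dx p = 0.
Proof. by move=> Qp; rewrite /displacement /transplant; case: asboolP. Qed.

Section KineticFirstVariation.
Context {R : realType} {d : nat}.
Notation V := 'rV[R]_d.
Notation E := (R * 'rV[R]_d)%type.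
Variables (Omega : set V) (T : R) (x Y : R -> V -> V) (O : set V) (dx : R -> V -> V).
Hypotheses (oO : open Omega) (xY : inverse_flows Omega T x Y)
  (iO : initial_volume Omega O) (vdx : Defs.variation T O dx).

Let Q := cylinder Omega T.
Notation w := (displacement Omega T Y dx).
Notation K := (displacement_support x dx).

Let oQ : open Q. Proof. exact: open_cylinder. Qed.
Let sw : smooth_on setT w. Proof. exact: (displacement_smooth oO xY iO vdx). Qed.
Let cK : compact K. Proof. exact: (displacement_compact xY iO vdx). Qed.
Let KQ : K `<=` Q. Proof. exact: (displacement_supportQ xY iO vdx). Qed.
Let w0 p : ~ K p -> w p = 0. Proof. exact: (displacement_off xY). Qed.

(** Neither the integrand nor, by [image_displaced], the domain of integration
    depends on the variation. *)
Lemma displaced_flow_kinetic_constant (v : R -> V -> V) :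
  is_derive (0 : R) (1 : R) (fun h => kinetic_action T (fun=> v) O (displaced_flow x dx h)) 0.
Proof.
have [L LP] := flow_constant_w oO xY iO vdx; have [L0 _ _ _ _] := LP.
have [h0 h00 sm] := small_parameter L0.
have C h : `|h| <= h0 -> kinetic_action T (fun=> v) O (displaced_flow x dx h) =
    kinetic_action T (fun=> v) O x.
  move=> /sm sh; rewrite /kinetic_action /volume_integral; apply: eq_Rintegral => t.
  by rewrite inE/= in_itv/= => tT; rewrite (image_displaced xY iO vdx LP sh tT).
apply: (is_derive_quadratic (C := 0) h00) => h hh.
by rewrite !C ?normr0 ?(ltW h00)// subrr mulr0 subr0 normr0 mul0r.
Qed.

(** The velocity of the displaced flow contains the rate of the variation,
    which has an Eulerian form as it is a variation itself. *)
Lemma variation_dt : Defs.variation T O (dt dx).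
Proof.
have [sdx cdx dxO] := vdx.
have dE : spacetime (dt dx) = 'D_((1, 0)) (spacetime dx).
  by apply/funext => -[t z]; rewrite /spacetime dt_spacetime.
have cl : closed (supp (spacetime dx)) by exact: closed_closure.
have sub : supp (spacetime (dt dx)) `<=` supp (spacetime dx).
  rewrite [X in _ `<=` X](closure_id _).1//; apply: closure_subset => p /= Dp.
  apply: contrapT => np; move/eqP: Dp; apply; rewrite dE.
  apply: (etrans (near_derive_eq (g := cst 0) _ _)); last exact: derive_cst.
  apply: (open_near (closed_openC cl)) np => q /= nq; apply/eqP.
  by apply: contra_notT nq => dq; exact: subset_closure.
split.
- by rewrite dE; exact: smooth_on_derive.
- exact: subclosed_compact (@closed_closure _ _) cdx sub.
- exact: subset_trans sub dxO.
Qed.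

Notation w' := (displacement Omega T Y (dt dx)).

Variable v : R -> V -> V.
Variable N : set E.
Hypotheses (oN : open N) (NC : closed_cylinder Omega T `<=` N)
  (sv : smooth_on N (spacetime v)).
Hypothesis xv : forall t X, 0 <= t <= T -> Omega X -> dt x t X = v t (x t X).

Let QN : Q `<=` N. Proof. by move=> p /cylinder_closed/NC. Qed.
Let svQ : smooth_on Q (spacetime v). Proof. exact: smooth_onS QN sv. Qed.

Lemma derive_trajectory (W : normedModType R) (f : E -> W) t z : Q (t, z) ->
  differentiable f (t, z) ->
  'D_1 (fun r : R => f (r, x r (Y t z))) t = 'D_((1, v t z)) f (t, z).
Proof.
move=> Qp df; have [tT Oz] := Qp; have tT' := cylinder_le Qp.
have OX := inverse_funr xY tT' Oz.
have xX := inverse_rl xY tT' Oz.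
pose X := Y t z; pose c (r : R) : E := (r, x r X).
have QX : Q (t, X) by [].
have sx := smooth_field_cylinder (inverse_smoothl xY).
have dx0 : differentiable (spacetime x) (t, X) by exact: (smooth_on_differentiable sx QX).
have [dxE dxd] := derive_slice1 (spacetime x) t X (1 : R).
have dxX : differentiable (fun r : R => x r X) t.
  by apply/derivable1_diffP; rewrite -[derivable _ _ _]/(derivable (fun r => spacetime x (r, X)) t 1) dxd; exact: diff_derivable.
have did : differentiable (fun r : R => r) t by exact: (smooth_on_differentiable (smooth_id openT) I).
have dc : differentiable c t by exact: differentiable_pair.
have Dc : 'D_1 c t = (1, v t z).
  rewrite (deriveE _ dc) (diff_pair did dxX) -(deriveE _ dxX) -(deriveE _ did).
  congr (_, _); first exact: derive_id.
  exact: (etrans (esym (derive1E _ _)) (etrans (xv tT' OX) (congr1 (v t) xX))).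
have ct : c t = (t, z) by rewrite /c xX.
have dfc : differentiable f (c t) by rewrite ct.
apply: (etrans (derive_comp (1 : R) dc dfc)).
exact: (congr2 (fun k q => 'D_k f q) Dc ct).
Qed.

Lemma near_time t : 0 < t < T -> \forall r \near t, 0 <= r <= T.
Proof.
move=> tT; have o : open [set r : R | 0 < r < T].
  rewrite (_ : [set r : R | _] = `]0, T[%classic); first exact: interval_open.
  by apply/seteqP; split=> r /=; rewrite in_itv.
by apply: (open_near o _ tT) => r /= /andP[r0 rT]; rewrite !ltW.
Qed.

(** The time derivative of a Lagrangian displacement is the material derivative
    of its Eulerian form. *)
Lemma material_derivative p : Q p -> w' p = 'D_((1, spacetime v p)) w p.
Proof.
case: p => t z Qp; have [tT Oz] := Qp.
have OX := inverse_funr xY (cylinder_le Qp) Oz.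
have dw : differentiable w (t, z) by exact: (smooth_on_differentiable sw).
apply: (etrans (displacement_on Y (dt dx) Qp)).
apply: (etrans (derive1E (fun r => dx r (Y t z)) t)).
apply: (etrans _ (derive_trajectory Qp dw)).
apply: (near_derive_eq (f := fun r => dx r (Y t z))).
by apply: filterS (near_time tT) => r rT; rewrite -(displacementE xY iO vdx rT OX).
Qed.

Lemma varied_scaled (a : R -> E -> R) (a' : E -> R) :
  varied Q K a a' -> (forall p, Q p -> {for p, continuous (a 0)}) ->
  (forall p, Q p -> ~ K p -> a 0 p = 0) ->
  varied Q K (fun h p => h * a h p) (a 0).
Proof.
move=> va c0 a0; have [B aB] := varied_bounded cK KQ va.
have [ca a'0 [h0 [M [h00 H]]]] := va; split => //.
exists (Num.min h0 1), (`|M| + `|B|); split; first by rewrite lt_min h00 ltr01.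
move=> h; rewrite le_min => /andP[hh h1] p Qp; have [c e t] := H h hh p Qp; split.
- exact: cvgZl_tmp.
- by move=> nK; rewrite e// a0// !mulr0.
- rewrite mul0r subr0 -mulrBr normrM -[h ^+ 2]real_normK ?num_real// expr2 mulrC mulrA.
  rewrite ler_wpM2r//; have := ler_normD (a h p - a 0 p - h *: a' p) (h *: a' p).
  rewrite subrK => /le_trans; apply; rewrite mulrDl; apply: lerD.
    apply: (le_trans t); rewrite -[h ^+ 2]real_normK ?num_real// expr2 mulrA.
    apply: (@le_trans _ _ (`|M| * `|h| * `|h|)).
      by rewrite ler_wpM2r// ler_wpM2r// ler_norm.
    by rewrite -[leRHS]mulr1 ler_wpM2l// mulr_ge0.
  rewrite normrZ mulrC ler_wpM2r//; apply: (le_trans (aB p Qp)); exact: ler_norm.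
Qed.

(** The Eulerian velocity of the displaced flow. *)
Let carried h (p : E) : V :=
  spacetime v (p.1, undisplaced w h p) + h *: w' (p.1, undisplaced w h p).
Let carried' (p : E) : V :=
  \row_i (- 'D_((0, w p)) (fun p => spacetime v p ord0 i) p + w' p ord0 i).

Let sw' : smooth_on setT w'. Proof. exact: (displacement_smooth oO xY iO variation_dt). Qed.

Let w'0 p : Q p -> ~ K p -> w' p = 0.
Proof.
move=> Qp nK; rewrite (material_derivative Qp).
have clK : closed K := compact_closed (@norm_hausdorff _ _) cK.
apply: (etrans (near_derive_eq (g := cst 0) _ _)); last exact: derive_cst.
by apply: (open_near (closed_openC clK)) nK => q /= nq; exact: w0.
Qed.

Lemma varied_add (a b : R -> E -> R) a' b' : varied Q K a a' -> varied Q K b b' ->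
  varied Q K (fun h p => a h p + b h p) (fun p => a' p + b' p).
Proof.
move=> [ca a0 [h1 [M1 [h10 H1]]]] [cb b0 [h2 [M2 [h20 H2]]]]; split.
- by move=> p Qp; apply: cvgD; [exact: ca|exact: cb].
- by move=> p Qp nK; rewrite a0// b0// addr0.
- exists (Num.min h1 h2), (M1 + M2); split; first by rewrite lt_min h10.
  move=> h; rewrite le_min => /andP[hh1 hh2] p Qp.
  have [c1 e1 t1] := H1 h hh1 p Qp; have [c2 e2 t2] := H2 h hh2 p Qp; split.
  + exact: cvgD.
  + by move=> nK; rewrite e1// e2.
  + rewrite scalerDr mulrDl.
    have -> : a h p + b h p - (a 0 p + b 0 p) - (h *: a' p + h *: b' p) =
      (a h p - a 0 p - h *: a' p) + (b h p - b 0 p - h *: b' p) by ring.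
    by rewrite (le_trans (ler_normD _ _))// lerD.
Qed.

Let varied_carried : varied Q K carried carried'.
Proof.
apply: varied_row => i.
have svi : smooth_on Q (fun p => spacetime v p ord0 i) by exact: smooth_coord.
have swi : smooth_on Q (fun p => w' p ord0 i).
  by apply: smooth_coord => //; apply: smooth_onS sw'.
have v1 := varied_transported oO xY iO vdx svi.
have v2 := varied_transported oO xY iO vdx swi.
pose b h (p : E) := w' (p.1, undisplaced w h p) ord0 i.
have b0E p : b 0 p = w' p ord0 i by rewrite /b (position0 oO xY iO vdx).
have b0F : b 0 = (fun p => w' p ord0 i) by apply/funext.
have v3 : varied Q K (fun h p => h * b h p) (b 0).
  have cb0 p : Q p -> {for p, continuous (b 0)}.
    by move=> Qp; rewrite b0F; exact: (smooth_on_continuous swi).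
  have b00 p : Q p -> ~ K p -> b 0 p = 0 by move=> Qp nK; rewrite b0E w'0// mxE.
  exact: (varied_scaled v2 cb0 b00).
apply: (varied_eq oQ _ _ (varied_add v1 v3)) => [h p Qp|p Qp].
  by rewrite /carried /b mxE [in RHS]mxE.
by rewrite /carried' b0E mxE.
Qed.

Let half_square (q : V) : R := 2^-1 * dot q q.

Let smooth_half_square : smooth_on setT half_square.
Proof.
apply: smooth_mul; [exact: openT|exact: smooth_cst openT|].
by apply: smooth_dot; [exact: openT|exact: smooth_id openT|exact: smooth_id openT].
Qed.

Let derive_half_square q k : 'D_k half_square q = dot q k.
Proof.
have [e1 e2] : is_derive (0 : R) (1 : R) (fun s : R => half_square (q + s *: k)) (dot q k).
  apply: (@is_derive_quadratic R _ _ 1 `|half_square k|) => // h _.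
  rewrite scale0r addr0 /half_square !dotDl !dotDr !dotZl !dotZr (dotC k q).
  rewrite [X in `|X|](_ : _ = h ^+ 2 * (2^-1 * dot k k)); last by field.
  by rewrite normrM (ger0_norm (sqr_ge0 h)) mulrC lexx.
have dq : differentiable half_square q by exact: (smooth_on_differentiable smooth_half_square).
have qE : q + (0 : R) *: k = q by rewrite scale0r addr0.
have dq' : differentiable half_square (q + (0 : R) *: k) by rewrite qE.
have [_ e3] := is_derive_line dq'.
exact: (etrans (congr1 (fun y => 'D_k half_square y) (esym qE)) (etrans (esym e3) e2)).
Qed.

Let carried0 p : carried 0 p = spacetime v p.
Proof. by rewrite /carried scale0r addr0 (position0 oO xY iO vdx). Qed.

Let varied_kinetic : varied Q K (fun h p => half_square (carried h p))
  (fun p => dot (spacetime v p) (carried' p)).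
Proof.
have c0 p : Q p -> {for p, continuous (carried 0)}.
  have -> : carried 0 = spacetime v by apply/funext => q; exact: carried0.
  exact: (smooth_on_continuous svQ).
have := varied_comp cK KQ (finite_basis_rV d) openT smooth_half_square c0 (fun _ _ => I) varied_carried.
by apply: (varied_eq oQ) => [h p _//|p _]; rewrite derive_half_square carried0.
Qed.

Lemma velocity_displaced L h t z : flow_constant w L -> small L h -> 0 <= t <= T -> Omega z ->
  velocity Omega (displaced_flow x dx h) t z =
  v t (undisplaced w h (t, z)) + h *: dt dx t (Y t (undisplaced w h (t, z))).
Proof.
move=> LP sh tT Oz; rewrite /velocity (eulerian_displaced xY iO vdx LP sh)//.
set g := undisplaced w h (t, z).
have Og : Omega g by exact: (undisplaced_Omega xY iO vdx LP sh).
have OY := inverse_funr xY tT Og.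
have [Nx [oNx NxC sx]] := inverse_smoothl xY; have [sdx _ _] := vdx.
have dX : derivable (fun r => x r (Y t g)) t 1.
  have [_ e] := derive_slice1 (spacetime x) t (Y t g) (1 : R).
  rewrite -[X in derivable X]/(fun r => spacetime x (r, Y t g)) e; apply: diff_derivable.
  apply: (smooth_on_differentiable sx); by apply: NxC; split; [exact: tT|exact: subset_closure].
have ddX : derivable (fun r => dx r (Y t g)) t 1.
  have [_ e] := derive_slice1 (spacetime dx) t (Y t g) (1 : R).
  rewrite -[X in derivable X]/(fun r => spacetime dx (r, Y t g)) e; apply: diff_derivable.
  exact: (smooth_on_differentiable sdx).
rewrite /dt !derive1E.
rewrite -[X in 'D_1 X t]/((fun r => x r (Y t g)) + h \*: (fun r => dx r (Y t g))).
have dZ : derivable (h \*: (fun r => dx r (Y t g))) t 1 by exact: derivableZ.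
rewrite (deriveD dX dZ) (deriveZ _ ddX).
have xE : 'D_1 (fun r => x r (Y t g)) t = v t g.
  by rewrite -derive1E -[LHS]/(dt x t (Y t g)) xv// (inverse_rl xY).
exact: (congr1 (fun a => a + _) xE).
Qed.

Definition acceleration (t : R) (z : V) : V := dt v t z + 'D_(v t z) (v t) z.

Lemma accelerationE p i : Q p -> spacetime acceleration p ord0 i =
  'D_((1, 0)) (fun q => spacetime v q ord0 i) p +
  \sum_j spacetime v p ord0 j * 'D_((0, delta_mx ord0 j)) (fun q => spacetime v q ord0 i) p.
Proof.
case: p => t z Qp; have dv := smooth_on_differentiable svQ Qp.
have [dvi _] := derive_coord 0 i dv.
rewrite /spacetime/= /acceleration mxE dt_spacetime; congr (_ + _).
  by rewrite -(derive_coord ((1, 0) : E) i dv).2.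
have -> : 'D_(v t z) (v t) z = 'D_((0, v t z)) (spacetime v) (t, z).
  exact: (derive_slice2 (spacetime v) t z _).1.
by rewrite -(derive_coord ((0, v t z) : E) i dv).2 (derive_basis dvi (spatial_basis (v t z))).
Qed.

Hypothesis div_v : forall t z, 0 <= t <= T -> Omega z -> divergence (v t) z = 0.

Lemma divergence_spacetime (f : R -> V -> V) t z :
  divergence (f t) z = \sum_j 'D_((0, delta_mx ord0 j)) (fun q => spacetime f q ord0 j) (t, z).
Proof.
apply: eq_bigr => j _.
exact: (derive_slice2 (fun q => spacetime f q ord0 j) t z _).1.
Qed.

Lemma local_integral_derive (g : E -> R) k : coordinate_direction k -> local_test Q K g ->
  local_integral Q ('D_k g) = 0.
Proof.
move=> kc tg; have c1 : smooth_on Q (fun _ : E => 1 : R) by exact: smooth_cst.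
have e := local_integral_parts oQ cK KQ kc c1 tg.
have -> : local_integral Q ('D_k g) = local_integral Q (fun p => 1 * 'D_k g p).
  by apply: eq_local_integral => p _; rewrite mul1r.
have z : local_integral Q (fun p => 'D_k (fun=> 1 : R) p * g p) = 0.
  apply: (etrans _ (@local_integral0 R d Q)); apply: eq_local_integral => p _.
  by apply: (etrans (congr1 (fun a => a * g p) (derive_cst _ _ _))); rewrite mul0r.
by apply: (etrans e); rewrite z oppr0.
Qed.

Hypothesis div_dx : divergence_free Omega T x dx.

Let vi i (p : E) := spacetime v p ord0 i.
Let wi i (p : E) := w p ord0 i.
Let D0 (f : E -> R) := 'D_((1, 0)) f.
Let D (j : 'I_d) (f : E -> R) := 'D_((0, delta_mx ord0 j)) f.

(** The terms which [kinetic_balance] adds to the work of the acceleration are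
    derivatives of local test functions, so their integrals vanish. *)
Let kinetic_gradient :
  local_integral Q (fun p => dot (spacetime v p) (carried' p)) =
  local_integral Q (fun p => dot (- spacetime acceleration p) (w p)).
Proof.
have svi i : smooth_on Q (vi i) by exact: smooth_coord.
have swi i : smooth_on Q (wi i) by apply: smooth_coord => //; exact: smooth_onS sw.
have twi i : local_test Q K (wi i).
  by split => // p Qp nK; rewrite /wi w0// mxE.
pose s i p := vi i p * wi i p.
have ts i : local_test Q K (s i) by exact: (local_testM oQ (svi i) (twi i)).
pose S p := \sum_i s i p.
have tS : local_test Q K S by exact: (local_test_sum oQ (index_enum 'I_d) ts).
pose e p := 2^-1 * \sum_i vi i p * vi i p.
have se : smooth_on Q e.
  apply: (smooth_mul oQ); first exact: smooth_cst.
  by apply: smooth_sum => // i; exact: smooth_mul.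
pose f j p := vi j p * S p.
have tf j : local_test Q K (f j) by exact: (local_testM oQ (svi j) tS).
pose g j p := e p * wi j p.
have tg j : local_test Q K (g j) by exact: (local_testM oQ se (twi j)).
have c0 : coordinate_direction ((1, 0) : E) by left.
have cj j : coordinate_direction ((0, delta_mx ord0 j) : E) by right; exists j.
have tD0 : local_test Q K (D0 S) by exact: (local_test_derive oQ cK _ tS).
have tDf j : local_test Q K (D j (f j)) by exact: (local_test_derive oQ cK _ (tf j)).
have tDg j : local_test Q K (D j (g j)) by exact: (local_test_derive oQ cK _ (tg j)).
have tDfs := local_test_sum oQ (index_enum 'I_d) tDf.
have tDgs := local_test_sum oQ (index_enum 'I_d) tDg.
have sE : smooth_on Q (spacetime acceleration).
  apply: smooth_row => // i.
  have s1 : smooth_on Q (fun p => D0 (vi i) p + \sum_j vi j p * D j (vi i) p).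
    apply: smooth_add => //; first exact: smooth_on_derive.
    apply: smooth_sum => // j; apply: smooth_mul => //; exact: smooth_on_derive.
  by apply: (smooth_on_ext oQ _ s1) => p Qp; rewrite (accelerationE i Qp).
have tA : local_test Q K (fun p => dot (- spacetime acceleration p) (w p)).
  split; first by apply: smooth_dot => //; [exact: smooth_opp|exact: smooth_onS sw].
  by move=> p Qp nK; rewrite w0// dotC dot0l.
have tmg : local_test Q K (fun p => -1 * \sum_j D j (g j) p).
  by apply: (local_testM oQ _ tDgs); exact: smooth_cst.
have ID0 : local_integral Q (D0 S) = 0 by exact: (local_integral_derive c0 tS).
have IDf : local_integral Q (fun p => \sum_j D j (f j) p) = 0.
  apply: (etrans (local_integral_sum oQ cK KQ (index_enum 'I_d) tDf)).
  by apply: big1 => j _; exact: (local_integral_derive (cj j) (tf j)).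
have IDg : local_integral Q (fun p => \sum_j D j (g j) p) = 0.
  apply: (etrans (local_integral_sum oQ cK KQ (index_enum 'I_d) tDg)).
  by apply: big1 => j _; exact: (local_integral_derive (cj j) (tg j)).
(* insert the time derivative of v . w and the two divergences *)
transitivity (local_integral Q (fun p => dot (- spacetime acceleration p) (w p) +
    ((D0 S p + \sum_j D j (f j) p) + -1 * \sum_j D j (g j) p))); last first.
  have t2 := local_testD oQ tD0 tDfs.
  rewrite (local_integralD oQ cK KQ tA (local_testD oQ t2 tmg)).
  rewrite (local_integralD oQ cK KQ t2 tmg) (local_integralD oQ cK KQ tD0 tDfs).
  by rewrite (local_integralZ oQ cK KQ (-1) tDgs) ID0 IDf IDg mulr0 !addr0.
apply: eq_local_integral => p Qp.
have dvi i k : derivable (vi i) p k.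
  by apply: diff_derivable; exact: (smooth_on_differentiable (svi i)).
have dwi i k : derivable (wi i) p k.
  by apply: diff_derivable; exact: (smooth_on_differentiable (swi i)).
have dS k : derivable S p k.
  by case: tS => sS _; apply: diff_derivable; exact: (smooth_on_differentiable sS).
have de k : derivable e p k.
  by apply: diff_derivable; exact: (smooth_on_differentiable se).
have mulE (a b : E -> R) k : derivable a p k -> derivable b p k ->
    'D_k (fun q => a q * b q) p = a p * 'D_k b p + b p * 'D_k a p.
  by move=> da db; exact: (deriveM da db).
have DS k : 'D_k S p = \sum_i (vi i p * 'D_k (wi i) p + wi i p * 'D_k (vi i) p).
  have -> : S = \sum_i s i by apply/funext => q; rewrite fct_sumE.
  rewrite derive_sum => [|i]; last by apply: derivableM.
  by apply: eq_bigr => i _; exact: mulE.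
have De k : 'D_k e p = \sum_i vi i p * 'D_k (vi i) p.
  have dq i : derivable (fun q => vi i q * vi i q) p k by exact: derivableM.
  have -> : e = 2^-1 *: (\sum_i (fun q => vi i q * vi i q)).
    by apply/funext => q; rewrite /e fctE fct_sumE.
  rewrite deriveZ; last exact: derivable_sum.
  rewrite derive_sum//.
  have half (c : R) : 2^-1 * (c + c) = c by field.
  rewrite scaler_sumr; apply: eq_bigr => i _.
  exact: (etrans (congr1 (fun c => 2^-1 * c) (mulE _ _ _ (dvi i k) (dvi i k))) (half _)).
have dv0 : \sum_j D j (vi j) p = 0.
  case: (p) Qp => t z Qp'; have [_ Oz] := Qp'.
  exact: (etrans (esym (divergence_spacetime v t z)) (div_v (cylinder_le Qp') Oz)).
have dw0 : \sum_j D j (wi j) p = 0.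
  case: (p) Qp => t z Qp'; have [tT Oz] := Qp'.
  apply: (etrans _ (div_dx tT Oz)); apply: eq_bigr => j _.
  apply: (etrans (esym (derive_slice2 (wi j) t z _).1)).
  apply: near_derive_eq; apply: (open_near oO _ Oz) => z' Oz'.
  exact: (congr1 (fun r : V => r ord0 j) (esym (eulerian_variation dx xY tT Oz'))).
have cE i : carried' p ord0 i = - (\sum_j wi j p * D j (vi i) p) +
    (D0 (wi i) p + \sum_j vi j p * D j (wi i) p).
  have dfv : differentiable (vi i) p by exact: (smooth_on_differentiable (svi i)).
  have dfw : differentiable (wi i) p by exact: (smooth_on_differentiable (swi i)).
  have dfW : differentiable w p by exact: (smooth_on_differentiable sw).
  have e1 := derive_basis dfv (spatial_basis (w p)).
  have e2 := derive_basis dfw (spatial_basis (spacetime v p)).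
  have e3 : w' p ord0 i = 'D_((1, spacetime v p)) (wi i) p.
    apply: (etrans (congr1 (fun r : V => r ord0 i) (material_derivative Qp))).
    exact: (esym (derive_coord ((1, spacetime v p) : E) i dfW).2).
  have e4 : ((1, spacetime v p) : E) = ((1, 0) : E) + (0, spacetime v p).
    by rewrite -[RHS]/(1 + 0, 0 + _) addr0 add0r.
  have e5 := derive_addv ((1, 0) : E) (0, spacetime v p) dfw.
  have e6 : carried' p ord0 i = - 'D_((0, w p)) (vi i) p + w' p ord0 i by rewrite mxE.
  apply: (etrans e6); apply: (congr2 (fun a b => - a + b) e1).
  apply: (etrans e3); apply: (etrans (congr1 (fun k => 'D_k (wi i) p) e4)).
  exact: (etrans e5 (congr1 (fun b => _ + b) e2)).
have aE i : spacetime acceleration p ord0 i = D0 (vi i) p + \sum_j vi j p * D j (vi i) p.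
  exact: (accelerationE i Qp).
have fE j : D j (f j) p = vi j p * (\sum_i (vi i p * D j (wi i) p + wi i p * D j (vi i) p)) +
    (\sum_i vi i p * wi i p) * D j (vi j) p.
  exact: (etrans (mulE _ _ _ (dvi j _) (dS _)) (congr1 (fun a => vi j p * a + S p * _) (DS _))).
have gE j : D j (g j) p = e p * D j (wi j) p + wi j p * (\sum_i vi i p * D j (vi i) p).
  exact: (etrans (mulE _ _ _ (de _) (dwi j _)) (congr1 (fun a => e p * _ + wi j p * a) (De _))).
have bal := @kinetic_balance R d (fun i => vi i p) (fun i => wi i p) (fun i => D0 (vi i) p)
  (fun i => D0 (wi i) p) (fun i j => D j (vi i) p) (fun i j => D j (wi i) p) (e p) dv0 dw0.
apply: (etrans (eq_bigr _ (fun i _ => congr1 (fun a => vi i p * a) (cE i)))).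
apply: (etrans bal).
have reassoc (a b c r : R) : a + ((b + c) + -1 * r) = a + (b + c - r) by rewrite mulN1r.
apply: (etrans _ (esym (reassoc _ _ _ _))).
refine (congr2 +%R _ (congr2 (fun a b : R => a - b) (congr2 +%R (esym (DS _)) _) _)).
- apply: eq_bigr => i _; apply: (congr1 (fun a => a * wi i p)).
  by rewrite [RHS]mxE; exact: (congr1 -%R (esym (aE i))).
- by apply: eq_bigr => j _; exact: (esym (fE j)).
- by apply: eq_bigr => j _; exact: (esym (gE j)).
Qed.

Lemma kinetic_first_variation : is_derive (0 : R) (1 : R)
  (fun h => kinetic_action T (velocity Omega) O (fun t X => x t X + h *: dx t X))
  (volume_integral T O x
     (fun t y => dot (- acceleration t y) (eulerian Omega x dx t y))).
Proof.
have [L LP] := flow_constant_w oO xY iO vdx; have [L0 _ _ _ _] := LP.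
have [h0 h00 sm] := small_parameter L0.
rewrite (volume_integral_force xY iO vdx (fun t y => - acceleration t y)).
rewrite -[X in is_derive _ _ _ X]/(local_integral Q (fun p => dot (- spacetime acceleration p) (w p))).
rewrite -kinetic_gradient.
have kin_int : volume_integrable T O x (fun t z => half_square (v t z)).
  apply: (volume_integrable_continuous oO (inverse_smoothl xY) _ (inverse_smoothr xY) _ iO oN NC).
  - by move=> t tT; exact: (inverse_flows_bij xY tT).
  - exact: (inverse_lr xY).
  move=> p Np; have c1 := smooth_on_continuous sv Np.
  have c2 := smooth_on_continuous smooth_half_square (I : setT (spacetime v p)).
  by have := continuous_comp c1 c2; rewrite /spacetime.
apply: (is_derive_volume_integral oQ cK KQ varied_kinetic kin_int _ _ _ h00).
- by move=> p; exact: (displacement_support_volume vdx).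
- by move=> [t z] Qp; exact: (@cylinder_le R d Omega T t z).
- by move=> t z Qp; rewrite carried0.
move=> h /sm sh.
exists (fun t y => half_square (velocity Omega (displaced_flow x dx h) t y)).
  rewrite /kinetic_action /volume_integral; apply: eq_Rintegral => t; rewrite inE/= in_itv/= => tT.
  by have <- := image_displaced xY iO vdx LP sh tT.
move=> t z tT zO.
have Oz : Omega z.
  by case: iO zO => OO _ _ [X OX <-]; exact: (inverse_funl xY tT (OO X OX)).
rewrite (velocity_displaced LP sh tT Oz); case: asboolP => [Qp|nQ].
  have Qg : Q (t, undisplaced w h (t, z)).
    by split; [case: Qp|exact: (undisplaced_Omega xY iO vdx LP sh)].
  exact: (congr1 (fun a => half_square (_ + h *: a)) (esym (displacement_on Y (dt dx) Qg))).
have nK : ~ K (t, z) by move/KQ.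
rewrite (undisplaced_off w0 LP sh nK)/=.
have -> : dt dx t (Y t z) = 0.
  have [sd cd dO] := variation_dt.
  have OY := inverse_funr xY tT Oz.
  apply: (etrans (esym (displacementE xY iO variation_dt tT OY))).
  by rewrite (inverse_rl xY tT Oz); exact: displacement_outside.
by rewrite scaler0 addr0.
Qed.

End KineticFirstVariation.

(** * Bump functions *)

Section SmoothStep.
Context {R : realType}.
Implicit Types x y : R.

(** The functions [x^-n exp(-1/x)], extended by zero to the left of the origin;
    this family is stable under derivation, up to linear combinations. *)
Definition flat (n : nat) (x : R) : R :=
  if 0 < x then x^-1 ^+ n * expR (- x^-1) else 0.

Lemma flat_pos n x : 0 < x -> flat n x = x^-1 ^+ n * expR (- x^-1).
Proof. by rewrite /flat => ->. Qed.

Lemma flat_le0 n x : x <= 0 -> flat n x = 0.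
Proof. by rewrite /flat ltNge => ->. Qed.

Lemma flat_ge0 n x : 0 <= flat n x.
Proof.
rewrite /flat; case: ifP => // x0.
by rewrite mulr_ge0 ?expR_ge0// exprn_ge0// invr_ge0 ltW.
Qed.

Lemma flat_gt0 n x : 0 < x -> 0 < flat n x.
Proof. by move=> x0; rewrite flat_pos// mulr_gt0 ?expR_gt0// exprn_gt0// invr_gt0. Qed.

(** This bound gives differentiability at the origin, where the derivative is
    zero, at every order at once. *)
Lemma flat_quadratic n : exists C, forall x, `|flat n x| <= C * x ^+ 2.
Proof.
exists (n.+2)`!%:R => x; rewrite ger0_norm ?flat_ge0//.
have [x0|x0] := leP x 0; first by rewrite flat_le0// mulr_ge0// sqr_ge0.
rewrite flat_pos// expRN ler_pdivrMr ?expR_gt0//.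
have y0 : 0 <= x^-1 by rewrite invr_ge0 ltW.
(* exp (1/x) exceeds the term of order n+2 of its series in 1/x *)
have := expR_ge1Dxn n.+1 y0; set e := expR _ => H.
have {}H : x^-1 ^+ n.+2 / (n.+2)`!%:R <= e by rewrite (le_trans _ H)// lerDr.
rewrite ler_pdivrMr ?ltr0n ?fact_gt0// in H.
have -> : x^-1 ^+ n = x ^+ 2 * x^-1 ^+ n.+2.
  by rewrite [x^-1 ^+ n.+2]exprS [x^-1 ^+ n.+1]exprS; field; rewrite gt_eqF.
have -> : (n.+2)`!%:R * x ^+ 2 * e = x ^+ 2 * (e * (n.+2)`!%:R) by ring.
by rewrite ler_wpM2l// sqr_ge0.
Qed.

Lemma is_derive_flat n x :
  is_derive x (1 : R) (flat n) (- n%:R * flat n.+1 x + flat n.+2 x).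
Proof.
have [x0|x0|x0] := ltgtP x 0.
- rewrite !flat_le0 ?ltW// mulr0 addr0.
  have o : open [set y : R | y < 0] by exact: open_lt.
  have e : \near x, cst 0 x = flat n x.
    by apply: (open_near o _ x0) => y /= y0; rewrite flat_le0// ltW.
  by apply: near_eq_is_derive e _ => //; rewrite oner_eq0.
- have o : open [set y : R | 0 < y] by exact: open_gt.
  have e : \near x, (fun y => y^-1 ^+ n * expR (- y^-1)) x = flat n x.
    by apply: (open_near o _ x0) => y /= y0; rewrite flat_pos.
  apply: near_eq_is_derive e _ => //; rewrite ?oner_eq0//.
  rewrite !flat_pos//.
  have dV : is_derive x (1 : R) (fun y : R => y^-1) (- x ^- 2 *: 1).
    by apply: is_deriveV; rewrite gt_eqF.
  have dX := is_deriveX (f := fun y : R => y^-1) n dV.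
  have dN : is_derive x (1 : R) (fun y : R => - y^-1) (- (- x ^- 2 *: 1)).
    exact: is_deriveN dV.
  have dE := is_derive1_comp (f := expR) (g := fun y : R => - y^-1) (is_derive_expR _) dN.
  have fE : (fun y : R => y^-1 ^+ n * expR (- y^-1)) =
      (fun y => y^-1) ^+ n * (expR \o (fun y => - y^-1)).
    by apply/funext => y; rewrite /= fctE exprfctE.
  rewrite fE; apply: (is_derive_eq (is_deriveM dX dE)).
  rewrite /= fctE /GRing.scale/= !mulr1.
  rewrite -exprVn; move: (expR _) => q; set y := x^-1.
  by case: n {dX fE} => [|n] /=; rewrite !exprS; ring.
- rewrite x0 !flat_le0// mulr0 addr0.
  have [C HC] := flat_quadratic n.
  apply: (@is_derive_quadratic R _ _ 1 C) => // h _.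
  by rewrite (flat_le0 n (lexx 0)) subr0 mulr0 subr0.
Qed.

Lemma smooth_flat n : smooth_on setT (flat n).
Proof.
apply/smooth_onP => k; elim: k n => // k IH n.
have df x : differentiable (flat n) x by apply/derivable1_diffP; case: (is_derive_flat n x).
apply: smooth_uptoS; [exact: openT|by move=> x _; exact: df|move=> v].
exists (cst v * (cst (- n%:R) * flat n.+1 + flat n.+2)).
  have sc (a : R) : smooth_upto k setT (cst a : R -> R) by exact: smooth_upto_cst openT.
  exact: (smooth_upto_mul openT (sc v) (smooth_upto_add openT
    (smooth_upto_mul openT (sc _) (IH n.+1)) (IH n.+2))).
move=> x _; have [_ e] := is_derive_flat n x.
have vE : v = v *: (1 : R) by rewrite /GRing.scale/= mulr1.
by apply: (etrans (congr1 (fun k => 'D_k (flat n) x) vE)); rewrite (derive_scalev _ _ (df x)) e.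
Qed.

Lemma smooth_inv (U : set R) : open U -> (forall x, U x -> x != 0) ->
  smooth_on U (fun x => x^-1).
Proof.
move=> oU U0; apply/smooth_onP => k; elim: k => // k IH.
have dV x : U x -> is_derive x (1 : R) (fun y : R => y^-1) (- x ^- 2 *: 1).
  by move=> Ux; apply: is_deriveV; exact: U0.
have df x : U x -> differentiable (fun y : R => y^-1) x.
  by move=> Ux; apply/derivable1_diffP; case: (dV x Ux).
apply: smooth_uptoS => // v.
exists (cst (- v) * ((fun y : R => y^-1) * (fun y : R => y^-1))).
  have sc (a : R) : smooth_upto k U (cst a : R -> R) by exact: smooth_upto_cst oU.
  have sm := smooth_upto_mul oU IH IH.
  exact: (smooth_upto_mul oU (sc (- v)) sm).
move=> x Ux; have [_ e] := dV x Ux.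
have vE : v = v *: (1 : R) by rewrite /GRing.scale/= mulr1.
apply: (etrans (congr1 (fun k => 'D_k (fun y : R => y^-1) x) vE)).
rewrite (derive_scalev _ _ (df x Ux)) e /GRing.scale/= !fctE.
by rewrite mulr1 mulrN mulNr expr2 invfM.
Qed.

(** Segments are run through by this step rather than uniformly, which makes
    line integrals integrals of smooth test functions over the whole line. *)
Definition smooth_step (x : R) : R := flat 0 x / (flat 0 x + flat 0 (1 - x)).

Lemma smooth_step_den x : 0 < flat 0 x + flat 0 (1 - x).
Proof.
have [x0|x0] := ltP 0 x; first by rewrite ltr_pwDl ?flat_gt0 ?flat_ge0.
by rewrite ltr_wpDl ?flat_ge0// flat_gt0// subr_gt0 (le_lt_trans x0).
Qed.

Lemma smooth_step_le0 x : x <= 0 -> smooth_step x = 0.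
Proof. by move=> x0; rewrite /smooth_step flat_le0// mul0r. Qed.

Lemma smooth_step_ge1 x : 1 <= x -> smooth_step x = 1.
Proof.
move=> x1; rewrite /smooth_step [flat 0 (1 - x)]flat_le0 ?subr_le0// addr0 divff//.
by rewrite gt_eqF// flat_gt0// (lt_le_trans ltr01).
Qed.

Lemma smooth_step_ge0 x : 0 <= smooth_step x.
Proof. by rewrite mulr_ge0 ?flat_ge0// invr_ge0 ltW// smooth_step_den. Qed.

Lemma smooth_step_le1 x : smooth_step x <= 1.
Proof. by rewrite ler_pdivrMr ?smooth_step_den// mul1r lerDl flat_ge0. Qed.

Lemma smooth_flat_comp (X : normedModType R) (U : set X) (f : X -> R) n : open U ->
  smooth_on U f -> smooth_on U (fun q => flat n (f q)).
Proof.
move=> oU sf; exact: (@smooth_comp _ _ _ U setT (flat n) f finite_basisR oU openT (fun _ _ => I) (@smooth_flat n) sf).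
Qed.

Lemma smooth_smooth_step : smooth_on setT smooth_step.
Proof.
have s1 : smooth_on setT (flat 0) by exact: smooth_flat.
have s2 : smooth_on setT (fun x : R => flat 0 (1 - x)).
  apply: (smooth_flat_comp _ openT).
  by apply: (smooth_sub openT); [exact: smooth_cst openT|exact: smooth_id openT].
apply: (smooth_mul openT s1).
have o : open [set y : R | 0 < y] by exact: open_gt.
have sV : smooth_on [set y : R | 0 < y] (fun x => x^-1).
  by apply: smooth_inv => // x /= x0; rewrite gt_eqF.
have sD : smooth_on setT (fun x => flat 0 x + flat 0 (1 - x)) by exact: smooth_add openT s1 s2.
exact: (@smooth_comp _ _ _ setT _ _ _ finite_basisR openT o (fun x _ => smooth_step_den x) sV sD).
Qed.

Definition bump (x : R) : R := flat 0 (1 + x) * flat 0 (1 - x).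

Lemma bump_ge0 x : 0 <= bump x. Proof. by rewrite mulr_ge0 ?flat_ge0. Qed.

Lemma bump_gt0 x : `|x| < 1 -> 0 < bump x.
Proof. by rewrite ltr_norml => /andP[a b]; rewrite mulr_gt0// flat_gt0 ?subr_gt0// addrC -[1]opprK subr_gt0. Qed.

Lemma bump_off x : 1 <= `|x| -> bump x = 0.
Proof.
rewrite /bump; have [x0|x0] := leP 0 x.
  by rewrite ger0_norm// => x1; rewrite [X in _ * X]flat_le0 ?mulr0// subr_le0.
by rewrite ltr0_norm// => x1; rewrite [X in X * _]flat_le0 ?mul0r// -[x]opprK subr_le0.
Qed.

Lemma smooth_bump (X : normedModType R) (U : set X) (f : X -> R) : open U ->
  smooth_on U f -> smooth_on U (fun q => bump (f q)).
Proof.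
move=> oU sf; apply: (smooth_mul oU).
  by apply: smooth_flat_comp => //; apply: smooth_add => //; exact: smooth_cst.
by apply: smooth_flat_comp => //; apply: smooth_sub => //; exact: smooth_cst.
Qed.

End SmoothStep.

Section BoxBumps.
Context {R : realType} {d : nat}.
Notation V := 'rV[R]_d.
Notation E := (R * 'rV[R]_d)%type.

Definition box_bump (c : V) (r : R) (z : V) : R := \prod_i bump (r^-1 * (z ord0 i - c ord0 i)).

Lemma smooth_box_bump (X : normedModType R) (U : set X) (f : X -> V) c r : open U ->
  smooth_on U f -> smooth_on U (fun x => box_bump c r (f x)).
Proof.
move=> oU sf; apply: smooth_prod => // i; apply: smooth_bump => //.
apply: smooth_mul => //; first exact: smooth_cst.
apply: smooth_sub => //; first exact: smooth_coord.
exact: smooth_cst.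
Qed.

Lemma box_bump_ge0 c r z : 0 <= box_bump c r z.
Proof. by apply: prodr_ge0 => i _; exact: bump_ge0. Qed.

Lemma box_bump_gt0 c r : 0 < r -> 0 < box_bump c r c.
Proof.
move=> r0; apply: prodr_gt0 => i _; apply: bump_gt0.
by rewrite subrr mulr0 normr0.
Qed.

Lemma box_bump_off c r z : 0 < r -> r <= `|z - c| -> box_bump c r z = 0.
Proof.
move=> r0 rz.
suff [i iP] : exists i, 1 <= `|r^-1 * (z ord0 i - c ord0 i)|.
  by rewrite /box_bump (bigD1 i)//= bump_off// mul0r.
apply: contrapT => nP; move: rz; apply/negP; rewrite -ltNge.
rewrite -[`|z - c|]/(mx_norm (z - c)) mx_normrE; apply/bigmax_ltP; split => // -[j i] _ /=.
rewrite ord1 ltNge; apply/negP => ri; apply: nP; exists i.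
by rewrite normrM gtr0_norm ?invr_gt0// mulrC ler_pdivlMr// mul1r; rewrite !mxE in ri.
Qed.

End BoxBumps.

(** * Uniqueness of forces *)

Section FundamentalLemma.
Context {R : realType}.

(** Forces of the action principle are tested in space-time, those of the
    dissipation principle in space at a fixed time. *)
Definition has_bumps (X : normedModType R) : Prop := forall (c : X) (r : R), 0 < r ->
  exists rho : X -> R, [/\ smooth_on setT rho, forall p, 0 <= rho p, 0 < rho c &
    forall p, r <= `|p - c| -> rho p = 0].

Lemma has_bumps_rV d : has_bumps 'rV[R]_d.
Proof.
move=> c r r0; exists (box_bump c r); split.
- by apply: smooth_box_bump; [exact: openT|exact: smooth_id openT].
- by move=> p; exact: box_bump_ge0.
- exact: box_bump_gt0.
- by move=> p; exact: box_bump_off.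
Qed.

Lemma smooth_fst (X1 X2 : normedModType R) (U : set (X1 * X2)%type) : open U ->
  smooth_on U (fun p : X1 * X2 => p.1).
Proof. by move=> oU; apply: (@smooth_linear _ _ _ _ fst) => // p; exact: cvg_fst. Qed.

Lemma smooth_snd (X1 X2 : normedModType R) (U : set (X1 * X2)%type) : open U ->
  smooth_on U (fun p : X1 * X2 => p.2).
Proof. by move=> oU; apply: (@smooth_linear _ _ _ _ snd) => // p; exact: cvg_snd. Qed.

Lemma has_bumps_spacetime d : has_bumps (R * 'rV[R]_d)%type.
Proof.
move=> c r r0; exists (fun p => bump (r^-1 * (p.1 - c.1)) * box_bump c.2 r p.2); split.
- have s1 := @smooth_fst R 'rV[R]_d setT openT; have s2 := @smooth_snd R 'rV[R]_d setT openT.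
  apply: smooth_mul; first exact: openT.
    apply: smooth_bump; first exact: openT.
    apply: smooth_mul; [exact: openT|exact: smooth_cst openT|].
    by apply: smooth_sub; [exact: openT|exact: s1|exact: smooth_cst openT].
  by apply: smooth_box_bump; [exact: openT|exact: s2].
- by move=> p; rewrite mulr_ge0 ?bump_ge0// box_bump_ge0.
- by rewrite subrr mulr0 mulr_gt0 ?box_bump_gt0// bump_gt0 ?normr0.
- move=> p; rewrite prod_normE le_max /= => /orP[rp|rp].
    rewrite bump_off ?mul0r// normrM gtr0_norm ?invr_gt0//.
    by rewrite mulrC ler_pdivlMr// mul1r.
  by rewrite box_bump_off ?mulr0.
Qed.

Lemma supp_off (X W : normedModType R) (f : X -> W) p : ~ supp f p -> f p = 0.
Proof. by move=> nf; apply/eqP; apply: contra_notT nf => fp; exact: subset_closure. Qed.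

Lemma supp_sub (X W : normedModType R) (f : X -> W) (K : set X) : closed K ->
  (forall p, ~ K p -> f p = 0) -> supp f `<=` K.
Proof.
move=> cK f0; rewrite [X in _ `<=` X](closure_id K).1//; apply: closure_subset => p /= fp.
by apply: contrapT => /f0 e; rewrite e eqxx in fp.
Qed.

Section OneChart.
Context dd (T : measurableType dd) (X : normedModType R).
Context (nu : {measure set T -> \bar R}) (e : T -> X).
Hypothesis ch : chart nu e.

Lemma norm_ball_compact (c : X) r : compact [set p | `|p - c| <= r].
Proof.
have cl : closed [set p : X | `|p - c| <= r].
  have : closed ((fun p : X => `|p - c|) @^-1` [set y : R | y <= r]).
    apply: closed_comp; last exact: closed_le.
    move=> p _; apply: (@continuous_comp _ _ _ (fun p : X => p - c) (@Num.norm R X)).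
      by apply: cvgB; [exact: cvg_id|exact: cvg_cst].
    exact: norm_continuous.
  by [].
apply: subclosed_compact cl (chart_cpt ch (M := r + `|c|)) _ => p /= pr.
by rewrite -[p](subrK c) (le_trans (ler_normD _ _))// lerD2r.
Qed.

Lemma bump_support (U : set X) c : has_bumps X -> open U -> U c ->
  exists rho : X -> R, [/\ smooth_on setT rho /\ 0 < rho c, forall p, 0 <= rho p,
    compact (supp rho) & supp rho `<=` U].
Proof.
move=> hb oU Uc.
have /nbhs_ballP[r r0 rU] : nbhs c U by exact: open_nbhs_nbhs.
have r2 : 0 < r / 2 by rewrite divr_gt0.
have [rho [srho rho0 rhoc rhooff]] := hb c (r / 2) r2.
have cK := @norm_ball_compact c (r / 2).
have clK := compact_closed (@norm_hausdorff _ _) cK.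
have sK : supp rho `<=` [set p | `|p - c| <= r / 2].
  by apply: supp_sub => // p /= /negP; rewrite -ltNge => /ltW/rhooff.
exists rho; split => //; first exact: subclosed_compact (@closed_closure _ _) cK sK.
move=> p /sK /= pr; apply: rU; rewrite -ball_normE /ball_/= distrC (le_lt_trans pr)//.
by rewrite ltr_pdivrMr// ltr_pMr// ltr1n.
Qed.

(** Tested against a bump concentrated where [h] keeps a sign, the integral
    would not be zero. *)
Lemma fundamental_lemma (U : set X) (h : X -> R) : has_bumps X -> open U ->
  (forall p, U p -> {for p, continuous h}) ->
  (forall rho : X -> R, smooth_on setT rho -> compact (supp rho) -> supp rho `<=` U ->
     \int[nu]_z (rho (e z) * h (e z)) = 0) ->
  forall p, U p -> h p = 0.
Proof.
move=> hb oU ch0 H c Uc; apply: contrapT => hc.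
have h2 : 0 < h c * h c by rewrite -expr2 exprn_even_gt0//=; apply/eqP.
have ck p : U p -> {for p, continuous (fun p => h p * h c)}.
  by move=> Up; apply: cvgM; [exact: ch0|exact: cvg_cst].
pose A := [set p | U p /\ 0 < h p * h c].
have oA : open A.
  rewrite openE => p [Up hp]; apply: filterI; first exact: open_nbhs_nbhs.
  have := ck p Up _ (open_nbhs_nbhs (conj (@open_gt R 0) hp)).
  by [].
have [rho [[srho rhoc] rho0 cs sA]] := bump_support hb oA (conj Uc h2).
have sU : supp rho `<=` U by move=> p /sA[].
pose F p := rho p * h p.
have tF : test_fun F.
  apply: (test_fun_off oU cs sU) => [p Up|p /supp_off e0].
    by apply: cvgM; [exact: (smooth_on_continuous srho)|exact: ch0].
  by rewrite /F e0 mul0r.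
have := integral_testZ ch (h c) tF; rewrite (H rho srho cs sU) mulr0 => I0.
have tG := test_funZ (h c) tF.
suff : 0 < \int[nu]_z (h c * F (e z)) by rewrite I0 ltxx.
apply: (integral_chart_gt0 ch (f := fun p => h c * F p) (x0 := c) tG).
  move=> p; have [sp|/supp_off e0] := pselect (supp rho p); last by rewrite /F e0 mul0r mulr0.
  by have [_ hp] := sA p sp; rewrite mulrCA mulr_ge0// mulrC ltW.
by rewrite mulrCA mulr_gt0.
Qed.

End OneChart.
End FundamentalLemma.

Section ForceUniqueness.
Context {R : realType} {d : nat}.
Notation V := 'rV[R]_d.
Notation E := (R * 'rV[R]_d)%type.
Variables (Omega : set V) (T : R) (x Y : R -> V -> V).
Hypotheses (oO : open Omega) (xY : inverse_flows Omega T x Y).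
Let Q := cylinder Omega T.
Let oQ : open Q. Proof. exact: open_cylinder. Qed.

(** The test field, carried back to material coordinates by the flow map, is
    the variation: flow map and inverse flow play symmetric parts. Hence forces
    are tested against all Eulerian fields. *)
Lemma test_field_variation (W : E -> V) : smooth_on setT W -> compact (supp W) ->
  supp W `<=` Q -> exists O dx, [/\ initial_volume Omega O, Defs.variation T O dx &
    forall p, Q p -> displacement Omega T Y dx p = W p].
Proof.
move=> sW cW WQ; pose W' t z := W (t, z).
have W'E : spacetime W' = W by apply/funext => -[].
have Yx := inverse_flows_sym xY.
pose dx t X := transplant Omega T x W' (t, X).
have dxE : spacetime dx = transplant Omega T x W' by apply/funext => -[].
have sW' : smooth_on setT (spacetime W') by rewrite W'E.
have cW' : compact (supp (spacetime W')) by rewrite W'E.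
have W'Q : supp (spacetime W') `<=` cylinder Omega T by rewrite W'E.
have sdx := transplant_smooth oO Yx sW' cW' W'Q.
have cdx := transplant_supp_compact Yx cW' W'Q.
have dxQ := transplant_supp_cylinder Yx cW' W'Q.
have [M [_ HM]] := compact_bounded cdx.
pose O := Omega `&` [set z | `|z| < M + 1].
have oB : open O.
  apply: openI => //.
  have : open ((fun z : V => `|z|) @^-1` [set y : R | y < M + 1]).
    by apply: open_comp; [move=> z _; exact: norm_continuous|exact: open_lt].
  by [].
exists O, dx; split.
- split; first by move=> z [].
    exists (M + 1); split; first exact: num_real.
    by move=> N MN z [_ /= zM]; rewrite ltW// (lt_trans zM).
  exact: (chart_open (@chart_rV R d) oB).
- split; [by rewrite dxE|by rewrite dxE|].
  rewrite dxE => -[t X] tX; have [tT OX] := dxQ _ tX; split => //.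
  move/interior_id: oB => ->; split => //=.
  have M2 : M < M + 2^-1 by rewrite ltrDl invr_gt0 ltr0n.
  have : `|(t, X)| <= M + 2^-1 by exact: (HM _ M2 _ tX).
  rewrite prod_normE ge_max/= => /andP[_ H]; rewrite (le_lt_trans H)// ltrD2l.
  by rewrite invf_lt1// ltr1n.
- move=> [t z] Qp; have [tT Oz] := Qp; have tT' := cylinder_le Qp.
  apply: (etrans (displacement_on Y dx Qp)); rewrite /dx /transplant /=.
  have Qy : cylinder Omega T (t, Y t z) by split => //=; exact: (inverse_funr xY).
  by case: asboolP => // _; rewrite /W' (inverse_rl xY).
Qed.

(** Both fields represent the derivative of the same function at zero, for the
    variation whose displacement is [W]. *)
Lemma first_variation_weak (adm : (R -> V -> V) -> Prop) J f g (W : E -> V) :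
  first_variation Omega T adm J x f -> first_variation Omega T adm J x g ->
  smooth_on setT W -> compact (supp W) -> supp W `<=` Q ->
  (forall dx, (forall p, Q p -> displacement Omega T Y dx p = W p) -> adm dx) ->
  local_integral Q (fun p => dot (spacetime f p) (W p)) =
  local_integral Q (fun p => dot (spacetime g p) (W p)).
Proof.
move=> [_ Hf] [_ Hg] sW cW WQ aW.
have [B [dx [iO vdx dW]]] := test_field_variation sW cW WQ.
have ad := aW dx dW.
have [_ e1] := Hf B dx iO vdx ad; have [_ e2] := Hg B dx iO vdx ad.
have E' (k : R -> V -> V) : local_integral Q (fun p => dot (spacetime k p) (W p)) =
    volume_integral T B x (fun t y => dot (k t y) (eulerian Omega x dx t y)).
  rewrite (volume_integral_force xY iO vdx k).
  by apply: eq_local_integral => p Qp; rewrite (dW p Qp).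
by rewrite !E' -e1 -e2.
Qed.

Lemma local_integral_fundamental (f g : E -> V) : smooth_on Q f -> smooth_on Q g ->
  (forall W : E -> V, smooth_on setT W -> compact (supp W) -> supp W `<=` Q ->
     local_integral Q (fun p => dot (f p) (W p)) = local_integral Q (fun p => dot (g p) (W p))) ->
  forall p, Q p -> f p = g p.
Proof.
move=> sf sg H p Qp; apply/rowP => i; apply/eqP; rewrite -subr_eq0; apply/eqP.
have ch := @chart_spacetime R d.
have sfi := smooth_coord i oQ sf; have sgi := smooth_coord i oQ sg.
apply: (fundamental_lemma ch (h := fun q => f q ord0 i - g q ord0 i) (U := Q)) => //.
- exact: has_bumps_spacetime.
- move=> q Qq; apply: cvgB; first exact: (smooth_on_continuous sfi Qq).
  exact: (smooth_on_continuous sgi Qq).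
move=> rho srho crho rhoQ.
pose W q := rho q *: (delta_mx ord0 i : V).
have sW : smooth_on setT W by exact: (smooth_scalel _ openT srho).
have W0 q : ~ supp rho q -> W q = 0 by move=> /supp_off e; rewrite /W e scale0r.
have sWs : supp W `<=` supp rho by apply: supp_sub => //; exact: closed_closure.
have cW := subclosed_compact (@closed_closure _ _) crho sWs.
have dE (k : V) q : dot k (W q) = rho q * k ord0 i.
  rewrite dotC dotZl /dot (bigD1 i)//= big1 ?addr0 => [|j ji].
    by rewrite mxE !eqxx mul1r.
  by rewrite mxE eqxx (negbTE ji) mul0r.
have t (k : E -> V) : smooth_on Q k -> local_test Q (supp rho) (fun q => rho q * k q ord0 i).
  move=> sk; split.
    apply: smooth_mul => //; [exact: smooth_onS srho|exact: smooth_coord].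
  by move=> q _ /supp_off ->; rewrite mul0r.
have := H W sW cW (subset_trans sWs rhoQ).
have eE (k : E -> V) : local_integral Q (fun q => dot (k q) (W q)) =
    local_integral Q (fun q => rho q * k q ord0 i).
  by apply: eq_local_integral => q _; exact: dE.
rewrite !eE => /eqP; rewrite -subr_eq0 => /eqP I0.
have ts := local_testM oQ (smooth_cst (-1 : R) oQ) (t g sg).
rewrite -[LHS](spacetime_integralE (F := fun q => rho q * (f q ord0 i - g q ord0 i))); last first.
  apply: (test_fun_off oQ crho rhoQ) => [q Qq|q /supp_off ->]; last by rewrite mul0r.
  apply: cvgM; first exact: (smooth_on_continuous srho).
  apply: cvgB; first exact: (smooth_on_continuous sfi Qq).
  exact: (smooth_on_continuous sgi Qq).
rewrite -[RHS]I0 -mulN1r -(local_integralZ oQ crho rhoQ (-1) (t g sg)).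
rewrite -(local_integralD oQ crho rhoQ (t f sf) ts).
apply: eq_spacetime_integral => q; rewrite /zero_extend; case: asboolP => [_|nQ].
  by rewrite mulrBr mulN1r.
by rewrite supp_off ?mul0r// => /rhoQ.
Qed.

End ForceUniqueness.

(** * Dissipation at a fixed time *)

Section SpatialTestFunctions.
Context {R : realType} {d : nat}.
Notation V := 'rV[R]_d.
Variables (Omega K : set V).
Hypotheses (oO : open Omega) (cK : compact K) (KO : K `<=` Omega).
Implicit Types f g : V -> R.

Definition spatial_test f : Prop := smooth_on Omega f /\ forall z, ~ K z -> f z = 0.

Lemma spatial_test_fun f : spatial_test f -> test_fun f.
Proof.
by move=> [sf f0]; apply: (test_fun_off oO cK KO) => // z; exact: smooth_on_continuous.
Qed.

Lemma spatial_testM f g : smooth_on Omega f -> spatial_test g ->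
  spatial_test (fun z => f z * g z).
Proof.
by move=> sf [sg g0]; split=> [|z /g0 ->]; [exact: smooth_mul|rewrite mulr0].
Qed.

Lemma spatial_testD f g : spatial_test f -> spatial_test g ->
  spatial_test (fun z => f z + g z).
Proof.
move=> [sf f0] [sg g0]; split; first exact: smooth_add.
by move=> z nz; rewrite f0// g0// addr0.
Qed.

Lemma spatial_test_sum (I : Type) (s : seq I) (f : I -> V -> R) :
  (forall i, spatial_test (f i)) -> spatial_test (fun z => \sum_(i <- s) f i z).
Proof.
move=> tf; split; first by apply: smooth_sum => // i; case: (tf i).
by move=> z nz; rewrite big1// => i _; case: (tf i) => _; apply.
Qed.

Lemma spatial_test_derive g v : spatial_test g -> spatial_test ('D_v g).
Proof.
move=> [sg g0]; split; first exact: smooth_on_derive.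
have clK : closed K := compact_closed (@norm_hausdorff _ _) cK.
move=> z nz; apply: (etrans (near_derive_eq (g := cst 0) _ _)); last exact: derive_cst.
exact: (open_near (closed_openC clK) _ nz).
Qed.

Lemma integral_rV_test f : spatial_test f ->
  integral_rV Omega f = \int[leb R d]_z f (crd R d z).
Proof.
move=> [_ f0]; rewrite /integral_rV Rintegral_mkcond; apply: eq_Rintegral => z _.
rewrite patchE; case: ifPn => //; rewrite notin_setE => nO.
by rewrite f0// => /KO.
Qed.

Lemma integrable_rV_test f : spatial_test f -> integrable_rV Omega f.
Proof.
move=> tf; have ch := @chart_rV R d.
apply: integrableS (test_fun_integrable ch (spatial_test_fun tf)) => //.
exact: (chart_open ch oO).
Qed.

Lemma integral_rV_testD f g : spatial_test f -> spatial_test g ->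
  integral_rV Omega (fun z => f z + g z) = integral_rV Omega f + integral_rV Omega g.
Proof.
move=> tf tg; rewrite !integral_rV_test//; last exact: spatial_testD.
exact: (integral_testD (@chart_rV R d) (spatial_test_fun tf) (spatial_test_fun tg)).
Qed.

Lemma spatial_testZ k f : spatial_test f -> spatial_test (fun z => k * f z).
Proof. by apply: spatial_testM; exact: smooth_cst. Qed.

Lemma integral_rV_testZ k f : spatial_test f ->
  integral_rV Omega (fun z => k * f z) = k * integral_rV Omega f.
Proof.
move=> tf; rewrite !integral_rV_test//; last exact: spatial_testZ.
exact: (integral_testZ (@chart_rV R d) k (spatial_test_fun tf)).
Qed.

Lemma integral_rV_test_sum (I : Type) (s : seq I) (f : I -> V -> R) :
  (forall i, spatial_test (f i)) ->
  integral_rV Omega (fun z => \sum_(i <- s) f i z) = \sum_(i <- s) integral_rV Omega (f i).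
Proof.
move=> tf; elim: s => [|i s IH].
  rewrite big_nil /integral_rV; under eq_Rintegral do rewrite big_nil.
  by rewrite Rintegral_cst ?mul0r//; exact: (chart_open (@chart_rV R d) oO).
rewrite big_cons -IH -integral_rV_testD//; last exact: spatial_test_sum.
by apply: eq_Rintegral => z _; rewrite big_cons.
Qed.

Lemma eq_integral_rV f g : (forall z, Omega z -> f z = g z) ->
  integral_rV Omega f = integral_rV Omega g.
Proof. by move=> fg; apply: eq_Rintegral => z; rewrite inE => /fg. Qed.

Lemma spatial_test_smooth f : spatial_test f -> smooth_on setT f.
Proof.
move=> [sf f0]; have clK : closed K := compact_closed (@norm_hausdorff _ _) cK.
have -> : setT = Omega `|` ~` K.
  by apply/esym/seteqP; split=> // p _; have [/KO|] := pselect (K p); [left|right].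
apply: smooth_onU => //.
apply: (smooth_on_ext (closed_openC clK) _ (smooth_cst 0 (closed_openC clK))) => z nK.
by rewrite f0.
Qed.

Lemma spatial_parts f g i : smooth_on Omega f -> spatial_test g ->
  integral_rV Omega (fun z => f z * partial i g z) =
  - integral_rV Omega (fun z => partial i f z * g z).
Proof.
move=> sf tg; have [sg g0] := tg.
have t1 : spatial_test (fun z => f z * partial i g z).
  by apply: spatial_testM => //; exact: spatial_test_derive.
have t2 : spatial_test (fun z => partial i f z * g z).
  by apply: spatial_testM => //; exact: smooth_on_derive.
have tF : spatial_test (fun z => f z * g z) by exact: spatial_testM.
have sF := spatial_test_smooth tF.
apply/eqP; rewrite -addr_eq0 -integral_rV_testD//; apply/eqP.
have e : \int[leb R d]_z partial i (fun z => f z * g z) (crd R d z) = 0.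
  apply: integral_partial; first exact: spatial_test_fun.
    by move=> z; apply: diff_derivable; exact: (smooth_on_differentiable sF).
  by move=> z; exact: (smooth_on_continuous (smooth_on_derive _ sF)).
apply: (etrans (eq_integral_rV (g := partial i (fun z => f z * g z)) _)).
  move=> z Oz; have df : derivable f z (delta_mx ord0 i).
    by apply: diff_derivable; exact: (smooth_on_differentiable sf).
  have dg : derivable g z (delta_mx ord0 i).
    by apply: diff_derivable; exact: (smooth_on_differentiable sg).
  apply: (etrans _ (esym (deriveM df dg))).
  exact: (congr1 (fun a => f z * partial i g z + a) (mulrC _ _)).
rewrite integral_rV_test//; exact: spatial_test_derive.
Qed.

(** Half the variation of a quadratic functional is its polar form: the
    corrections to the base density have compact support, so that only the
    base density has to be assumed integrable. *)
Lemma is_derive_quadratic_integral (q : R -> V -> R) (q0 g1 g2 : V -> R) :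
  integrable_rV Omega q0 -> spatial_test g1 -> spatial_test g2 ->
  (forall h z, Omega z -> q h z = q0 z + ((2 * h) * g1 z + h ^+ 2 * g2 z)) ->
  is_derive (0 : R) (1 : R) (fun h => 2^-1 * integral_rV Omega (q h)) (integral_rV Omega g1).
Proof.
move=> iq t1 t2 qE.
have JE h : integral_rV Omega (q h) = integral_rV Omega q0 +
    ((2 * h) * integral_rV Omega g1 + h ^+ 2 * integral_rV Omega g2).
  have tc := spatial_testD (spatial_testZ (2 * h) t1) (spatial_testZ (h ^+ 2) t2).
  rewrite (eq_integral_rV (qE h)) -integral_rV_testZ// -integral_rV_testZ//.
  rewrite -integral_rV_testD; [|exact: spatial_testZ|exact: spatial_testZ].
  apply: (RintegralD (f1 := q0 \o crd R d)) => //.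
    exact: (chart_open (@chart_rV R d) oO).
  exact: (integrable_rV_test tc).
apply: (@is_derive_quadratic R _ _ 1 `|2^-1 * integral_rV Omega g2|) => // h _.
rewrite !JE [X in `|X|](_ : _ = h ^+ 2 * (2^-1 * integral_rV Omega g2)); last by field.
by rewrite normrM (ger0_norm (sqr_ge0 h)) mulrC lexx.
Qed.

Variables (phi theta : V -> R) (u v : V -> V) (eta : R -> R -> R) (nu : R).
Hypotheses (sphi : smooth_on Omega phi) (su : smooth_on Omega u) (sv : smooth_on Omega v)
  (seta : smooth_on Omega (fun z => eta (phi z) (theta z)))
  (fin : integrable_rV Omega (dissipation_density eta nu phi theta u v)).
Variable du : V -> V.
Hypotheses (sdu : smooth_on setT du) (du0 : forall z, ~ K z -> du z = 0).

Definition friction (z : V) : V :=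
  (eta (phi z) (theta z) * dot (u z - v z) (grad phi z)) *: grad phi z.

Let sgphi : smooth_on Omega (grad phi).
Proof.
apply: smooth_row => // i; apply: (smooth_on_ext oO _ (smooth_on_derive (delta_mx ord0 i) sphi)).
by move=> z _; rewrite mxE.
Qed.

Let a z := dot (u z - v z) (grad phi z).
Let b z := dot (du z) (grad phi z).

Let sa : smooth_on Omega a.
Proof. by apply: smooth_dot => //; exact: smooth_sub. Qed.

Let tb : spatial_test b.
Proof.
split; first by apply: smooth_dot => //; exact: smooth_onS sdu.
by move=> z nK; rewrite /b du0// dot0l.
Qed.

Let e z := eta (phi z) (theta z).

Let teab : spatial_test (fun z => e z * a z * b z).
Proof. by apply: spatial_testM => //; exact: smooth_mul. Qed.

Let tebb : spatial_test (fun z => e z * b z * b z).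
Proof. by apply: spatial_testM => //; apply: smooth_mul => //; case: tb. Qed.

(** The viscous term does not contain [u] and stays in the base density, with
    the square of the unperturbed friction. *)
Lemma friction_variation_u : is_derive (0 : R) (1 : R)
  (fun h => 2^-1 * dissipation Omega eta nu phi theta (fun z => u z + h *: du z) v)
  (integral_rV Omega (fun z => dot (friction z) (du z))).
Proof.
have -> : integral_rV Omega (fun z => dot (friction z) (du z)) =
    integral_rV Omega (fun z => e z * a z * b z).
  by apply: eq_integral_rV => z _; rewrite /friction dotZl [dot (grad _ _) _]dotC.
apply: (is_derive_quadratic_integral fin teab tebb) => h z Oz.
rewrite /dissipation_density !real_normK ?num_real//.
have -> : u z + h *: du z - v z = (u z - v z) + h *: du z by rewrite addrAC.
rewrite dotDl dotZl -/(a z) -/(b z) -/(e z); ring.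
Qed.

Let vi i z := v z ord0 i.
Let dui i z := du z ord0 i.

Let svi i : smooth_on Omega (vi i). Proof. exact: smooth_coord. Qed.

Let tdui i : spatial_test (dui i).
Proof.
split; first by apply: smooth_coord => //; exact: smooth_onS sdu.
by move=> z nK; rewrite /dui du0// mxE.
Qed.

Let c z := \sum_i \sum_j partial j (vi i) z * partial j (dui i) z.
Let c2 z := \sum_i \sum_j partial j (dui i) z * partial j (dui i) z.

Let tc : spatial_test c.
Proof.
apply: spatial_test_sum => i; apply: spatial_test_sum => j.
apply: spatial_testM; first exact: smooth_on_derive.
exact: spatial_test_derive.
Qed.

Let tc2 : spatial_test c2.
Proof.
apply: spatial_test_sum => i; apply: spatial_test_sum => j.
have t := spatial_test_derive (delta_mx ord0 j) (tdui i).
by apply: spatial_testM => //; case: t.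
Qed.

Lemma laplacianE (f : V -> R) z : laplacian f z = \sum_j partial j (partial j f) z.
Proof.
apply: eq_bigr => j _.
have fE : (fun y => grad f y ord0 j) = partial j f by apply/funext => y; rewrite mxE.
by rewrite fE.
Qed.

Let viscous : integral_rV Omega c = - integral_rV Omega (fun z => dot (vlaplacian v z) (du z)).
Proof.
pose F i j z := partial j (vi i) z * partial j (dui i) z.
pose G i j z := partial j (partial j (vi i)) z * dui i z.
have tF i j : spatial_test (F i j).
  apply: spatial_testM; first exact: smooth_on_derive.
  exact: spatial_test_derive.
have tG i j : spatial_test (G i j).
  apply: spatial_testM => //; do 2 apply: smooth_on_derive; exact: svi.
have e1 : integral_rV Omega c = \sum_i \sum_j integral_rV Omega (F i j).
  apply: (etrans (integral_rV_test_sum (index_enum 'I_d) (fun i => spatial_test_sum (index_enum 'I_d) (tF i)))).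
  by apply: eq_bigr => i _; exact: (integral_rV_test_sum (index_enum 'I_d) (tF i)).
have e2 : integral_rV Omega (fun z => dot (vlaplacian v z) (du z)) =
    \sum_i \sum_j integral_rV Omega (G i j).
  apply: (etrans (eq_integral_rV (g := fun z => \sum_i \sum_j G i j z) _)).
    move=> z _; apply: eq_bigr => i _; rewrite mxE laplacianE mulr_suml.
    by apply: eq_bigr.
  apply: (etrans (integral_rV_test_sum (index_enum 'I_d) (fun i => spatial_test_sum (index_enum 'I_d) (tG i)))).
  by apply: eq_bigr => i _; exact: (integral_rV_test_sum (index_enum 'I_d) (tG i)).
rewrite e1 e2 -sumrN; apply: eq_bigr => i _; rewrite -sumrN; apply: eq_bigr => j _.
exact: (spatial_parts j (smooth_on_derive _ (svi i)) (tdui i)).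
Qed.

Lemma dissipation_variation_v : is_derive (0 : R) (1 : R)
  (fun h => 2^-1 * dissipation Omega eta nu phi theta u (fun z => v z + h *: du z))
  (integral_rV Omega (fun z => dot (- friction z - nu *: vlaplacian v z) (du z))).
Proof.
pose g1 z := -1 * (e z * a z * b z) + nu * c z.
pose g2 z := e z * b z * b z + nu * c2 z.
have t1 : spatial_test g1 by apply: spatial_testD; exact: spatial_testZ.
have t2 : spatial_test g2 by apply: spatial_testD => //; exact: spatial_testZ.
have tl : spatial_test (fun z => dot (vlaplacian v z) (du z)).
  apply: spatial_test_sum => i; apply: spatial_testM; last exact: (tdui i).
  have sl : smooth_on Omega (fun z => \sum_j partial j (partial j (vi i)) z).
    apply: smooth_sum => // j; do 2 apply: smooth_on_derive; exact: svi.
  by apply: (smooth_on_ext oO _ sl) => z _; rewrite mxE laplacianE.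
have gI : integral_rV Omega g1 =
    integral_rV Omega (fun z => dot (- friction z - nu *: vlaplacian v z) (du z)).
  rewrite integral_rV_testD; [|exact: spatial_testZ|exact: spatial_testZ].
  rewrite (integral_rV_testZ nu tc) viscous mulrN -mulNr -integral_rV_testZ//.
  have t3 := spatial_testZ (- nu) tl; have t4 := spatial_testZ (-1) teab.
  rewrite -(integral_rV_testD t4 t3).
  apply: eq_integral_rV => z _; rewrite dotDl -scaleNr dotZl dotNl.
  rewrite /friction dotZl [dot (grad _ _) _]dotC mulN1r.
  by rewrite /e /a /b !mulNr.
apply: (is_derive_eq _ gI); apply: (is_derive_quadratic_integral fin t1 t2) => h z Oz.
have gE i : grad (fun y => (v y + h *: du y) ord0 i) z = grad (vi i) z + h *: grad (dui i) z.
  apply/rowP => j; rewrite !mxE.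
  have dv : derivable (vi i) z (delta_mx ord0 j).
    by apply: diff_derivable; exact: (smooth_on_differentiable (svi i)).
  have ddu : derivable (dui i) z (delta_mx ord0 j).
    by case: (tdui i) => s _; apply: diff_derivable; exact: (smooth_on_differentiable s).
  have dZ : derivable (h \*: dui i) z (delta_mx ord0 j) by exact: derivableZ.
  have fE : (fun y => (v y + h *: du y) ord0 i) = vi i + h \*: dui i.
    by apply/funext => y; rewrite !mxE.
  rewrite /partial fE; apply: (etrans (deriveD dv dZ)).
  exact: (congr1 (fun x => _ + x) (deriveZ h ddu)).
have nE : grad_normsq (fun y => v y + h *: du y) z = grad_normsq v z + (2 * h * c z + h ^+ 2 * c2 z).
  rewrite /grad_normsq /c /c2 2!mulr_sumr -!big_split; apply: eq_bigr => i _ /=.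
  rewrite gE !dotDl !dotDr !dotZl !dotZr [dot (grad (dui i) z) (grad (vi i) z)]dotC.
  have E1 : \sum_j partial j (vi i) z * partial j (dui i) z = dot (grad (vi i) z) (grad (dui i) z).
    by apply: eq_bigr => j _; rewrite !mxE.
  have E2 : \sum_j partial j (dui i) z * partial j (dui i) z = dot (grad (dui i) z) (grad (dui i) z).
    by apply: eq_bigr => j _; rewrite !mxE.
  rewrite E1 E2; move: (dot _ _) (dot _ _) (dot _ _) => p q r; ring.
rewrite /dissipation_density nE !real_normK ?num_real//.
have -> : u z - (v z + h *: du z) = (u z - v z) - h *: du z by rewrite opprD addrA.
rewrite [dot (u z - v z - _) _]dotDl dotNl dotZl -/(a z) -/(b z) -/(e z) /g1 /g2 -/(a z) -/(b z) -/(e z).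
move: (a z) (b z) (e z) (c z) (c2 z) (grad_normsq v z) => a' b' e' c' c2' n; ring.
Qed.

End SpatialTestFunctions.

(** * Dissipative forces *)

Section DissipativeForces.
Context {R : realType} {d : nat}.
Notation V := 'rV[R]_d.
Notation E := (R * 'rV[R]_d)%type.
Variables (Omega : set V) (T : R).
Hypothesis oO : open Omega.
Let Q := cylinder Omega T.
Let oQ : open Q. Proof. exact: open_cylinder. Qed.

Lemma smooth_slice (f : R -> V -> R) t : smooth_on Q (spacetime f) -> 0 < t < T ->
  smooth_on Omega (f t).
Proof.
move=> sf tT; have st : smooth_on Omega (fun z : V => ((t, z) : E)).
  by apply: smooth_pair => //; [exact: smooth_cst|exact: smooth_id].
have tQ z : Omega z -> Q (t, z) by [].
exact: (@smooth_comp R V E Omega Q (spacetime f) (fun z => (t, z)) finite_basisE oO oQ tQ sf st).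
Qed.

Lemma smooth_slice_row (f : R -> V -> V) t : smooth_on Q (spacetime f) -> 0 < t < T ->
  smooth_on Omega (f t).
Proof.
move=> sf tT; apply: smooth_row => // i.
exact: (@smooth_slice (fun t z => f t z ord0 i) t (smooth_coord i oQ sf) tT).
Qed.

Variables (phi theta : R -> V -> R) (u v : R -> V -> V) (eta : R -> R -> R) (nu : R).
Hypotheses (sphi : smooth_on Q (spacetime phi)) (stheta : smooth_on Q (spacetime theta))
  (theta0 : forall t z, Q (t, z) -> 0 < theta t z)
  (su : smooth_on Q (spacetime u)) (sv : smooth_on Q (spacetime v))
  (seta : smooth_on [set p : R * R | 0 < p.2] (fun p => eta p.1 p.2))
  (fin : finite_dissipation Omega T eta nu phi theta u v).

Definition friction_force t : V -> V := friction (phi t) (theta t) (u t) (v t) eta.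

Definition viscous_force t z : V := - friction_force t z - nu *: vlaplacian (v t) z.

Lemma smooth_eta_field : smooth_on Q (fun p => eta (spacetime phi p) (spacetime theta p)).
Proof.
have o : open [set p : R * R | 0 < p.2].
  have : open ((fun p : R * R => p.2) @^-1` [set y : R | 0 < y]).
    by apply: open_comp; [move=> p _; exact: cvg_snd|exact: open_gt].
  by [].
have sp := smooth_pair oQ sphi stheta.
apply: (@smooth_comp R E (R * R)%type Q _ (fun p => eta p.1 p.2)
  (fun p => (spacetime phi p, spacetime theta p)) _ oQ o _ seta sp).
  exact: finite_basis_prod finite_basisR finite_basisR.
by move=> [t z] Qp; exact: theta0.
Qed.

Lemma smooth_friction_force : smooth_on Q (spacetime friction_force).
Proof.
have sg := smooth_grad oQ sphi.
have sd : smooth_on Q (fun p => eta (spacetime phi p) (spacetime theta p) *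
    dot (spacetime u p - spacetime v p) (spacetime (fun t => grad (phi t)) p)).
  apply: smooth_mul => //; first exact: smooth_eta_field.
  by apply: smooth_dot => //; exact: smooth_sub.
exact: (smooth_scale_field oQ sd sg).
Qed.

Lemma smooth_vlaplacian : smooth_on Q (spacetime (fun t => vlaplacian (v t))).
Proof.
apply: smooth_row => // i; pose vi q := spacetime v q ord0 i.
pose D (j : 'I_d) (f : E -> R) : E -> R := 'D_((0, delta_mx ord0 j)) f.
have svi : smooth_on Q vi by exact: smooth_coord.
have s : smooth_on Q (fun p => \sum_j D j (D j vi) p).
  by apply: smooth_sum => // j; do 2 apply: smooth_on_derive.
apply: (smooth_on_ext oQ _ s) => -[t z] _.
rewrite [RHS]mxE laplacianE; apply: eq_bigr => j _.
have e1 (y : V) : partial j (fun y => v t y ord0 i) y = D j vi (t, y).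
  exact: (derive_slice2 vi t y (delta_mx ord0 j)).1.
apply: (etrans (esym (derive_slice2 (D j vi) t z (delta_mx ord0 j)).1)).
exact: (congr1 (fun f => partial j f z) (esym (funext e1))).
Qed.

Let slice_eta t : 0 < t < T -> smooth_on Omega (fun z => eta (phi t z) (theta t z)).
Proof. exact: (@smooth_slice (fun t z => eta (phi t z) (theta t z)) t smooth_eta_field). Qed.

Lemma dissipative_force_u : dissipative_force Omega T
  (fun t w => dissipation Omega eta nu (phi t) (theta t) w (v t)) u friction_force.
Proof.
split; first exact: smooth_friction_force.
move=> t du tT sdu cdu duO.
exact: (friction_variation_u oO cdu duO (smooth_slice sphi tT) (smooth_slice_row su tT)
  (smooth_slice_row sv tT) (slice_eta tT) (fin tT) sdu (@supp_off R V V du)).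
Qed.

Lemma dissipative_force_v : dissipative_force Omega T
  (fun t w => dissipation Omega eta nu (phi t) (theta t) (u t) w) v viscous_force.
Proof.
split.
  apply: (smooth_sub oQ); first exact: (smooth_opp oQ smooth_friction_force).
  exact: (smooth_scale nu oQ smooth_vlaplacian).
move=> t du tT sdu cdu duO.
exact: (dissipation_variation_v oO cdu duO (smooth_slice sphi tT) (smooth_slice_row su tT)
  (smooth_slice_row sv tT) (slice_eta tT) (fin tT) sdu (@supp_off R V V du)).
Qed.

(** The force is tested at each time separately, so that the fundamental lemma
    is applied in space alone. *)
Lemma dissipative_force_unique D w f g : dissipative_force Omega T D w f ->
  dissipative_force Omega T D w g -> forall t z, 0 < t < T -> Omega z -> f t z = g t z.
Proof.
move=> [sf Hf] [sg Hg] t z tT Oz; apply/rowP => i; apply/eqP; rewrite -subr_eq0; apply/eqP.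
have sfi := smooth_coord i oO (smooth_slice_row sf tT).
have sgi := smooth_coord i oO (smooth_slice_row sg tT).
have ch := @chart_rV R d.
apply: (fundamental_lemma ch (h := fun q => f t q ord0 i - g t q ord0 i) (U := Omega)) => //.
- exact: has_bumps_rV.
- move=> q Oq; have cf := smooth_on_continuous sfi Oq.
  have cg := smooth_on_continuous sgi Oq.
  exact: (cvgB cf cg).
move=> rho srho crho rhoO.
pose W q := rho q *: (delta_mx ord0 i : V).
have sW : smooth_on setT W by exact: (smooth_scalel _ openT srho).
have W0 q : ~ supp rho q -> W q = 0 by move=> /supp_off e; rewrite /W e scale0r.
have sWs : supp W `<=` supp rho by apply: supp_sub => //; exact: closed_closure.
have cW := subclosed_compact (@closed_closure _ _) crho sWs.
have [_ e1] := Hf t W tT sW cW (subset_trans sWs rhoO).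
have [_ e2] := Hg t W tT sW cW (subset_trans sWs rhoO).
have dE (k : V) q : dot k (W q) = rho q * k ord0 i.
  rewrite dotC dotZl /dot (bigD1 i)//= big1 ?addr0 => [|j ji].
    by rewrite mxE !eqxx mul1r.
  by rewrite mxE eqxx (negbTE ji) mul0r.
have tst (k : R -> V -> V) : smooth_on Omega (fun q => k t q ord0 i) ->
    spatial_test Omega (supp rho) (fun q => rho q * k t q ord0 i).
  move=> sk; split; first by apply: smooth_mul => //; exact: smooth_onS srho.
  by move=> q /supp_off ->; rewrite mul0r.
have eE (k : R -> V -> V) : integral_rV Omega (fun q => dot (k t q) (W q)) =
    integral_rV Omega (fun q => rho q * k t q ord0 i).
  by apply: eq_integral_rV => q _; exact: dE.
have I0 : integral_rV Omega (fun q => rho q * f t q ord0 i) =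
    integral_rV Omega (fun q => rho q * g t q ord0 i).
  by rewrite -!eE -e1 -e2.
have tf := tst f sfi; have tg := tst g sgi.
have tm := spatial_testZ oO (-1) tg.
have eD := integral_rV_testD oO crho rhoO tf tm.
rewrite (integral_rV_testZ oO crho rhoO (-1) tg) I0 mulN1r subrr in eD.
rewrite -[RHS]eD (integral_rV_test rhoO (spatial_testD oO tf tm)).
by apply: eq_Rintegral => q _; rewrite mulrBr mulN1r.
Qed.

End DissipativeForces.

(** * Integrals depending on a parameter *)

Section ParameterIntegral.
Context {R : realType} dd (T : measurableType dd) (X Z : normedModType R).
Context (nu : {measure set T -> \bar R}) (e : T -> Z).
Hypotheses (ch : chart nu e) (fX : finite_basis X) (fZ : finite_basis Z).
Variables (U : set X) (M : R).
Hypothesis oU : open U.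
Implicit Types G : X * Z -> R.

Definition strip : set (X * Z)%type := [set p | U p.1].

(** The support is bounded in the variable of integration, uniformly in the
    parameter. *)
Definition strip_test G := smooth_on strip G /\
  forall x s, U x -> M < `|s| -> G (x, s) = 0.

Definition param_integral G (x : X) : R := \int[nu]_c G (x, e c).

Let oS : open strip.
Proof.
have : open ((fun p : X * Z => p.1) @^-1` U) by apply: open_comp => // p _; exact: cvg_fst.
by [].
Qed.

Lemma strip_test_derive G v : strip_test G -> strip_test ('D_((v, 0)) G).
Proof.
move=> [sG G0]; split; first exact: smooth_on_derive.
move=> x s Ux Ms; apply: (etrans (esym (derive_slice1 G x s v).1)).
apply: (etrans (near_derive_eq (g := cst 0) _ _)); last exact: derive_cst.
by apply: (open_near oU _ Ux) => y Uy; exact: G0.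
Qed.

Lemma strip_test_fun G x : strip_test G -> U x -> test_fun (fun s => G (x, s)).
Proof.
move=> [sG G0] Ux; split; last by exists M => s; exact: G0.
move=> s; have c1 := @continuous_pairl R X Z x s.
have c2 : {for (x, s), continuous G} by exact: (smooth_on_continuous sG).
exact: (continuous_comp c1 c2).
Qed.

(** The remainder of the integrand is quadratic in the increment of the
    parameter, uniformly on a compact set, and zero elsewhere. *)
Lemma param_integral_differentiable G x : strip_test G -> U x ->
  differentiable (param_integral G) x /\
  forall v, 'D_v (param_integral G) x = param_integral ('D_((v, 0)) G) x.
Proof.
move=> tG Ux; have [sG G0] := tG.
have dG s : differentiable G (x, s) by exact: (smooth_on_differentiable sG).
pose L v := param_integral ('D_((v, 0)) G) x.
have tL v := strip_test_fun (strip_test_derive v tG) Ux.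
have L_lin : linear L.
  move=> k v w; rewrite /L /param_integral.
  have -> : (fun c => 'D_((k *: v + w, 0)) G (x, e c)) =
      (fun c => k * 'D_((v, 0)) G (x, e c) + 'D_((w, 0)) G (x, e c)).
    apply/funext => c.
    have vE : ((k *: v + w, 0) : X * Z) = k *: ((v, 0) : X * Z) + (w, 0).
      by rewrite -[RHS]/(k *: v + w, k *: 0 + 0) scaler0 addr0.
    apply: (etrans (congr1 (fun u => 'D_u G (x, e c)) vE)).
    apply: (etrans (derive_addv _ _ (dG (e c)))).
    exact: (congr1 (fun a => a + _) (derive_scalev _ _ (dG (e c)))).
  apply: (etrans (integral_testD ch (test_funZ k (tL v)) (tL w))).
  exact: (congr1 (fun a => a + _) (integral_testZ ch k (tL v))).
pose K : set (X * Z)%type := [set x] `*` [set s : Z | `|s| <= M].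
have cK : compact K by apply: compact_setX; [exact: compact_set1|exact: (chart_cpt ch)].
have KS : K `<=` strip by move=> [y s] [/= -> _].
have [C C0 [r r0 [DC TC]]] := uniform_taylor (finite_basis_prod fX fZ) oS sG cK KS.
set B := fine (nu (e @^-1` [set s | `|s| <= M])).
have B0 : 0 <= B by exact: fine_ge0.
have norm_pair (k : X) : `|((k, 0) : X * Z)| = `|k|.
  by rewrite prod_normE /= normr0; apply/max_idPl.
have LB v : `|L v| <= C * B * `|v|.
  rewrite /L mulrAC; apply: (integral_chart_bound ch _ (tL v)).
  - by rewrite mulr_ge0.
  - move=> s; have [sM|Ms] := leP `|s| M; last first.
      by rewrite (strip_test_derive v tG).2// normr0 mulr_ge0.
    by rewrite -norm_pair; apply: DC.
  - by move=> s; exact: (strip_test_derive v tG).2.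
pose Ll : {linear X -> R} := HB.pack L (GRing.isLinear.Build _ _ _ _ _ L_lin).
have L_cont : continuous Ll.
  have CB : 0 < C * B + 1 by rewrite ltr_wpDl// mulr_ge0.
  move=> v; apply/cvgrPdist_le => ep ep0.
  have q0 : 0 < ep / (C * B + 1) by exact: divr_gt0.
  near=> w.
  rewrite -linearB (le_trans (LB _))//.
  apply: (@le_trans _ _ ((C * B + 1) * `|v - w|)); first by rewrite ler_wpM2r// lerDl.
  rewrite mulrC -ler_pdivlMr//; near: w; apply: cvgr_dist_le q0; exact: cvg_id.
have approx (ep : R) : 0 < ep ->
    \forall h \near (0 : X), `|param_integral G (h + x) - param_integral G x - Ll h| <= ep * `|h|.
  move=> ep0; near=> h.
  have hr : `|h| < r by near: h; exact: nbhs0_lt.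
  have hC : `|h| <= ep / (C * B + 1).
    by near: h; apply: nbhs0_le; rewrite divr_gt0// ltr_wpDl// mulr_ge0.
  have Uh : U (h + x).
    near: h; have : \forall y \near x, U y by exact: open_nbhs_nbhs.
    by rewrite (near_shift 0) subr0.
  have t1 := strip_test_fun tG Uh; have t0 := strip_test_fun tG Ux.
  pose F s := G (h + x, s) + (-1 * G (x, s) + -1 * 'D_((h, 0)) G (x, s)).
  have tF : test_fun F.
    exact: (test_funD t1 (test_funD (test_funZ (-1) t0) (test_funZ (-1) (tL h)))).
  have FE : param_integral G (h + x) - param_integral G x - Ll h = \int[nu]_c F (e c).
    rewrite (integral_testD ch t1 (test_funD (test_funZ (-1) t0) (test_funZ (-1) (tL h)))).
    rewrite (integral_testD ch (test_funZ (-1) t0) (test_funZ (-1) (tL h))).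
    by rewrite (integral_testZ ch (-1) t0) (integral_testZ ch (-1) (tL h)) !mulN1r addrA.
  have FB : `|\int[nu]_c F (e c)| <= C * `|h| ^+ 2 * B.
    apply: (integral_chart_bound ch _ tF).
    - by rewrite mulr_ge0 ?sqr_ge0.
    - move=> s; have [sM|Ms] := leP `|s| M; last first.
        rewrite /F !G0// (strip_test_derive h tG).2// !mulr0 !addr0 normr0.
        by rewrite mulr_ge0 ?sqr_ge0.
      have hr' : `|((h, 0) : X * Z)| < r by rewrite norm_pair.
      have [_ _] := TC (x, s) (h, 0) (conj erefl sM) hr'.
      rewrite norm_pair -[(x, s) + (h, 0)]/(x + h, s + 0) addr0 [x + h]addrC.
      by rewrite /F !mulN1r addrA.
    - move=> s Ms; rewrite /F !G0// (strip_test_derive h tG).2//.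
      by rewrite !mulr0 !addr0.
  rewrite FE (le_trans FB)// mulrAC expr2 mulrA ler_wpM2r//.
  have CB : 0 < C * B + 1 by rewrite ltr_wpDl// mulr_ge0.
  rewrite ler_pdivlMr// in hC; apply: le_trans hC; rewrite mulrC.
  by rewrite ler_wpM2l// lerDl.
have [df dE] := differentiable_approx L_cont approx.
by split => // v; rewrite (deriveE _ df) dE.
Unshelve. all: by end_near. Qed.

Lemma smooth_param_integral G : strip_test G -> smooth_on U (param_integral G).
Proof.
move=> tG; apply/smooth_onP => n; elim: n G tG => // n IH G tG.
apply: smooth_uptoS => //.
  by move=> x Ux; case: (param_integral_differentiable tG Ux).
move=> v; exists (param_integral ('D_((v, 0)) G)).
  by apply: IH; exact: strip_test_derive.
by move=> x Ux; case: (param_integral_differentiable tG Ux).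
Qed.

End ParameterIntegral.

Section StepIntegral.
Context {R : realType}.

Lemma integral_derive_step (f : R -> R) : (forall x, derivable f x 1) -> continuous ('D_1 f) ->
  (forall x, x <= 0 -> f x = f 0) -> (forall x, 1 <= x -> f x = f 1) ->
  \int[@lebesgue_measure R]_x 'D_1 f x = f 1 - f 0.
Proof.
move=> df cD f0 f1.
have cf : continuous f by move=> x; apply: differentiable_continuous; exact/derivable1_diffP.
have D0 x : x < 0 -> 'D_1 f x = 0.
  move=> x0; apply: (etrans (near_derive_eq (g := cst (f 0)) _ _)); last exact: derive_cst.
  by apply: (open_near (@open_lt R 0) _ x0) => y y0; apply: f0; exact: ltW.
have D1 x : 1 < x -> 'D_1 f x = 0.
  move=> x0; apply: (etrans (near_derive_eq (g := cst (f 1)) _ _)); last exact: derive_cst.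
  by apply: (open_near (@open_gt R 1) _ x0) => y y0; apply: f1; exact: ltW.
have -> : \int[@lebesgue_measure R]_x 'D_1 f x = \int[@lebesgue_measure R]_(x in `[0, 1]) 'D_1 f x.
  rewrite [RHS]Rintegral_mkcond; congr Rintegral; apply/funext => x.
  rewrite patchE; case: ifPn => //; rewrite notin_setE/= in_itv/= => /negP.
  by rewrite negb_and -!ltNge => /orP[/D0|/D1].
rewrite /Rintegral (@continuous_FTC2 _ _ f)//=.
- exact: continuous_subspaceT.
- split.
  + by move=> x _; exact: df.
  + by apply: cvg_at_right_filter; exact: cf.
  + by apply: cvg_at_left_filter; exact: cf.
- by move=> x _; rewrite derive1E.
Qed.

End StepIntegral.

Section TranslationInvariance.
Context {R : realType} {d : nat}.
Notation V := 'rV[R]_d.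
Notation E := (R * 'rV[R]_d)%type.

Lemma spacetime_integral_sum (I : Type) (s : seq I) (f : I -> E -> R) :
  (forall i, test_fun (f i)) ->
  spacetime_integral (fun p => \sum_(i <- s) f i p) = \sum_(i <- s) spacetime_integral (f i).
Proof.
move=> tf; elim: s => [|i s IH].
  by rewrite big_nil -[RHS](@spacetime_integral0 R d); apply: eq_spacetime_integral => p; rewrite big_nil.
rewrite big_cons -IH -(spacetime_integralD (tf i) (test_fun_sum s tf)).
by apply: eq_spacetime_integral => p; rewrite big_cons.
Qed.

(** The derivative of the integral with respect to the amount of translation
    is the integral of a spatial derivative of a test function, which is
    zero. *)
Lemma spacetime_integral_shift (f : E -> R) (k : V) : smooth_on setT f -> bounded_support f ->
  spacetime_integral (fun p => f (p.1, p.2 + k)) = spacetime_integral f.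
Proof.
move=> sf bf; have [M fM] := bf.
pose G (q : R * E) := f (q.2.1, q.2.2 + q.1 *: k).
have fE := @finite_basisE R d.
have ch := @chart_spacetime R d.
pose M' := M + 2 * `|k|.
(* a neighbourhood of the interval of translation parameters [0, 1] *)
pose U := [set a : R | `|a| < 2].
have oU : open U.
  have : open ((fun a : R => `|a|) @^-1` [set y : R | y < 2]).
    by apply: open_comp; [move=> z _; exact: norm_continuous|exact: open_lt].
  by [].
have s2 : smooth_on setT (fun q : R * E => q.2) by exact: smooth_snd openT.
have s1 : smooth_on setT (fun q : R * E => q.1) by exact: smooth_fst openT.
have s21 : smooth_on setT (fun q : R * E => q.2.1).
  apply: (@smooth_lin_comp R _ E _ setT fst (fun q : R * E => q.2) openT _ s2).
  by move=> p; exact: cvg_fst.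
have s22 : smooth_on setT (fun q : R * E => q.2.2).
  apply: (@smooth_lin_comp R _ E _ setT snd (fun q : R * E => q.2) openT _ s2).
  by move=> p; exact: cvg_snd.
have sg : smooth_on setT (fun q : R * E => (q.2.1, q.2.2 + q.1 *: k)).
  apply: (smooth_pair openT s21); apply: (smooth_add openT s22).
  exact: (smooth_scalel _ openT s1).
have sG : smooth_on setT G.
  exact: (@smooth_comp R (R * E)%type E setT setT f _ fE openT openT (fun _ _ => I) sf sg).
have tG : strip_test U M' G.
  split; first exact: smooth_onS sG.
  move=> a p /= a2 Mp; apply: fM; rewrite /M' in Mp.
  have : `|p| <= `|(p.1, p.2 + a *: k)| + 2 * `|k|.
    have ak : `|a *: k| <= 2 * `|k| by rewrite normrZ ler_wpM2r// ltW.
    rewrite [`|p|]prod_normE ge_max; apply/andP; split.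
      rewrite [X in _ <= X + _]prod_normE /=; apply: ler_wpDr; first by rewrite mulr_ge0.
      by rewrite le_max lexx.
    rewrite -[p.2](addrK (a *: k)) (le_trans (ler_normB _ _))// lerD//.
    by rewrite [leRHS]prod_normE le_max addrK lexx orbT.
  by move=> H; rewrite -(ltrD2r (2 * `|k|)); exact: lt_le_trans Mp H.
pose N (a : R) := \int[(@lebesgue_measure R \x leb R d)%E]_c G (a, (c.1, crd R d c.2)).
have dN a : U a -> is_derive a (1 : R) N 0.
  move=> Ua; have [dN DN] := param_integral_differentiable ch finite_basisR fE oU tG Ua.
  have e0 : 'D_1 N a = 0.
    apply: (etrans (DN 1)); rewrite /param_integral.
    pose h (p : E) := f (p.1, p.2 + a *: k).
    have sh : smooth_on setT h.
      have su : smooth_on setT (fun p : E => (p.1, p.2 + a *: k)).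
        apply: (smooth_pair openT (smooth_fst openT)).
        by apply: (smooth_add openT (smooth_snd openT)); exact: smooth_cst openT.
      exact: (@smooth_comp R E E setT setT f _ fE openT openT (fun _ _ => I) sf su).
    have bh : bounded_support h by exists M' => p Mp; exact: tG.2.
    have th := smooth_test_fun sh bh.
    have hD p : 'D_((1, 0)) G (a, p) = 'D_((0, k)) h p.
      case: p => t z; apply: (derive_congr _).1 => b.
      have -> : b *: ((1, 0) : R * E) + (a, (t, z)) = (b + a, (t, z)).
        by rewrite -[LHS]/(b * 1 + a, b *: (0 : E) + (t, z)) mulr1 scaler0 add0r.
      have -> : b *: ((0, k) : E) + (t, z) = (t, b *: k + z).
        by rewrite -[LHS]/(b * 0 + t, b *: k + z) mulr0 add0r.
      rewrite /G /h /=; congr (f (_, _)).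
      by rewrite scalerDl addrA [b *: k + z]addrC.
    have tD i : test_fun ('D_((0, delta_mx ord0 i)) h).
      apply: derive_test_fun => // p.
      exact: (smooth_on_continuous (smooth_on_derive _ sh)).
    pose H p := \sum_i k ord0 i * 'D_((0, delta_mx ord0 i)) h p.
    have tDk i : test_fun (fun p => k ord0 i * 'D_((0, delta_mx ord0 i)) h p).
      exact: (test_funZ _ (tD i)).
    have tH : test_fun H by exact: test_fun_sum.
    have GH c : 'D_((1, 0)) G (a, (c.1, crd R d c.2)) = H (c.1, crd R d c.2).
      apply: (etrans (hD _)).
      exact: (derive_basis (smooth_on_differentiable sh I) (spatial_basis k)).
    transitivity (\int[(@lebesgue_measure R \x leb R d)%E]_c H (c.1, crd R d c.2)).
      by apply: eq_Rintegral => c _; exact: GH.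
    apply: (etrans (esym (spacetime_integralE tH))).
    apply: (etrans (spacetime_integral_sum (index_enum 'I_d) tDk)).
    apply: big1 => i _; apply: (etrans (spacetime_integralZ _ (tD i))).
    rewrite spacetime_integral_partial ?mulr0//.
      by move=> p; apply: diff_derivable; exact: (smooth_on_differentiable sh).
    by move=> p; exact: (smooth_on_continuous (smooth_on_derive _ sh)).
  split; first by apply/derivable1_diffP.
  exact: e0.
have N01 : N 1 = N 0.
  have df s : 0 <= s <= 1 -> differentiable N (0 + s *: (1 : R)).
    move=> /andP[q0 q1]; apply/derivable1_diffP.
    have -> : 0 + s *: (1 : R) = s by rewrite add0r /GRing.scale/= mulr1.
    have Us : U s by rewrite /U/= ger0_norm// (le_lt_trans q1)// ltr1n.
    by case: (dN s Us).
  have [s /andP[q0 q1] e] := MVT_line df.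
  have sE : 0 + s *: (1 : R) = s by rewrite add0r /GRing.scale/= mulr1.
  have Us : U s by rewrite /U/= ger0_norm// (le_lt_trans q1)// ltr1n.
  have [_ e0] := dN s Us; apply/eqP; rewrite -subr_eq0; apply/eqP.
  rewrite add0r in e; apply: (etrans e).
  exact: (etrans (congr1 (fun y => 'D_1 N y) sE) e0).
have NE a : U a -> spacetime_integral (fun p => f (p.1, p.2 + a *: k)) = N a.
  move=> Ua; have tGa : test_fun (fun p : E => f (p.1, p.2 + a *: k)).
    exact: (strip_test_fun tG Ua).
  exact: (spacetime_integralE tGa).
have U1 : U 1 by rewrite /U/= normr1 ltr1n.
have U0 : U 0 by rewrite /U/= normr0.
have := NE 1 U1; rewrite N01 -(NE 0 U0) scale1r => ->.
by apply: eq_spacetime_integral => p; rewrite scale0r addr0 -surjective_pairing.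
Qed.

End TranslationInvariance.

(** * Circulation of a field along polygons *)

Section LineIntegrals.
Context {R : realType} {d : nat}.
Notation V := 'rV[R]_d.
Notation E := (R * 'rV[R]_d)%type.

Definition step_rate : R -> R := 'D_1 (@smooth_step R).

Lemma smooth_step_rate : smooth_on setT step_rate.
Proof. by apply: smooth_on_derive; exact: smooth_smooth_step. Qed.

Lemma step_rate_off s : 1 < `|s| -> step_rate s = 0.
Proof.
have [s0|s0] := leP 0 s.
  rewrite ger0_norm// => s1.
  apply: (etrans (near_derive_eq (g := cst (1 : R)) _ _)); last exact: derive_cst.
  by apply: (open_near (@open_gt R 1) _ s1) => y /ltW; exact: smooth_step_ge1.
move=> _; apply: (etrans (near_derive_eq (g := cst (0 : R)) _ _)); last exact: derive_cst.
by apply: (open_near (@open_lt R 0) _ s0) => y /ltW; exact: smooth_step_le0.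
Qed.

Lemma step_test_fun (f : R -> R) : continuous f -> test_fun (fun s => step_rate s * f s).
Proof.
move=> cf; split; last by exists 1 => s /step_rate_off ->; rewrite mul0r.
by move=> s; apply: cvgM; [exact: (smooth_on_continuous smooth_step_rate)|exact: cf].
Qed.

Definition along (a b : V) (r : R) : V := a + r *: (b - a).

(** Parametrized by the smooth step, the segment gives a test function on the
    line as integrand. *)
Definition line_integral (F : E -> V) (t : R) (a b : V) : R :=
  \int[@lebesgue_measure R]_s
     (step_rate s * dot (F (t, along a b (smooth_step s))) (b - a)).

Lemma step01 (s : R) : 0 <= smooth_step s <= 1.
Proof. by rewrite smooth_step_ge0 smooth_step_le1. Qed.

Lemma smooth_step_comp (X : normedModType R) (U : set X) (f : X -> R) : open U ->
  smooth_on U f -> smooth_on U (fun q => smooth_step (f q)).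
Proof.
move=> oU sf; exact: (@smooth_comp R X R U setT (@smooth_step R) f finite_basisR oU openT (fun _ _ => I) (@smooth_smooth_step R) sf).
Qed.

Lemma smooth_step_rate_comp (X : normedModType R) (U : set X) (f : X -> R) : open U ->
  smooth_on U f -> smooth_on U (fun q => step_rate (f q)).
Proof.
move=> oU sf; exact: (@smooth_comp R X R U setT step_rate f finite_basisR oU openT (fun _ _ => I) smooth_step_rate sf).
Qed.

Section Segment.
Variables (Q P : set E) (F : E -> V) (a b : V).
Hypotheses (oQ : open Q) (oP : open P) (sF : smooth_on Q F)
  (PQ : forall p r, P p -> 0 <= r <= 1 -> Q (p.1, p.2 + along a b r)).
Variable rho : E -> R.
Hypotheses (srho : smooth_on setT rho) (crho : compact (supp rho)) (rhoP : supp rho `<=` P).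

Let D : V := b - a.
Let gam (s : R) : V := along a b (smooth_step s).

Let smooth_gam (X : normedModType R) (U : set X) (f : X -> R) : open U ->
  smooth_on U f -> smooth_on U (fun q => gam (f q)).
Proof.
move=> oU sf; apply: (smooth_add oU (smooth_cst a oU)).
exact: (smooth_scalel D oU (smooth_step_comp oU sf)).
Qed.

(** The mean of the translates of [rho] along the segment. *)
Definition smeared (p : E) : R :=
  \int[@lebesgue_measure R]_s (step_rate s * rho (p.1, p.2 - gam s)).

Let G1 (q : E * R) : R := step_rate q.2 * rho (q.1.1, q.1.2 - gam q.2).

Let proj11 (U : set (E * R)) : open U -> smooth_on U (fun q => q.1.1).
Proof.
move=> oU; apply: (@smooth_lin_comp R _ E _ U fst (fun q : E * R => q.1) oU _ (smooth_fst oU)).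
by move=> p; exact: cvg_fst.
Qed.

Let proj12 (U : set (E * R)) : open U -> smooth_on U (fun q => q.1.2).
Proof.
move=> oU; apply: (@smooth_lin_comp R _ E _ U snd (fun q : E * R => q.1) oU _ (smooth_fst oU)).
by move=> p; exact: cvg_snd.
Qed.

Let rate_snd (U : set (E * R)) : open U -> smooth_on U (fun q => step_rate q.2).
Proof. by move=> oU; exact: (smooth_step_rate_comp oU (smooth_snd oU)). Qed.

Let sG1 : smooth_on setT G1.
Proof.
have s := smooth_pair openT (proj11 openT)
  (smooth_sub openT (proj12 openT) (smooth_gam openT (smooth_snd openT))).
apply: (smooth_mul openT (rate_snd openT)).
exact: (@smooth_comp R (E * R)%type E setT setT rho _ finite_basisE openT openT (fun _ _ => I) srho s).
Qed.

Let tG1 : strip_test setT 1 G1.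
Proof.
split; first exact: smooth_onS sG1.
by move=> p s _ /step_rate_off e; rewrite /G1 /= e mul0r.
Qed.

Lemma smooth_smeared : smooth_on setT smeared.
Proof. exact: (smooth_param_integral chart_real finite_basisE finite_basisR openT tG1). Qed.

Definition smeared_support : set E :=
  (fun q : E * R => (q.1.1, q.1.2 + along a b q.2)) @` (supp rho `*` [set r | 0 <= r <= 1]).

Lemma smeared_support_compact : compact smeared_support.
Proof.
apply: continuous_compact; last first.
  apply: compact_setX => //; have := @segment_compact R 0 1.
  by rewrite (_ : [set` `[0, 1]] = [set r : R | 0 <= r <= 1])//; apply/seteqP; split=> r /=; rewrite in_itv.
apply: continuous_subspaceT => q.
have s : smooth_on setT (fun q : E * R => (q.1.1, q.1.2 + along a b q.2)).
  apply: (smooth_pair openT (proj11 openT)); apply: (smooth_add openT (proj12 openT)).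
  apply: (smooth_add openT (smooth_cst a openT)).
  exact: (smooth_scalel D openT (smooth_snd openT)).
exact: (smooth_on_continuous s).
Qed.

Lemma smeared_supportQ : smeared_support `<=` Q.
Proof. by move=> _ [[p r] [/= /rhoP Pp r01] <-]; exact: PQ. Qed.

Let rho_off p s : ~ smeared_support p -> rho (p.1, p.2 - gam s) = 0.
Proof.
move=> nK; apply: supp_off => sp; apply: nK.
exists ((p.1, p.2 - gam s), smooth_step s); first by split => //=; exact: step01.
by rewrite /= subrK -surjective_pairing.
Qed.

Lemma smeared_off p : ~ smeared_support p -> smeared p = 0.
Proof.
move=> nK; rewrite /smeared; under eq_Rintegral do rewrite rho_off// mulr0.
by rewrite Rintegral_cst// mul0r.
Qed.

(** Along the direction of the segment, the derivative of the integrand is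
    minus its derivative in the parameter of the segment, and the fundamental
    theorem of calculus leaves the end points. *)
Lemma derive_smeared t z : 'D_((0, D)) smeared (t, z) = rho (t, z - a) - rho (t, z - b).
Proof.
have [_ dE] := param_integral_differentiable chart_real finite_basisE finite_basisR openT tG1 (I : setT (t, z)).
apply: (etrans (dE _)); pose c : E := (t, z - a); pose u : E := (0, - D).
pose g r := rho (c + r *: u); pose f s := - g (smooth_step s).
have lineE s : (t, z - gam s) = c + smooth_step s *: u.
  rewrite -[RHS]/(t + smooth_step s *: 0, z - a + smooth_step s *: - D).
  by rewrite scaler0 addr0 scalerN /gam /along opprD addrA.
have drho p : differentiable rho p by exact: (smooth_on_differentiable srho).
have dg r : is_derive r (1 : R) g ('D_u rho (c + r *: u)) by exact: is_derive_line.
have dstep s : is_derive s (1 : R) (@smooth_step R) (step_rate s).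
  have ds : derivable (@smooth_step R) s 1.
    by apply: diff_derivable; exact: (smooth_on_differentiable (@smooth_smooth_step R)).
  exact: (DeriveDef ds erefl).
have df s : is_derive s (1 : R) f (- (step_rate s * 'D_u rho (c + smooth_step s *: u))).
  have H := is_derive1_comp (f := g) (g := @smooth_step R) (dg (smooth_step s)) (dstep s).
  apply: (is_derive_eq (is_deriveN H)).
  by congr (- _); rewrite /GRing.scale/= mulrC.
have DuE p : 'D_((0, D)) rho p = - 'D_u rho p.
  by rewrite (derive_spatial_opp _ (drho p)) opprK.
have GE s : 'D_((((0, D) : E), 0)) G1 ((t, z), s) = 'D_1 f s.
  have [_ ->] := df s; apply: (etrans (esym (derive_slice1 G1 ((t, z) : E) s (0, D)).1)).
  have [shE shd] : 'D_((0, D)) (fun p : E => rho (p.1, p.2 - gam s)) (t, z) = 'D_((0, D)) rho (t, z - gam s) /\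
      derivable (fun p : E => rho (p.1, p.2 - gam s)) (t, z) (0, D) = derivable rho (t, z - gam s) (0, D).
    by apply: derive_congr => h; congr (rho (_, _)); rewrite /= addrA.
  have dsh : derivable (fun p : E => rho (p.1, p.2 - gam s)) (t, z) (0, D).
    by rewrite shd; exact: diff_derivable.
  apply: (etrans (deriveZ (step_rate s) dsh)).
  apply: (etrans (congr1 (fun x => step_rate s * x) (etrans shE (DuE _)))).
  by rewrite mulrN; apply: (congr1 (fun p => - (step_rate s * 'D_u rho p))); exact: lineE.
transitivity (\int[@lebesgue_measure R]_s 'D_1 f s).
  by apply: eq_Rintegral => s _; exact: GE.
have cD : continuous ('D_1 f).
  have sg : smooth_on setT g.
    have sl : smooth_on setT (fun r : R => c + r *: u).
      by apply: (smooth_add openT (smooth_cst c openT)); exact: (smooth_scalel u openT (smooth_id openT)).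
    exact: (@smooth_comp R R E setT setT rho _ finite_basisE openT openT (fun _ _ => I) srho sl).
  have sf : smooth_on setT f.
    apply: (smooth_opp openT).
    exact: (@smooth_comp R R R setT setT g _ finite_basisR openT openT (fun _ _ => I) sg (@smooth_smooth_step R)).
  by move=> s; exact: (smooth_on_continuous (smooth_on_derive _ sf)).
rewrite integral_derive_step //.
- rewrite /f (smooth_step_le0 (lexx 0)) (smooth_step_ge1 (lexx 1)) opprK addrC /g.
  rewrite scale0r addr0 scale1r; congr (_ - rho _).
  by rewrite -[LHS]/(t + 0, z - a - D) addr0 /D opprB addrA subrK.
- by move=> s s0; rewrite /f smooth_step_le0// smooth_step_le0.
- by move=> s s1; rewrite /f smooth_step_ge1// smooth_step_ge1.
Qed.

Lemma smooth_line_integral : smooth_on P (fun p => line_integral F p.1 (p.2 + a) (p.2 + b)).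
Proof.
pose H (q : E * R) : R := step_rate q.2 * dot (F (q.1.1, q.1.2 + gam q.2)) D.
have o2 : open [set q : E * R | P q.1].
  have : open ((fun q : E * R => q.1) @^-1` P) by apply: open_comp => // q _; exact: cvg_fst.
  by [].
have sFD : smooth_on Q (fun p => dot (F p) D) by apply: smooth_dot => //; exact: smooth_cst.
have sH : smooth_on [set q : E * R | P q.1] H.
  apply: (smooth_mul o2 (rate_snd o2)).
  have s := smooth_pair o2 (proj11 o2) (smooth_add o2 (proj12 o2) (smooth_gam o2 (smooth_snd o2))).
  exact: (@smooth_comp R (E * R)%type E _ Q (fun p => dot (F p) D) _ finite_basisE o2 oQ (fun q Pq => PQ Pq (step01 q.2)) sFD s).
have tH : strip_test P 1 H.
  split; first exact: sH.
  by move=> p s _ /step_rate_off e; rewrite /H /= e mul0r.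
have sI := smooth_param_integral chart_real finite_basisE finite_basisR oP tH.
apply: (smooth_on_ext oP _ sI) => p Pp; apply: eq_Rintegral => s _.
have bD : p.2 + b - (p.2 + a) = D by rewrite opprD addrACA subrr add0r.
by rewrite /H /= /along bD addrA.
Qed.

Lemma fubini_spacetime (k : E * R -> R) : test_fun k ->
  test_fun (fun p => \int[@lebesgue_measure R]_s k (p, s)) ->
  spacetime_integral (fun p => \int[@lebesgue_measure R]_s k (p, s)) =
  \int[@lebesgue_measure R]_s spacetime_integral (fun p => k (p, s)).
Proof.
move=> tk tI; rewrite (spacetime_integralE tI).
have chE : chart (sigma_finite_product (@lebesgue_measure R) (leb R d))
    (fun z : measurableTypeR R * eucl R d => (z.1, crd R d z.2)) := @chart_spacetime R d.
have := fubini_test_fun chE chart_real tk.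
move=> fub; apply: (etrans fub); apply: eq_Rintegral => s _.
exact: (esym (spacetime_integralE (test_fun_slice2 tk s))).
Qed.

(** Testing [F] against the smeared bump, in the direction of the segment, is
    testing its line integrals along the translates of the segment against the
    bump. *)
Lemma smeared_circulation :
  spacetime_integral (fun p => dot (F p) D * smeared p) =
  spacetime_integral (fun p => rho p * line_integral F p.1 (p.2 + a) (p.2 + b)).
Proof.
(* the two integrands over space-time and segment parameter, of which the
   second is the first after the translation by [gam q.2] in space *)
pose m (q : E * R) : R := dot (F q.1) D * G1 q.
pose n (q : E * R) : R := rho q.1 * (step_rate q.2 * dot (F (q.1.1, q.1.2 + gam q.2)) D).
have o1 : open [set q : E * R | Q q.1].
  have : open ((fun q : E * R => q.1) @^-1` Q) by apply: open_comp => // q _; exact: cvg_fst.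
  by [].
have o2 : open [set q : E * R | P q.1].
  have : open ((fun q : E * R => q.1) @^-1` P) by apply: open_comp => // q _; exact: cvg_fst.
  by [].
have cI : compact [set s : R | `|s| <= 1] by exact: (chart_cpt chart_real).
have sFD : smooth_on Q (fun p => dot (F p) D) by apply: smooth_dot => //; exact: smooth_cst.
have sm : smooth_on [set q : E * R | Q q.1] m.
  apply: (smooth_mul o1); last exact: smooth_onS sG1.
  exact: (@smooth_comp R (E * R)%type E _ Q (fun p => dot (F p) D) (fun q => q.1) finite_basisE o1 oQ (fun q Hq => Hq) sFD (smooth_fst o1)).
have sn : smooth_on [set q : E * R | P q.1] n.
  apply: (smooth_mul o2).
    exact: (@smooth_comp R (E * R)%type E _ setT rho (fun q => q.1) finite_basisE o2 openT (fun _ _ => I) srho (smooth_fst o2)).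
  apply: (smooth_mul o2 (rate_snd o2)).
  have s := smooth_pair o2 (proj11 o2) (smooth_add o2 (proj12 o2) (smooth_gam o2 (smooth_snd o2))).
  exact: (@smooth_comp R (E * R)%type E _ Q (fun p => dot (F p) D) _ finite_basisE o2 oQ (fun q Pq => PQ Pq (step01 q.2)) sFD s).
have rate0 s : ~ `|s| <= 1 -> step_rate s = 0 by move/negP; rewrite -ltNge => /step_rate_off.
have tm : test_fun m.
  apply: (test_fun_off o1 (compact_setX smeared_support_compact cI)).
  - by move=> [p s] [/smeared_supportQ].
  - by move=> q; exact: smooth_on_continuous.
  - move=> [p s] nK; rewrite /m /G1 /=.
    have [Kp|nKp] := pselect (smeared_support p); last by rewrite rho_off// !mulr0.
    by rewrite rate0 ?mul0r ?mulr0// => s1; exact: nK.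
have tn : test_fun n.
  apply: (test_fun_off o2 (compact_setX crho cI)).
  - by move=> [p s] [/rhoP].
  - by move=> q; exact: smooth_on_continuous.
  - move=> [p s] nK; rewrite /n /=.
    have [Kp|/supp_off ->] := pselect (supp rho p); last by rewrite mul0r.
    by rewrite rate0 ?mul0r ?mulr0// => s1; exact: nK.
have shift s : spacetime_integral (fun p => m (p, s)) = spacetime_integral (fun p => n (p, s)).
  have sms : smooth_on setT (fun p => m (p, s)).
    have clK : closed smeared_support := compact_closed (@norm_hausdorff _ _) smeared_support_compact.
    have -> : setT = Q `|` ~` smeared_support.
      by apply/esym/seteqP; split=> // p _; have [/smeared_supportQ|] := pselect (smeared_support p); [left|right].
    apply: smooth_onU.
      have sp : smooth_on Q (fun p => ((p, s) : E * R)).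
        exact: (smooth_pair oQ (smooth_id oQ) (smooth_cst s oQ)).
      have fER : finite_basis (E * R)%type := finite_basis_prod finite_basisE finite_basisR.
      have inQ (p : E) : Q p -> [set q : E * R | Q q.1] (p, s) by [].
      exact: (@smooth_comp R E (E * R)%type Q [set q : E * R | Q q.1] m (fun p => (p, s)) fER oQ o1 inQ sm sp).
    apply: (smooth_on_ext (closed_openC clK) _ (smooth_cst 0 (closed_openC clK))) => p nK.
    by rewrite /m /G1 rho_off// !mulr0.
  have bms : bounded_support (fun p => m (p, s)).
    by have [_ [N mN]] := test_fun_slice2 tm s; exists N.
  rewrite -(spacetime_integral_shift (gam s) sms bms); apply: eq_spacetime_integral => -[t z].
  rewrite /m /n /G1 /= addrK; ring.
have e1 p : dot (F p) D * smeared p = \int[@lebesgue_measure R]_s m (p, s).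
  exact: (esym (integral_testZ chart_real _ (strip_test_fun tG1 (I : setT p)))).
have e2 p : rho p * line_integral F p.1 (p.2 + a) (p.2 + b) =
    \int[@lebesgue_measure R]_s n (p, s).
  have bD : p.2 + b - (p.2 + a) = D by rewrite opprD addrACA subrr add0r.
  have aE s : along (p.2 + a) (p.2 + b) s = p.2 + along a b s.
    by rewrite /along bD addrA.
  have [sp|/supp_off e] := pselect (supp rho p); last first.
    rewrite e mul0r; apply: esym; rewrite /n /= e.
    by under eq_Rintegral do rewrite mul0r; rewrite Rintegral_cst// mul0r.
  have tl : test_fun (fun s => step_rate s * dot (F (p.1, p.2 + gam s)) D).
    apply: step_test_fun => s.
    have sg : smooth_on setT (fun s : R => ((p.1, p.2 + gam s) : E)).
      apply: (smooth_pair openT (smooth_cst p.1 openT)).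
      exact: (smooth_add openT (smooth_cst p.2 openT) (smooth_gam openT (smooth_id openT))).
    have s1 := @smooth_comp R R E setT Q (fun p => dot (F p) D) _ finite_basisE openT oQ (fun s _ => PQ (rhoP sp) (step01 s)) sFD sg.
    exact: (smooth_on_continuous s1).
  apply: (etrans _ (esym (integral_testZ chart_real (rho p) tl))); congr (_ * _).
  by apply: eq_Rintegral => s _; rewrite bD aE.
have tMm : test_fun (fun p => \int[@lebesgue_measure R]_s m (p, s)).
  have -> : (fun p => \int[@lebesgue_measure R]_s m (p, s)) = (fun p => dot (F p) D * smeared p).
    by apply/funext.
  apply: (test_fun_off oQ smeared_support_compact smeared_supportQ) => [p Qp|p /smeared_off ->].
    by apply: (smooth_on_continuous (smooth_mul oQ sFD _) Qp); exact: smooth_onS smooth_smeared.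
  by rewrite mulr0.
have tMn : test_fun (fun p => \int[@lebesgue_measure R]_s n (p, s)).
  have -> : (fun p => \int[@lebesgue_measure R]_s n (p, s)) =
      (fun p => rho p * line_integral F p.1 (p.2 + a) (p.2 + b)).
    by apply/funext.
  apply: (test_fun_off oP crho rhoP) => [p Pp|p /supp_off ->]; last by rewrite mul0r.
  by apply: (smooth_on_continuous (smooth_mul oP _ smooth_line_integral) Pp); exact: smooth_onS srho.
rewrite (eq_spacetime_integral e1) (eq_spacetime_integral e2).
rewrite (fubini_spacetime tm tMm) (fubini_spacetime tn tMn).
by apply: eq_Rintegral => s _; exact: shift.
Qed.

End Segment.
Section Polygons.
Variables (Omega : set V) (T : R) (F : E -> V).
Hypothesis oO : open Omega.
Let Q := cylinder Omega T.
Let oQ : open Q. Proof. exact: open_cylinder. Qed.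
Hypothesis sF : smooth_on Q F.

Fixpoint polygon (a : V) (l : seq V) : Prop :=
  if l is b :: l' then (forall r, 0 <= r <= 1 -> Omega (along a b r)) /\ polygon b l'
  else True.

(** The polygon is translated by [p.2]. The translates form a neighbourhood of
    the polygon, and a circulation depending on a point of space-time can be
    tested against bumps. *)
Fixpoint circulation (p : E) (a : V) (l : seq V) : R :=
  if l is b :: l' then line_integral F p.1 (p.2 + a) (p.2 + b) + circulation p b l' else 0.

Fixpoint translates_in (p : E) (a : V) (l : seq V) : Prop :=
  if l is b :: l' then (forall r, 0 <= r <= 1 -> Q (p.1, p.2 + along a b r)) /\ translates_in p b l'
  else True.

Lemma near_translates_in t a l : 0 < t < T -> polygon a l ->
  \forall p \near ((t, 0) : E), translates_in p a l.
Proof.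
move=> tT; elim: l a => [|b l IH] a /=; first by move=> _; apply: filterE.
move=> [ab /IH nl].
have cI : compact [set r : R | 0 <= r <= 1].
  have := @segment_compact R 0 1.
  by rewrite (_ : [set` `[0, 1]] = [set r : R | 0 <= r <= 1])//; apply/seteqP; split=> r /=; rewrite in_itv.
move/compact_near_coveringP : cI => cI.
have H : \forall p \near ((t, 0) : E), [set r : R | 0 <= r <= 1] `<=` (fun r => Q (p.1, p.2 + along a b r)).
  apply: (cI E (nbhs ((t, 0) : E)) (fun p r => Q (p.1, p.2 + along a b r))) => r r01.
  have s : smooth_on setT (fun q : R * E => ((q.2.1, q.2.2 + along a b q.1) : E)).
    have s1 : smooth_on setT (fun q : R * E => q.1) by exact: smooth_fst openT.
    have s2 : smooth_on setT (fun q : R * E => q.2) by exact: smooth_snd openT.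
    have s21 : smooth_on setT (fun q : R * E => q.2.1).
      apply: (@smooth_lin_comp R _ E _ setT fst (fun q : R * E => q.2) openT _ s2).
      by move=> p; exact: cvg_fst.
    have s22 : smooth_on setT (fun q : R * E => q.2.2).
      apply: (@smooth_lin_comp R _ E _ setT snd (fun q : R * E => q.2) openT _ s2).
      by move=> p; exact: cvg_snd.
    apply: (smooth_pair openT s21); apply: (smooth_add openT s22).
    exact: (smooth_add openT (smooth_cst a openT) (smooth_scalel (b - a) openT s1)).
  have Qr : Q (t, 0 + along a b r) by split => //=; rewrite add0r; exact: ab.
  have c := smooth_on_continuous s (I : setT (r, ((t, 0) : E))).
  exact: (c _ (open_nbhs_nbhs (conj oQ Qr))).
by near=> p; split; near: p.
Unshelve. all: by end_near. Qed.

Section Tested.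
Variables (P : set E) (rho : E -> R).
Hypotheses (oP : open P) (srho : smooth_on setT rho) (crho : compact (supp rho))
  (rhoP : supp rho `<=` P).

Lemma smooth_circulation a l : (forall p, P p -> translates_in p a l) ->
  smooth_on P (fun p => circulation p a l).
Proof.
elim: l a => [|b l IH] a Pl /=; first exact: smooth_cst.
apply: (smooth_add oP); last by apply: IH => p /Pl[].
by apply: (smooth_line_integral oQ oP sF) => p r /Pl[+ _]; apply.
Qed.

(** A test field for circulations: on each segment the smeared bump times the
    direction of the segment. Its divergence is concentrated at the ends of
    the segments and cancels at the inner vertices. *)
Lemma polygon_field a l : (forall p, P p -> translates_in p a l) ->
  exists W : E -> V, exists K : set E,
  [/\ smooth_on setT W, compact K /\ K `<=` Q, forall p, ~ K p -> W p = 0,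
      forall t z, \sum_j 'D_((0, delta_mx ord0 j)) (fun q => W q ord0 j) (t, z) =
        rho (t, z - a) - rho (t, z - last a l) &
      spacetime_integral (fun p => dot (F p) (W p)) =
      spacetime_integral (fun p => rho p * circulation p a l)].
Proof.
elim: l a => [|b l IH] a Pl.
  exists (fun=> 0), set0; split.
  - exact: smooth_cst openT.
  - by split; [exact: compact0|exact: sub0set].
  - by move=> p _.
  - move=> t z /=; rewrite subrr; apply: big1 => j _.
    apply: (etrans _ (derive_cst (0 : R) ((t, z) : E) (0, delta_mx ord0 j))).
    apply: (congr1 (fun f : E -> R => 'D_((0, delta_mx ord0 j)) f (t, z))).
    by apply/funext => q; rewrite mxE.
  - by apply: eq_spacetime_integral => p; rewrite [LHS]dotC [LHS]dot0l mulr0.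
have [|W [K [sW [cK KQ] W0 Wdiv WI]]] := IH b; first by move=> p /Pl[].
have PQ p r : P p -> 0 <= r <= 1 -> Q (p.1, p.2 + along a b r) by move=> /Pl[+ _]; apply.
pose w := smeared a b rho; pose K1 := smeared_support a b rho.
have sw : smooth_on setT w by exact: smooth_smeared.
have cK1 : compact K1 by exact: smeared_support_compact.
have K1Q : K1 `<=` Q by exact: (smeared_supportQ PQ rhoP).
have w0 p : ~ K1 p -> w p = 0 by exact: smeared_off.
exists (fun p => w p *: (b - a) + W p), (K1 `|` K); split.
- exact: (smooth_add openT (smooth_scalel _ openT sw) sW).
- by split; [exact: compactU|move=> p [/K1Q|/KQ]].
- move=> p nK; rewrite w0 ?W0 ?scale0r ?addr0// => Kp; apply: nK; by [left|right].
- move=> t z /=.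
  (* the contributions of the common end point of two segments cancel *)
  have tele (x y u : R) : (x - y) + (y - u) = x - u by rewrite addrA subrK.
  apply: (etrans _ (tele _ (rho (t, z - b)) _)).
  apply: (etrans _ (congr2 +%R (derive_smeared a b srho t z) (Wdiv t z))).
  have dw := smooth_on_differentiable sw (I : setT (t, z)).
  apply: (etrans _ (congr1 (fun x => x + _) (esym (derive_basis dw (spatial_basis (b - a)))))).
  rewrite -big_split; apply: eq_bigr => j _.
  have swj : derivable (fun q => w q) (t, z) (0, delta_mx ord0 j) by exact: diff_derivable.
  have sWj : derivable (fun q => W q ord0 j) (t, z) (0, delta_mx ord0 j).
    by apply: diff_derivable; exact: (smooth_on_differentiable (smooth_coord j openT sW)).
  have dZ : derivable ((b - a) ord0 j \*: w) (t, z) (0, delta_mx ord0 j) by exact: derivableZ.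
  have fE : (fun q => (w q *: (b - a) + W q) ord0 j) =
      ((b - a) ord0 j \*: w) + (fun q => W q ord0 j).
    by apply/funext => q; rewrite !mxE mulrC.
  apply: (etrans (congr1 (fun f => 'D_((0, delta_mx ord0 j)) f (t, z)) fE)).
  apply: (etrans (deriveD dZ sWj)).
  exact: (congr1 (fun x => x + _) (deriveZ _ swj)).
- have sFD (k : E -> V) : smooth_on setT k -> smooth_on Q (fun p => dot (F p) (k p)).
    by move=> sk; exact: (smooth_dot oQ sF (smooth_onS (@subsetT _ Q) sk)).
  have t1 : test_fun (fun p => dot (F p) (b - a) * w p).
    apply: (test_fun_off oQ cK1 K1Q) => [p Qp|p /w0 ->]; last by rewrite mulr0.
    have s : smooth_on Q (fun p => dot (F p) (b - a) * w p).
      apply: (smooth_mul oQ); last exact: smooth_onS sw.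
      by apply: (sFD (fun=> b - a)); exact: smooth_cst openT.
    exact: (smooth_on_continuous s Qp).
  have t2 : test_fun (fun p => dot (F p) (W p)).
    apply: (test_fun_off oQ cK KQ) => [p Qp|p /W0 ->]; last by rewrite dotC dot0l.
    exact: (smooth_on_continuous (sFD W sW) Qp).
  have tr (c : E -> R) : smooth_on P c -> test_fun (fun p => rho p * c p).
    move=> sc; apply: (test_fun_off oP crho rhoP) => [p Pp|p /supp_off ->]; last by rewrite mul0r.
    by apply: (smooth_on_continuous (smooth_mul oP _ sc) Pp); exact: smooth_onS srho.
  transitivity (spacetime_integral (fun p => dot (F p) (b - a) * w p + dot (F p) (W p))).
    by apply: eq_spacetime_integral => p; rewrite [LHS]dotDr [X in X + _]dotZr mulrC.
  rewrite (spacetime_integralD t1 t2) WI (smeared_circulation oQ oP sF PQ srho crho rhoP).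
  rewrite -spacetime_integralD; last 2 first.
    exact: tr (smooth_line_integral oQ oP sF PQ).
    by apply: tr; apply: smooth_circulation => p /Pl[].
  by apply: eq_spacetime_integral => p; rewrite /= mulrDr.
Qed.

End Tested.

Hypothesis F_orth : forall W : E -> V, smooth_on setT W -> compact (supp W) -> supp W `<=` Q ->
  (forall t z, \sum_j 'D_((0, delta_mx ord0 j)) (fun q => W q ord0 j) (t, z) = 0) ->
  local_integral Q (fun p => dot (F p) (W p)) = 0.

(** Tested against the bump smeared along a closed polygon, which is free of
    divergence, [F] shows the mean of its circulations along the translates of
    the polygon; the bump being arbitrary, the circulation vanishes. *)
Lemma closed_circulation t a l : 0 < t < T -> polygon a l -> last a l = a ->
  circulation (t, 0) a l = 0.
Proof.
move=> tT al la; have nP := near_translates_in tT al.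
pose P := interior [set p : E | translates_in p a l].
have oP : open P by exact: open_interior.
have PT p : P p -> translates_in p a l by exact: interior_subset.
have Pt : P (t, 0) by [].
have sc := smooth_circulation oP PT.
apply: (fundamental_lemma (@chart_spacetime R d) (h := fun p => circulation p a l) (@has_bumps_spacetime R d) oP) => //.
  by move=> p; exact: smooth_on_continuous.
move=> rho srho crho rhoP.
have [W [K [sW [cK KQ] W0 Wdiv WI]]] := polygon_field oP srho crho rhoP PT.
have sWK : supp W `<=` K.
  by apply: supp_sub W0; exact: (compact_closed (@norm_hausdorff _ _) cK).
have cW := subclosed_compact (@closed_closure _ _) cK sWK.
have div0 t' z : \sum_j 'D_((0, delta_mx ord0 j)) (fun q => W q ord0 j) (t', z) = 0.
  by rewrite Wdiv la subrr.
have e := F_orth sW cW (subset_trans sWK KQ) div0.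
have tr : test_fun (fun p => rho p * circulation p a l).
  apply: (test_fun_off oP crho rhoP) => [p Pp|p /supp_off ->]; last by rewrite mul0r.
  by apply: (smooth_on_continuous (smooth_mul oP _ sc) Pp); exact: smooth_onS srho.
apply: (etrans (esym (spacetime_integralE tr))); rewrite -WI -[RHS]e.
apply: eq_spacetime_integral => p; rewrite /zero_extend; case: asboolP => [_|nQ]; first exact: erefl.
have Wp : W p = 0 by apply: W0 => Kp; exact: nQ (KQ p Kp).
by rewrite Wp dotC dot0l.
Qed.

End Polygons.
End LineIntegrals.

(** * Potentials *)

Section Potential.
Context {R : realType} {d : nat}.
Notation V := 'rV[R]_d.
Notation E := (R * 'rV[R]_d)%type.
Variables (Omega : set V) (T : R) (F : E -> V).
Hypothesis oO : open Omega.
Let Q := cylinder Omega T.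
Let oQ : open Q. Proof. exact: open_cylinder. Qed.
Hypothesis sF : smooth_on Q F.
Hypothesis closed_zero : forall t a l, 0 < t < T -> polygon Omega a l -> last a l = a ->
  circulation F (t, 0) a l = 0.

Notation circ t := (circulation F ((t, 0) : E)).

Lemma circulation_cat t a l l' : circ t a (l ++ l') = circ t a l + circ t (last a l) l'.
Proof. by elim: l a => [|b l IH] a /=; rewrite ?add0r// IH addrA. Qed.

Lemma polygon_cat a l l' : polygon Omega a (l ++ l') <->
  polygon Omega a l /\ polygon Omega (last a l) l'.
Proof.
elim: l a => [|b l IH] a /=; first by split=> [|[]].
by rewrite IH; split=> [[? [? ?]]|[[? ?] ?]].
Qed.

Definition linked (a z : V) : Prop := exists2 l, polygon Omega a l & last a l = z.

Lemma linked_trans a b c : linked a b -> linked b c -> linked a c.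
Proof.
move=> [l al <-] [l' bl <-]; exists (l ++ l'); last by rewrite last_cat.
by apply/polygon_cat.
Qed.

Lemma alongC (a b : V) r : along a b r = along b a (1 - r).
Proof.
apply/rowP => i; rewrite !mxE; ring.
Qed.

Lemma linked_sym a b : linked a b -> linked b a.
Proof.
move=> [l]; elim: l a => [|c l IH] a /=; first by move=> _ <-; exists [::].
move=> [ac cl] lb; apply: (linked_trans (IH c cl lb)).
exists [:: a] => //=; split => // r /andP[r0 r1]; rewrite alongC; apply: ac.
by rewrite subr_ge0 r1 gerBl r0.
Qed.

(** A point chosen in the component of [z], the same one for all its points;
    [Omega] may have several components. *)
Definition base (z : V) : V := xget 0 (linked z).

Lemma linked_base z : linked (base z) z.
Proof.
apply: linked_sym; apply: (xgetPex 0).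
by exists z; exists [::].
Qed.

Lemma base_eq z z' : linked z z' -> base z = base z'.
Proof.
move=> zz'; rewrite /base; congr (xget _ _); apply/seteqP; split=> y.
  by apply: linked_trans; exact: linked_sym.
exact: linked_trans.
Qed.

Definition route (z : V) : seq V :=
  xget [::] [set l | polygon Omega (base z) l /\ last (base z) l = z].

Lemma routeP z : polygon Omega (base z) (route z) /\ last (base z) (route z) = z.
Proof.
have [l al la] := linked_base z.
exact: (xgetPex [::] (ex_intro (fun l => polygon Omega (base z) l /\ last (base z) l = z) l (conj al la))).
Qed.

Definition potential (t : R) (z : V) : R := circ t (base z) (route z).

Lemma circulation_independent t a l l' : 0 < t < T -> polygon Omega a l -> polygon Omega a l' ->
  last a l = last a l' -> circ t a l = circ t a l'.
Proof.
move=> tT al al' e.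
have [k kl kz] : linked (last a l) a by apply: linked_sym; exists l.
have c1 : circ t a (l ++ k) = 0.
  by apply: closed_zero => //; [apply/polygon_cat|rewrite last_cat].
have c2 : circ t a (l' ++ k) = 0.
  by apply: closed_zero => //; [apply/polygon_cat; rewrite -e|rewrite last_cat -e].
apply: (addIr (circ t (last a l) k)).
by rewrite -circulation_cat c1 e -circulation_cat c2.
Qed.

(** The segment closes the routes to its end points to a polygon, along which
    the circulation is zero. *)
Lemma potential_segment t z z' : 0 < t < T -> (forall r, 0 <= r <= 1 -> Omega (along z z' r)) ->
  potential t z' = potential t z + line_integral F t z z'.
Proof.
move=> tT zz'; have [p1 l1] := routeP z; have [p2 l2] := routeP z'.
have bb : base z = base z' by apply: base_eq; exists [:: z'].
rewrite /potential.
have -> : line_integral F t z z' = circ t z [:: z'] by rewrite /= !add0r addr0.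
rewrite -[in circ t z [:: z']]l1 -circulation_cat bb; apply: circulation_independent => //.
  by apply/polygon_cat; rewrite -bb l1.
by rewrite last_cat -bb l1 -[in RHS]l2 bb.
Qed.

(** Near a given time, the circulation is the restriction to the translation
    zero of a function smooth in time and translation. *)
Lemma smooth_circulation_time a l : polygon Omega a l ->
  smooth_on [set p : E | 0 < p.1 < T] (fun p => circ p.1 a l).
Proof.
move=> al vs p tT; have nP := near_translates_in oO tT al.
pose P := interior [set p : E | translates_in Omega T p a l].
have oP : open P by exact: open_interior.
have PT p' : P p' -> translates_in Omega T p' a l by exact: interior_subset.
have sc := smooth_circulation oO sF oP PT.
have s0 U : open U -> smooth_on U (fun p : E => ((p.1, 0) : E)).
  by move=> oU; exact: (smooth_pair oU (smooth_fst oU) (smooth_cst 0 oU)).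
have oP' : open [set p : E | P (p.1, 0)].
  have : open ((fun p : E => ((p.1, 0) : E)) @^-1` P).
    by apply: open_comp => // q _; exact: (smooth_on_continuous (s0 _ openT)).
  by [].
have sI := @smooth_comp R E E [set p : E | P (p.1, 0)] P (fun p => circulation F p a l)
  (fun p => (p.1, 0)) finite_basisE oP' oP (fun p Pp => Pp) sc (s0 _ oP').
exact: sI.
Qed.

Lemma line_integral_gradient t z : Q (t, z) ->
  exists U : set E, [/\ open U, U (t, z), U `<=` Q,
    forall p r, U p -> 0 <= r <= 1 -> Omega (along z p.2 r) &
    smooth_on U (fun p => line_integral F p.1 z p.2) /\ forall i,
    'D_((0, delta_mx ord0 i)) (fun p : E => line_integral F p.1 z p.2) (t, z) = F (t, z) ord0 i].
Proof.
move=> Qp; have [tT Oz] := Qp.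
have /nbhs_ballP[r r0 rO] : nbhs z Omega by exact: open_nbhs_nbhs.
pose U := [set p : E | (0 < p.1 < T) /\ ball z r p.2].
have oU : open U by apply: (@open_cylinder R d (ball z r) T); exact: ball_open.
have inB (p : E) s : U p -> 0 <= s <= 1 -> ball z r (along z p.2 s).
  move=> [_]; rewrite -!ball_normE /ball_/= => pr /andP[s0 s1].
  rewrite /along opprD addNKr normrN normrZ ger0_norm// distrC.
  by rewrite (le_lt_trans _ pr)// ler_piMl.
have UQ (p : E) s : U p -> 0 <= s <= 1 -> Q (p.1, along z p.2 s).
  by move=> Up s01; split; [case: Up|apply: rO; exact: inB].
pose G (q : E * R) : R := step_rate q.2 * dot (F (q.1.1, along z q.1.2 (smooth_step q.2))) (q.1.2 - z).
have oS : open [set q : E * R | U q.1].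
  have : open ((fun q : E * R => q.1) @^-1` U) by apply: open_comp => // q _; exact: cvg_fst.
  by [].
have s11 : smooth_on [set q : E * R | U q.1] (fun q => q.1.1).
  apply: (@smooth_lin_comp R _ E _ _ fst (fun q : E * R => q.1) oS _ (smooth_fst oS)).
  by move=> p; exact: cvg_fst.
have s12 : smooth_on [set q : E * R | U q.1] (fun q => q.1.2).
  apply: (@smooth_lin_comp R _ E _ _ snd (fun q : E * R => q.1) oS _ (smooth_fst oS)).
  by move=> p; exact: cvg_snd.
have sz : smooth_on [set q : E * R | U q.1] (fun q => q.1.2 - z).
  exact: (smooth_sub oS s12 (smooth_cst z oS)).
have sal : smooth_on [set q : E * R | U q.1] (fun q => ((q.1.1, along z q.1.2 (smooth_step q.2)) : E)).
  apply: (smooth_pair oS s11); apply: (smooth_add oS (smooth_cst z oS)).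
  exact: (smooth_scale_field oS (smooth_step_comp oS (smooth_snd oS)) sz).
have sFi j : smooth_on [set q : E * R | U q.1] (fun q => F (q.1.1, along z q.1.2 (smooth_step q.2)) ord0 j).
  exact: (@smooth_comp R (E * R)%type E _ Q (fun p => F p ord0 j) _ finite_basisE oS oQ (fun q Uq => UQ q.1 _ Uq (step01 q.2)) (smooth_coord j oQ sF) sal).
have sG : smooth_on [set q : E * R | U q.1] G.
  apply: (smooth_mul oS (smooth_step_rate_comp oS (smooth_snd oS))).
  by apply: (smooth_dot oS _ sz); exact: smooth_row.
have tG : strip_test U 1 G.
  split; first exact: sG.
  by move=> p s _ /step_rate_off e; rewrite /G /= e mul0r.
have Up : U (t, z) by split=> //; exact: ballxx.
exists U; split => //.
- by move=> p [pT /rO].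
- by move=> p s Up' s01; apply: rO; exact: inB.
split; first exact: (smooth_param_integral chart_real finite_basisE finite_basisR oU tG).
move=> i.
have [_ dE] := param_integral_differentiable chart_real finite_basisE finite_basisR oU tG Up.
apply: (etrans (dE _)).
have DG s : 'D_((((0, delta_mx ord0 i) : E), 0)) G ((t, z), s) = F (t, z) ord0 i * step_rate s.
  pose v : E * R := ((0, delta_mx ord0 i), 0).
  pose A j (q : E * R) := step_rate q.2 * F (q.1.1, along z q.1.2 (smooth_step q.2)) ord0 j.
  pose B j (q : E * R) := (q.1.2 - z) ord0 j.
  have sA j : smooth_on [set q : E * R | U q.1] (A j).
    exact: (smooth_mul oS (smooth_step_rate_comp oS (smooth_snd oS)) (sFi j)).
  have sB j : smooth_on [set q : E * R | U q.1] (B j) by exact: smooth_coord.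
  have Us : [set q : E * R | U q.1] ((t, z), s) by [].
  have dA j : derivable (A j) ((t, z), s) v by apply: diff_derivable; exact: (smooth_on_differentiable (sA j)).
  have dB j : derivable (B j) ((t, z), s) v by apply: diff_derivable; exact: (smooth_on_differentiable (sB j)).
  have GE : G = \sum_j A j * B j.
    apply/funext => q; rewrite fct_sumE /G /dot mulr_sumr; apply: eq_bigr => j _.
    by rewrite /A /B -mulrA.
  (* the factor [q.1.2 - z] vanishes at [(t, z)], so that the derivative of
     the field does not contribute *)
  have B0 j : B j ((t, z), s) = 0 by rewrite /B /= subrr mxE.
  have DB j : 'D_v (B j) ((t, z), s) = (j == i)%:R.
    apply: derive_affine => h; rewrite /B /= !mxE eqxx /=.
    by rewrite /GRing.scale /= subrr add0r addrK.
  rewrite GE; apply: (etrans (derive_sum (fun j => derivableM (dA j) (dB j)))).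
  rewrite (bigD1 i)//= big1 ?addr0 => [|j ji].
    apply: (etrans (deriveM (dA i) (dB i))); rewrite DB B0 eqxx /GRing.scale/= mulr1 mul0r addr0.
    by rewrite /A /= /along subrr scaler0 addr0 mulrC.
  apply: (etrans (deriveM (dA j) (dB j))); rewrite DB B0 (negbTE ji) /GRing.scale/=.
  by rewrite mulr0 mul0r addr0.
transitivity (\int[@lebesgue_measure R]_s (F (t, z) ord0 i * step_rate s)).
  by apply: eq_Rintegral => s _; exact: DG.
have tr : test_fun (@step_rate R).
  split; first by move=> s; exact: (smooth_on_continuous (@smooth_step_rate R)).
  by exists 1; exact: step_rate_off.
(* what remains is the value of the field times the integral of [step_rate],
   which is one *)
rewrite (integral_testZ chart_real _ tr).
rewrite integral_derive_step.
- by rewrite (smooth_step_le0 (lexx 0)) (smooth_step_ge1 (lexx 1)) subr0 mulr1.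
- by move=> s; apply: diff_derivable; exact: (smooth_on_differentiable (@smooth_smooth_step R)).
- by move=> s; exact: (smooth_on_continuous (@smooth_step_rate R)).
- by move=> s s0; rewrite !smooth_step_le0.
- by move=> s s1; rewrite !smooth_step_ge1.
Qed.

Lemma potential_local t z : Q (t, z) ->
  exists U : set E, [/\ open U, U (t, z), smooth_on U (spacetime potential) &
    forall i, 'D_((0, delta_mx ord0 i)) (spacetime potential) (t, z) = F (t, z) ord0 i].
Proof.
move=> Qp; have [U [oU Up UQ Useg [sL DL]]] := line_integral_gradient Qp.
have [pz _] := routeP z.
pose c (p : E) := circ p.1 (base z) (route z).
pose L (p : E) := line_integral F p.1 z p.2.
have sc : smooth_on U c by apply: smooth_onS (smooth_circulation_time pz) => p /UQ[].
have potE p : U p -> c p + L p = spacetime potential p.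
  move=> Up'; have [pT _] := UQ p Up'.
  by rewrite /spacetime (potential_segment pT (fun r => Useg p r Up')).
exists U; split => //; first exact: (smooth_on_ext oU potE (smooth_add oU sc sL)).
move=> i; apply: (etrans (near_derive_eq (g := c + L) _ _)).
  by apply: (open_near oU _ Up) => p Up'; rewrite -potE.
have dc : derivable c (t, z) (0, delta_mx ord0 i).
  by apply: diff_derivable; exact: (smooth_on_differentiable sc).
have dL : derivable L (t, z) (0, delta_mx ord0 i).
  by apply: diff_derivable; exact: (smooth_on_differentiable sL).
apply: (etrans (deriveD dc dL)).
have c0 : 'D_((0, delta_mx ord0 i)) c (t, z) = 0.
  apply: derive_affine => h; rewrite scaler0 addr0 /c.
  have -> : (h *: ((0, delta_mx ord0 i) : E) + (t, z)).1 = t.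
    by rewrite -[LHS]/(h * 0 + t) mulr0 add0r.
  by [].
exact: (etrans (congr2 +%R c0 (DL i)) (add0r _)).
Qed.

Lemma potentialP : smooth_on Q (spacetime potential) /\
  forall t z, 0 < t < T -> Omega z -> grad (potential t) z = F (t, z).
Proof.
split=> [vs [t z] Qp|t z tT Oz].
  by have [U [_ Up sU _]] := potential_local Qp; exact: sU.
have [U [_ _ _ D]] := potential_local (conj tT Oz : Q (t, z)).
by apply/rowP => i; rewrite grad_spacetime mxE.
Qed.

End Potential.

(** The circulations along closed polygons vanish, so that the line integral
    from a base point is a potential. *)
Lemma orthogonal_gradient (R : realType) (d : nat) (Omega : set 'rV[R]_d) (T : R)
    (F : R * 'rV[R]_d -> 'rV[R]_d) : open Omega -> smooth_on (cylinder Omega T) F ->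
  (forall W : R * 'rV[R]_d -> 'rV[R]_d, smooth_on setT W -> compact (supp W) ->
     supp W `<=` cylinder Omega T ->
     (forall t z, \sum_j 'D_((0, delta_mx ord0 j)) (fun q => W q ord0 j) (t, z) = 0) ->
     local_integral (cylinder Omega T) (fun p => dot (F p) (W p)) = 0) ->
  exists p : R -> 'rV[R]_d -> R, smooth_on (cylinder Omega T) (spacetime p) /\
    forall t z, 0 < t < T -> Omega z -> grad (p t) z = F (t, z).
Proof.
move=> oO sF orth; exists (potential Omega F).
apply: (potentialP oO sF) => t a l tT al la.
exact: (closed_circulation oO sF orth tT al la).
Qed.

(** * Force balances *)

Section ForceBalance.
Context {R : realType} {d : nat}.
Notation V := 'rV[R]_d.
Notation E := (R * 'rV[R]_d)%type.
Variables (Omega : set V) (T : R).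
Hypothesis oO : open Omega.
Let Q := cylinder Omega T.
Let oQ : open Q. Proof. exact: open_cylinder. Qed.

(** A balance of forces is a statement about some choice of the forces; where
    each of them is unique, it is the equation between the known ones. *)
Lemma force_balanceE (is_i is_c is_d : (R -> V -> V) -> Prop) (fi fc fd : R -> V -> V) :
  is_i fi -> is_c fc -> is_d fd ->
  (forall f, is_i f -> forall p, Q p -> spacetime f p = spacetime fi p) ->
  (forall f, is_c f -> forall p, Q p -> spacetime f p = spacetime fc p) ->
  (forall f, is_d f -> forall p, Q p -> spacetime f p = spacetime fd p) ->
  force_balance Omega T is_i is_c is_d <->
  forall t y, 0 < t < T -> Omega y -> fc t y + fd t y = fi t y.
Proof.
move=> hi hc hd ui uc ud; split=> [[gi [gc [gd [Hi Hc Hd B]]]] t y tT Oy|H]; last first.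
  by exists fi, fc, fd.
have Qp : Q (t, y) by [].
have ei := ui _ Hi _ Qp; have ec := uc _ Hc _ Qp; have ed := ud _ Hd _ Qp.
rewrite /spacetime/= in ei ec ed.
by rewrite -ei -ec -ed; exact: B.
Qed.

Section Flow.
Variables (x Y : R -> V -> V).
Hypothesis xY : inverse_flows Omega T x Y.

Lemma first_variation_unique J f g :
  first_variation Omega T unconstrained J x f -> first_variation Omega T unconstrained J x g ->
  forall p, Q p -> spacetime f p = spacetime g p.
Proof.
move=> Hf Hg; have [[sf _] [sg _]] := (Hf, Hg).
apply: (local_integral_fundamental oO sf sg) => W sW cW WQ.
exact: (first_variation_weak oO xY Hf Hg sW cW WQ (fun _ _ => I)).
Qed.

Lemma volume_integral_force0 O dx : initial_volume Omega O -> Defs.variation T O dx ->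
  volume_integral T O x (fun t y => dot ((fun _ _ => 0 : V) t y) (eulerian Omega x dx t y)) = 0.
Proof.
move=> iO vdx; rewrite (volume_integral_force xY iO vdx (fun _ _ => 0)).
apply: (etrans _ (@local_integral0 R d Q)).
by apply: eq_local_integral => p _; rewrite [LHS]dot0l.
Qed.

Lemma inertial_force_none adm :
  inertial_force Omega T adm (@no_kinetic_action R d) x (fun _ _ => 0).
Proof.
split; first exact: smooth_cst.
by move=> O dx iO vdx _; rewrite volume_integral_force0//; exact: is_derive_cst.
Qed.

(** The kinetic energy of a fixed Eulerian velocity is blind to the variations
    of the flow map, which preserve the transported volume. *)
Lemma inertial_force_fixed adm v :
  inertial_force Omega T adm (kinetic_action T (fun=> v)) x (fun _ _ => 0).
Proof.
split; first exact: smooth_cst.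
move=> O dx iO vdx _; rewrite volume_integral_force0//.
exact: (displaced_flow_kinetic_constant oO xY iO vdx v).
Qed.

Variables (psi : R -> V -> R -> R) (phi theta : R -> V -> R) (N : set E).
Hypotheses (smooth_psi : smooth_on [set q : R * V * R | 0 < q.2]
    (fun q => psi q.1.1 q.1.2 q.2))
  (oN : open N) (NC : closed_cylinder Omega T `<=` N)
  (sphi : smooth_on N (spacetime phi)) (stheta : smooth_on N (spacetime theta))
  (th0 : forall p, N p -> 0 < spacetime theta p).

Lemma conservative_force_density adm (mp mt : bool) phi0 theta0 :
  (mp -> transported Omega T x phi0 phi) -> (mt -> transported Omega T x theta0 theta) ->
  conservative_force Omega T adm psi (transported_phase Omega phi mp phi0)
    (transported_temperature Omega theta mt theta0) x
    (conservative_density psi phi theta mp mt).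
Proof.
move=> trp trt; split.
  exact: (smooth_opp oQ (smooth_conservative_density oO smooth_psi NC sphi stheta th0 mp mt)).
move=> O dx iO vdx _.
exact: (conservative_first_variation oO xY iO vdx smooth_psi oN NC sphi stheta th0 trp trt).
Qed.

Variables (u v : R -> V -> V) (eta : R -> R -> R) (nu : R).
Hypotheses (su : smooth_on Q (spacetime u)) (sv : smooth_on Q (spacetime v))
  (seta : smooth_on [set p : R * R | 0 < p.2] (fun p => eta p.1 p.2))
  (fin : finite_dissipation Omega T eta nu phi theta u v).

Let QN : Q `<=` N. Proof. by move=> p /cylinder_closed/NC. Qed.

Let sphiQ := smooth_onS QN sphi.
Let sthetaQ := smooth_onS QN stheta.
Let th0Q t z : Q (t, z) -> 0 < theta t z.
Proof. by move=> /QN/th0. Qed.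

Lemma phase_force_balance kin (mt : bool) phi0 theta0 :
  transported Omega T x phi0 phi -> (mt -> transported Omega T x theta0 theta) ->
  inertial_force Omega T unconstrained kin x (fun _ _ => 0) ->
  force_balance Omega T (inertial_force Omega T unconstrained kin x)
    (conservative_force Omega T unconstrained psi (transported_phase Omega phi true phi0)
       (transported_temperature Omega theta mt theta0) x)
    (dissipative_force Omega T
       (fun t w => dissipation Omega eta nu (phi t) (theta t) w (v t)) u) <->
  forall t y, 0 < t < T -> Omega y ->
    - (eta (phi t y) (theta t y) * dot (u t y - v t y) (grad (phi t) y)) *: grad (phi t) y =
    chemical_potential psi phi theta t y *: grad (phi t) y +
    mt%:R *: (entropy psi phi theta t y *: grad (theta t) y).
Proof.
move=> trp trt hi.
have hc := conservative_force_density unconstrained (mp := true) (fun _ => trp) trt.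
have hd := dissipative_force_u oO sphiQ sthetaQ th0Q su sv seta fin.
have B := force_balanceE hi hc hd.
apply: (iff_trans (B _ _ _)).
- by move=> f Hf p Qp; exact: (first_variation_unique Hf hi Qp).
- move=> f Hf p Qp; apply: oppr_inj; exact: (first_variation_unique Hf hc Qp).
- by move=> f Hf [t y] [tT Oy]; exact: (dissipative_force_unique oO Hf hd tT Oy).
have E1 t y : conservative_density psi phi theta true mt t y =
    chemical_potential psi phi theta t y *: grad (phi t) y +
    mt%:R *: (entropy psi phi theta t y *: grad (theta t) y).
  by rewrite /conservative_density scale1r.
split=> H t y tT Oy; have := H t y tT Oy; rewrite E1.
  by move=> /eqP; rewrite addr_eq0 => /eqP ->; rewrite scaleNr.
by move=> <-; rewrite scaleNr addNr.
Qed.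

End Flow.

(** Integrated by parts, this is the integral of [p] times the divergence of
    [W]: pressure forces do no work along divergence-free variations. *)
Lemma gradient_orthogonal (p : R -> V -> R) (W : E -> V) (K : set E) :
  smooth_on Q (spacetime p) -> smooth_on setT W -> compact K -> K `<=` Q ->
  (forall q, ~ K q -> W q = 0) ->
  (forall q, Q q -> \sum_j 'D_((0, delta_mx ord0 j)) (fun q => W q ord0 j) q = 0) ->
  local_integral Q (fun q => dot (spacetime (fun t => grad (p t)) q) (W q)) = 0.
Proof.
move=> sp sW cK KQ W0 div0.
pose w j q := W q ord0 j; pose D (j : 'I_d) (f : E -> R) := 'D_((0, delta_mx ord0 j)) f.
have tw j : local_test Q K (w j).
  split; first by apply: smooth_coord => //; exact: smooth_onS sW.
  by move=> q _ nK; rewrite /w W0// mxE.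
have tD j : local_test Q K (fun q => spacetime p q * D j (w j) q).
  by apply: (local_testM oQ sp); exact: (local_test_derive oQ cK _ (tw j)).
have tP j : local_test Q K (fun q => D j (spacetime p) q * w j q).
  by apply: (local_testM oQ _ (tw j)); exact: smooth_on_derive.
have parts j : local_integral Q (fun q => spacetime p q * D j (w j) q) =
    - local_integral Q (fun q => D j (spacetime p) q * w j q).
  by apply: (local_integral_parts oQ cK KQ _ sp (tw j)); right; exists j.
transitivity (local_integral Q (fun q => \sum_j D j (spacetime p) q * w j q)).
  apply: eq_local_integral => -[t z] _; apply: eq_bigr => j _.
  by rewrite /spacetime/= grad_spacetime mxE.
apply: (etrans (local_integral_sum oQ cK KQ (index_enum 'I_d) tP)).
transitivity (- \sum_j local_integral Q (fun q => spacetime p q * D j (w j) q)).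
  by rewrite -sumrN; apply: eq_bigr => j _; rewrite parts opprK.
rewrite -(local_integral_sum oQ cK KQ (index_enum 'I_d) tD).
apply: (etrans (congr1 -%R _) (oppr0 _)).
apply: (etrans _ (@local_integral0 R d Q)); apply: eq_local_integral => q Qq.
by rewrite -mulr_sumr div0// mulr0.
Qed.

Section ViscousFlow.
Variables (y Y : R -> V -> V).
Hypothesis yY : inverse_flows Omega T y Y.
Variables (psi : R -> V -> R -> R) (phi theta : R -> V -> R) (N : set E).
Hypotheses (smooth_psi : smooth_on [set q : R * V * R | 0 < q.2]
    (fun q => psi q.1.1 q.1.2 q.2))
  (oN : open N) (NC : closed_cylinder Omega T `<=` N)
  (sphi : smooth_on N (spacetime phi)) (stheta : smooth_on N (spacetime theta))
  (th0 : forall p, N p -> 0 < spacetime theta p).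
Variables (u v : R -> V -> V) (eta : R -> R -> R) (nu : R) (theta0 : V -> R).
Hypotheses (su : smooth_on Q (spacetime u)) (sv : smooth_field Omega T v)
  (yv : forall t X, 0 <= t <= T -> Omega X -> dt y t X = v t (y t X))
  (div_v : forall t z, 0 <= t <= T -> Omega z -> divergence (v t) z = 0)
  (seta : smooth_on [set p : R * R | 0 < p.2] (fun p => eta p.1 p.2))
  (fin : finite_dissipation Omega T eta nu phi theta u v)
  (trt : transported Omega T y theta0 theta).

Let QN : Q `<=` N. Proof. by move=> p /cylinder_closed/NC. Qed.
Let sphiQ := smooth_onS QN sphi.
Let sthetaQ := smooth_onS QN stheta.
Let th0Q t z : Q (t, z) -> 0 < theta t z. Proof. by move=> /QN/th0. Qed.
Let svQ : smooth_on Q (spacetime v). Proof. exact: smooth_field_cylinder. Qed.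

Let adm := divergence_free Omega T y.
Let Jkin := kinetic_action T (velocity Omega).
Let thermal (t : R) (z : V) : V := entropy psi phi theta t z *: grad (theta t) z.

Lemma smooth_acceleration : smooth_on Q (spacetime (acceleration v)).
Proof.
have s1 : smooth_on Q (spacetime (dt v)).
  by apply: (smooth_on_ext oQ _ (smooth_on_derive ((1, 0) : E) svQ)) => -[t z] _; rewrite /spacetime dt_spacetime.
have s2 : smooth_on Q (fun p => 'D_((0, spacetime v p)) (spacetime v) p).
  apply: smooth_row => // i; have svi := smooth_coord i oQ svQ.
  have s : smooth_on Q (fun p => \sum_j spacetime v p ord0 j *
      'D_((0, delta_mx ord0 j)) (fun q => spacetime v q ord0 i) p).
    apply: (smooth_sum _ _ oQ) => j; apply: (smooth_mul oQ); first exact: smooth_coord.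
    exact: smooth_on_derive.
  apply: (smooth_on_ext oQ _ s) => p Qp; have dv := smooth_on_differentiable svQ Qp.
  apply: (etrans (esym (derive_basis (smooth_on_differentiable svi Qp) (spatial_basis (spacetime v p))))).
  exact: (derive_coord ((0, spacetime v p) : E) i dv).2.
apply: (smooth_on_ext oQ _ (smooth_add oQ s1 s2)) => -[t z] _.
rewrite /spacetime/= /acceleration; congr (_ + _).
by apply: esym; exact: (derive_slice2 (spacetime v) t z _).1.
Qed.

Lemma inertial_force_acceleration :
  inertial_force Omega T adm Jkin y (fun t z => - acceleration v t z).
Proof.
split; first exact: (smooth_opp oQ smooth_acceleration).
have [Nv [oNv NvC sNv]] := sv.
move=> O dx iO vdx div_dx.
exact: (kinetic_first_variation oO yY iO vdx oNv NvC sNv yv div_v div_dx).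
Qed.

Let conservative_density_thermal t z :
  conservative_density psi phi theta false true t z = thermal t z.
Proof. by rewrite /conservative_density scale0r scale1r add0r. Qed.

Lemma conservative_force_thermal :
  conservative_force Omega T adm psi (fun=> phi) (push Omega theta0) y thermal.
Proof.
have [s H] := conservative_force_density yY smooth_psi oN NC sphi stheta th0
  adm (mp := false) (mt := true) (phi0 := theta0) (fun f => False_ind _ (notF f)) (fun _ => trt).
have tE : conservative_density psi phi theta false true = thermal.
  by apply/funext => t; apply/funext => z; exact: conservative_density_thermal.
by rewrite tE in s H.
Qed.

Let friction_v := friction_force phi theta u v eta.

(** What is left of the momentum balance before the pressure: its vanishing
    up to a gradient is the balance of forces. *)
Let gap (t : R) (z : V) : V :=
  thermal t z + (acceleration v t z + (- friction_v t z - nu *: vlaplacian (v t) z)).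

Let smooth_thermal : smooth_on Q (spacetime thermal).
Proof.
apply: (smooth_scale_field oQ); first exact: (smooth_entropy smooth_psi oQ sphiQ sthetaQ (fun p => @th0Q p.1 p.2)).
exact: smooth_grad.
Qed.

Lemma divergence_free_displacement dx (W : E -> V) :
  (forall p, Q p -> displacement Omega T Y dx p = W p) ->
  (forall t z, \sum_j 'D_((0, delta_mx ord0 j)) (fun q => W q ord0 j) (t, z) = 0) -> adm dx.
Proof.
move=> dW div0 t z tT Oz; apply: (etrans _ (div0 t z)); apply: eq_bigr => j _.
apply: (etrans _ (derive_slice2 (fun q => W q ord0 j) t z (delta_mx ord0 j)).1).
apply: near_derive_eq; apply: (open_near oO _ Oz) => z' Oz'.
rewrite (eulerian_variation dx yY tT Oz'); exact: (congr1 (fun r : V => r ord0 j) (dW (t, z') (conj tT Oz'))).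
Qed.

(** The forces along the divergence-free variations are known up to fields
    orthogonal to all divergence-free test fields, which are the gradients. *)
Lemma viscous_force_balance :
  force_balance Omega T (inertial_force Omega T adm Jkin y)
    (conservative_force Omega T adm psi (fun=> phi) (push Omega theta0) y)
    (dissipative_force Omega T
       (fun t w => dissipation Omega eta nu (phi t) (theta t) (u t) w) v) <->
  exists p : R -> V -> R, smooth_on Q (spacetime p) /\
    forall t z, 0 < t < T -> Omega z -> gap t z + grad (p t) z = 0.
Proof.
have hi := inertial_force_acceleration; have hc := conservative_force_thermal.
have hd := dissipative_force_v oO sphiQ sthetaQ th0Q su svQ seta fin.
split=> [[fi [fc [fd [Hi Hc Hd B]]]]|[p [sp H]]]; last first.
  (* the pressure gradient, orthogonal to the admissible variations, is put
     into the inertial force *)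
  exists (fun t z => - acceleration v t z - grad (p t) z), thermal,
    (viscous_force phi theta u v eta nu); split; [|exact: hc|exact: hd|].
  - have sg := smooth_grad oQ sp; have [si Hi] := hi.
    split; first exact: (smooth_sub oQ si sg).
    move=> O dx iO vdx ad; apply: (is_derive_eq (Hi O dx iO vdx ad)).
    rewrite !(volume_integral_force yY iO vdx).
    pose w := displacement Omega T Y dx; pose K := displacement_support y dx.
    have sw : smooth_on setT w by exact: (displacement_smooth oO yY iO vdx).
    have cK : compact K by exact: (displacement_compact yY iO vdx).
    have KQ : K `<=` Q by exact: (displacement_supportQ yY iO vdx).
    have w0 q : ~ K q -> w q = 0 by exact: (displacement_off yY).
    have t_dot (f : E -> V) : smooth_on Q f -> local_test Q K (fun q => dot (f q) (w q)).
      move=> sf; split; first exact: (smooth_dot oQ sf (smooth_onS (@subsetT _ Q) sw)).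
      by move=> q _ nK; rewrite w0// dotC dot0l.
    have div0 q : Q q -> \sum_j 'D_((0, delta_mx ord0 j)) (fun q => w q ord0 j) q = 0.
      case: q => t z [tT Oz]; apply: (etrans _ (ad t z tT Oz)); apply: eq_bigr => j _.
      apply: (etrans (esym (derive_slice2 (fun q => w q ord0 j) t z (delta_mx ord0 j)).1)).
      apply: near_derive_eq; apply: (open_near oO _ Oz) => z' Oz'.
      exact: (congr1 (fun r : V => r ord0 j) (esym (eulerian_variation dx yY tT Oz'))).
    have g0 := gradient_orthogonal sp sw cK KQ w0 div0.
    have t1 := t_dot _ si; have t2 := t_dot _ sg.
    have t3 := local_testM oQ (smooth_cst (-1 : R) oQ) t2.
    apply: (etrans _ (etrans (esym (local_integralD oQ cK KQ t1 t3)) _)).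
      by rewrite (local_integralZ oQ cK KQ (-1) t2) g0 mulr0 addr0.
    by apply: eq_local_integral => q _; rewrite mulN1r -dotNl -dotDl.
  - move=> t z tT Oz; have /eqP := H t z tT Oz; rewrite /gap /viscous_force => /eqP e.
    apply/eqP; rewrite -subr_eq0 -[X in _ == X]e -/(friction_v t z).
    move: (friction_v t z) (thermal t z) (acceleration v t z) (nu *: _) (grad _ _) => a1 a2 a3 a4 a5.
    by apply/eqP/rowP => i; rewrite !mxE; ring.
have sgap : smooth_on Q (spacetime gap).
  apply: (smooth_add oQ smooth_thermal); apply: (smooth_add oQ smooth_acceleration).
  by case: hd.
have [p [sp gp]] : exists p : R -> V -> R, smooth_on Q (spacetime p) /\
    forall t z, 0 < t < T -> Omega z -> grad (p t) z = spacetime gap (t, z).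
  apply: (orthogonal_gradient oO sgap) => W sW cW WQ div0.
  have ad dx : (forall p, Q p -> displacement Omega T Y dx p = W p) -> adm dx.
    by move=> dW; exact: (divergence_free_displacement dW div0).
  have ei := first_variation_weak oO yY Hi hi sW cW WQ ad.
  have ec := first_variation_weak oO yY Hc hc sW cW WQ ad.
  have [sfi _] := Hi; have [sfc _] := Hc; have [si _] := hi; have [sc _] := hc.
  have t_dot (f : E -> V) : smooth_on Q f -> local_test Q (supp W) (fun q => dot (f q) (W q)).
    move=> sf; split; first exact: (smooth_dot oQ sf (smooth_onS (@subsetT _ Q) sW)).
    by move=> q _ /supp_off ->; rewrite dotC dot0l.
  pose I f := local_integral Q (fun q => dot (f q) (W q)).
  have ID (f g : E -> V) : smooth_on Q f -> smooth_on Q g -> I (fun q => f q + g q) = I f + I g.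
    move=> sf sg; apply: (etrans _ (local_integralD oQ cW WQ (t_dot f sf) (t_dot g sg))).
    by apply: eq_local_integral => q _; rewrite dotDl.
  have IN (f : E -> V) : smooth_on Q f -> I (fun q => - f q) = - I f.
    move=> sf; rewrite -[RHS]mulN1r; apply: (etrans _ (local_integralZ oQ cW WQ (-1) (t_dot f sf))).
    by apply: eq_local_integral => q _; rewrite dotNl mulN1r.
  have e : I (spacetime gap) = I (fun q => (spacetime fi q - spacetime (fun t z => - acceleration v t z) q) +
      (spacetime (fun t z => - fc t z) q - spacetime (fun t z => - thermal t z) q)).
    apply: eq_local_integral => -[t z] [tT Oz]; congr (dot _ _).
    have b := B t z tT Oz; have D := dissipative_force_unique oO Hd hd tT Oz.
    rewrite /spacetime/= -b D /gap /viscous_force -/friction_v.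
    move: (friction_v t z) (fc t z) (thermal t z) (acceleration v t z) (nu *: _) => a1 a2 a3 a4 a5.
    apply/rowP => i; rewrite !mxE; ring.
  have IB (f g : E -> V) : smooth_on Q f -> smooth_on Q g -> I (fun q => f q - g q) = I f - I g.
    move=> sf sg; apply: (etrans (ID f (fun q => - g q) sf (smooth_opp oQ sg))).
    exact: (congr1 (fun r => I f + r) (IN g sg)).
  apply: (etrans e); apply: (etrans (ID _ _ (smooth_sub oQ sfi si) (smooth_sub oQ sfc sc))).
  have sub0 (a b : R) : a = b -> a - b = 0 by move=> ->; rewrite subrr.
  have z1 := etrans (IB _ _ sfi si) (sub0 _ _ ei).
  have z2 := etrans (IB _ _ sfc sc) (sub0 _ _ ec).
  exact: (etrans (congr2 +%R z1 z2) (addr0 0)).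
exists (fun t z => - p t z); split; first exact: (smooth_opp oQ sp).
move=> t z tT Oz.
have -> : grad (fun z => - p t z) z = - grad (p t) z.
  apply/rowP => i; rewrite !mxE /partial.
  have dp : derivable (p t) z (delta_mx ord0 i).
    rewrite -[derivable _ _ _]/(derivable (fun z => spacetime p (t, z)) z (delta_mx ord0 i)).
    rewrite (derive_slice2 (spacetime p) t z (delta_mx ord0 i)).2.
    by apply: diff_derivable; exact: (smooth_on_differentiable sp (conj tT Oz : Q (t, z))).
  exact: (deriveN dp).
by rewrite gp// subrr.
Qed.

End ViscousFlow.

End ForceBalance.

(** * The phase equation *)

Section PhaseEquation.
Context {R : realType} {d : nat}.
Notation V := 'rV[R]_d.
Notation E := (R * 'rV[R]_d)%type.
Variables (Omega : set V) (T : R).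
Hypothesis oO : open Omega.
Let Q := cylinder Omega T.
Let oQ : open Q. Proof. exact: open_cylinder. Qed.

Lemma positive_neighbourhood (phi theta : R -> V -> R) :
  smooth_field Omega T phi -> smooth_field Omega T theta ->
  (forall t y, 0 <= t <= T -> closure Omega y -> 0 < theta t y) ->
  exists N : set E, [/\ open N, closed_cylinder Omega T `<=` N,
    smooth_on N (spacetime phi), smooth_on N (spacetime theta) &
    forall p, N p -> 0 < spacetime theta p].
Proof.
move=> [N1 [oN1 cN1 s1]] [N2 [oN2 cN2 s2]] th0.
pose N := [set p : E | [/\ N1 p, N2 p & 0 < spacetime theta p]].
have oN : open N.
  rewrite openE => p [Np1 Np2 tp].
  have c := smooth_on_continuous s2 Np2 (open_nbhs_nbhs (conj (@open_gt R 0) tp)).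
  by apply: filterS3 (open_nbhs_nbhs (conj oN1 Np1)) (open_nbhs_nbhs (conj oN2 Np2)) c => q.
exists N; split => //.
- move=> [t z] Cp; split; [exact: cN1|exact: cN2|].
  by case: Cp => tT cz; exact: th0.
- by apply: smooth_onS s1 => p [].
- by apply: smooth_onS s2 => p [].
- by move=> p [].
Qed.

(** The phase is constant along the trajectories, whose velocity is [u]; the
    chain rule at the trajectory through [y] gives the equation. *)
Lemma phase_transport (x Y u : R -> V -> V) (phi0 : V -> R) (phi : R -> V -> R) :
  inverse_flows Omega T x Y ->
  (forall t X, 0 <= t <= T -> Omega X -> dt x t X = u t (x t X)) ->
  smooth_on Q (spacetime phi) -> transported Omega T x phi0 phi ->
  forall t y, 0 < t < T -> Omega y -> dt phi t y + dot (u t y) (grad (phi t) y) = 0.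
Proof.
move=> xY xu sphi tr t y tT Oy; have Qp : Q (t, y) by [].
have df := smooth_on_differentiable sphi Qp.
have e1 := derive_trajectory xY xu Qp df.
have OX := inverse_funr xY (cylinder_le Qp) Oy.
have e2 : 'D_1 (fun r : R => spacetime phi (r, x r (Y t y))) t = 0.
  apply: (etrans (near_derive_eq (g := cst (phi0 (Y t y))) _ _)); last exact: derive_cst.
  by apply: filterS (near_time tT) => r rT; exact: tr.
have e3 : ((1, u t y) : E) = ((1, 0) : E) + (0, u t y).
  by rewrite -[RHS]/(1 + 0, 0 + _) addr0 add0r.
have e4 := derive_addv ((1, 0) : E) (0, u t y) df.
apply: (etrans _ (etrans (esym e1) e2)).
apply: (etrans _ (congr1 (fun k => 'D_k (spacetime phi) (t, y)) (esym e3))).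
apply: (etrans _ (esym e4)).
exact: (congr2 +%R (dt_spacetime phi t y) (esym (spatial_derive_dot (u t y) df))).
Qed.

Lemma closure_zero (A : set E) (h : E -> R) p : {for p, continuous h} ->
  (forall q, A q -> h q = 0) -> closure A p -> h p = 0.
Proof.
move=> ch hA cA; apply: contrapT => hp.
have o : open [set r : R | r != 0].
  rewrite (_ : [set _ | _] = ~` [set 0]); first exact/closed_openC/closed_eq.
  by apply/seteqP; split=> r /= /eqP.
have hp0 : [set r : R | r != 0] (h p) by apply/eqP.
have [q [Aq /= hq]] := cA _ (ch _ (open_nbhs_nbhs (conj o hp0))).
by rewrite hA// eqxx in hq.
Qed.

(** The motion law is the gradient flow multiplied by the gradient of the phase;
    where this gradient does not vanish it can be divided out, and the quotient
    passes to the closure by continuity. *)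
Lemma motion_gradient_flow (phi mu e : R -> V -> R) (u : R -> V -> V) :
  smooth_on Q (spacetime phi) -> smooth_on Q (spacetime mu) -> smooth_on Q (spacetime e) ->
  (forall t y, 0 < t < T -> Omega y -> 0 < e t y) ->
  (forall t y, 0 < t < T -> Omega y -> dt phi t y + dot (u t y) (grad (phi t) y) = 0) ->
  (forall t y, 0 < t < T -> Omega y ->
     - (e t y * dot (u t y) (grad (phi t) y)) *: grad (phi t) y = mu t y *: grad (phi t) y) <->
  (forall t y, 0 < t < T -> Omega y ->
     closure [set p | cylinder Omega T p /\ grad (phi p.1) p.2 != 0] (t, y) ->
     dt phi t y = (e t y)^-1 * mu t y).
Proof.
move=> sphi smu se e0 tr.
have flow t y : 0 < t < T -> Omega y ->
    (dt phi t y = (e t y)^-1 * mu t y) <-> (- (e t y * dot (u t y) (grad (phi t) y)) = mu t y).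
  move=> tT Oy; have en0 : e t y != 0 by rewrite gt_eqF// e0.
  have /eqP := tr t y tT Oy; rewrite addr_eq0 => /eqP ->; split=> [E|<-].
    by rewrite -mulrN E mulrA mulfV// mul1r.
  by rewrite mulrN mulrA mulVf// mul1r.
split=> H t y tT Oy; last first.
  have [->|g0] := eqVneq (grad (phi t) y) 0; first by rewrite !scaler0.
  by congr (_ *: _); apply/flow => //; apply: H => //; exact: subset_closure.
move=> cl; have Qp : Q (t, y) by [].
pose h p := 'D_((1, 0)) (spacetime phi) p * spacetime e p - spacetime mu p.
have sh : smooth_on Q h.
  by apply: (smooth_sub oQ) => //; apply: (smooth_mul oQ) => //; exact: smooth_on_derive.
have en0 : e t y != 0 by rewrite gt_eqF// e0.
suff h0 : h (t, y) = 0.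
  apply: (mulIf en0); rewrite mulrAC mulVf// mul1r; apply/eqP; rewrite -subr_eq0.
  by rewrite dt_spacetime; apply/eqP.
(* [h] vanishes where the gradient does not, hence on the closure *)
apply: (closure_zero (smooth_on_continuous sh Qp) _ cl) => -[t' y'] [[tT' Oy'] /= g0].
have en0' : e t' y' != 0 by rewrite gt_eqF// e0.
have e1 : dt phi t' y' = (e t' y')^-1 * mu t' y'.
  apply/flow => //; have /eqP := H t' y' tT' Oy'; rewrite -subr_eq0 -scalerBl scaler_eq0.
  by rewrite (negbTE g0) orbF subr_eq0 => /eqP.
rewrite /h /spacetime/= -[X in X * _](dt_spacetime phi t' y') e1.
by rewrite mulrAC mulVf// mul1r subrr.
Qed.

Lemma momentum_balance (heat friction acc viscous pressure drag : V) : friction = - drag ->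
  heat + (acc + (- friction - viscous)) + pressure = 0 <->
  acc + pressure = - drag + viscous - heat.
Proof.
move=> ->.
have -> : heat + (acc + (- - drag - viscous)) + pressure =
    (acc + pressure) - (- drag + viscous - heat) by apply/rowP => i; rewrite !mxE; ring.
by split=> [/eqP|->]; rewrite ?subrr// subr_eq0 => /eqP.
Qed.

Lemma grad_quadratic (c k : R) (q : V) : grad (fun p : V => c / 2 * dot p p + k) q = c *: q.
Proof.
have s1 : smooth_on setT (fun p : V => c / 2 * dot p p).
  apply: (smooth_mul openT (smooth_cst _ openT)).
  by apply: (smooth_dot openT); exact: smooth_id openT.
have s : smooth_on setT (fun p : V => c / 2 * dot p p + k).
  exact: (smooth_add openT s1 (smooth_cst k openT)).
apply/rowP => i; rewrite !mxE /partial; pose v : V := delta_mx ord0 i.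
have H : is_derive (0 : R) (1 : R) (fun r : R => c / 2 * dot (q + r *: v) (q + r *: v) + k) (c * dot q v).
  apply: (@is_derive_quadratic R _ _ 1 `|c / 2 * dot v v|) => // h _.
  rewrite scale0r addr0 !dotDl !dotDr !dotZl !dotZr (dotC v q).
  rewrite [X in `|X|](_ : _ = h ^+ 2 * (c / 2 * dot v v)); last by field.
  by rewrite normrM (ger0_norm (sqr_ge0 h)) mulrC lexx.
have qE : q + (0 : R) *: v = q by rewrite scale0r addr0.
have dq : differentiable (fun p : V => c / 2 * dot p p + k) (q + (0 : R) *: v).
  exact: (smooth_on_differentiable s).
have [_ e1] := is_derive_line dq; have [_ e2] := H.
have e3 : dot q v = q ord0 i.
  rewrite /dot (bigD1 i)//= big1 ?addr0 => [|j ji]; first by rewrite mxE !eqxx mulr1.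
  by rewrite mxE eqxx (negbTE ji) mulr0.
apply: (etrans (congr1 (fun y => 'D_v (fun p : V => c / 2 * dot p p + k) y) (esym qE))).
by apply: (etrans (esym e1)); rewrite e2 e3.
Qed.

Lemma allen_cahn_potential (psi : R -> V -> R -> R) (phi theta : R -> V -> R)
    (eps lambda theta_c c_v : R) (chi W g : R -> R) t y :
  smooth_on setT W -> smooth_on Q (spacetime phi) ->
  (forall t y, 0 < t < T -> Omega y -> 0 < theta t y) ->
  (forall a p th, 0 < th ->
     psi a p th = eps / 2 * dot p p + eps^-1 * W a
       - chi eps * (lambda / theta_c) * (th - theta_c) * g a
       + c_v * th * (1 - ln th)) ->
  theta t y = theta_c -> 0 < t < T -> Omega y ->
  chemical_potential psi phi theta t y =
    eps * laplacian (phi t) y - eps^-1 * derive1 W (phi t y).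
Proof.
move=> sW sphi th0 psiE thc tT Oy; rewrite /chemical_potential.
have tc0 : 0 < theta_c by rewrite -thc; exact: th0.
congr (_ - _); last first.
  have -> : psi_phi psi (phi t y) (grad (phi t) y) (theta t y) =
      derive1 (fun a => eps^-1 * W a + (eps / 2 * dot (grad (phi t) y) (grad (phi t) y) +
        c_v * theta_c * (1 - ln theta_c))) (phi t y).
    rewrite /psi_phi thc; congr (derive1 _ _); apply/funext => a.
    by rewrite psiE// subrr mulr0 mul0r subr0; ring.
  have dW : derivable W (phi t y) 1.
    by apply: diff_derivable; exact: (smooth_on_differentiable sW).
  rewrite !derive1E; apply: (etrans (deriveD (derivableZ dW) (derivable_cst _ _ _))).
  rewrite derive_cst addr0; exact: (deriveZ eps^-1 dW).
rewrite laplacianE mulr_sumr; apply: eq_bigr => j _.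
have sj : smooth_on Omega (partial j (phi t)).
  by apply: smooth_on_derive; exact: (smooth_slice oO sphi tT).
have dj : derivable (partial j (phi t)) y (delta_mx ord0 j).
  by apply: diff_derivable; exact: (smooth_on_differentiable sj).
apply: (etrans (near_derive_eq (g := eps \*: partial j (phi t)) _ _)); last exact: (deriveZ eps dj).
apply: (open_near oO _ Oy) => z Oz.
have thz : 0 < theta t z by exact: th0.
pose k := eps^-1 * W (phi t z) - chi eps * (lambda / theta_c) * (theta t z - theta_c) * g (phi t z)
       + c_v * theta t z * (1 - ln (theta t z)).
have -> : psi_grad psi (phi t z) (grad (phi t) z) (theta t z) = eps *: grad (phi t) z.
  rewrite -(grad_quadratic eps k); rewrite /psi_grad; congr (grad _ _); apply/funext => p.
  by rewrite psiE// /k !addrA.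
by rewrite !mxE.
Qed.

End PhaseEquation.

(** * Equations of motion *)

Theorem theorem2p6 (R : realType) (d : nat) (d23 : (d = 2 \/ d = 3)%N)
    (Omega : set 'rV[R]_d) (openOmega : open Omega) (T : R) (T0 : 0 < T)
    (psi : R -> 'rV[R]_d -> R -> R)
    (smooth_psi : smooth_on [set p : R * 'rV[R]_d * R | 0 < p.2]
       (fun p => psi p.1.1 p.1.2 p.2))
    (eta : R -> R -> R)
    (smooth_eta : smooth_on [set p : R * R | 0 < p.2] (fun p => eta p.1 p.2))
    (eta_gt0 : forall a th : R, 0 < th -> 0 < eta a th)
    (nu : R)
    (u x : R -> 'rV[R]_d -> 'rV[R]_d)
    (smooth_u : smooth_field Omega T u)
    (tangential_u : tangential Omega T u)
    (flow_x : unique_flow_map Omega T u x)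
    (phi0 : 'rV[R]_d -> R) (phi theta : R -> 'rV[R]_d -> R)
    (smooth_phi0 : smooth_near (closure Omega) phi0)
    (smooth_phi : smooth_field Omega T phi)
    (phi_x : transported Omega T x phi0 phi)
    (smooth_theta : smooth_field Omega T theta)
    (theta_gt0 : forall t y, 0 <= t <= T -> closure Omega y -> 0 < theta t y) :
  let mu := chemical_potential psi phi theta in
  let s := entropy psi phi theta in
  let zero_velocity : R -> 'rV[R]_d -> 'rV[R]_d := fun _ _ => 0 in
  let transport_equation :=
    forall t y, 0 < t < T -> Omega y ->
      dt phi t y + dot (u t y) (grad (phi t) y) = 0 in
  (* (i) *)
  (forall (theta0 : 'rV[R]_d -> R),
     smooth_near (closure Omega) theta0 ->
     transported Omega T x theta0 theta ->
     finite_dissipation Omega T eta nu phi theta u zero_velocity ->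
     transport_equation /\
     (force_balance Omega T
        (inertial_force Omega T unconstrained no_kinetic_action x)
        (conservative_force Omega T unconstrained psi
           (push Omega phi0) (push Omega theta0) x)
        (dissipative_force Omega T
           (fun t w => dissipation Omega eta nu (phi t) (theta t) w
                         (zero_velocity t)) u)
      <->
      forall t y, 0 < t < T -> Omega y ->
        - (eta (phi t y) (theta t y) * dot (u t y) (grad (phi t) y))
            *: grad (phi t) y
        = mu t y *: grad (phi t) y + s t y *: grad (theta t) y))
  /\
  (* (ii) *)
  (finite_dissipation Omega T eta nu phi theta u zero_velocity ->
   let motion :=
     forall t y, 0 < t < T -> Omega y ->
       - (eta (phi t y) (theta t y) * dot (u t y) (grad (phi t) y))
           *: grad (phi t) y
       = mu t y *: grad (phi t) y in
   let gradient_flow t y :=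
     dt phi t y = (eta (phi t y) (theta t y))^-1 * mu t y in
   [/\ transport_equation,
       force_balance Omega T
         (inertial_force Omega T unconstrained no_kinetic_action x)
         (conservative_force Omega T unconstrained psi
            (push Omega phi0) (fun=> theta) x)
         (dissipative_force Omega T
            (fun t w => dissipation Omega eta nu (phi t) (theta t) w
                          (zero_velocity t)) u)
       <-> motion,
       (* where grad phi vanishes on an open set the motion law says nothing
          about mu, so the division by grad phi is made on the closure of the
          set where it does not vanish *)
       motion <->
       (forall t y, 0 < t < T -> Omega y ->
          closure [set p | cylinder Omega T p /\ grad (phi p.1) p.2 != 0]
            (t, y) ->
          gradient_flow t y) &
       forall (eps lambda theta_c c_v : R) (chi W g : R -> R),
         smooth_on setT W -> smooth_on setT g ->
         (forall a p th, 0 < th ->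
            psi a p th = eps / 2 * dot p p + eps^-1 * W a
              - chi eps * (lambda / theta_c) * (th - theta_c) * g a
              + c_v * th * (1 - ln th)) ->
         (forall t y, 0 <= t <= T -> Omega y -> theta t y = theta_c) ->
         forall t y, 0 < t < T -> Omega y ->
           (gradient_flow t y <->
            dt phi t y = (eta (phi t y) theta_c)^-1 *
              (eps * laplacian (phi t) y - eps^-1 * derive1 W (phi t y)))])
  /\
  (* (iii) *)
  (forall (v y : R -> 'rV[R]_d -> 'rV[R]_d) (theta0 : 'rV[R]_d -> R),
     smooth_field Omega T v ->
     (forall t z, 0 <= t <= T -> Omega z -> divergence (v t) z = 0) ->
     flow_map Omega T v y ->
     smooth_near (closure Omega) theta0 ->
     transported Omega T y theta0 theta ->
     finite_dissipation Omega T eta nu phi theta u v ->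
     transport_equation /\
     (force_balance Omega T
        (inertial_force Omega T unconstrained (kinetic_action T (fun=> v)) x)
        (conservative_force Omega T unconstrained psi
           (push Omega phi0) (fun=> theta) x)
        (dissipative_force Omega T
           (fun t w => dissipation Omega eta nu (phi t) (theta t) w (v t)) u)
      /\
      force_balance Omega T
        (inertial_force Omega T (divergence_free Omega T y)
           (kinetic_action T (velocity Omega)) y)
        (conservative_force Omega T (divergence_free Omega T y) psi
           (fun=> phi) (push Omega theta0) y)
        (dissipative_force Omega T
           (fun t w => dissipation Omega eta nu (phi t) (theta t) (u t) w) v)
      <->
      (forall t z, 0 < t < T -> Omega z ->
         - (eta (phi t z) (theta t z) * dot (u t z - v t z) (grad (phi t) z))
             *: grad (phi t) z
         = mu t z *: grad (phi t) z)
      /\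
      exists p : R -> 'rV[R]_d -> R,
        smooth_on (cylinder Omega T) (spacetime p) /\
        forall t z, 0 < t < T -> Omega z ->
          dt v t z + 'D_(v t z) (v t) z + grad (p t) z
            = - (mu t z *: grad (phi t) z) + nu *: vlaplacian (v t) z
              - s t z *: grad (theta t) z
          /\ divergence (v t) z = 0)).
Proof.
move=> mu s zero_velocity transport_eq.
have [flow_ux _] := flow_x.
have [Y xY] := flow_map_inverse flow_ux.
have [_ _ _ _ xu] := flow_ux.
have oQ : open (cylinder Omega T) by exact: open_cylinder.
have [N [oN NC sphi stheta th0]] := positive_neighbourhood smooth_phi smooth_theta theta_gt0.
have QN : cylinder Omega T `<=` N by move=> p /cylinder_closed/NC.
have sphiQ := smooth_onS QN sphi; have sthetaQ := smooth_onS QN stheta.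
have suQ := smooth_field_cylinder smooth_u.
have szero : smooth_on (cylinder Omega T) (spacetime zero_velocity) by exact: smooth_cst.
have transport : transport_eq by exact: (phase_transport xY xu sphiQ phi_x).
have theta_pos t y : 0 < t < T -> Omega y -> 0 < theta t y.
  by move=> tT Oy; apply: (th0 (t, y)); apply: QN.
have phase := phase_force_balance openOmega xY smooth_psi oN NC sphi stheta th0 suQ.
have scal0 (a b : 'rV[R]_d) : a + (false%:R : R) *: b = a by rewrite scale0r addr0.
have scal1 (a b : 'rV[R]_d) : a + (true%:R : R) *: b = a + b by rewrite scale1r.
split; last split.
- move=> theta0 stheta0 trt fin; split; first exact: transport.
  refine (iff_trans (phase zero_velocity eta nu szero smooth_eta fin _ true phi0 theta0 phi_x
    (fun _ => trt) (inertial_force_none openOmega xY unconstrained)) _).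
  by split=> H t y tT Oy; have := H t y tT Oy; rewrite subr0 scal1.
- move=> fin motion gradient_flow.
  have smu := smooth_onS QN (smooth_chemical_potential smooth_psi oN sphi stheta th0).
  have seta : smooth_on (cylinder Omega T) (spacetime (fun t y => eta (phi t y) (theta t y))).
    by apply: (smooth_eta_field openOmega sphiQ sthetaQ _ smooth_eta) => t y [tT Oy]; exact: theta_pos.
  split; first exact: transport.
  (* the temperature is not transported; [phi0] merely fills the place of its
     initial value *)
  + apply: (iff_trans (phase zero_velocity eta nu szero smooth_eta fin _ false phi0 phi0 phi_x
      (fun f => False_ind _ (notF f)) (inertial_force_none openOmega xY unconstrained))).
    by split=> H t y tT Oy; have := H t y tT Oy; rewrite subr0 scal0.
  + apply: (motion_gradient_flow openOmega sphiQ smu seta _ transport) => t y tT Oy.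
    by apply: eta_gt0; exact: theta_pos.
  + move=> eps lambda theta_c c_v chi W g sW sg psiE thc t y tT Oy.
    have tT' : 0 <= t <= T by case/andP: tT => t0 tT; rewrite !ltW.
    rewrite /gradient_flow /mu (allen_cahn_potential openOmega sW sphiQ theta_pos psiE (thc t y tT' Oy) tT Oy).
    by rewrite thc.
- move=> v y theta0 sv div_v flow_vy stheta0 trt fin; split; first exact: transport.
  have [Z yZ] := flow_map_inverse flow_vy; have [_ _ _ _ yv] := flow_vy.
  have svQ := smooth_field_cylinder sv.
  have A := phase v eta nu svQ smooth_eta fin _ false phi0 phi0 phi_x
    (fun f => False_ind _ (notF f)) (inertial_force_fixed openOmega xY unconstrained v).
  have B := viscous_force_balance openOmega yZ smooth_psi oN NC sphi stheta th0 suQ sv yv div_v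
    smooth_eta fin trt.
  apply: (iff_trans (and_iff_compat_r _ A)); apply: (iff_trans (and_iff_compat_l _ B)).
  have frictionE t z : - (eta (phi t z) (theta t z) * dot (u t z - v t z) (grad (phi t) z))
        *: grad (phi t) z = mu t z *: grad (phi t) z ->
      friction_force phi theta u v eta t z = - (mu t z *: grad (phi t) z).
    by rewrite scaleNr => <-; rewrite opprK.
  split=> [[H1 [p [sp H2]]]|[H1 [p [sp H2]]]].
    have H t z : 0 < t < T -> Omega z ->
        - (eta (phi t z) (theta t z) * dot (u t z - v t z) (grad (phi t) z))
          *: grad (phi t) z = mu t z *: grad (phi t) z.
      by move=> tT Oz; rewrite H1// scal0.
    split; first exact: H.
    exists p; split=> // t z tT Oz; split; last first.
      by apply: div_v => //; case/andP: tT => t0 tT; rewrite !ltW.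
    exact: (momentum_balance _ _ _ _ (frictionE t z (H t z tT Oz))).1 (H2 t z tT Oz).
  split; first by move=> t z tT Oz; rewrite H1// scal0.
  exists p; split=> // t z tT Oz; have [e _] := H2 t z tT Oz.
  exact: (momentum_balance _ _ _ _ (frictionE t z (H1 t z tT Oz))).2 e.
Qed.
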